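(* Let $n\ge2$, let $1<p,q<\infty$ with $\frac1p+\frac1q=1$, let $\Omega\subset\mathbb{R}^n$ be a bounded John domain, and let $\beta\in\mathbb{R}$ satisfy $$\beta p>-(n-\dim_A(\partial\Omega)).$$ Then there is a constant $C$ such that for every $f\in L^q(\Omega,d^{-\beta q})$ with $\int_\Omega f=0$ there exists a vector field $\mathbf{u}\in W^{1,q}_0(\Omega,d^{-\beta q})^n$ that is a solution of $\operatorname{div}\mathbf{u}=f$ in $\Omega$ and verifies $$\|D\mathbf{u}\|_{L^q(\Omega,d^{-\beta q})}\le C\|f\|_{L^q(\Omega,d^{-\beta q})}.$$
   Context: Notation: $d(x)=\mathrm{dist}(x,\partial\Omega)$. For a weight $\omega$ (measurable, a.e. positive), $\|f\|_{L^q(\Omega,\omega)}=(\int_\Omega|f|^q\omega\,dx)^{1/q}$. $D\mathbf{u}$ is the (weak) Jacobian matrix. $W^{1,q}_0(\Omega,d^{-\beta q})$ is the closure of $C_c^\infty(\Omega)$ in the weighted Sobolev norm $\|u\|_{L^q(\Omega,d^{-\beta q})}+\|\nabla u\|_{L^q(\Omega,d^{-\beta q})}$. John domain: a bounded domain $\Omega\subset\mathbb{R}^n$ is a John domain if there are constants $0<a_0\le b_0<\infty$ and a point $x_0\in\Omega$ such that for each $x\in\Omega\setminus\{x_0\}$ there is a rectifiable curve $\gamma_x$ in $\Omega$ from $x$ to $x_0$, parametrized by arc length on $[0,L_x]$, $L_x=\mathrm{length}(\gamma_x)$, $\gamma_x(0)=x$, with $L_x\le b_0$ and $\mathrm{dist}(\gamma_x(\tau),\partial\Omega)\ge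 \frac{a_0}{L_x}\tau$ for all $\tau\in[0,L_x]$. Assouad dimension: for $E\subset\mathbb{R}^n$ and $r>0$, $N_r(E)$ is the least number of open balls of radius $r$ needed to cover $E$; $\dim_A(E)$ is the infimum of all $\lambda\ge0$ for which there is $C>0$ such that $\sup_{x\in E}N_r(B_R(x)\cap E)\le C(R/r)^\lambda$ for all $0<r<R$. *)

(* Defs.v *)
From HB Require Import structures.
From mathcomp Require Import all_boot all_order all_algebra.
From mathcomp Require Import all_classical all_reals all_analysis.

Set Implicit Arguments.
Unset Strict Implicit.
Unset Printing Implicit Defensive.

Import Order.TTheory GRing.Theory Num.Theory.
Import numFieldNormedType.Exports.

Local Open Scope classical_set_scope.
Local Open Scope ring_scope.

(* Points of R^n are row vectors. The library equips n.-tuple, but not 'rV_n,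
   with a sigma-algebra; as there, we take the one generated by the coordinate
   projections, which on 'rV[R]_n is the Borel sigma-algebra. *)

Definition rV_display : measure_display -> measure_display.
Proof. exact. Qed.

Section measurable_rV.
Context {R : realType} (n : nat).

Let coors : 'I_n -> 'rV[R]_n -> measurableTypeR R := fun i x => x ord0 i.

Let rV_set0 : g_sigma_preimage coors set0.
Proof. exact: sigma_algebra0. Qed.

Let rV_setC A : g_sigma_preimage coors A -> g_sigma_preimage coors (~` A).
Proof. exact: sigma_algebraC. Qed.

Let rV_bigcup (F : (set 'rV[R]_n)^nat) :
  (forall i, g_sigma_preimage coors (F i)) ->
  g_sigma_preimage coors (\bigcup_i (F i)).
Proof. exact: sigma_algebra_bigcup. Qed.

HB.instance Definition _ := @isMeasurable.Build (rV_display default_measure_display)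
  'rV[R]_n (g_sigma_preimage coors) rV_set0 rV_setC rV_bigcup.

Lemma measurable_coor (i : 'I_n) :
  measurable_fun [set: 'rV[R]_n] (fun x : 'rV[R]_n => x ord0 i : measurableTypeR R).
Proof.
move=> _ Y mY; rewrite setTI; apply: sub_sigma_algebra => /=.
rewrite -bigcup_seq/=; exists i => /=; first by rewrite mem_index_enum.
by exists Y => //; rewrite setTI.
Qed.

Lemma measurable_fun_coorP d (T : measurableType d) (f : T -> 'rV[R]_n) :
  (forall i, measurable_fun [set: T] (fun x => f x ord0 i : measurableTypeR R)) ->
  measurable_fun [set: T] f.
Proof.
move=> mf _; apply: (@measurability _ _ _ _ setT f
  (\big[setU/set0]_(i < n) preimage_set_system setT (coors i) measurable)) => //.
rewrite -bigcup_seq => _ [_ [i _ [A mA <-]] <-].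
by rewrite setTI; exact: mf.
Qed.

End measurable_rV.

Section lebesgue_rV.
Context {R : realType}.

Definition rV_cons n (z : measurableTypeR R * 'rV[R]_n) : 'rV[R]_n.+1 :=
  row_mx (z.1 : R)%:M z.2.

Definition rV_uncons n (x : 'rV[R]_n.+1) : measurableTypeR R * 'rV[R]_n :=
  (x ord0 ord0, \row_i x ord0 (lift ord0 i)).

Lemma rV_cons0 n z : @rV_cons n z ord0 ord0 = z.1.
Proof.
have -> : @ord0 n = lshift n (@ord0 0) by apply: ord_inj.
by apply: (etrans (row_mxEl _ _ _ _)); rewrite mxE eqxx mulr1n.
Qed.

Lemma rV_cons_lift n z i : @rV_cons n z ord0 (lift ord0 i) = z.2 ord0 i.
Proof.
have -> : lift ord0 i = rshift 1 i by apply: ord_inj.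
exact: row_mxEr.
Qed.

Lemma rV_consK n : cancel (@rV_cons n) (@rV_uncons n).
Proof.
move=> z; rewrite /rV_uncons rV_cons0 (_ : \row_i _ = z.2); first by case: z.
by apply/rowP => i; rewrite mxE rV_cons_lift.
Qed.

Lemma measurable_rV_cons n : measurable_fun setT (@rV_cons n).
Proof.
apply: measurable_fun_coorP => i.
case: (unliftP ord0 i) => [j ->|->].
- apply: (@eq_measurable_fun _ _ _ _ setT
    ((fun x : 'rV[R]_n => x ord0 j : measurableTypeR R) \o snd)).
    by move=> z _; rewrite /= rV_cons_lift.
  by apply: measurableT_comp => //; exact: measurable_coor.
- apply: (@eq_measurable_fun _ _ _ _ setT fst) => //.
  by move=> z _; rewrite rV_cons0.
Qed.

Lemma measurable_rV_uncons n : measurable_fun setT (@rV_uncons n).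
Proof.
apply: measurable_fun_pair; first exact: measurable_coor.
apply: measurable_fun_coorP => i.
apply: (@eq_measurable_fun _ _ _ _ setT
  (fun x : 'rV[R]_n.+1 => x ord0 (lift ord0 i) : measurableTypeR R)).
  by move=> z _; rewrite mxE.
exact: measurable_coor.
Qed.

Section step.
Variables (n : nat) (m : {sigma_finite_measure set 'rV[R]_n -> \bar R}).

Definition lebesgue_rV_step : set 'rV[R]_n.+1 -> \bar R :=
  pushforward (@lebesgue_measure R \x m)%E (@rV_cons n).

Let mcons := @measurable_rV_cons n.

Let step0 : lebesgue_rV_step set0 = 0%E.
Proof. by rewrite /lebesgue_rV_step /pushforward preimage_set0 measure0. Qed.

Let step_ge0 A : (0 <= lebesgue_rV_step A)%E.
Proof. exact: measure_ge0. Qed.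

Let step_sigma_additive : semi_sigma_additive lebesgue_rV_step.
Proof.
move=> F mF tF mUF; rewrite /lebesgue_rV_step /pushforward preimage_bigcup.
apply: measure_semi_sigma_additive.
- by move=> k; rewrite -[X in measurable X]setTI; exact: mcons.
- apply/trivIsetP => /= i j _ _ ij; rewrite -preimage_setI.
  by move/trivIsetP : tF => /(_ _ _ _ _ ij) ->//; rewrite preimage_set0.
- by rewrite -preimage_bigcup -[X in measurable X]setTI; exact: mcons.
Qed.

HB.instance Definition _ := isMeasure.Build _ _ _ lebesgue_rV_step
  step0 step_ge0 step_sigma_additive.

Let step_sigma_finite : sigma_finite setT lebesgue_rV_step.
Proof.
have /sigma_finiteP[F [TF ndF Foo]] := sigma_finiteT (@lebesgue_measure R).
have /sigma_finiteP[G [TG ndG Goo]] := sigma_finiteT m.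
exists (fun k => @rV_uncons n @^-1` (F k `*` G k)).
  rewrite -preimage_bigcup (_ : \bigcup_k _ = setT) ?preimage_setT//.
  apply/seteqP; split => // -[x y] _.
  have [k _ Fkx] : (\bigcup_k F k) x by rewrite -TF.
  have [l _ Gly] : (\bigcup_k G k) y by rewrite -TG.
  exists (maxn k l) => //; split => /=.
  - by move: x Fkx; exact/subsetPset/ndF/leq_maxl.
  - by move: y Gly; exact/subsetPset/ndG/leq_maxr.
move=> k; have [mF Fk] := Foo k; have [mG Gk] := Goo k; split.
  rewrite -[X in measurable X]setTI; apply: measurable_rV_uncons => //.
  exact: measurableX.
rewrite /lebesgue_rV_step /pushforward -comp_preimage.
rewrite (_ : _ \o _ = id); last by apply/funext => z /=; rewrite rV_consK.
by rewrite preimage_id product_measure1E// lte_mul_pinfty// ge0_fin_numE.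
Qed.

HB.instance Definition _ :=
  Measure_isSigmaFinite.Build _ _ _ lebesgue_rV_step step_sigma_finite.

End step.

(* n-dimensional Lebesgue measure, by iterated products:
   R^0 carries the unit mass, and R^(n+1) is identified with R * R^n. *)
Fixpoint lebesgue_rV (n : nat) : {sigma_finite_measure set 'rV[R]_n -> \bar R} :=
  match n with
  | 0 => \d_(0 : 'rV[R]_0)
  | n'.+1 => lebesgue_rV_step (lebesgue_rV n')
  end.

Lemma lebesgue_rV_box n (A : 'I_n -> set (measurableTypeR R)) :
  (forall i, measurable (A i)) ->
  lebesgue_rV n [set x | forall i, A i (x ord0 i)] =
  (\prod_(i < n) @lebesgue_measure R (A i))%E.
Proof.
elim: n A => [|n IH] A mA.
  by rewrite big_ord0 /= diracE mem_set// => -[].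
have mB : measurable [set x : 'rV[R]_n | forall i, A (lift ord0 i) (x ord0 i)].
  rewrite (_ : [set x : 'rV[R]_n | _] = \bigcap_(i in [set: 'I_n])
      ((fun x : 'rV[R]_n => x ord0 i : measurableTypeR R) @^-1` A (lift ord0 i))).
    apply: fin_bigcap_measurable => // i _.
    by rewrite -[X in measurable X]setTI; exact: measurable_coor.
  by apply/seteqP; split => x /= h i; [move=> _|]; exact: h.
rewrite big_ord_recl -(IH (fun i => A (lift ord0 i)))// -product_measure1E//.
rewrite /= /lebesgue_rV_step /pushforward; congr (_ _).
apply/seteqP; split => z /=.
  move=> h; split; first by have := h ord0; rewrite rV_cons0.
  by move=> i; have := h (lift ord0 i); rewrite rV_cons_lift.
by move=> [h0 h1] i; case: (unliftP ord0 i) => [j ->|->];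
  rewrite ?rV_cons0 ?rV_cons_lift.
Qed.

End lebesgue_rV.

(* The library norm on matrices is the max norm; fnorm is the Euclidean
   (Frobenius) norm, used for all distances, balls, lengths and norms below. *)
Definition fnorm (R : realType) (m n : nat) (A : 'M[R]_(m, n)) : R :=
  Num.sqrt (\sum_i \sum_j A i j ^+ 2).

Section geometry.
Context {R : realType} {n : nat}.
Implicit Types (E Omega : set 'rV[R]_n) (x : 'rV[R]_n) (r : R).

Definition eball x r : set 'rV[R]_n := [set y | fnorm (y - x) < r].

Definition boundary Omega : set 'rV[R]_n := closure Omega `\` interior Omega.

Definition dist_bd Omega x : R := inf [set fnorm (x - y) | y in boundary Omega].

(* +oo when E has no finite cover by balls of radius r *)
Definition covering_number r E : \bar R :=
  ereal_inf [set (k%:R)%:E | k in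
    [set k : nat | exists c : 'I_k -> 'rV[R]_n,
       E `<=` \bigcup_(i in [set: 'I_k]) eball (c i) r]].

Definition assouad_dim E : \bar R :=
  ereal_inf [set lambda%:E | lambda in
    [set lambda : R | 0 <= lambda /\
       exists2 C : R, 0 < C & forall r s : R, 0 < r -> r < s ->
         (ereal_sup [set covering_number r (eball x s `&` E) | x in E] <=
          (C * (s / r) `^ lambda)%:E)%E]].

(* Counterpart of the library's total_variation, for vector-valued functions. *)
Definition curve_length (a b : R) (gamma : R -> 'rV[R]_n) : \bar R :=
  ereal_sup [set (\sum_(0 <= k < size s)
      fnorm (gamma (nth b (a :: s) k.+1) - gamma (nth b (a :: s) k)))%:E
    | s in itv_partition a b].

(* Rectifiable curve of length L in Omega from x to y, parametrized by arc
   length on [0, L]. *)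
Definition arc_length_curve Omega x y (L : R) (gamma : R -> 'rV[R]_n) : Prop :=
  [/\ 0 <= L, {within `[0, L], continuous gamma},
      gamma 0 = x /\ gamma L = y,
      (forall t, 0 <= t <= L -> Omega (gamma t)) &
      (forall t, 0 <= t <= L -> curve_length 0 t gamma = t%:E)].

Definition john_domain Omega : Prop :=
  [/\ open Omega, connected Omega, bounded_set Omega &
      exists a0 b0 : R, exists x0 : 'rV[R]_n,
      [/\ 0 < a0, a0 <= b0, Omega x0 &
          forall x, Omega x -> x <> x0 ->
          exists (L : R) (gamma : R -> 'rV[R]_n),
            [/\ arc_length_curve Omega x x0 L gamma, L <= b0 &
                forall t, 0 <= t <= L ->
                  a0 / L * t <= dist_bd Omega (gamma t)]]].

End geometry.

Section sobolev.
Context {R : realType} {n : nat}.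
Implicit Types (Omega : set 'rV[R]_n) (q : R) (w u v phi : 'rV[R]_n -> R).

Definition wnorm Omega q w u : \bar R :=
  ((\int[lebesgue_rV n]_(x in Omega) (`|u x| `^ q * w x)%:E) `^ q^-1)%E.

Definition wLq Omega q w : set ('rV[R]_n -> R) :=
  [set u | measurable_fun Omega u /\ (wnorm Omega q w u < +oo)%E].

Definition partial (i : 'I_n) phi : 'rV[R]_n -> R :=
  fun x => 'D_(delta_mx ord0 i) (phi : 'rV[R]_n -> R^o) x.

Definition gradient phi : 'rV[R]_n -> 'rV[R]_n :=
  fun x => \row_i partial i phi x.

(* This is C^infty: differentiability at each order makes the partial
   derivatives of that order continuous. *)
Definition smooth phi : Prop :=
  forall (s : seq 'I_n) x,
    differentiable (foldr partial phi s : 'rV[R]_n -> R^o) x.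

Definition test_fun Omega : set ('rV[R]_n -> R) :=
  [set phi | [/\ smooth phi, compact (closure [set x | phi x != 0]) &
                 closure [set x | phi x != 0] `<=` Omega]].

Definition loc_integrable Omega u : Prop :=
  forall K, compact K -> K `<=` Omega ->
    (lebesgue_rV n).-integrable K (EFin \o u).

Definition weak_partial Omega (i : 'I_n) u v : Prop :=
  [/\ loc_integrable Omega u, loc_integrable Omega v &
      forall phi, test_fun Omega phi ->
        (\int[lebesgue_rV n]_(x in Omega) (u x * partial i phi x)%:E =
         - \int[lebesgue_rV n]_(x in Omega) (v x * phi x)%:E)%E].

Definition weak_gradient Omega u (g : 'rV[R]_n -> 'rV[R]_n) : Prop :=
  forall i, weak_partial Omega i u (fun x => g x ord0 i).

Definition weak_jacobian Omega (u : 'rV[R]_n -> 'rV[R]_n)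
    (Du : 'rV[R]_n -> 'M[R]_n) : Prop :=
  forall i j, weak_partial Omega j (fun x => u x ord0 i) (fun x => Du x i j).

(* Norm of the pair (u, g), where g stands for the weak gradient of u. *)
Definition sobolev_norm Omega q w u (g : 'rV[R]_n -> 'rV[R]_n) : \bar R :=
  (wnorm Omega q w u + wnorm Omega q w (fun x => fnorm (g x)))%E.

(* Weighted W^{1,q}, as the set of pairs (u, weak gradient of u). *)
Definition sobolev Omega q w u (g : 'rV[R]_n -> 'rV[R]_n) : Prop :=
  [/\ wLq Omega q w u, weak_gradient Omega u g &
      forall i, wLq Omega q w (fun x => g x ord0 i)].

Definition sobolev0 Omega q w : set ('rV[R]_n -> R) :=
  [set u | exists2 g, sobolev Omega q w u g &
     forall e : R, 0 < e -> exists2 phi, test_fun Omega phi &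
       (sobolev_norm Omega q w (fun x => u x - phi x)%R
          (fun x => g x - gradient phi x)%R < e%:E)%E].

End sobolev.

(* Main.v *)
(* It suffices to find theta < 1 such that every mean-zero f admits a smooth
   compactly supported u with |Du| <= C |f| and |f - div u| <= theta |f| in the
   weighted L^q norm: iterating on the error gives a geometric series whose sum
   solves div u = f.

   By density f may be taken constant on small cubes of a dyadic lattice.  Each
   lattice cube in the support is joined to a central Whitney cube by the chain
   of Whitney cubes met by its John curve, and its mass is carried along the
   chain one cube at a time.  This writes f as a sum of mean-zero pieces, each
   living in a window of size comparable to one Whitney cube; the weighted l^q
   sum of the pieces is controlled by a Hardy-type inequality on the chains,
   where the Assouad dimension enters through sums of d^gamma over the lattice
   points near the boundary.

   On one window the discrete divergence equation is solved on a torus by the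
   gradient of the time-integrated heat flow of a lazy random walk.  The
   resulting second-order Riesz transforms are bounded on l^q, uniformly in the
   mesh, by a Bellman function argument: the bilinear form of the transform is
   dominated by the growth of a function B of the two heat extensions for which
   both B + c u v and B - c u v are midpoint convex.  A cutoff, whose error is
   corrected with a solution that loses one derivative, localizes the discrete
   field; products of one-variable splines turn it into a smooth field whose
   divergence is the sum of c_m b_m, where c_m is the value of f on the m-th cell
   and b_m : R^n -> [0, 1] a bump inside that cell.  The error, the sum of
   c_m (1 - b_m) over the cells, is a fixed fraction of f in norm. *)
From HB Require Import structures.
Require Import Defs.
From mathcomp Require Import all_boot all_order all_algebra ring lra zify.
From mathcomp Require Import all_classical all_reals all_analysis.
From mathcomp Require Import measurable_realfun.

Set Implicit Arguments.
Unset Strict Implicit.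
Unset Printing Implicit Defensive.

Import Order.TTheory GRing.Theory Num.Theory.
Import numFieldNormedType.Exports.

Local Open Scope classical_set_scope.
Local Open Scope ring_scope.

(** * A Bellman function *)

(** Step functions reduce the main estimates to finite sums; the weight and the mesh are then the
    two obstacles. The weight may degenerate at the boundary, so the estimates on windows are
    unweighted (the weight is essentially constant there), and the weight enters through the masses
    sent along chains. With [gamma = (beta - dl) * p], a Jensen inequality with weights [d ^ gamma]
    costs sums of [d ^ gamma] over lattice points, which are under control as soon as an Assouad
    exponent [lambda] is below [n + gamma]. The strict inequality on [beta] leaves room for some
    [dl > 0], and the excess [dl * q] becomes geometric decay along chains. The mesh must not enter
    the constant of a window. The Bellman argument asks of the walk only a positive kernel charging
    0 and each [e i]; as a torus is finite, finitely many dyadic scales in [B] suffice, and the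
    constants do not depend on how many. The divergence of a test field is smooth, so a step
    function is not reached exactly; capturing a fixed fraction of it is enough for the
    iteration. *)

Section huber.
Context {R : realType}.
Implicit Types r u v a b : R.

Lemma bernoulli_tangent m r a : 0 <= r -> 0 <= a ->
  a ^+ m.+1 + m.+1%:R * a ^+ m * (r - a) <= r ^+ m.+1.
Proof.
move=> r0 a0; elim: m => [|m IH]; first by rewrite !expr1 expr0 !mul1r; lra.
rewrite [r ^+ _]exprS; apply: le_trans (ler_wpM2l r0 IH).
rewrite -subr_ge0 (_ : m.+2%:R = m.+1%:R + 1) ?natr1// !(exprS a).
have := exprn_ge0 m a0; set y := a ^+ m; set k := m.+1%:R => y0.
rewrite (_ : _ - _ = k * y * (r - a) ^+ 2); last by ring.
by rewrite mulr_ge0 ?sqr_ge0 ?mulr_ge0 ?exprn_ge0.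
Qed.

(** Linear growth beyond 1 makes the sum over small scales [l] converge; the power near 0, once its
    exponent exceeds [p] and [q], makes the sum over large scales converge. The two pieces match to
    first order at 1, which keeps convexity. *)
Definition huber m r : R := if r <= 1 then r ^+ m else 1 + m%:R * (r - 1).

(** The clause at [a = 0] serves the composition with the Euclidean norm, which has no gradient at
    the origin; an exponent of at least 2 makes the slope vanish there. *)
Lemma huber_tangent m a : 0 <= a ->
  exists2 s, 0 <= s /\ (a = 0 -> s = 0) &
    forall r, 0 <= r -> huber m.+2 a + s * (r - a) <= huber m.+2 r.
Proof.
move=> a0; rewrite /huber; have [a1|a1] := leP a 1.
  exists (m.+2%:R * a ^+ m.+1).
    by split=> [|->]; rewrite ?expr0n ?mulr0 ?mulr_ge0 ?exprn_ge0.
  move=> r r0; have [r1|r1] := leP r 1; first exact: bernoulli_tangent.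
  have := @bernoulli_tangent m.+1 1 a ler01 a0; rewrite expr1n.
  have : a ^+ m.+1 <= 1 by rewrite exprn_ile1.
  have : 0 <= m.+2%:R :> R by [].
  set x := _ ^+ m.+1; set y := a ^+ m.+2; set n := _%:R => n0 x1 h.
  by have : 0 <= n * ((1 - x) * (r - 1)); [rewrite !mulr_ge0//; lra | nra].
exists m.+2%:R; first by split => // ar; move: a1; rewrite ar ltNge ler01.
move=> r r0; have [r1|r1] := leP r 1; last by nra.
by have := @bernoulli_tangent m.+1 r 1 r0 ler01; rewrite !expr1n; nra.
Qed.

Lemma huber_ge0 m r : 0 <= r -> 0 <= huber m r.
Proof.
move=> r0; rewrite /huber; have [r1|r1] := leP r 1; first exact: exprn_ge0.
by rewrite addr_ge0// mulr_ge0// subr_ge0 ltW.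
Qed.

Lemma huber_nd m r s : 0 <= r -> r <= s -> huber m r <= huber m s.
Proof.
move=> r0 rs; rewrite /huber; have [r1|r1] := leP r 1; have [s1|s1] := leP s 1.
- by rewrite lerXn2r ?nnegrE// (le_trans r0).
- by rewrite (@le_trans _ _ 1) ?exprn_ile1// lerDl mulr_ge0// subr_ge0 ltW.
- by have := lt_le_trans r1 (le_trans rs s1); rewrite ltxx.
- by rewrite lerD2l ler_wpM2l// lerB.
Qed.

Lemma huber_le_lin m r : 0 <= r -> huber m.+1 r <= m.+1%:R * r.
Proof.
move=> r0; rewrite /huber; have [r1|r1] := leP r 1.
  rewrite exprS mulrC ler_wpM2r// (@le_trans _ _ 1) ?exprn_ile1//.
  by rewrite ler1n.
by have : 1 <= m.+1%:R :> R by [rewrite ler1n]; nra.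
Qed.

Lemma huber_le_exp m r : 0 <= r -> huber m.+1 r <= m.+1%:R * r ^+ m.+1.
Proof.
move=> r0; have [r1|r1] := leP r 1.
  by rewrite /huber r1 ler_peMl ?exprn_ge0// ler1n.
apply: le_trans (huber_le_lin _ r0) _; rewrite ler_wpM2l// exprS.
by rewrite ler_peMr// exprn_ege1// ltW.
Qed.

End huber.

Section bellman.
Context {R : realType}.
Implicit Types (u v a b l : R).

Definition nrm2 a b : R := Num.sqrt (a ^+ 2 + b ^+ 2).

Lemma nrm2_ge0 a b : 0 <= nrm2 a b. Proof. exact: sqrtr_ge0. Qed.

Lemma nrm2_sqr a b : nrm2 a b ^+ 2 = a ^+ 2 + b ^+ 2.
Proof. by rewrite sqr_sqrtr// addr_ge0 ?sqr_ge0. Qed.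

Lemma nrm2_CS a b c d : a * c + b * d <= nrm2 a b * nrm2 c d.
Proof.
have [h|h] := leP (a * c + b * d) 0.
  by rewrite (le_trans h)// mulr_ge0 ?nrm2_ge0.
rewrite -(@ler_pXn2r _ 2) ?nnegrE ?mulr_ge0 ?nrm2_ge0 ?(ltW h)//.
rewrite exprMn !nrm2_sqr; have := sqr_ge0 (a * d - b * c); nra.
Qed.

Lemma nrm2_le_max a b : exists2 c, nrm2 a b <= c & c = 2 * `|a| \/ c = 2 * `|b|.
Proof.
have H x y : `|x| <= `|y| -> nrm2 x y <= 2 * `|y|.
  move=> xy; rewrite -(@ler_pXn2r _ 2) ?nnegrE ?mulr_ge0 ?nrm2_ge0//.
  rewrite nrm2_sqr -(real_normK (num_real x)) -(real_normK (num_real y)).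
  by have := normr_ge0 x; nra.
have [ab|ab] := leP `|a| `|b|; first by exists (2 * `|b|); [exact: H|right].
exists (2 * `|a|); last by left.
by rewrite /nrm2 addrC; apply: H; exact: ltW.
Qed.

Lemma nrm2_ge_coord a b : `|a| <= nrm2 a b /\ `|b| <= nrm2 a b.
Proof.
split; rewrite -(@ler_pXn2r _ 2) ?nnegrE ?nrm2_ge0// nrm2_sqr real_normK ?num_real//.
  by rewrite lerDl sqr_ge0.
by rewrite lerDr sqr_ge0.
Qed.

Variables (p q : R) (m : nat).

(* Anisotropic rescaling by [l ^ (1/q), l ^ (1/p)] multiplies [u * v] by [l]. *)
Definition bterm l u v : R :=
  l * huber (2 * m.+1) (nrm2 (l `^ (- q^-1) * u) (l `^ (- p^-1) * v)).

Definition bellman (s : seq R) u v : R := \sum_(l <- s) bterm l u v.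

(** Convexity, in the form that Jensen's inequality uses directly: a supporting plane at every
    point. *)
Definition subgrad (B : R -> R -> R) := forall c1 c2, exists g1 g2,
  forall y1 y2, B c1 c2 + g1 * (y1 - c1) + g2 * (y2 - c2) <= B y1 y2.

Lemma subgrad_bterm l : 0 <= l -> subgrad (bterm l).
Proof.
move=> l0 c1 c2; set a := l `^ (- q^-1); set b := l `^ (- p^-1).
have [s [s0 sE] hs] := @huber_tangent R (2 * m) _ (nrm2_ge0 (a * c1) (b * c2)).
set N := nrm2 (a * c1) (b * c2) in s0 sE hs.
(* The gradient of the composite: slope [s] times the unit vector [(a * c1, b * c2) / N], pulled
   back by the rescaling. When [N = 0] the slope is 0 and so is the subgradient. *)
exists (l * s * a * (a * c1) / N), (l * s * b * (b * c2) / N) => y1 y2.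
rewrite /bterm -/a -/b mul2n doubleS -!mul2n.
apply: (@le_trans _ _ (l * (huber (2 * m).+2 N + s * (nrm2 (a * y1) (b * y2) - N)))); last first.
  by rewrite ler_wpM2l// hs// nrm2_ge0.
rewrite -addrA [X in _ <= X]mulrDr lerD2l.
have [N0|N0] := eqVneq N 0.
  by rewrite sE// !(mulr0, mul0r) addr0.
have -> : l * s * a * (a * c1) / N * (y1 - c1) + l * s * b * (b * c2) / N * (y2 - c2) =
   l * (s * (((a * c1) * (a * y1) + (b * c2) * (b * y2)) / N - N)).
  have := nrm2_sqr (a * c1) (b * c2); rewrite -/N => NE.
  transitivity (l * s * ((a * c1 * (a * y1) + b * c2 * (b * y2)) - ((a * c1) ^+ 2 + (b * c2) ^+ 2)) / N).
    by field.
  by rewrite -NE; field.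
rewrite ler_wpM2l// ler_wpM2l// lerD2r.
rewrite ler_pdivrMr ?lt0r ?N0 ?nrm2_ge0//.
by rewrite [X in _ <= X]mulrC; exact: nrm2_CS.
Qed.

Lemma subgrad_bellman s : (forall l, l \in s -> 0 <= l) -> subgrad (bellman s).
Proof.
elim: s => [|l s IH] h c1 c2.
  by exists 0, 0 => y1 y2; rewrite /bellman !big_nil !mul0r !addr0.
have [g1 [g2 hg]] := IH (fun l' ls => h l' (@mem_behead _ (l :: s) l' ls)) c1 c2.
have [k1 [k2 hk]] := subgrad_bterm (h _ (mem_head _ _)) c1 c2.
exists (k1 + g1), (k2 + g2) => y1 y2; rewrite /bellman !big_cons.
by have := hg y1 y2; have := hk y1 y2; rewrite /bellman; lra.
Qed.

Lemma bterm_ge0 l u v : 0 <= l -> 0 <= bterm l u v.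
Proof. by move=> l0; rewrite mulr_ge0// huber_ge0// nrm2_ge0. Qed.

(* On the unit ball the Huber function is [(a^2 + b^2)^(m+1)], whose second
   difference dominates [|d|^2 * M^m] by the parallelogram identity. *)
Lemma bterm_gain l u v du dv :
  p^-1 + q^-1 = 1 -> 0 < l -> forall k : R, 0 < k ->
  (forall e : bool, nrm2 (l `^ (- q^-1) * (u + (-1) ^+ e * du))
     (l `^ (- p^-1) * (v + (-1) ^+ e * dv)) <= 1) ->
  (exists e : bool, k <= nrm2 (l `^ (- q^-1) * (u + (-1) ^+ e * du))
     (l `^ (- p^-1) * (v + (-1) ^+ e * dv)) ^+ 2) ->
  2 * (k / 2) ^+ m * `|du * dv| <=
    (bterm l (u + du) (v + dv) + bterm l (u - du) (v - dv)) / 2 - bterm l u v.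
Proof.
move=> pq l0 k k0 hle [e0 he0].
set a := l `^ (- q^-1) in hle he0 *; set b := l `^ (- p^-1) in hle he0 *.
have ab : l * (a * b) = 1.
  rewrite /a /b -powRD; last by rewrite (gt_eqF l0) implybT.
  rewrite -opprD [_ + p^-1]addrC pq.
  by rewrite powR_inv1 ?ltW// mulfV// gt_eqF.
have h0 := hle false; have h1 := hle true.
rewrite !expr0 !mul1r in h0; rewrite !expr1 !mulN1r in h1.
set X := (a * (u + du)) ^+ 2 + (b * (v + dv)) ^+ 2.
set Y := (a * (u - du)) ^+ 2 + (b * (v - dv)) ^+ 2.
set Dd := (a * du) ^+ 2 + (b * dv) ^+ 2.
set Mm := (X + Y) / 2.
have Z : (a * u) ^+ 2 + (b * v) ^+ 2 = Mm - Dd by rewrite /Mm /X /Y /Dd; field.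
have X0 : 0 <= X by rewrite addr_ge0 ?sqr_ge0.
have Y0 : 0 <= Y by rewrite addr_ge0 ?sqr_ge0.
have D0 : 0 <= Dd by rewrite addr_ge0 ?sqr_ge0.
have Z0 : 0 <= Mm - Dd by rewrite -Z addr_ge0 ?sqr_ge0.
have kM : k / 2 <= Mm.
  rewrite /Mm ler_pM2r ?invr_gt0//.
  case: e0 he0; rewrite nrm2_sqr.
    by rewrite expr1 !mulN1r -/Y => /le_trans; apply; rewrite lerDr.
  by rewrite expr0 !mul1r -/X => /le_trans; apply; rewrite lerDl.
have X1 : X <= 1 by rewrite /X -nrm2_sqr exprn_ile1 ?nrm2_ge0.
have Y1 : Y <= 1 by rewrite /Y -nrm2_sqr exprn_ile1 ?nrm2_ge0.
have z1 : nrm2 (a * u) (b * v) <= 1.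
  rewrite -(@expr_le1 _ 2)// ?nrm2_ge0// nrm2_sqr Z.
  rewrite (@le_trans _ _ Mm) ?gerBl//.
  rewrite /Mm ler_pdivrMr// mul1r; apply: lerD X1 Y1.
rewrite /bterm -/a -/b /huber h0 h1 z1 !exprM !nrm2_sqr -/X -/Y Z.
have pw : Mm ^+ m.+1 <= (X ^+ m.+1 + Y ^+ m.+1) / 2.
  have MM : 0 <= Mm by rewrite divr_ge0// addr_ge0.
  have := bernoulli_tangent m X0 MM; have := bernoulli_tangent m Y0 MM.
  set A := _ ^+ m; set B := _%:R.
  have -> : Y - Mm = - (X - Mm) by rewrite /Mm; field.
  by lra.
have st : (Mm - Dd) ^+ m.+1 <= Mm ^+ m.+1 - Dd * Mm ^+ m.
  rewrite !exprS -mulrBl; apply: ler_wpM2l => //.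
  by rewrite lerXn2r ?nnegrE// ?gerBl// (le_trans Z0)// gerBl.
have duv : 2 * (l^-1 * `|du * dv|) <= Dd.
  have -> : l^-1 = a * b by rewrite -[RHS]mul1r -(mulVf (lt0r_neq0 l0)) -mulrA ab mulr1.
  have -> : a * b * `|du * dv| = `|(a * du)| * `|b * dv|.
    by rewrite !normrM (ger0_norm (powR_ge0 _ _ : 0 <= a))
      (ger0_norm (powR_ge0 _ _ : 0 <= b)); ring.
  rewrite /Dd -(real_normK (num_real (a * du))) -(real_normK (num_real (b * dv))).
  by have := sqr_ge0 (`|a * du| - `|b * dv|); nra.
apply: (@le_trans _ _ (l * (Dd * Mm ^+ m))); last first.
  have -> : (l * X ^+ m.+1 + l * Y ^+ m.+1) / 2 - l * (Mm - Dd) ^+ m.+1 =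
    l * ((X ^+ m.+1 + Y ^+ m.+1) / 2 - (Mm - Dd) ^+ m.+1) by field.
  by rewrite ler_pM2l//; lra.
apply: (@le_trans _ _ (l * (2 * (l^-1 * `|du * dv|) * (k / 2) ^+ m))).
  rewrite le_eqVlt; apply/orP; left; apply/eqP.
  by field; rewrite gt_eqF.
have k20 : 0 <= k / 2 by rewrite divr_ge0// ltW.
rewrite ler_pM2l//; apply: ler_pM duv _.
- by rewrite !mulr_ge0// invr_ge0 ltW.
- exact: exprn_ge0.
- by rewrite lerXn2r ?nnegrE// (le_trans k20).
Qed.

End bellman.

Section geometric.
Context {R : realType}.
Implicit Types (b y : R).

Lemma sum_expr_le b n : 1 < b -> \sum_(j < n) b ^+ j <= b ^+ n / (b - 1).
Proof.
move=> b1; rewrite ler_pdivlMr ?subr_gt0//.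
by rewrite mulrC -subrX1 gerBl.
Qed.

Lemma sum_powR_le b y n : 1 < b ->
  \sum_(j < n | j%:R <= y) b ^+ j <= b `^ y * (b / (b - 1)).
Proof.
move=> b1; have b0 : 0 < b by apply: lt_trans b1.
have bb : 0 <= b / (b - 1) by rewrite divr_ge0 ?subr_ge0 ?(ltW b1)// ltW.
elim: n => [|n IH]; first by rewrite big_ord0 mulr_ge0// powR_ge0.
rewrite big_mkcond big_ord_recr/= -big_mkcond/=; case: ifPn => [ny|_]; last first.
  by rewrite addr0.
apply: (@le_trans _ _ (\sum_(j < n.+1) b ^+ j)).
  rewrite big_ord_recr/= lerD2r [leRHS](bigID (fun j : 'I_n => j%:R <= y))/= lerDl.
  by apply: sumr_ge0 => j _; rewrite exprn_ge0// ltW.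
apply: le_trans (sum_expr_le _ b1) _; rewrite exprSr -mulrA.
rewrite ler_wpM2r// -powR_mulrn ?(ltW b0)//.
by apply: ler_powR => //; exact: ltW.
Qed.

Lemma sum_powRN_le b y n : 1 < b ->
  \sum_(j < n | y <= j%:R) b ^- j <= b `^ (- y) * (b / (b - 1)).
Proof.
move=> b1; have b0 : 0 < b by apply: lt_trans b1.
rewrite (reindex_inj rev_ord_inj)/=.
rewrite (eq_big (fun j : 'I_n => j%:R <= n%:R - 1 - y)
  (fun j : 'I_n => b ^+ j * b `^ (1 - n%:R))); last 2 first.
- move=> j; rewrite natrB// -natr1.
  by apply/idP/idP; lra.
- move=> j _; rewrite -!powR_mulrn ?ltW// -powRN -powRD ?(gt_eqF b0) ?implybT//.
  by rewrite natrB// -natr1; congr (_ `^ _); lra.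
rewrite -mulr_suml.
apply: le_trans (ler_wpM2r (powR_ge0 _ _) (sum_powR_le _ _ b1)) _.
rewrite mulrAC -powRD ?(gt_eqF b0) ?implybT//.
by rewrite (_ : _ + _ = - y) ?lexx//; lra.
Qed.

End geometric.

Lemma powR_div {R : realType} (x y s : R) : 0 <= x -> 0 <= y ->
  (x / y) `^ s = x `^ s / y `^ s.
Proof.
move=> x0 y0; rewrite powRM ?invr_ge0//; congr (_ * _).
by rewrite -[y^-1]powR_inv1// -powRrM mulN1r powRN.
Qed.

Section bellman_function.
Context {R : realType}.
Variables (p q : R).
Hypotheses (p1 : 1 < p) (q1 : 1 < q) (pq : p^-1 + q^-1 = 1).

Let p0 : 0 < p. Proof. exact: lt_trans p1. Qed.
Let q0 : 0 < q. Proof. exact: lt_trans q1. Qed.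

Definition scales (K : nat) : seq R :=
  [seq 2 `^ (j%:R - K%:R) | j <- iota 0 (2 * K).+1].

Lemma scales_gt0 K l : l \in scales K -> 0 < l.
Proof. by case/mapP => j _ ->; rewrite powR_gt0. Qed.

Lemma scales_mem (k : int) K : (absz k <= K)%N -> 2 `^ k%:~R \in scales K.
Proof.
move=> kK; apply/mapP; exists (absz (k + K%:Z)).
  by rewrite mem_iota; lia.
congr (_ `^ _); rewrite natr_absz ger0_norm; last by lia.
by rewrite rmorphD/= pmulrn addrK.
Qed.

Lemma dyadic_bracket (t : R) : 0 < t ->
  exists k : int, 2 `^ k%:~R / 2 <= t < 2 `^ k%:~R.
Proof.
move=> t0; pose k := Num.floor (ln t / ln 2).
have l2 : 0 < ln (2 : R) by rewrite ln_gt0// ltr1n.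
have tE : t = 2 `^ (ln t / ln 2).
  by rewrite /powR ifF ?pnatr_eq0// divfK ?gt_eqF// lnK.
have [h1 h2] : k%:~R <= ln t / ln 2 /\ ln t / ln 2 < (k + 1)%:~R.
  by split; [exact: Num.Theory.floor_le|exact: floorD1_gt].
exists (k + 1); apply/andP; split; last first.
  by rewrite [ltLHS]tE /powR ifF ?pnatr_eq0// ltr_expR ltr_pM2r.
rewrite [leRHS]tE rmorphD/= powRD ?pnatr_eq0 ?implybT// powRr1// mulfK//.
by apply: ler_powR; rewrite ?ler1n.
Qed.

Let M := (Num.truncn (p + q)).+1.

(** Small enough that its powers [1 / p] and [1 / q] are at most 1/2, which puts both rescaled
    coordinates of a point in the unit ball. *)
Let theta : R := 2 `^ (- (p + q)).

Let rescale (r t l u : R) : 1 < r -> 0 < t -> 0 < l -> `|u| `^ r <= t ->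
  l `^ (- r^-1) * `|u| <= (t / l) `^ r^-1.
Proof.
move=> r1 t0 l0 ut; have r0 : 0 < r by exact: lt_trans r1.
rewrite powRN mulrC powR_div ?(ltW t0) ?(ltW l0)// ler_wpM2r ?invr_ge0 ?powR_ge0//.
have -> : `|u| = (`|u| `^ r) `^ r^-1 by rewrite -powRrM mulfV ?gt_eqF// powRr1.
by apply: ge0_ler_powR; rewrite ?nnegrE ?invr_ge0 ?powR_ge0 ?(ltW r0) ?(ltW t0).
Qed.

Let rescale_eq (r l u : R) : 1 < r -> 0 < l ->
  l `^ (- r^-1) * `|u| = (`|u| `^ r / l) `^ r^-1.
Proof.
move=> r1 l0; have r0 : 0 < r by exact: lt_trans r1.
rewrite powRN mulrC powR_div ?powR_ge0 ?(ltW l0)//.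
by rewrite -powRrM mulfV ?gt_eqF// powRr1.
Qed.

Let theta0 : 0 < theta. Proof. by rewrite powR_gt0. Qed.

Let theta_half r : 0 < r -> r <= p + q -> theta `^ r^-1 <= 2^-1.
Proof.
move=> r0 rpq; rewrite -powRrM -[leRHS]powR_inv1//.
apply: ler_powR; first by rewrite ler1n.
by rewrite mulNr lerN2 ler_pdivlMr// mul1r.
Qed.

(** A single scale yields the gain: [l] comparable to the largest of [|u + du| ^ q], [|u - du| ^ q],
    [|v + dv| ^ p], [|v - dv| ^ p]. There both endpoints lie in the unit ball and one of them is
    bounded below, as [bterm_gain] asks. Every other scale has a nonnegative second difference by
    convexity; [K] only has to be large enough for [l] to be among the scales. *)
Lemma bellman_gain : exists2 c : R, 0 < c & forall u v du dv,
  exists K0 : nat, forall K, (K0 <= K)%N ->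
  c * `|du * dv| <= (bellman p q M (scales K) (u + du) (v + dv) +
     bellman p q M (scales K) (u - du) (v - dv)) / 2 - bellman p q M (scales K) u v.
Proof.
pose k0 := (theta / 2) ^+ 2.
have k0_gt0 : 0 < k0 by rewrite exprn_gt0// divr_gt0.
exists (2 * (k0 / 2) ^+ M); first by rewrite mulr_gt0// exprn_gt0// divr_gt0.
move=> u v du dv.
have mid s : (forall l, l \in s -> 0 <= l) ->
    0 <= (bellman p q M s (u + du) (v + dv) + bellman p q M s (u - du) (v - dv)) / 2
         - bellman p q M s u v.
  move=> /(subgrad_bellman p q M)/(_ u v)[g1 [g2 hg]].
  by have := hg (u + du) (v + dv); have := hg (u - du) (v - dv); lra.
have [duv|duv] := eqVneq (du * dv) 0.
  exists 0%N => K _; rewrite duv normr0 mulr0; apply: mid => l ls.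
  exact/ltW/(scales_gt0 ls).
pose U (e : bool) := u + (-1) ^+ e * du.
pose V (e : bool) := v + (-1) ^+ e * dv.
pose N e := Num.max (`|U e| `^ q) (`|V e| `^ p).
pose t := Num.max (N false) (N true).
have Nt e : N e <= t by rewrite /t le_max; case: e; rewrite lexx ?orbT.
have t0 : 0 < t.
  rewrite lt_neqAle eq_sym andbC (le_trans _ (Nt true)) ?le_max ?powR_ge0//=.
  apply/eqP => tE; case/eqP: duv.
  have E e : U e = 0.
    apply/eqP; rewrite -normr_eq0; apply/eqP/(@powR_eq0_eq0 _ _ q)/eqP.
    by rewrite eq_le powR_ge0 andbT -tE (le_trans _ (Nt e))// le_max lexx.
  have := E false; have := E true; rewrite /U expr0 expr1 => e1 e2.
  by rewrite (_ : du = 0) ?mul0r//; lra.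
have [k /andP[k1 k2]] := dyadic_bracket (divr_gt0 t0 theta0).
set l := 2 `^ k%:~R in k1 k2.
have l0 : 0 < l by rewrite powR_gt0.
have tl : t / l <= theta by rewrite ler_pdivrMr// mulrC -ler_pdivrMr// ltW.
have tl2 : theta / 2 <= t / l.
  by move: k1; rewrite ler_pdivlMr// => k1; rewrite ler_pdivlMr// mulrAC ler_pdivrMr//; lra.
have tl0 : 0 <= t / l by rewrite divr_ge0 ?ltW.
exists (absz k) => K kK.
have lK := scales_mem kK; rewrite -/l in lK.
have Ue e : `|l `^ (- q^-1) * U e| <= 2^-1.
  rewrite normrM (ger0_norm (powR_ge0 _ _)).
  apply: le_trans (rescale q1 t0 l0 _) _.
    by rewrite (le_trans _ (Nt e))// le_max lexx.
  apply: le_trans (theta_half q0 _); last by rewrite lerDr ltW.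
  by apply: ge0_ler_powR; rewrite ?nnegrE ?invr_ge0 ?(ltW q0) ?(ltW theta0).
have Ve e : `|l `^ (- p^-1) * V e| <= 2^-1.
  rewrite normrM (ger0_norm (powR_ge0 _ _)).
  apply: le_trans (rescale p1 t0 l0 _) _.
    by rewrite (le_trans _ (Nt e))// le_max lexx orbT.
  apply: le_trans (theta_half p0 _); last by rewrite lerDl ltW.
  by apply: ge0_ler_powR; rewrite ?nnegrE ?invr_ge0 ?(ltW p0) ?(ltW theta0).
have small e : nrm2 (l `^ (- q^-1) * U e) (l `^ (- p^-1) * V e) <= 1.
  rewrite -(@expr_le1 _ 2)// ?nrm2_ge0// nrm2_sqr.
  rewrite -(real_normK (num_real (_ * U e))) -(real_normK (num_real (_ * V e))).
  have := Ue e; have := Ve e.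
  set x := `|_ * U e|; set y := `|_ * V e| => y2 x2.
  by have := normr_ge0 (l `^ (- q^-1) * U e); have := normr_ge0 (l `^ (- p^-1) * V e); rewrite -/x -/y; nra.
have [e0 he0] : exists e : bool, k0 <= nrm2 (l `^ (- q^-1) * U e) (l `^ (- p^-1) * V e) ^+ 2.
  have th2 : 0 < theta / 2 by rewrite divr_gt0.
  have low r : 1 < r -> theta / 2 <= (t / l) `^ r^-1.
    move=> r1; have r0 : 0 < r by exact: lt_trans r1.
    apply: (@le_trans _ _ ((theta / 2) `^ r^-1)); last first.
      by apply: ge0_ler_powR; rewrite ?nnegrE ?invr_ge0 ?(ltW r0) ?(ltW th2).
    rewrite -[leLHS]powRr1 ?(ltW th2)//; apply: ger_powR.
      rewrite th2/= ler_pdivrMr// mul1r (@le_trans _ _ 1)//; last by lra.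
      rewrite -[leRHS](powRr0 (2 : R)).
      by apply: ler_powR; rewrite ?ler1n// oppr_le0 addr_ge0 ?(ltW p0) ?(ltW q0).
    by rewrite invf_le1 ?ltW.
  have [e Ne] : exists e, N e = t.
    rewrite /t; have [h|h] := leP (N false) (N true); first by exists true.
    by exists false.
  exists e; have [n1 n2] := nrm2_ge_coord (l `^ (- q^-1) * U e) (l `^ (- p^-1) * V e).
  rewrite lerXn2r ?nnegrE ?nrm2_ge0 ?(ltW th2)//.
  move: Ne; rewrite /N; have [h|h] := leP (`|U e| `^ q) (`|V e| `^ p) => Ne.
    apply: le_trans n2; rewrite normrM (ger0_norm (powR_ge0 _ _)) (rescale_eq _ p1 l0) Ne.
    exact: low p1.
  apply: le_trans n1; rewrite normrM (ger0_norm (powR_ge0 _ _)) (rescale_eq _ q1 l0) Ne.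
  exact: low q1.
have gn := bterm_gain M pq l0 k0_gt0 small (ex_intro _ e0 he0).
have B a b : bellman p q M (scales K) a b =
   bterm p q M l a b + bellman p q M (rem l (scales K)) a b.
  by rewrite /bellman (perm_big _ (perm_to_rem lK)) big_cons.
have mr : forall x, x \in rem l (scales K) -> 0 <= x by move=> x /mem_rem/scales_gt0/ltW.
by have := mid _ mr; rewrite !B; move: gn; lra.
Qed.

Let N := (2 * M.+1)%N.

Let ltN : p + q < N%:R.
Proof.
apply: lt_le_trans (truncnS_gt _) _; rewrite ler_nat /N mul2n -addnn.
exact: leq_trans (leqnSn _) (leq_addr _ _).
Qed.

(** The scales are split at [l ~ |u| ^ r]. Below, the linear bound of [huber] gives terms
    [l ^ (1 - 1/r) * |u|], which sum geometrically since [r > 1]; above, the power bound gives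
    [l ^ (1 - N/r) * |u| ^ N], which sum since [r < N]. Both sums are of order [|u| ^ r]. *)
Let one_scale_sum (r : R) : 1 < r -> r < N%:R -> exists2 C : R, 0 <= C & forall K (u : R),
  \sum_(l <- scales K) l * huber N (2 * (l `^ (- r^-1) * `|u|)) <= C * `|u| `^ r.
Proof.
move=> r1 rN; have r0 : 0 < r by exact: lt_trans r1.
pose s1 := 1 - r^-1; pose s2 := N%:R / r - 1.
have s10 : 0 < s1 by rewrite subr_gt0 invf_lt1.
have s20 : 0 < s2 by rewrite subr_gt0 ltr_pdivlMr// mul1r.
have pow2 s : 0 < s -> 1 < (2 : R) `^ s.
  by move=> s0; rewrite /powR ifF ?pnatr_eq0// expR_gt1 mulr_gt0// ln_gt0// ltr1n.
have b10 := pow2 _ s10; have b20 := pow2 _ s20.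
set b1 := 2 `^ s1 in b10; set b2 := 2 `^ s2 in b20.
pose C1 := N%:R * 2 * (b1 / (b1 - 1)); pose C2 := N%:R * 2 ^+ N * (b2 / (b2 - 1)).
have bb b : 1 < b -> 0 <= b / (b - 1).
  by move=> h; rewrite divr_ge0 ?subr_ge0 ?(ltW h)// ltW// (lt_trans _ h).
exists (C1 + C2).
  by rewrite addr_ge0// mulr_ge0 ?bb// mulr_ge0// exprn_ge0.
move=> K u; have [->|u0] := eqVneq u 0.
  rewrite normr0 powR0 ?gt_eqF// mulr0 big1_seq// => l _.
  by rewrite !mulr0 /huber ler01 /N mulnS expr0n mulr0.
have y0 : 0 < `|u| `^ r by rewrite powR_gt0// normr_gt0.
set y := `|u| `^ r in y0 *; pose ka := ln y / ln 2.
have yE : y = 2 `^ ka.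
  by rewrite /powR ifF ?pnatr_eq0// divfK ?gt_eqF ?ln_gt0 ?ltr1n// lnK.
rewrite /scales big_map -[iota _ _]/(index_iota 0 (2 * K).+1) big_mkord.
pose F (j : nat) : R := 2 `^ (j%:R - K%:R) *
  huber N (2 * ((2 `^ (j%:R - K%:R)) `^ (- r^-1) * `|u|)).
have F0 j : 0 <= F j.
  by rewrite mulr_ge0 ?powR_ge0// huber_ge0// !mulr_ge0 ?powR_ge0.
rewrite (eq_bigr (fun j : 'I_(2 * K).+1 => F j))//.
have xE (j : nat) : (2 `^ (j%:R - K%:R)) `^ (- r^-1) * `|u| = 2 `^ ((ka + K%:R - j%:R) / r).
  rewrite rescale_eq ?powR_gt0// -/y yE -powRB; last by rewrite pnatr_eq0 implybT.
  by rewrite -powRrM opprB addrA.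
have FE (j : nat) : F j = 2 `^ (j%:R - K%:R) * huber N (2 * 2 `^ ((ka + K%:R - j%:R) / r)).
  by congr (_ * huber N (2 * _)); exact: xE.
have low (j : nat) : j%:R <= ka + K%:R -> F j <= y * (N%:R * 2) * (b1 `^ (- (ka + K%:R)) * b1 ^+ j).
  move=> _; rewrite FE.
  apply: (@le_trans _ _ (2 `^ (j%:R - K%:R) * (N%:R * (2 * 2 `^ ((ka + K%:R - j%:R) / r))))).
    by rewrite ler_wpM2l ?powR_ge0// huber_le_lin// mulr_ge0// powR_ge0.
  rewrite yE -powR_mulrn ?powR_ge0// -!powRrM -!(mulrA _ _ (_ * _)).
  rewrite (_ : 2 `^ _ * (N%:R * _) = N%:R * 2 * (2 `^ (j%:R - K%:R) * 2 `^ ((ka + K%:R - j%:R) / r))); last by ring.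
  rewrite (_ : 2 `^ ka * _ = N%:R * 2 * (2 `^ ka * (2 `^ (s1 * - (ka + K%:R)) * 2 `^ (s1 * j%:R)))); last by ring.
  rewrite -!powRD ?pnatr_eq0 ?implybT// /s1 le_eqVlt; apply/orP; left; apply/eqP.
  by congr (_ * _ `^ _); field; rewrite gt_eqF.
have up (j : nat) : ka + K%:R <= j%:R -> F j <= y * (N%:R * 2 ^+ N) * (b2 `^ (ka + K%:R) * b2 ^- j).
  move=> _; rewrite FE.
  apply: (@le_trans _ _ (2 `^ (j%:R - K%:R) * (N%:R * (2 * 2 `^ ((ka + K%:R - j%:R) / r)) ^+ N))).
    by rewrite ler_wpM2l ?powR_ge0// /N mulnS huber_le_exp// mulr_ge0// powR_ge0.
  rewrite exprMn yE -[(2 `^ (_ / r)) ^+ N]powR_mulrn ?powR_ge0// -[b2 ^+ j]powR_mulrn ?powR_ge0// -powRN -!powRrM.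
  set X := 2 `^ (j%:R - K%:R); set Y := 2 `^ (_ * N%:R).
  rewrite (_ : X * _ = N%:R * 2 ^+ N * (X * Y)); last by ring.
  rewrite [leRHS](_ : _ = N%:R * 2 ^+ N * (2 `^ ka * (2 `^ (s2 * (ka + K%:R)) * 2 `^ (s2 * - j%:R)))); last by ring.
  rewrite /X /Y -!powRD ?pnatr_eq0 ?implybT// /s2 le_eqVlt; apply/orP; left; apply/eqP.
  by congr (_ * _ `^ _); field; rewrite gt_eqF.
apply: (@le_trans _ _ (\sum_(j < (2 * K).+1 | j%:R <= ka + K%:R) F j +
                       \sum_(j < (2 * K).+1 | ka + K%:R <= j%:R) F j)).
  rewrite [leLHS](bigID (fun j : 'I_(2 * K).+1 => j%:R <= ka + K%:R))/= lerD2l.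
  rewrite big_mkcond [leRHS]big_mkcond/=; apply: ler_sum => j _.
  by rewrite -ltNge; case: ifPn => [/ltW -> //|_]; case: ifP.
rewrite mulrDl; apply: lerD.
  apply: le_trans (ler_sum _ (fun (j : 'I_(2 * K).+1) => low j)) _.
  rewrite -!mulr_sumr.
  apply: le_trans (ler_wpM2l _ (ler_wpM2l _ (sum_powR_le _ _ b10))) _.
  - by rewrite mulr_ge0 ?(ltW y0)// mulr_ge0.
  - exact: powR_ge0.
  - rewrite (_ : y * _ * _ = C1 * y * (b1 `^ (- (ka + K%:R)) * b1 `^ (ka + K%:R))); last by rewrite /C1; ring.
    by rewrite -powRD ?(gt_eqF (lt_trans ltr01 b10)) ?implybT// addNr powRr0 mulr1.
apply: le_trans (ler_sum _ (fun (j : 'I_(2 * K).+1) => up j)) _.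
rewrite -!mulr_sumr.
apply: le_trans (ler_wpM2l _ (ler_wpM2l _ (sum_powRN_le _ _ b20))) _.
- by rewrite mulr_ge0 ?(ltW y0)// mulr_ge0// exprn_ge0.
- exact: powR_ge0.
- rewrite (_ : y * _ * _ = C2 * y * (b2 `^ (ka + K%:R) * b2 `^ (- (ka + K%:R)))); last by rewrite /C2; ring.
  by rewrite -powRD ?(gt_eqF (lt_trans ltr01 b20)) ?implybT// addrN powRr0 mulr1.
Qed.

(** The Euclidean norm is at most twice the larger coordinate and [huber] is nondecreasing, so each
    term is bounded by two one-variable terms. *)
Lemma bellman_bound : exists2 C : R, 0 <= C & forall K (u v : R),
  bellman p q M (scales K) u v <= C * (`|u| `^ q + `|v| `^ p).
Proof.
have pN : p < N%:R by apply: lt_trans ltN; rewrite ltrDl.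
have qN : q < N%:R by apply: lt_trans ltN; rewrite ltrDr.
have [C1 C10 h1] := one_scale_sum q1 qN; have [C2 C20 h2] := one_scale_sum p1 pN.
exists (C1 + C2); first exact: addr_ge0.
move=> K u v; apply: (@le_trans _ _ (C1 * `|u| `^ q + C2 * `|v| `^ p)); last first.
  set x := _ `^ q; set y := _ `^ p.
  rewrite [leRHS](_ : _ = C1 * x + C2 * y + (C1 * y + C2 * x)); last by ring.
  by rewrite lerDl addr_ge0// mulr_ge0// powR_ge0.
apply: le_trans (lerD (h1 K u) (h2 K v)).
rewrite -big_split/= /bellman big_seq [leRHS]big_seq; apply: ler_sum => l /scales_gt0 l0.
rewrite /bterm -mulrDr ler_wpM2l ?(ltW l0)//.
have [c hc hE] := nrm2_le_max (l `^ (- q^-1) * u) (l `^ (- p^-1) * v).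
apply: le_trans (huber_nd _ (nrm2_ge0 _ _) hc) _.
have hp a b : 0 <= huber N (2 * ((l `^ a) * `|b|)).
  by rewrite huber_ge0// !mulr_ge0 ?powR_ge0.
case: hE => ->; rewrite normrM (ger0_norm (powR_ge0 _ _)).
- by rewrite lerDl.
- by rewrite lerDr.
Qed.

Lemma bellman_ge0 K u v : 0 <= bellman p q M (scales K) u v.
Proof.
by rewrite /bellman big_seq sumr_ge0// => l /scales_gt0/ltW l0; exact: bterm_ge0.
Qed.

(* [B + c u v] and [B - c u v] are midpoint convex on any given finite
   configuration once enough scales are included in the sum. *)
Theorem bellman_function : exists C c : R, [/\ 0 <= C, 0 < c &
  exists B : nat -> R -> R -> R, [/\ forall K, subgrad (B K),
    forall K u v, 0 <= B K u v <= C * (`|u| `^ q + `|v| `^ p) &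
    forall u v du dv, exists K0 : nat, forall K, (K0 <= K)%N ->
      c * `|du * dv| <= (B K (u + du) (v + dv) + B K (u - du) (v - dv)) / 2 - B K u v]].
Proof.
have [C C0 hC] := bellman_bound; have [c c0 hc] := bellman_gain.
exists C, c; split => //; exists (fun K => bellman p q M (scales K)); split => //.
- by move=> K; apply: subgrad_bellman => l /scales_gt0/ltW.
- by move=> K u v; rewrite bellman_ge0 hC.
Qed.

End bellman_function.

(** * The divergence equation on a discrete torus *)

Section powR_convexity.
Context {R : realType}.
Implicit Types (r a b : R).

(** The tangent line inequality is Young's inequality for [a] and [b ^ (r - 1)] in disguise. *)
Lemma powR_tangent r a b : 1 < r -> 0 <= a -> 0 <= b ->
  b `^ r + r * b `^ (r - 1) * (a - b) <= a `^ r.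
Proof.
move=> r1 a0 b0; have r0 : 0 < r by exact: lt_trans r1.
have r10 : 0 < r - 1 by rewrite subr_gt0.
have rr : r^-1 + (r / (r - 1))^-1 = 1 by field; rewrite !gt_eqF.
have := conjugate_powR a0 (powR_ge0 b (r - 1)) r0 (divr_gt0 r0 r10) rr.
rewrite -powRrM (_ : (r - 1) * _ = r); last by field; rewrite gt_eqF.
rewrite -(ler_pM2l r0).
rewrite (_ : r * (a `^ r / r + _) = a `^ r + (r - 1) * b `^ r); last first.
  by field; rewrite !gt_eqF.
move=> h; have bE : b `^ (r - 1) * b = b `^ r.
  have [->|bn0] := eqVneq b 0; first by rewrite mulr0 powR0 ?gt_eqF.
  by rewrite -[X in _ * X]powRr1// -powRD ?subrK// bn0 implybT.
rewrite mulrBr -[X in _ - X]mulrA bE; lra.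
Qed.

(** The weights are not normalized: the same form serves counting measure, the geometric weights of
    a series and the weights [d ^ gamma] of the Hardy inequality. The proof takes the tangent line
    at the weighted mean [b]. *)
Lemma powR_jensen (I : eqType) (s : seq I) (P : pred I) (c a : I -> R) r :
  1 < r -> (forall i, P i -> 0 <= c i) -> (forall i, P i -> 0 <= a i) ->
  (\sum_(i <- s | P i) c i * a i) `^ r <=
  (\sum_(i <- s | P i) c i) `^ (r - 1) * \sum_(i <- s | P i) c i * a i `^ r.
Proof.
move=> r1 c0 a0; have r0 : 0 < r by exact: lt_trans r1.
set S := \sum_(i <- s | P i) c i; set A := \sum_(i <- s | P i) _.
have S0 : 0 <= S by exact: sumr_ge0.
have A0 : 0 <= A by apply: sumr_ge0 => i Pi; rewrite mulr_ge0 ?c0 ?a0.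
have [SE|Sn0] := eqVneq S 0.
  have cz i : i \in s -> P i -> c i = 0.
    move=> si Pi; have : S == 0 by rewrite SE.
    by rewrite psumr_eq0// => /allP/(_ _ si); rewrite Pi => /eqP.
  have -> : A = 0 by rewrite /A big_seq_cond big1// => i /andP[si Pi]; rewrite cz ?mul0r.
  by rewrite powR0 ?gt_eqF// mulr_ge0 ?powR_ge0// sumr_ge0// => i Pi; rewrite mulr_ge0 ?powR_ge0 ?c0.
have Sp : 0 < S by rewrite lt_neqAle eq_sym Sn0.
set b := A / S; have b0 : 0 <= b by rewrite divr_ge0.
have bS : S * b = A by rewrite /b mulrC divfK.
have : S * b `^ r <= \sum_(i <- s | P i) c i * a i `^ r.
  apply: (@le_trans _ _ (\sum_(i <- s | P i) (c i * b `^ r + r * b `^ (r - 1) * (c i * a i - c i * b)))).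
    rewrite big_split/= -mulr_suml -/S lerDl -mulr_sumr sumrB -mulr_suml -/S -/A.
    by rewrite bS subrr mulr0.
  apply: ler_sum => i Pi; have := ler_wpM2l (c0 _ Pi) (powR_tangent r1 (a0 _ Pi) b0).
  by apply: le_trans; rewrite le_eqVlt; apply/orP; left; apply/eqP; ring.
move=> h; have -> : A `^ r = S `^ (r - 1) * (S * b `^ r).
  rewrite -bS.
  rewrite powRM// mulrA; congr (_ * _).
  by rewrite -{3}[S]powRr1// -powRD ?subrK// Sn0 implybT.
by rewrite ler_wpM2l ?powR_ge0.
Qed.

Lemma powR_sum_le (I : eqType) (s : seq I) (P : pred I) (a : I -> R) r :
  1 < r -> (forall i, P i -> 0 <= a i) ->
  (\sum_(i <- s | P i) a i) `^ r <=
  (count P s)%:R `^ (r - 1) * \sum_(i <- s | P i) a i `^ r.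
Proof.
move=> r1 a0; have := @powR_jensen I s P (fun=> 1) a r r1 (fun _ _ => ler01) a0.
rewrite (eq_bigr a); last by move=> i _; rewrite mul1r.
rewrite big_const_seq iter_addr_0 => /le_trans; apply.
by under eq_bigr do rewrite mul1r.
Qed.

Lemma powR_convex2 r t a b : 1 < r -> 0 <= t <= 1 -> 0 <= a -> 0 <= b ->
  (t * a + (1 - t) * b) `^ r <= t * a `^ r + (1 - t) * b `^ r.
Proof.
move=> r1 /andP[t0 t1] a0 b0.
have := @powR_jensen bool [:: true; false] xpredT (fun x => if x then t else 1 - t)
  (fun x => if x then a else b) r r1.
rewrite !big_cons !big_nil/= !addr0 => /(_ _ _)/le_trans; apply.
- by case=> _ //; rewrite subr_ge0.
- by case.
- by rewrite [t + _]addrC subrK powR1 mul1r.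
Qed.

Lemma powR_add_le r a b : 1 < r -> 0 <= a -> 0 <= b ->
  (a + b) `^ r <= 2 `^ (r - 1) * (a `^ r + b `^ r).
Proof.
move=> r1 a0 b0.
have := @powR_sum_le bool [:: true; false] xpredT (fun x => if x then a else b) r r1.
by rewrite !big_cons !big_nil/= !addr0; apply => -[].
Qed.

End powR_convexity.

Section lr_norm.
Context {R : realType} {V : finType}.
Implicit Types (f g : V -> R) (r : R).

Definition lrpow r f : R := \sum_x `|f x| `^ r.
Definition lrnorm r f : R := lrpow r f `^ r^-1.

Lemma lrpow_ge0 r f : 0 <= lrpow r f.
Proof. by apply: sumr_ge0 => x _; exact: powR_ge0. Qed.

Lemma lrnorm_ge0 r f : 0 <= lrnorm r f. Proof. exact: powR_ge0. Qed.

Lemma lrnormK r f : r != 0 -> lrnorm r f `^ r = lrpow r f.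
Proof. by move=> r0; rewrite -powRrM mulVf// powRr1// lrpow_ge0. Qed.

Lemma lrpow_eq0 r f : r != 0 -> lrpow r f = 0 -> forall x, f x = 0.
Proof.
move=> r0 fE x; apply/eqP; rewrite -normr_eq0; apply/eqP/(@powR_eq0_eq0 _ _ r).
by apply: (psumr_eq0P _ fE) => // y _; exact: powR_ge0.
Qed.

Variable r : R.
Hypothesis r1 : 1 < r.
Let r0 : 0 < r. Proof. exact: lt_trans r1. Qed.

Lemma ler_lrpow f g : (forall x, `|f x| <= `|g x|) -> lrpow r f <= lrpow r g.
Proof. by move=> fg; apply: ler_sum => x _; apply: ge0_ler_powR; rewrite ?nnegrE ?(ltW r0). Qed.

Lemma ler_lrnorm f g : (forall x, `|f x| <= `|g x|) -> lrnorm r f <= lrnorm r g.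
Proof.
by move=> fg; apply: ge0_ler_powR; rewrite ?nnegrE ?invr_ge0 ?(ltW r0) ?lrpow_ge0// ler_lrpow.
Qed.

Lemma eq_lrnorm f g : f =1 g -> lrnorm r f = lrnorm r g.
Proof. by move=> fg; congr (_ `^ _); apply: eq_bigr => x _; rewrite fg. Qed.

Lemma lrnormZ c f : lrnorm r (fun x => c * f x) = `|c| * lrnorm r f.
Proof.
rewrite /lrnorm /lrpow; under eq_bigr do rewrite normrM powRM//.
rewrite -mulr_sumr powRM ?powR_ge0 ?lrpow_ge0//.
by rewrite -powRrM mulfV ?gt_eqF// powRr1.
Qed.

Lemma lrnorm_eq0 f : lrnorm r f = 0 -> forall x, f x = 0.
Proof. by move/powR_eq0_eq0; apply: lrpow_eq0; exact: lt0r_neq0. Qed.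

(** Minkowski by convexity: [f + g] is [A + B] times a convex combination of [f / A] and [g / B],
    with weights [A / (A + B)] and [B / (A + B)]. *)
Lemma lrnorm_add f g : lrnorm r (fun x => f x + g x) <= lrnorm r f + lrnorm r g.
Proof.
have [A0|An0] := eqVneq (lrnorm r f) 0.
  by rewrite A0 add0r; apply: ler_lrnorm => x; rewrite (lrnorm_eq0 A0) add0r.
have [B0|Bn0] := eqVneq (lrnorm r g) 0.
  by rewrite B0 addr0; apply: ler_lrnorm => x; rewrite (lrnorm_eq0 B0) addr0.
have Ap : 0 < lrnorm r f by rewrite lt_neqAle eq_sym An0 lrnorm_ge0.
have Bp : 0 < lrnorm r g by rewrite lt_neqAle eq_sym Bn0 lrnorm_ge0.
have := lrnormK g (lt0r_neq0 r0); have := lrnormK f (lt0r_neq0 r0).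
move: Ap Bp {An0 Bn0}; move: (lrnorm r f) (lrnorm r g) => A B Ap Bp fA gB.
have AB : 0 < A + B by exact: addr_gt0.
pose t := A / (A + B).
have t01 : 0 <= t <= 1.
  by rewrite /t divr_ge0 ?(ltW Ap) ?(ltW AB)//= ler_pdivrMr// mul1r lerDl ltW.
have tE : 1 - t = B / (A + B) by rewrite /t; field; rewrite gt_eqF.
suff h : lrpow r (fun x => f x + g x) <= (A + B) `^ r.
  rewrite -[leRHS]powRr1 ?(ltW AB)// -(mulfV (lt0r_neq0 r0)) powRrM.
  by apply: ge0_ler_powR; rewrite ?nnegrE ?invr_ge0 ?(ltW r0) ?lrpow_ge0 ?powR_ge0.
have key x : `|f x + g x| `^ r <= (A + B) `^ r * (t * (`|f x| `^ r / A `^ r) + (1 - t) * (`|g x| `^ r / B `^ r)).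
  apply: (@le_trans _ _ ((A + B) `^ r * (t * (`|f x| / A) + (1 - t) * (`|g x| / B)) `^ r)).
    rewrite -powRM ?(ltW AB)//; last first.
      have [t0 t1] := andP t01.
      by rewrite addr_ge0// mulr_ge0 ?subr_ge0// divr_ge0// ltW.
    have -> : (A + B) * (t * (`|f x| / A) + (1 - t) * (`|g x| / B)) = `|f x| + `|g x|.
      by rewrite tE /t; field; rewrite !gt_eqF.
    by apply: ge0_ler_powR; rewrite ?nnegrE ?addr_ge0 ?(ltW r0)// ler_normD.
  rewrite ler_wpM2l ?powR_ge0// -!powR_div ?(ltW Ap) ?(ltW Bp)//.
  by apply: powR_convex2 => //; rewrite divr_ge0// ltW.
apply: le_trans (ler_sum _ (fun x _ => key x)) _.
rewrite -mulr_sumr big_split/= -!mulr_sumr -!mulr_suml -!/(lrpow _ _).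
rewrite -fA -gB.
by rewrite !divff ?gt_eqF ?powR_gt0// !mulr1 [t + _]addrC subrK mulr1.
Qed.

Lemma lrnorm_sum (I : Type) (s : seq I) (P : pred I) (F : I -> V -> R) :
  lrnorm r (fun x => \sum_(i <- s | P i) F i x) <= \sum_(i <- s | P i) lrnorm r (F i).
Proof.
elim: s => [|i s IH].
  rewrite big_nil (@eq_lrnorm _ (fun x => 0 * 0)); last by move=> x; rewrite big_nil mulr0.
  by rewrite lrnormZ normr0 mul0r.
rewrite big_cons; case: ifPn => Pi; last first.
  by rewrite (@eq_lrnorm _ (fun x => \sum_(j <- s | P j) F j x))// => x; rewrite big_cons (negPf Pi).
rewrite (@eq_lrnorm _ (fun x => F i x + \sum_(j <- s | P j) F j x)); last first.
  by move=> x; rewrite big_cons Pi.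
by apply: le_trans (lrnorm_add _ _) _; rewrite lerD2l.
Qed.

End lr_norm.

(** * Convolutions and the lazy random walk *)

Section convolution_operators.
Context {R : realType} {V : finZmodType}.
Implicit Types (T : (V -> R) -> V -> R) (f g : V -> R).

(* [T] is convolution with a measure of total variation at most [c]. *)
Definition opb T (c : R) := exists (I : finType) (a : I -> R) (s : I -> V),
  (forall f x, T f x = \sum_i a i * f (x + s i)) /\ \sum_i `|a i| <= c.

Lemma opb_le T c c' : opb T c -> c <= c' -> opb T c'.
Proof. by move=> [I [a [s [h hc]]]] cc'; exists I, a, s; split => //; exact: le_trans cc'. Qed.

Lemma opb_ext T T' c : (forall f x, T f x = T' f x) -> opb T c -> opb T' c.
Proof. by move=> TT [I [a [s [h hc]]]]; exists I, a, s; split => // f x; rewrite -TT. Qed.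

Lemma opb_shift v : opb (fun f x => f (x + v)) 1.
Proof.
exists unit, (fun=> 1), (fun=> v).
by split => [f x|]; rewrite (big_pred1 tt) ?mul1r ?normr1//; case.
Qed.

Lemma opb_id : opb (fun f x => f x) 1.
Proof. by apply: opb_ext (opb_shift 0) => f x; rewrite addr0. Qed.

Lemma opb_add T T' c c' : opb T c -> opb T' c' -> opb (fun f x => T f x + T' f x) (c + c').
Proof.
move=> [I [a [s [h hc]]]] [J [b [t [k kc]]]].
exists (I + J)%type, (fun z => match z with inl i => a i | inr j => b j end),
  (fun z => match z with inl i => s i | inr j => t j end).
by split => [f x|]; rewrite big_sumType/= ?h ?k//; exact: lerD.
Qed.

Lemma opb_scale (d : R) T c : opb T c -> opb (fun f x => d * T f x) (`|d| * c).
Proof.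
move=> [I [a [s [h hc]]]]; exists I, (fun i => d * a i), s; split => [f x|].
  by rewrite h mulr_sumr; apply: eq_bigr => i _; rewrite mulrA.
by under eq_bigr do rewrite normrM; rewrite -mulr_sumr ler_wpM2l.
Qed.

Lemma opb_opp T c : opb T c -> opb (fun f x => - T f x) c.
Proof.
move=> /(opb_scale (-1)); rewrite normrN1 mul1r; apply: opb_ext => f x.
by rewrite mulN1r.
Qed.

Lemma opb_comp T T' c c' : opb T c -> opb T' c' -> opb (fun f => T (T' f)) (c * c').
Proof.
move=> [I [a [s [h hc]]]] [J [b [t [k kc]]]].
exists (I * J)%type, (fun z => a z.1 * b z.2), (fun z => s z.1 + t z.2); split => [f x|].
  rewrite h -(pair_bigA _ (fun i j => a i * b j * f (x + (s i + t j))))/=.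
  apply: eq_bigr => i _; rewrite k mulr_sumr; apply: eq_bigr => j _.
  by rewrite addrA mulrA.
rewrite -(pair_bigA _ (fun i j => `|a i * b j|))/=.
under eq_bigr => i _ do under eq_bigr => j _ do rewrite normrM.
under eq_bigr => i _ do rewrite -mulr_sumr.
by rewrite -mulr_suml ler_pM// sumr_ge0.
Qed.

Lemma opb0 : opb (fun f x => 0) 0.
Proof.
by exists void, (fun=> 0), (fun=> 0); split => [f x|]; rewrite big1//; case.
Qed.

(** Convolutions on a commutative group commute, which lets the walk, the differences and the
    operators of [Qs_divergence] be exchanged. *)
Lemma opb_comm T T' c c' f x : opb T c -> opb T' c' -> T (T' f) x = T' (T f) x.
Proof.
move=> [I [a [s [h _]]]] [J [b [t [k _]]]]; rewrite h k.
under eq_bigr => i _ do rewrite k mulr_sumr.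
rewrite exchange_big/=; apply: eq_bigr => j _; rewrite h mulr_sumr.
by apply: eq_bigr => i _; rewrite addrAC mulrCA.
Qed.

Lemma opb_linD T c f g x : opb T c -> T (fun y => f y + g y) x = T f x + T g x.
Proof.
by move=> [I [a [s [h _]]]]; rewrite !h -big_split/=; apply: eq_bigr => i _; rewrite mulrDr.
Qed.

Lemma opb_linZ T c d f x : opb T c -> T (fun y => d * f y) x = d * T f x.
Proof.
by move=> [I [a [s [h _]]]]; rewrite !h mulr_sumr; apply: eq_bigr => i _; rewrite mulrCA.
Qed.

Lemma opb_lin_sum T c (n : nat) (F : nat -> V -> R) x : opb T c ->
  T (fun y => \sum_(t < n) F t y) x = \sum_(t < n) T (F t) x.
Proof.
move=> h; elim: n => [|n IH].
  rewrite big_ord0 (_ : (fun y => _) = fun y => 0 * F 0%N y); last first.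
    by apply/funext => y; rewrite big_ord0 mul0r.
  by rewrite (opb_linZ _ _ _ h) mul0r.
rewrite big_ord_recr/= -IH -(opb_linD _ _ _ h).
by congr (T _ x); apply/funext => y; rewrite big_ord_recr.
Qed.

Lemma opb_iter T t : opb T 1 -> opb (iter t T) 1.
Proof.
move=> h; elim: t => [|t IH]; first exact: opb_id.
by have := opb_comp h IH; rewrite mul1r.
Qed.

Lemma sum_shift (f : V -> R) v : \sum_x f (x + v) = \sum_x f x.
Proof. by rewrite [RHS](reindex_inj (addIr v)). Qed.

Lemma lrnorm_shift r f v : lrnorm r (fun x => f (x + v)) = lrnorm r f.
Proof. by congr (_ `^ _); rewrite /lrpow (sum_shift (fun x => `|f x| `^ r)). Qed.

Lemma opb_norm r T c f : 1 < r -> opb T c -> lrnorm r (T f) <= c * lrnorm r f.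
Proof.
move=> r1 [I [a [s [h hc]]]].
rewrite (eq_lrnorm _ (h f)).
apply: le_trans (lrnorm_sum r1 _ _ _) _.
apply: (@le_trans _ _ (\sum_i `|a i| * lrnorm r f)).
  apply: ler_sum => i _; rewrite (lrnormZ r1 (a i) (fun x => f (x + s i))).
  by rewrite (lrnorm_shift r f (s i)).
by rewrite -mulr_suml ler_wpM2r ?lrnorm_ge0.
Qed.

End convolution_operators.

Section random_walk.
Context {R : realType} {n : nat} {V : finZmodType}.
Variable e : 'I_n -> V.
Implicit Types (f g F G : V -> R) (i j : 'I_n) (s : seq 'I_n).

Definition Dm i f : V -> R := fun x => f x - f (x - e i).
(** The transpose of [Dm i] for [dot], that is, minus the forward difference. *)
Definition Dp i f : V -> R := fun x => f x - f (x + e i).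
(** The lazy step is, up to a translation, the square of the average of the identity and one shift,
    so its iterates are binomial averages of even order. Also [1 - Qi i] is a quarter of [Dm i]
    composed with [Dp i], which is where divergences come from. *)
Definition Qi i f : V -> R := fun x => f x / 2 + (f (x + e i) + f (x - e i)) / 4.
Definition Qs s f : V -> R := foldr Qi f s.
Definition Q f : V -> R := Qs (enum 'I_n) f.

Definition dot f g : R := \sum_x f x * g x.

Lemma dot_shift f g v : dot (fun x => f (x + v)) g = dot f (fun x => g (x - v)).
Proof.
by rewrite /dot -(sum_shift _ (- v)); apply: eq_bigr => x _; rewrite subrK.
Qed.

Lemma dotDl f f' g : dot (fun x => f x + f' x) g = dot f g + dot f' g.
Proof. by rewrite /dot -big_split/=; apply: eq_bigr => x _; rewrite mulrDl. Qed.

Lemma dotC f g : dot f g = dot g f.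
Proof. by apply: eq_bigr => x _; rewrite mulrC. Qed.

Lemma dotZl c f g : dot (fun x => c * f x) g = c * dot f g.
Proof. by rewrite /dot mulr_sumr; apply: eq_bigr => x _; rewrite mulrA. Qed.

Lemma dot_suml N (F : nat -> V -> R) g :
  dot (fun x => \sum_(t < N) F t x) g = \sum_(t < N) dot (F t) g.
Proof. by rewrite /dot exchange_big/=; apply: eq_bigr => x _; rewrite mulr_suml. Qed.

Lemma dot_Dm i f g : dot (Dm i f) g = dot f (Dp i g).
Proof.
rewrite /dot /Dm /Dp; under eq_bigr do rewrite mulrBl.
under [RHS]eq_bigr do rewrite mulrBr.
rewrite !sumrB; congr (_ - _).
by rewrite -[LHS](sum_shift _ (e i)); apply: eq_bigr => x _; rewrite addrK.
Qed.

Lemma dot_Qi i f g : dot (Qi i f) g = dot f (Qi i g).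
Proof.
rewrite (_ : Qi i f = fun x => 2^-1 * f x + 4^-1 * (f (x + e i) + f (x - e i))); last first.
  by apply/funext => x; rewrite /Qi mulrC [X in _ + X]mulrC.
rewrite (_ : Qi i g = fun x => 2^-1 * g x + 4^-1 * (g (x - e i) + g (x + e i))); last first.
  by apply/funext => x; rewrite /Qi mulrC [X in _ + X]mulrC [g (x + _) + _]addrC.
rewrite dotDl !dotZl dotDl !dot_shift [RHS]dotC dotDl !dotZl dotDl opprK.
by rewrite ![dot f _]dotC.
Qed.

Lemma opb_Qi i : opb (Qi i) 1.
Proof.
have h := opb_add (opb_scale 2^-1 (@opb_id R V))
  (opb_scale 4^-1 (opb_add (@opb_shift R V (e i)) (opb_shift (- e i)))).
apply: opb_ext (opb_le h _) => [f x|]; first by rewrite /Qi mulrC [X in _ + X]mulrC.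
by rewrite !ger0_norm ?invr_ge0//; lra.
Qed.

Lemma opb_Dm i : opb (Dm i) 2.
Proof.
have h := opb_add (@opb_id R V) (opb_opp (@opb_shift R V (- e i))).
exact: opb_ext (opb_le h _).
Qed.

Lemma opb_Dp i : opb (Dp i) 2.
Proof.
have h := opb_add (@opb_id R V) (opb_opp (@opb_shift R V (e i))).
exact: opb_ext (opb_le h _).
Qed.

Lemma opb_Qs s : opb (Qs s) 1.
Proof.
elim: s => [|i s IH]; first exact: opb_id.
by have := opb_comp (opb_Qi i) IH; rewrite mulr1.
Qed.

Lemma opb_Q : opb Q 1. Proof. exact: opb_Qs. Qed.

Lemma dot_Qs s f g : dot (Qs s f) g = dot f (Qs s g).
Proof.
elim: s f g => //= i s IH f g; rewrite dot_Qi IH; congr dot; apply/funext => x.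
exact: opb_comm (opb_Qs s) (opb_Qi i).
Qed.

Lemma dot_iterQ t f g : dot (iter t Q f) g = dot f (iter t Q g).
Proof. by elim: t f g => //= t IH f g; rewrite dot_Qs IH -iterSr. Qed.

Lemma Qi_laplace i f x : f x - Qi i f x = 4^-1 * Dm i (Dp i f) x.
Proof. by rewrite /Qi /Dm /Dp subrK; field. Qed.

(** The product of the [Qi] is telescoped one factor at a time; each difference [(1 - Qi i) (Qs s)]
    is in divergence form in direction [i], and [Y i] collects the factors already applied. *)
Lemma Qs_divergence s : exists2 Y : 'I_n -> (V -> R) -> V -> R,
  (forall i, opb (Y i) (size s)%:R) &
  forall f x, f x - Qs s f x = \sum_i Dm i (fun y => 4^-1 * Dp i (Y i f) y) x.
Proof.
elim: s => [|i s [Y hY YE]].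
  exists (fun=> fun=> fun=> 0) => [i|f x]; first exact: opb0.
  by rewrite subrr big1// => i _; rewrite /Dm /Dp subrr.
exists (fun j f x => Y j f x + (j == i)%:R * Qs s f x) => [j|f x].
  have := opb_add (hY j) (opb_scale (j == i)%:R (opb_Qs s)).
  move=> /opb_le; apply; rewrite mulr1 -natr1 lerD2l.
  by case: (j == i); rewrite ?normr1 ?normr0.
have -> : f x - Qs (i :: s) f x = (f x - Qs s f x) + (Qs s f x - Qi i (Qs s f) x).
  by rewrite /=; ring.
rewrite YE Qi_laplace.
have -> : 4^-1 * Dm i (Dp i (Qs s f)) x = \sum_j Dm j (fun y => 4^-1 * Dp j (fun z => (j == i)%:R * Qs s f z) y) x.
  rewrite (bigD1 i)//= big1 ?addr0.
    by rewrite /Dm /Dp eqxx !mul1r; ring.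
  by move=> j /negPf ji; rewrite /Dm /Dp ji /= mulr0n; ring.
rewrite -big_split/=; apply: eq_bigr => j _.
by rewrite /Dm /Dp; ring.
Qed.

(** The lower bounds at 0 and at each [e i] leave room to perturb the kernel by a multiple of the
    difference of the unit masses at 0 and at [e i] while keeping it positive: this is what the
    Bellman argument asks of the walk. *)
Lemma markov_kernel s : exists mu : V -> R, [/\
  forall v, 0 <= mu v, \sum_v mu v = 1,
  forall f x, Qs s f x = \sum_v mu v * f (x + v) &
  4^-1 ^+ size s <= mu 0 /\ forall i, i \in s -> 4^-1 ^+ size s <= mu (e i)].
Proof.
elim: s => [|i s [mu [mu0 mu1 muE [m0 m1]]]].
  exists (fun v => (v == 0)%:R); split => //.
  - rewrite (bigD1 0)//= eqxx big1; first by rewrite addr0.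
    by move=> v /negPf ->.
  - move=> f x /=; rewrite (bigD1 0)//= eqxx mul1r addr0 big1; first by rewrite addr0.
    by move=> v /negPf ->; rewrite mul0r.
  - by rewrite eqxx; split.
exists (fun v => mu v / 2 + (mu (v - e i) + mu (v + e i)) / 4); split.
- by move=> v; rewrite addr_ge0// divr_ge0// addr_ge0.
- rewrite big_split/= -!mulr_suml big_split/= (sum_shift mu (- e i)) (sum_shift mu (e i)).
  by rewrite mu1; field.
- move=> f x; rewrite /= /Qi !muE.
  have E a : \sum_v mu v * f (x + a + v) = \sum_v mu (v - a) * f (x + v).
    rewrite -(sum_shift (fun v => mu (v - a) * f (x + v)) a).
    by apply: eq_bigr => v _; rewrite addrK -addrA [a + v]addrC.
  rewrite E (E (- e i)) -big_split/= !mulr_suml -big_split/=.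
  by apply: eq_bigr => v _; rewrite opprK; field.
have le4 (a b c : R) : 0 <= a -> 0 <= b -> 0 <= c -> a / 4 <= a / 2 + (b + c) / 4.
  by lra.
have le4' (a b c : R) : 0 <= a -> 0 <= b -> 0 <= c -> b / 4 <= a / 2 + (b + c) / 4.
  by lra.
have ex k : k <= mu 0 -> k * 4^-1 <= mu 0 / 2 + (mu (0 - e i) + mu (0 + e i)) / 4.
  move=> h; apply: le_trans (le4 _ _ _ (mu0 _) (mu0 _) (mu0 _)).
  by rewrite ler_pM2r ?invr_gt0.
split; first by rewrite /= exprSr; exact: ex.
move=> j; rewrite in_cons /= exprSr => /orP[/eqP ->|js].
  apply: le_trans (le4' _ _ _ (mu0 _) (mu0 _) (mu0 _)).
  by rewrite subrr ler_pM2r ?invr_gt0.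
apply: le_trans (le4 _ _ _ (mu0 _) (mu0 _) (mu0 _)).
by rewrite ler_pM2r ?invr_gt0// m1.
Qed.

End random_walk.

(** * The bilinear estimate for the walk *)

Lemma finite_eventually (I : finType) (P : I -> nat -> Prop) :
  (forall i, exists K0, forall K, (K0 <= K)%N -> P i K) -> exists K, forall i, P i K.
Proof.
move=> /choice[k hk]; exists (\max_i k i)%N => i; apply: hk.
exact: (leq_bigmax_cond (F := k)).
Qed.

Section walk_estimate.
Context {R : realType}.

Lemma subgrad_jensen (V : finType) (B : R -> R -> R) (l F G : V -> R) :
  subgrad B -> (forall v, 0 <= l v) -> \sum_v l v = 1 ->
  B (\sum_v l v * F v) (\sum_v l v * G v) <= \sum_v l v * B (F v) (G v).
Proof.
move=> hB l0 l1; have [g1 [g2 h]] := hB (\sum_v l v * F v) (\sum_v l v * G v).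
set a := \sum_v l v * F v in h *; set b := \sum_v l v * G v in h *.
apply: (@le_trans _ _ (\sum_v l v * (B a b + g1 * (F v - a) + g2 * (G v - b)))); last first.
  by apply: ler_sum => v _; rewrite ler_wpM2l.
rewrite (eq_bigr (fun v => l v * (B a b - g1 * a - g2 * b) + (g1 * (l v * F v) + g2 * (l v * G v)))).
  rewrite big_split/= -mulr_suml l1 big_split/= -!mulr_sumr -/a -/b le_eqVlt.
  by apply/orP; left; apply/eqP; ring.
by move=> v _; ring.
Qed.

(* [x * y = P1 * P2], so if [x] is much larger than [x + y] then it is
   comparable to [y], hence bounded by the geometric mean of [P1] and [P2]. *)
Lemma cross_term_le (x y P1 P2 : R) : x * y = P1 * P2 ->
  `|x| <= 2 * (`|x + y| + `|P1| + `|P2|).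
Proof.
move=> xy; rewrite leNgt; apply/negP => h.
have xyn : `|x| * `|y| = `|P1| * `|P2| by rewrite -!normrM xy.
have : `|x| - `|x + y| <= `|y|.
  by have := ler_normB (x + y) y; rewrite addrK; lra.
have := normr_ge0 (x + y); have := normr_ge0 P1; have := normr_ge0 P2.
move: h xyn; set a := `|x|; set b := `|y|; set s := `|x + y|; set c := `|P1|; set d := `|P2|.
move=> h xyn d0 c0 s0 hb.
have a0 : 0 < a by lra.
have b2 : a / 2 <= b by lra.
have : a * (a / 2) <= c * d by rewrite -xyn ler_pM2l.
have : c * d <= (a / 2) * (a / 2) by rewrite ler_pM//; lra.
by nra.
Qed.

Variables (n : nat) (p q : R).
Hypotheses (p1 : 1 < p) (q1 : 1 < q) (pq : p^-1 + q^-1 = 1).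

(** If [nu] is a signed measure of mass zero with [|nu| <= mu], then [mu + nu] and [mu - nu] are
    probability measures, and Jensen bounds [B] at the two points [F t.+1 +- dl F], [G t.+1 +- dl G]
    by averages of [B] at time [t]. The gain of [B] then bounds [|dl F * dl G|] by the decrease of
    the energy [E]. The sum over [t] telescopes, whence a constant independent of [T] and of the
    group. *)
Lemma walk_bilinear : exists2 C : R, 0 < C &
  forall (V : finZmodType) (e : 'I_n -> V) i j T (f g : V -> R),
  \sum_(t < T) \sum_x `|Dp e i (iter t (Q e) f) x| * `|Dp e j (iter t (Q e) g) x| <=
  C * (lrpow q f + lrpow p g).
Proof.
have [C [c [C0 c0 [B [Bcvx Bbd Bgain]]]]] := bellman_function p1 q1 pq.
pose k : R := 4^-1 ^+ n; have k0 : 0 < k by rewrite exprn_gt0.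
pose c' := c * k ^+ 2 / 16; have c'0 : 0 < c' by rewrite divr_gt0// mulr_gt0// exprn_gt0.
exists ((C + 1) / c'); first by rewrite divr_gt0// ltr_wpDl.
move=> V e i j T f g.
have [mu [mu0 mu1 muE [m0 me]]] := markov_kernel (R := R) e (enum 'I_n).
rewrite size_enum_ord -/k in m0 me.
have {}me l : k <= mu (e l) by apply: me; rewrite mem_enum.
pose F t := iter t (Q e) f; pose G t := iter t (Q e) g.
have FE t x : F t.+1 x = \sum_v mu v * F t (x + v) by exact: muE.
have GE t x : G t.+1 x = \sum_v mu v * G t (x + v) by exact: muE.
pose w l v := k * ((v == 0)%:R - (v == e l)%:R).
have wmu l v : `|w l v| <= mu v.
  rewrite /w normrM (ger0_norm (ltW k0)).
  have [->|v0] := eqVneq v 0; have [vE|ve] := eqVneq _ (e l).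
  - by rewrite subrr normr0 mulr0.
  - by rewrite subr0 normr1 mulr1.
  - by rewrite sub0r normrN1 mulr1 vE.
  - by rewrite subrr normr0 mulr0.
have wF l (H : V -> R) x : \sum_v w l v * H (x + v) = k * Dp e l H x.
  rewrite /w; under eq_bigr do rewrite -mulrA mulrBl.
  rewrite -mulr_sumr sumrB; congr (_ * (_ - _)).
    by rewrite (bigD1 0)//= eqxx mul1r addr0 big1 ?addr0// => v /negPf ->; rewrite mul0r.
  by rewrite (bigD1 (e l))//= eqxx mul1r big1 ?addr0// => v /negPf ->; rewrite mul0r.
have w0 l : \sum_v w l v = 0.
  by have := wF l (fun=> 1) 0; rewrite /Dp subrr mulr0; under eq_bigr do rewrite mulr1.
(* Three perturbations, in direction [i], in direction [j] and their mean: polarization needs all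
   three to reach the mixed product. *)
pose nu (a : 'I_3) v := if a == 0 :> nat then w i v else
  if a == 1%N :> nat then w j v else (w i v + w j v) / 2.
have numu a v : `|nu a v| <= mu v.
  rewrite /nu; case: ifP => _; first exact: wmu.
  case: ifP => _; first exact: wmu.
  rewrite normrM [`|2^-1|]ger0_norm// ler_pdivrMr// (le_trans (ler_normD _ _))//.
  by have := wmu i v; have := wmu j v; lra.
have nu0 a : \sum_v nu a v = 0.
  rewrite /nu; case: a => -[|[|a]] ? /=; rewrite ?w0//.
  by rewrite -mulr_suml big_split/= !w0 addr0 mul0r.
pose dl (a : 'I_3) (H : V -> R) x := \sum_v nu a v * H (x + v).
(* One number of scales for the finitely many configurations (time, point, perturbation) that
   occur. *)
have [K hK] := finite_eventually (P := fun (z : 'I_T * V * 'I_3) K =>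
   c * `|dl z.2 (F z.1.1) z.1.2 * dl z.2 (G z.1.1) z.1.2| <=
   (B K (F z.1.1.+1 z.1.2 + dl z.2 (F z.1.1) z.1.2) (G z.1.1.+1 z.1.2 + dl z.2 (G z.1.1) z.1.2) +
    B K (F z.1.1.+1 z.1.2 - dl z.2 (F z.1.1) z.1.2) (G z.1.1.+1 z.1.2 - dl z.2 (G z.1.1) z.1.2)) / 2 -
    B K (F z.1.1.+1 z.1.2) (G z.1.1.+1 z.1.2)) (fun z => Bgain _ _ _ _).
pose E t := \sum_x B K (F t x) (G t x).
have step (t : 'I_T) : c' * \sum_x `|Dp e i (F t) x| * `|Dp e j (G t) x| <= E t - E t.+1.
  pose W x := \sum_v mu v * B K (F t (x + v)) (G t (x + v)) - B K (F t.+1 x) (G t.+1 x).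
  have -> : E t - E t.+1 = \sum_x W x.
    rewrite /W sumrB; congr (_ - _); rewrite exchange_big/=.
    under eq_bigr => v _ do rewrite -mulr_sumr (sum_shift (fun x => B K (F t x) (G t x)) v).
    by rewrite -mulr_suml mu1 mul1r.
  rewrite mulr_sumr; apply: ler_sum => x _.
  have gain a : c * `|dl a (F t) x * dl a (G t) x| <= W x.
    apply: le_trans (hK (t, x, a)) _; rewrite lerD2r /=.
    have J (s : R) : s = 1 \/ s = -1 ->
      B K (F t.+1 x + s * dl a (F t) x) (G t.+1 x + s * dl a (G t) x) <=
      \sum_v (mu v + s * nu a v) * B K (F t (x + v)) (G t (x + v)).
      move=> sE.
      have := @subgrad_jensen _ _ (fun v => mu v + s * nu a v) (fun v => F t (x + v)) (fun v => G t (x + v)) (Bcvx K).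
      have split H : \sum_v (mu v + s * nu a v) * H (x + v) = \sum_v mu v * H (x + v) + s * dl a H x.
        by rewrite /dl mulr_sumr -big_split/=; apply: eq_bigr => v _; ring.
      rewrite !split -FE -GE; apply.
        move=> v; have := numu a v; rewrite ler_norml => /andP[].
        by case: sE => ->; lra.
      by rewrite big_split/= mu1 -mulr_sumr nu0 mulr0 addr0.
    have := J 1 (or_introl erefl); have := J (-1) (or_intror erefl).
    rewrite !mulN1r !mul1r; set X := B K _ _; set Y := B K _ _.
    rewrite (eq_bigr (fun v => mu v * B K (F t (x + v)) (G t (x + v)) - nu a v * B K (F t (x + v)) (G t (x + v)))); last by move=> v _; ring.
    rewrite [X in _ -> _ <= X -> _](eq_bigr (fun v => mu v * B K (F t (x + v)) (G t (x + v)) + nu a v * B K (F t (x + v)) (G t (x + v)))); last by move=> v _; ring.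
    by rewrite sumrB big_split/=; lra.
  have := gain ord0; have := gain (lift ord0 ord0); have := gain ord_max.
  rewrite /dl /nu /= !wF.
  have dl2 (H : V -> R) : \sum_v (w i v + w j v) / 2 * H (x + v) = k / 2 * (Dp e i H x + Dp e j H x).
    transitivity (2^-1 * (k * Dp e i H x + k * Dp e j H x)); last by ring.
    rewrite -(wF i) -(wF j) -big_split/= mulr_sumr.
    by apply: eq_bigr => v _; ring.
  rewrite !dl2; set ai := Dp e i (F t) x; set bi := Dp e i (G t) x.
  set aj := Dp e j (F t) x; set bj := Dp e j (G t) x.
  (* The three gains control [ai * bi], [aj * bj] and [(ai + aj) * (bi + bj)], hence the sum
     [ai * bj + aj * bi]. The single product [ai * bj] is recovered from [(ai * bj) * (aj * bi) =
     (aj * bi) * (ai * bj) = (ai * bi) * (aj * bj)]. *)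
  have cross := @cross_term_le (ai * bj) (aj * bi) (ai * bi) (aj * bj).
  have {}cross := cross ltac:(ring).
  have : `|ai * bj + aj * bi| <= `|(ai + aj) * (bi + bj)| + `|ai * bi| + `|aj * bj|.
    rewrite (_ : ai * bj + aj * bi = (ai + aj) * (bi + bj) - ai * bi - aj * bj); last by ring.
    by apply: le_trans (ler_normB _ _) _; rewrite lerD2r ler_normB.
  rewrite (_ : k / 2 * (ai + aj) * (k / 2 * (bi + bj)) = (k / 2) ^+ 2 * ((ai + aj) * (bi + bj))); last by ring.
  rewrite (_ : k * aj * (k * bj) = k ^+ 2 * (aj * bj)); last by ring.
  rewrite (_ : k * ai * (k * bi) = k ^+ 2 * (ai * bi)); last by ring.
  rewrite ![`|_ ^+ 2 * _|]normrM [`|k ^+ 2|]ger0_norm ?sqr_ge0// [`|(k / 2) ^+ 2|]ger0_norm ?sqr_ge0//.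
  rewrite -[`|ai| * _]normrM exprMn; move: cross.
  set z1 := `|ai * bj|; set z2 := `|ai * bj + _|; set z3 := `|ai * bi|; set z4 := `|aj * bj|.
  set z5 := `|(ai + aj) * _|; rewrite /c' => h1 h2 h3 h4 h5.
  have ck : 0 < c * k ^+ 2 by rewrite mulr_gt0// exprn_gt0.
  rewrite mulrAC ler_pdivrMr//.
  have := ler_wpM2l (ltW ck) (le_trans h1 (ler_wpM2l (ltW (ltr0Sn R 1)) (lerD (lerD h2 (lexx z3)) (lexx z4)))).
  by move: h3 h4 h5; set y := k ^+ 2; lra.
rewrite -(ler_pM2l c'0) mulr_sumr mulrA (mulrCA c') divff ?gt_eqF// mulr1.
apply: (@le_trans _ _ (\sum_(t < T) (E t - E t.+1))).
  by apply: ler_sum => t _; exact: step.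
have -> : \sum_(t < T) (E t - E t.+1) = E 0%N - E T.
  by elim: (T) => [|T' IH]; rewrite ?big_ord0 ?subrr// big_ord_recr/= IH addrA subrK.
apply: (@le_trans _ _ (E 0%N)).
  by rewrite gerBl sumr_ge0// => x _; have /andP[] := Bbd K (F T x) (G T x).
apply: (@le_trans _ _ (C * (lrpow q f + lrpow p g))).
  rewrite -big_split/= mulr_sumr; apply: ler_sum => x _.
  by have /andP[] := Bbd K (F 0%N x) (G 0%N x).
by rewrite ler_wpM2r// ?addr_ge0 ?lrpow_ge0// lerDl.
Qed.

(** The test function is [s * sg W * |W| ^ (q - 1)], the extremal of Hoelder's inequality, with [s]
    such that [A * lrpow p g] is half of the pairing and can be absorbed. *)
Lemma lrpow_dual (A : R) : 0 < A -> exists2 A' : R, 0 < A' &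
  forall (V : finType) (W : V -> R) (X : R),
  (forall g : V -> R, \sum_x W x * g x <= A * (X + lrpow p g)) -> lrpow q W <= A' * X.
Proof.
move=> A0; pose s : R := (2 * A) `^ (- (p - 1)^-1).
have s0 : 0 < s by rewrite powR_gt0// mulr_gt0.
have p0 : 0 < p by exact: lt_trans p1.
have p10 : 0 < p - 1 by rewrite subr_gt0.
exists (2 * A / s); first by rewrite divr_gt0// mulr_gt0.
move=> V W X h; pose g x := s * (Num.sg (W x) * `|W x| `^ (q - 1)).
have q0 : 0 < q by exact: lt_trans q1.
have q10 : q - 1 != 0 by rewrite gt_eqF// subr_gt0.
have dotE : \sum_x W x * g x = s * lrpow q W.
  rewrite /lrpow mulr_sumr; apply: eq_bigr => x _; rewrite /g mulrCA; congr (_ * _).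
  rewrite mulrA [W x * _]mulrC -normrEsg -{1}[`|W x|]powRr1//.
  have [->|W0] := eqVneq (W x) 0; first by rewrite normr0 (powR0 q10) mulr0 powR0// gt_eqF.
  by rewrite -powRD ?normr_eq0 ?W0 ?implybT// addrC subrK.
have gp : lrpow p g = s `^ p * lrpow q W.
  rewrite /lrpow mulr_sumr; apply: eq_bigr => x _; rewrite /g normrM powRM// (gtr0_norm s0).
  congr (_ * _); rewrite normrM; have [->|W0] := eqVneq (W x) 0.
    by rewrite sgr0 !normr0 mul0r !powR0// gt_eqF.
  rewrite normr_sg W0 mul1r ger0_norm ?powR_ge0// -powRrM; congr (_ `^ _).
  have : p * q = p + q.
    by move: pq; move/(congr1 (fun z => z * (p * q))); rewrite mulrDl mul1r => <-; field; rewrite !gt_eqF.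
  by lra.
have spE : A * s `^ p = s / 2.
  have -> : s `^ p = s * s `^ (p - 1).
    by rewrite -{2}[s]powRr1 ?(ltW s0)// -powRD ?(gt_eqF s0) ?implybT// addrC subrK.
  rewrite /s -[X in _ * (_ * X)]powRrM mulNr mulVf ?gt_eqF// powR_inv1 ?mulr_ge0 ?(ltW A0)//.
  by field; rewrite gt_eqF.
have := h g; rewrite dotE gp mulrDr [A * (_ * _)]mulrA spE => hh.
rewrite mulrAC ler_pdivlMr//; lra.
Qed.

End walk_estimate.

(** * Decay of the heat gradient *)

Lemma inv_sqrt_le {R : realType} (a b : R) : 0 < a -> a <= b -> (Num.sqrt b)^-1 <= (Num.sqrt a)^-1.
Proof.
move=> a0 ab; rewrite lef_pV2 ?posrE ?sqrtr_gt0//; first exact: ler_wsqrtr.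
exact: lt_le_trans ab.
Qed.

Section central_binomial.

Lemma bin_ratio m k : (k.+1 * 'C(m, k.+1) = (m - k) * 'C(m, k))%N.
Proof. exact: mul_bin_left. Qed.

Lemma bin_nd m k : (k.+1 <= m - k)%N -> ('C(m, k) <= 'C(m, k.+1))%N.
Proof.
move=> h; rewrite -(@leq_pmul2l k.+1)// bin_ratio.
by rewrite leq_mul2r h orbT.
Qed.

Lemma bin_ni m k : (m - k <= k.+1)%N -> ('C(m, k.+1) <= 'C(m, k))%N.
Proof.
move=> h; rewrite -(@leq_pmul2l k.+1)// bin_ratio.
by rewrite leq_mul2r h orbT.
Qed.

Lemma central_binS t : (t.+1 * 'C(2 * t.+1, t.+1) = 2 * (2 * t).+1 * 'C(2 * t, t))%N.
Proof.
have h1 := mul_bin_diag (2 * t).+2 t.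
have h2 := mul_bin_down (2 * t).+1 t.
rewrite mulnS -/(2 + 2 * t)%N add2n.
apply/eqP; rewrite -(@eqn_pmul2l t.+1)//; apply/eqP.
rewrite /= in h1 h2; rewrite -h1.
have h3 : ((2 * t).+1 - t = t.+1)%N by lia.
rewrite h3 in h2.
transitivity (2 * t.+1 * (t.+1 * 'C((2 * t).+1, t)))%N; first by lia.
by rewrite -h2; lia.
Qed.

(** The factor [2 * t + 1] is the one for which induction closes: its step is
    [4 (2t + 1) (2t + 3) <= 16 (t + 1) ^ 2]. *)
Lemma central_bin_le t : ('C(2 * t, t) ^ 2 * (2 * t).+1 <= 16 ^ t)%N.
Proof.
elim: t => [//|t IH].
have h := central_binS t.
set c := 'C(2 * t, t) in IH h; set c' := 'C(_, _) in h *; clearbody c c'.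
have t2 : (0 < t.+1 ^ 2)%N by [].
rewrite -(leq_pmul2l t2).
have -> : (t.+1 ^ 2 * (c' ^ 2 * (2 * t.+1).+1) = (t.+1 * c') ^ 2 * (2 * t.+1).+1)%N by rewrite expnMn mulnA.
rewrite h (expnS 16 t); set x := (16 ^ t)%N in IH *; clearbody x.
apply: (@leq_trans (4 * (2 * t).+1 * (2 * t.+1).+1 * (c ^ 2 * (2 * t).+1))%N); first by lia.
apply: leq_trans (leq_mul (leqnn _) IH) _.
by rewrite mulnA leq_mul2r; apply/orP; right; lia.
Qed.

End central_binomial.

Section heat_gradient.
Context {R : realType} {n : nat} {V : finZmodType}.
Variable e : 'I_n -> V.
Implicit Types (f g : V -> R) (i j : 'I_n).

Definition binavg i m f : V -> R :=
  fun x => \sum_(k < m.+1) 'C(m, k)%:R / 2 ^+ m * f (x + e i *+ k).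

Lemma binavgS i m f x : binavg i m.+1 f x = (binavg i m f x + binavg i m f (x + e i)) / 2.
Proof.
rewrite /binavg; under eq_bigr => k _ do rewrite exprS invfM mulrCA -mulrA.
rewrite -mulr_sumr mulrC; congr (_ / 2).
rewrite big_ord_recl/= bin0.
under eq_bigr => k _ do rewrite /bump /= add1n binS natrD !mulrDl.
rewrite big_split/= addrA; congr (_ + _).
  rewrite big_ord_recr/= bin_small// mulr0n !mul0r !addr0.
  rewrite [in RHS]big_ord_recl/= bin0 !mulr0n !addr0; congr (_ + _).
by apply: eq_bigr => k _; rewrite [e i *+ _.+1]mulrS addrA.
Qed.

Lemma iter_QiE i t f x : iter t (Qi e i) f x = binavg i (2 * t) f (x - e i *+ t).
Proof.
elim: t x => [|t IH] x.
  by rewrite /binavg muln0 big_ord1 bin0 expr0 divr1 mul1r mulr0n subr0 addr0.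
rewrite iterS /Qi !IH mulnS add2n !binavgS.
set y := x - e i *+ t.
have -> : x + e i - e i *+ t = y + e i by rewrite /y addrAC.
have -> : x - e i - e i *+ t = y - e i by rewrite /y addrAC.
have -> : x - e i *+ t.+1 = y - e i by rewrite /y mulrS opprD addrA addrAC.
by rewrite subrK; field.
Qed.

Let d (m k : nat) : R := if k is k'.+1 then ('C(m, k)%:R - 'C(m, k')%:R) else 1.

Lemma sum_d m K : \sum_(k < K.+1) d m k = 'C(m, K)%:R.
Proof.
elim: K => [|K IH]; first by rewrite big_ord1 /= bin0.
by rewrite big_ord_recr/= IH addrC subrK.
Qed.

(** The binomial row is unimodal and extended by zero, so its total variation is twice its maximum,
    the central coefficient. *)
Lemma opb_binavg_diff i t :
  opb (fun f x => binavg i (2 * t) f x - binavg i (2 * t) f (x + e i))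
      (2 * ('C(2 * t, t)%:R / 4 ^+ t)).
Proof.
exists 'I_(2 * t).+2, (fun k : 'I_(2 * t).+2 => d (2 * t) k / 2 ^+ (2 * t)), (fun k : 'I_(2 * t).+2 => e i *+ k).
split => [f x|].
  rewrite /binavg; set m := (2 * t)%N.
  have -> : \sum_(k < m.+2) d m k / 2 ^+ m * f (x + e i *+ k) =
     \sum_(k < m.+2) 'C(m, k)%:R / 2 ^+ m * f (x + e i *+ k) -
     \sum_(k < m.+1) 'C(m, k)%:R / 2 ^+ m * f (x + e i *+ k.+1).
    rewrite [LHS]big_ord_recl [in RHS]big_ord_recl /= bin0 -addrA -sumrB; congr (_ + _).
    by apply: eq_bigr => k _; rewrite /bump /= add1n; ring.
  rewrite [in RHS]big_ord_recr/= bin_small// mulr0n !mul0r addr0.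
  by congr (_ - _); apply: eq_bigr => k _; rewrite [e i *+ _.+1]mulrS addrA.
have -> : \sum_(k < (2 * t).+2) `|d (2 * t) k / 2 ^+ (2 * t)| =
  (\sum_(k < (2 * t).+2) `|d (2 * t) k|) / 4 ^+ t.
  rewrite mulr_suml; apply: eq_bigr => k _; rewrite normrM [`|_^-1|]ger0_norm ?invr_ge0 ?exprn_ge0//.
  by rewrite exprM (_ : 2 ^+ 2 = 4)// -natrX.
rewrite mulrA ler_pM2r ?invr_gt0 ?exprn_gt0//.
have dabs k : `|d (2 * t) k| = 2 * (if (k < t.+1)%N then d (2 * t) k else 0) - d (2 * t) k.
  case: k => [|k] /=; first by rewrite normr1; ring.
  case: ltnP => kt.
    by rewrite ger0_norm; [ring|rewrite subr_ge0 ler_nat bin_nd//; lia].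
  by rewrite mulr0 sub0r ler0_norm// subr_le0 ler_nat bin_ni//; lia.
rewrite (eq_bigr _ (fun (k : 'I_(2 * t).+2) _ => dabs k)) sumrB -mulr_sumr -big_mkcond/=.
rewrite sum_d bin_small// subr0.
rewrite -(@big_ord_widen _ _ _ t.+1 (2 * t).+2 (d (2 * t))); last by lia.
by rewrite sum_d.
Qed.

Lemma central_bin_sqrt t :
  'C(2 * t, t)%:R / 4 ^+ t <= (Num.sqrt t.+1%:R)^-1 :> R.
Proof.
have s0 : 0 < Num.sqrt (t.+1%:R : R) by rewrite sqrtr_gt0 ltr0n.
rewrite ler_pdivrMr ?exprn_gt0// mulrC ler_pdivlMr//.
rewrite -(@ler_pXn2r _ 2) ?nnegrE ?mulr_ge0 ?exprn_ge0 ?sqrtr_ge0//.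
rewrite exprMn sqr_sqrtr// -exprM [(t * 2)%N]mulnC [4 ^+ _]exprM (_ : 4 ^+ 2 = 16%:R); last by rewrite -natrX.
rewrite -!natrX -natrM ler_nat; apply: leq_trans (central_bin_le t).
by rewrite leq_mul2l; apply/orP; right; lia.
Qed.

Lemma iter_comp_comm (A B : (V -> R) -> V -> R) t f :
  (forall g, A (B g) = B (A g)) -> iter t (fun g => A (B g)) f = iter t A (iter t B f).
Proof.
move=> AB; elim: t f => //= t IH f; rewrite IH; congr (A _).
by elim: t {IH} (iter t B f) => //= t IH g; rewrite -IH AB.
Qed.

Lemma Qs_rem i s f : i \in s -> Qs e s f = Qi e i (Qs e (rem i s) f).
Proof.
elim: s => //= j s IH; rewrite in_cons; have [->//|ji /= his] := eqVneq i j.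
rewrite IH//=; apply/funext => x.
exact: opb_comm (opb_Qi _ _) (opb_Qi _ _).
Qed.

(** The decay comes from the factor [Qi e i] of the walk; the other factors commute with it and have
    total variation at most 1. *)
Lemma heat_gradient i t : opb (fun f => Dp e i (iter t (Q e) f)) (2 / Num.sqrt t.+1%:R).
Proof.
have h := opb_comp (opb_binavg_diff i t)
  (opb_comp (@opb_shift R V (- e i *+ t)) (opb_iter t (opb_Qs (R := R) e (rem i (enum 'I_n))))).
apply: opb_ext (opb_le h _) => [f x|]; last first.
  by rewrite !mulr1 ler_pM2l// central_bin_sqrt.
have -> : iter t (Q e) f = iter t (Qi e i) (iter t (Qs e (rem i (enum 'I_n))) f).
  rewrite -iter_comp_comm.
    by apply: eq_iter => g; rewrite /Q (@Qs_rem i)// mem_enum.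
  by move=> g; apply/funext => y; exact: opb_comm (opb_Qi _ _) (opb_Qs _ _).
rewrite /Dp !iter_QiE -mulNrn.
have E (g : V -> R) y : binavg i (2 * t) (fun z => g (z + - e i *+ t)) y =
    binavg i (2 * t) g (y + - e i *+ t).
  by rewrite /binavg; apply: eq_bigr => k _; rewrite addrAC.
by rewrite !E.
Qed.

Lemma sum_inv_sqrt T : \sum_(t < T) (Num.sqrt (t.+1%:R : R))^-1 <= 2 * Num.sqrt T%:R.
Proof.
elim: T => [|T IH]; first by rewrite big_ord0 mulr_ge0// sqrtr_ge0.
rewrite big_ord_recr/=; apply: le_trans (lerD IH (lexx _)) _.
have a0 := sqrtr_ge0 (T%:R : R).
have b0 : 0 < Num.sqrt (T.+1%:R : R) by rewrite sqrtr_gt0 ltr0n.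
have ab : Num.sqrt (T%:R : R) ^+ 2 + 1 = Num.sqrt (T.+1%:R : R) ^+ 2.
  by rewrite !sqr_sqrtr// natr1.
set a := Num.sqrt T%:R in a0 ab *; set b := Num.sqrt T.+1%:R in b0 ab *.
clearbody a b.
rewrite -lerBrDl -(ler_pM2r b0) mulVf ?gt_eqF//.
have : 0 <= (a - b) ^+ 2 by exact: sqr_ge0.
by nra.
Qed.

End heat_gradient.

Section heat_divergence.
Context {R : realType}.
Variables (n : nat) (p q : R).
Hypotheses (p1 : 1 < p) (q1 : 1 < q) (pq : p^-1 + q^-1 = 1).

(** The field is a truncated time integral of [(1 - Q) (1 + Q) Q^(2t)], which sums to [1 - Q^(2T)].
    Even times are used so that in the bilinear form one copy of [Q^t] falls on each argument, as in
    [walk_bilinear]. The time [T] trades the size of [U], of order [sqrt T], against the smoothness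
    of the remainder [g]. *)
Theorem heat_divergence : exists2 C : R, 0 < C &
  forall (V : finZmodType) (e : 'I_n -> V) (T : nat) (f : V -> R), (0 < T)%N ->
  exists (U : 'I_n -> V -> R) (g : V -> R), [/\
    forall x, f x = \sum_i Dm e i (U i) x + g x,
    forall i j, lrnorm q (Dm e j (U i)) <= C * lrnorm q f,
    forall i, lrnorm q (U i) <= C * Num.sqrt T%:R * lrnorm q f,
    lrnorm q g <= lrnorm q f &
    forall j, lrnorm q (Dm e j g) <= C / Num.sqrt T%:R * lrnorm q f].
Proof.
have q0 : 0 < q by exact: lt_trans q1.
have [A A0 hA] := @walk_bilinear R n p q p1 q1 pq.
have [A' A'0 hA'] := @lrpow_dual R p q p1 q1 pq A A0.
pose C := A' `^ q^-1 * (n%:R * 2) + n%:R * 2 + 2.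
have Cp : 0 <= A' `^ q^-1 * (n%:R * 2) by rewrite !mulr_ge0 ?powR_ge0.
have Cp2 : 0 <= n%:R * 2 :> R by rewrite mulr_ge0.
exists C; first by rewrite ltr_wpDl ?addr_ge0.
move=> V e T f T0.
have [Y hY YE] := Qs_divergence (R := R) e (enum 'I_n).
rewrite size_enum_ord in hY.
have oit t := opb_iter t (opb_Q (R := R) e).
pose f' x := f x + Q e f x.
pose U i x := \sum_(t < T) 4^-1 * Dp e i (iter t (Q e) (iter t (Q e) (Y i f'))) x.
pose g := iter (T + T) (Q e) f.
have sT : 0 < Num.sqrt (T%:R : R) by rewrite sqrtr_gt0 ltr0n.
have f'n : lrnorm q f' <= 2 * lrnorm q f.
  have := opb_norm f q1 (opb_add (@opb_id R V) (opb_Q e)).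
  by rewrite (_ : 1 + 1 = 2).
have Yn i : lrnorm q (Y i f') <= n%:R * 2 * lrnorm q f.
  by apply: le_trans (opb_norm f' q1 (hY i)) _; rewrite -mulrA ler_wpM2l.
exists U, g; split.
- move=> x; rewrite (_ : \sum_i _ = f x - g x) ?subrK//.
  have DU i : Dm e i (U i) x = \sum_(t < T) Dm e i (fun y => 4^-1 * Dp e i (Y i (iter (t + t) (Q e) f')) y) x.
    rewrite /U (opb_lin_sum T (fun t y => 4^-1 * Dp e i (iter t (Q e) (iter t (Q e) (Y i f'))) y) x (opb_Dm e i)).
    apply: eq_bigr => t _; congr (Dm e i _ x); apply/funext => y; congr (_ * Dp e i _ y).
    rewrite -iterD; apply/funext => z; exact: opb_comm (oit _) (hY i).
  rewrite (eq_bigr _ (fun i _ => DU i)) exchange_big/=.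
  rewrite (eq_bigr (fun t : 'I_T => iter (t + t) (Q e) f x - iter (t.+1 + t.+1) (Q e) f x)); last first.
    move=> t _; rewrite -YE -/(Q e _).
    have E k : iter k (Q e) f' = fun y => iter k (Q e) f y + iter k.+1 (Q e) f y.
      apply/funext => y; rewrite /f' (opb_linD _ _ _ (oit k)); congr (_ + _).
      by rewrite iterSr.
    rewrite -[Q e (iter _ _ _) x]/(iter (t + t).+1 (Q e) f' x) !E addSn addnS.
    by ring.
  rewrite /g; elim: (T) => [|T' IH]; first by rewrite big_ord0 subrr.
  by rewrite big_ord_recr/= IH addrA subrK.
- move=> i j.
  (* By [lrpow_dual] it is enough to pair with an arbitrary [h]; the pairing is then rearranged into
     [Dp i Q^t] acting on [Y i f'] against [Dp j Q^t] acting on [h]. *)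
  suff h : lrpow q (Dm e j (U i)) <= A' * lrpow q (Y i f').
    apply: (@le_trans _ _ (A' `^ q^-1 * lrnorm q (Y i f'))).
      rewrite /lrnorm -powRM ?lrpow_ge0 ?(ltW A'0)//.
      by apply: ge0_ler_powR; rewrite ?nnegrE ?invr_ge0 ?mulr_ge0 ?lrpow_ge0 ?(ltW q0) ?(ltW A'0).
    apply: (@le_trans _ _ (A' `^ q^-1 * (n%:R * 2) * lrnorm q f)).
      by rewrite -mulrA ler_wpM2l ?powR_ge0.
    by rewrite ler_wpM2r ?lrnorm_ge0// /C -addrA lerDl addr_ge0.
  apply: hA' => h; rewrite -/(dot (Dm e j (U i)) h) dot_Dm.
  rewrite (dot_suml T (fun t y => 4^-1 * Dp e i (iter t (Q e) (iter t (Q e) (Y i f'))) y)).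
  apply: le_trans (hA V e i j T (Y i f') h); apply: ler_sum => t _.
  rewrite dotZl.
  have -> : dot (Dp e i (iter t (Q e) (iter t (Q e) (Y i f')))) (Dp e j h) =
     dot (Dp e i (iter t (Q e) (Y i f'))) (Dp e j (iter t (Q e) h)).
    have -> : Dp e i (iter t (Q e) (iter t (Q e) (Y i f'))) = iter t (Q e) (Dp e i (iter t (Q e) (Y i f'))).
      by apply/funext => y; exact: opb_comm (opb_Dp e i) (oit t).
    rewrite dot_iterQ; congr dot.
    by apply/funext => y; exact: opb_comm (oit t) (opb_Dp e j).
  apply: (@le_trans _ _ `|4^-1 * dot (Dp e i (iter t (Q e) (Y i f'))) (Dp e j (iter t (Q e) h))|).
    exact: ler_norm.
  rewrite normrM ger0_norm ?invr_ge0// (@le_trans _ _ (1 * `|dot (Dp e i (iter t (Q e) (Y i f'))) (Dp e j (iter t (Q e) h))|))//.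
    by rewrite ler_wpM2r// invf_le1// ler1n.
  rewrite mul1r /dot (le_trans (ler_norm_sum _ _ _))//; apply: ler_sum => x _.
  by rewrite normrM.
- move=> i; apply: le_trans (lrnorm_sum q1 _ _ _) _.
  apply: (@le_trans _ _ (\sum_(t < T) (Num.sqrt t.+1%:R)^-1 * 2^-1 * (n%:R * 2 * lrnorm q f))).
    apply: ler_sum => t _; rewrite (lrnormZ q1 4^-1 (Dp e i (iter t (Q e) (iter t (Q e) (Y i f'))))).
    have h1 := opb_norm (iter t (Q e) (Y i f')) q1 (heat_gradient e i t).
    have h2 := opb_norm (Y i f') q1 (oit t); rewrite mul1r in h2.
    have c0 : 0 <= 2 / Num.sqrt (t.+1%:R : R) by rewrite divr_ge0// sqrtr_ge0.
    have h3 := le_trans h1 (ler_wpM2l c0 (le_trans h2 (Yn i))).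
    apply: le_trans (ler_wpM2l (normr_ge0 _) h3) _.
    rewrite ger0_norm ?invr_ge0// le_eqVlt; apply/orP; left; apply/eqP; field.
    by rewrite sqrtr_eq0 -ltNge ltr0n.
  rewrite -!mulr_suml.
  have := sum_inv_sqrt (R := R) T; have := lrnorm_ge0 q f.
  set S := \sum_(t < T) _; set N := lrnorm q f => N0 hS.
  apply: (@le_trans _ _ (2 * Num.sqrt T%:R * 2^-1 * (n%:R * 2 * N))).
    by rewrite ler_wpM2r ?mulr_ge0// ler_wpM2r.
  rewrite (_ : 2 * _ * _ * _ = n%:R * 2 * Num.sqrt T%:R * N); last by field.
  rewrite ler_wpM2r// ler_wpM2r ?(ltW sT)// /C.
  by rewrite -addrA addrCA lerDl addr_ge0.
- by have := opb_norm f q1 (oit (T + T)%N); rewrite mul1r.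
- move=> j.
  have h : lrnorm q (Dm e j g) = lrnorm q (Dp e j g).
    rewrite -(lrnorm_shift q (Dm e j g) (e j)) -[RHS]mul1r -normrN1 -(lrnormZ q1 (-1) (Dp e j g)).
    by apply: eq_lrnorm => x; rewrite /Dm /Dp addrK; ring.
  rewrite h; apply: le_trans (opb_norm f q1 (heat_gradient e j (T + T))) _.
  have hC : 2 <= C by rewrite /C lerDr addr_ge0.
  have hs : (Num.sqrt (T + T).+1%:R)^-1 <= (Num.sqrt (T%:R : R))^-1.
    by apply: inv_sqrt_le; [rewrite ltr0n | rewrite ler_nat -addnS leq_addr].
  have s0 : 0 <= (Num.sqrt ((T + T).+1%:R : R))^-1 by rewrite invr_ge0 sqrtr_ge0.
  have h2 := ler_pM (ler0n R 2) s0 hC hs.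
  exact: ler_pM (mulr_ge0 (ler0n R 2) s0) (lrnorm_ge0 q f) h2 (lexx _).
Qed.

End heat_divergence.

(** * Cutoffs and a crude solution on the torus *)

Section ffun_torus.
Variables (n M : nat).
HB.instance Definition _ := GRing.Zmodule.on {ffun 'I_n -> 'I_M.+1}.
End ffun_torus.

Section windows.
Context {R : realType}.
Variables (N : nat).
Hypothesis N0 : (0 < N)%N.
Implicit Types a t : nat.

(** The convolution of two normalized indicators of intervals of length [N]: total mass 1, height at
    most [1 / N], differences at most [1 / N ^ 2], as suits a bump of width [2 * N]. *)
Definition tent a t : R :=
  (\sum_(i < N) ((a + i <= t) && (t < a + i + N))%N%:R) / N%:R ^+ 2.

Let N1 : 0 < N%:R :> R. Proof. by rewrite ltr0n. Qed.

Lemma tent_ge0 a t : 0 <= tent a t.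
Proof. by rewrite divr_ge0 ?sumr_ge0// exprn_ge0. Qed.

Lemma tent_le a t : tent a t <= N%:R^-1.
Proof.
rewrite ler_pdivrMr ?exprn_gt0// expr2 mulKf ?gt_eqF//.
apply: (@le_trans _ _ (\sum_(i < N) 1)); last by rewrite sumr_const card_ord.
by apply: ler_sum => i _; case: (_ && _).
Qed.

Lemma tent_lt a t : (t < a)%N -> tent a t = 0.
Proof.
move=> ta; rewrite /tent big1 ?mul0r// => i _.
by rewrite (_ : (a + i <= t)%N = false)//; lia.
Qed.

Lemma tent_ge a t : (a + 2 * N <= t)%N -> tent a t = 0.
Proof.
move=> ta; rewrite /tent big1 ?mul0r// => i _.
by rewrite (_ : (t < a + i + N)%N = false) ?andbF//; have := ltn_ord i; lia.
Qed.

Lemma sum_indic (a k m : nat) : (a + k <= m)%N ->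
  \sum_(t < m) ((a <= t) && (t < a + k))%N%:R = k%:R :> R.
Proof.
move=> akm; rewrite -natr_sum; congr (_%:R).
transitivity (minn m (a + k) - minn m a)%N; last by lia.
elim: m {akm} => [|m IH]; first by rewrite big_ord0; lia.
by rewrite big_ord_recr/= IH; case: (leqP a m); case: (ltnP m (a + k)) => /=; lia.
Qed.

Lemma tent_sum a m : (a + 2 * N <= m)%N -> \sum_(t < m) tent a t = 1.
Proof.
move=> am; rewrite /tent -mulr_suml exchange_big/=.
rewrite (eq_bigr (fun=> N%:R)); last by move=> i _; apply: sum_indic; have := ltn_ord i; lia.
by rewrite sumr_const card_ord -[X in X / _]mulr_natr -expr2 divff// gt_eqF// exprn_gt0.
Qed.

Lemma tent_diff a t : `|tent a t.+1 - tent a t| <= N%:R ^- 2.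
Proof.
rewrite /tent -mulrBl normrM [`|_ ^- 2|]ger0_norm ?invr_ge0 ?exprn_ge0//.
rewrite -[leRHS]mul1r ler_pM2r ?invr_gt0 ?exprn_gt0// -sumrB.
pose v i : R := ((a + i <= t.+1) && (t.+1 < a + i + N))%N%:R.
rewrite (eq_bigr (fun i : 'I_N => v i - v i.+1)); last first.
  move=> i _; congr (_ - _%:R); rewrite /v; congr (nat_of_bool _); apply/idP/idP; lia.
have -> : \sum_(i < N) (v i - v i.+1) = v 0%N - v N.
  by elim: (N) => [|k IH]; rewrite ?big_ord0 ?subrr// big_ord_recr/= IH addrA subrK.
rewrite /v; case: (_ && _); case: (_ && _);
  by rewrite ?subrr ?subr0 ?sub0r ?normrN1 ?normr1 ?normr0.
Qed.

(** A primitive of one tent minus a later one: it rises between [N] and [3 * N], is 1 up to [4 * N],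
    and is back to 0 before [6 * N]. Its second differences, being differences of tents, are of
    order [1 / N ^ 2]. *)
Definition cutoff t : R := \sum_(s < t.+1) tent N s - \sum_(s < t.+1) tent (4 * N) s.

Lemma cutoff_diff t : cutoff t.+1 - cutoff t = tent N t.+1 - tent (4 * N) t.+1.
Proof. by rewrite /cutoff 2!(big_ord_recr t.+1)/=; ring. Qed.

Lemma sum_tent_le1 a t : \sum_(s < t) tent a s <= 1.
Proof.
rewrite -(@tent_sum a (t + (a + 2 * N))) ?leq_addl// big_split_ord/= lerDl.
by apply: sumr_ge0 => i _; exact: tent_ge0.
Qed.

Lemma sum_tent_full a t : (a + 2 * N <= t)%N -> \sum_(s < t) tent a s = 1.
Proof. exact: tent_sum. Qed.

Lemma sum_tent0 a t : (t <= a)%N -> \sum_(s < t) tent a s = 0.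
Proof. by move=> ta; rewrite big1// => s _; rewrite tent_lt// (leq_trans (ltn_ord s)). Qed.

Lemma sum_tent_ge0 a t : 0 <= \sum_(s < t) tent a s.
Proof. by apply: sumr_ge0 => i _; exact: tent_ge0. Qed.

Lemma cutoff_bound t : 0 <= cutoff t <= 1.
Proof.
rewrite /cutoff; have [t3|t3] := leqP (3 * N) t.+1.
  rewrite (@sum_tent_full N); last by lia.
  by rewrite subr_ge0 sum_tent_le1 gerBl sum_tent_ge0.
rewrite (@sum_tent0 (4 * N)); last by lia.
by rewrite subr0 sum_tent_ge0 sum_tent_le1.
Qed.

Lemma cutoff1 t : (3 * N <= t.+1 <= 4 * N)%N -> cutoff t = 1.
Proof.
move=> /andP[t3 t4]; rewrite /cutoff sum_tent_full; last by lia.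
by rewrite sum_tent0 ?subr0.
Qed.

Lemma cutoff0 t : (t < N)%N || (6 * N <= t.+1)%N -> cutoff t = 0.
Proof.
case/orP => h; first by rewrite /cutoff !sum_tent0 ?subrr//; lia.
by rewrite /cutoff !sum_tent_full ?subrr//; lia.
Qed.

Lemma tent2_le t : `|tent N t - tent (4 * N) t| <= N%:R^-1.
Proof.
have [h|h] := leqP (3 * N) t.
  rewrite tent_ge; last by lia.
  by rewrite sub0r normrN ger0_norm ?tent_ge0// tent_le.
by rewrite (@tent_lt (4 * N)) ?subr0 ?ger0_norm ?tent_ge0 ?tent_le//; lia.
Qed.

End windows.

Section torus.
Context {R : realType}.
Variables (n N M : nat).
Hypotheses (N0 : (0 < N)%N) (MN : M.+1 = (8 * N)%N).
Notation V := {ffun 'I_n -> 'I_M.+1}.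
Implicit Types (x y : V) (i j l : 'I_n) (f g h : V -> R) (t : 'I_M.+1).

Definition one_step : 'I_M.+1 := inZp 1.

Definition ev i : V := [ffun j => if j == i then one_step else 0].

Lemma sub_one t : nat_of_ord (t - one_step) = if t == 0%N :> nat then M else t.-1.
Proof.
rewrite /one_step /=; have tM := ltn_ord t.
have -> : (1 %% M.+1 = 1)%N by rewrite modn_small//; lia.
case: eqP => [->|/eqP t0]; first by rewrite add0n modn_small ?modn_small; lia.
rewrite [X in (t + X)%N]modn_small; last by lia.
rewrite (_ : (t + (M.+1 - 1) = t.-1 + M.+1)%N); last by lia.
by rewrite modnDr modn_small//; lia.
Qed.

Let N1 : 0 < N%:R :> R. Proof. by rewrite ltr0n. Qed.

Definition upd x l t : V := [ffun j => if j == l then t else x j].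

Lemma upd_id x l : upd x l (x l) = x.
Proof. by apply/ffunP => j; rewrite ffunE; case: eqP => [->|]. Qed.

Lemma updE x l t : upd x l t l = t.
Proof. by rewrite ffunE eqxx. Qed.

Lemma updN x l t j : j != l -> upd x l t j = x j.
Proof. by move=> /negPf jl; rewrite ffunE jl. Qed.

Lemma upd_upd x l t t' : upd (upd x l t) l t' = upd x l t'.
Proof. by apply/ffunP => j; rewrite !ffunE; case: eqP. Qed.

Lemma sub_ev x i j : (x - ev i) j = if j == i then x j - one_step else x j.
Proof. by rewrite !ffunE; case: eqP => //; rewrite subr0. Qed.

Lemma sub_ev_upd x i : x - ev i = upd x i (x i - one_step).
Proof. by apply/ffunP => j; rewrite sub_ev ffunE; case: eqP => [->|]. Qed.

Lemma upd_sub_ev x i l t : i != l -> upd (x - ev i) l t = upd x l t - ev i.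
Proof.
move=> il; apply/ffunP => j; rewrite ffunE !sub_ev ffunE.
by have [->|//] := eqVneq j l; rewrite eq_sym (negPf il).
Qed.

Lemma upd_shift x l s : upd x l (x l + s) = x + [ffun j => if j == l then s else 0].
Proof.
by apply/ffunP => j; rewrite !ffunE; case: eqP => [->//|]; rewrite addr0.
Qed.

Definition line l h x : R := \sum_t h (upd x l t).

Lemma lineE l h x : line l h x = \sum_s h (x + [ffun j => if j == l then s else 0]).
Proof.
rewrite /line (reindex_inj (addrI (x l))); apply: eq_bigr => s _.
by rewrite upd_shift.
Qed.

Lemma line_upd l h x t : line l h (upd x l t) = line l h x.
Proof. by apply: eq_bigr => s _; rewrite upd_upd. Qed.

Lemma line_Dm l j h x : j != l -> line l (Dm ev j h) x = Dm ev j (line l h) x.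
Proof.
move=> jl; rewrite /line /Dm sumrB; congr (_ - _); apply: eq_bigr => t _.
by rewrite upd_sub_ev.
Qed.

Variable r : R.
Hypothesis r1 : 1 < r.

Lemma line_norm l h : lrnorm r (line l (fun x => `|h x|)) <= M.+1%:R * lrnorm r h.
Proof.
rewrite (eq_lrnorm r (lineE l (fun x => `|h x|))).
apply: le_trans (lrnorm_sum r1 _ _ _) _.
rewrite (eq_bigr (fun=> lrnorm r h)); last first.
  move=> s _; rewrite (lrnorm_shift r (fun x => `|h x|)).
  by congr (_ `^ _); apply: eq_bigr => x _; rewrite normr_id.
by rewrite sumr_const card_ord mulr_natl.
Qed.

Lemma normr_line l h x : `|line l h x| <= line l (fun x => `|h x|) x.
Proof. exact: ler_norm_sum. Qed.

Let th (t : nat) : R := tent N N t.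

Let M8 : M.+1%:R = 8 * N%:R :> R. Proof. by rewrite MN natrM. Qed.

Let add8 (a b : R) : b <= 8 * a -> a + b <= 9 * a.
Proof. by lra. Qed.

Let le_mulDl (a b c : R) : 0 <= a -> 0 <= b -> c <= a * b + c.
Proof. by move=> a0 b0; rewrite lerDr mulr_ge0. Qed.

Let absorb (a b c : R) : 0 < c -> c * (a + b / c) = c * a + b.
Proof. by move=> c0; rewrite mulrDr [c * (_ / _)]mulrC divfK// gt_eqF. Qed.

Let add1_mul (k a b : R) : k * a * b + a * b <= (k + 1) * a * b.
Proof. by rewrite !mulrDl mul1r. Qed.

(** The line sum is spread along the fixed profile [th], of mass 1, so [h - EE l h] has zero sum on
    each line in direction [l] and [II l h] is a primitive of it that closes up around the torus. *)
Definition EE l h x : R := th (x l) * line l h x.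
Definition II l h x : R := \sum_(t : 'I_M.+1 | (t <= x l)%N) (h (upd x l t) - EE l h (upd x l t)).

Lemma EE_norm l h : lrnorm r (EE l h) <= 8 * lrnorm r h.
Proof.
apply: (@le_trans _ _ (lrnorm r (fun x => N%:R^-1 * line l (fun x => `|h x|) x))).
  apply: ler_lrnorm => // x; rewrite /EE normrM [leRHS]normrM; apply: ler_pM => //.
    have t0 : 0 <= th (x l) by exact: tent_ge0.
    by rewrite (ger0_norm t0) ger0_norm ?invr_ge0 ?(ltW N1)//; exact: tent_le.
  by rewrite (le_trans (normr_line _ _ _))// ler_norm.
rewrite (lrnormZ r1 N%:R^-1 (line l (fun x => `|h x|))).
have Ni : `|N%:R^-1| = N%:R^-1 :> R by rewrite ger0_norm// invr_ge0 ltW.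
rewrite Ni (ler_pdivrMl _ _ N1) mulrA [N%:R * 8]mulrC -M8; exact: line_norm.
Qed.

Lemma Dm_EE l j h x : j != l -> Dm ev j (EE l h) x = EE l (Dm ev j h) x.
Proof.
move=> jl; rewrite /EE line_Dm// /Dm sub_ev eq_sym (negPf jl).
by rewrite mulrBr.
Qed.

Lemma th_diff t : `|th t - th (t - one_step)%R| <= N%:R ^- 2.
Proof.
rewrite sub_one /th; case: eqP => [->|t0].
  rewrite tent_lt// tent_ge//; last by lia.
  by rewrite subrr normr0 invr_ge0 exprn_ge0.
have {1}-> : nat_of_ord t = t.-1.+1 by rewrite prednK// lt0n; exact/eqP.
exact: tent_diff.
Qed.

Lemma Dm_EE_norm l h : lrnorm r (Dm ev l (EE l h)) <= 8 / N%:R * lrnorm r h.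
Proof.
have E x : Dm ev l (EE l h) x = (th (x l) - th (x l - one_step)%R) * line l h x.
  by rewrite /Dm /EE sub_ev eqxx sub_ev_upd line_upd mulrBl.
apply: (@le_trans _ _ (lrnorm r (fun x => N%:R ^- 2 * line l (fun x => `|h x|) x))).
  apply: ler_lrnorm => // x; rewrite E normrM [leRHS]normrM; apply: ler_pM => //.
    by rewrite [leRHS]ger0_norm ?invr_ge0 ?exprn_ge0// th_diff.
  by rewrite (le_trans (normr_line _ _ _))// ler_norm.
rewrite (lrnormZ r1 (N%:R ^- 2) (line l (fun x => `|h x|))).
have Ni : 0 <= N%:R ^- 2 :> R by rewrite invr_ge0 exprn_ge0.
rewrite (ger0_norm Ni); apply: le_trans (ler_wpM2l Ni (line_norm l h)) _.
by rewrite M8 le_eqVlt; apply/orP; left; apply/eqP; field; rewrite gt_eqF.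
Qed.

Lemma sum_th : \sum_(t < M.+1) th t = 1.
Proof. by apply: tent_sum => //; rewrite MN; lia. Qed.

Lemma line_EE l h x : line l (EE l h) x = line l h x.
Proof.
rewrite /line /EE; under eq_bigr => t _ do rewrite updE line_upd.
by rewrite -mulr_suml sum_th mul1r.
Qed.

Lemma Dm_II l h x : Dm ev l (II l h) x = h x - EE l h x.
Proof.
rewrite /Dm /II sub_ev eqxx.
under [X in _ - X]eq_bigr => t _ do rewrite sub_ev_upd upd_upd.
rewrite sub_one; case: eqP => x0.
  rewrite [X in _ - X](_ : _ = 0) ?subr0.
    rewrite (big_pred1 (x l)) ?upd_id// => t /=.
    by rewrite x0 leqn0; apply/eqP/eqP => [t0|->//]; apply: val_inj; rewrite /= t0.
  rewrite (eq_bigl xpredT); last by move=> t /=; rewrite -ltnS ltn_ord.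
  by rewrite sumrB -/(line l h x) -/(line l (EE l h) x) line_EE subrr.
rewrite (bigD1 (x l))//= upd_id addrC -[RHS]add0r addrAC; congr (_ + _).
apply/eqP; rewrite subr_eq0; apply/eqP; apply: eq_bigl => t.
by rewrite -val_eqE /=; lia.
Qed.

Lemma Dm_II_ne l j h x : j != l -> Dm ev j (II l h) x = II l (Dm ev j h) x.
Proof.
move=> jl; rewrite /Dm /II sub_ev eq_sym (negPf jl) -sumrB.
apply: eq_bigr => t _; rewrite upd_sub_ev// -(Dm_EE h)//.
by rewrite /Dm; ring.
Qed.

(** [72 = 8 * 9]: a line has [8 * N] points, and [h - EE l h] is at most 9 times [h] in norm. *)
Lemma II_norm l h : lrnorm r (II l h) <= 72 * N%:R * lrnorm r h.
Proof.
apply: (@le_trans _ _ (lrnorm r (line l (fun x => `|h x - EE l h x|)))).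
  apply: ler_lrnorm => // x; rewrite /II (le_trans (ler_norm_sum _ _ _))//.
  rewrite [leRHS]ger0_norm ?sumr_ge0// /line [leRHS](bigID (fun t : 'I_M.+1 => (t <= x l)%N))/= lerDl.
  exact: sumr_ge0.
apply: le_trans (line_norm l _) _; rewrite M8.
rewrite (_ : 72 * _ * _ = 8 * N%:R * (9 * lrnorm r h)); last by ring.
rewrite ler_wpM2l ?mulr_ge0 ?(ltW N1)//.
rewrite (eq_lrnorm r (g := fun x => h x + -1 * EE l h x)); last by move=> x; rewrite mulN1r.
apply: le_trans (lrnorm_add r1 _ _) _; rewrite (lrnormZ r1) normrN1 mul1r.
exact: add8 (EE_norm l h).
Qed.

Definition Es (s : seq 'I_n) h : V -> R := foldr EE h s.

Lemma Es_norm s h : lrnorm r (Es s h) <= 8 ^+ size s * lrnorm r h.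
Proof.
elim: s => [|l s IH] /=; first by rewrite expr0 mul1r.
by rewrite exprS -mulrA; exact: le_trans (EE_norm l _) (ler_wpM2l (ler0n R 8) IH).
Qed.

Lemma Dm_Es_norm s j h :
  lrnorm r (Dm ev j (Es s h)) <= 8 ^+ size s * (lrnorm r (Dm ev j h) + lrnorm r h / N%:R).
Proof.
elim: s => [|l s IH] /=.
  by rewrite expr0 mul1r lerDl divr_ge0 ?lrnorm_ge0 ?(ltW N1).
rewrite exprS -mulrA; have [->|jl] := eqVneq j l.
  apply: le_trans (Dm_EE_norm l _) _.
  rewrite -mulrA; apply: (ler_wpM2l (ler0n R 8)).
  have Ni : 0 <= N%:R^-1 :> R by rewrite invr_ge0 ltW.
  apply: le_trans (ler_wpM2l Ni (Es_norm s h)) _.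
  rewrite mulrCA; apply: ler_wpM2l (exprn_ge0 _ (ler0n R 8)) _ _ _.
  by rewrite mulrC lerDr lrnorm_ge0.
rewrite (eq_lrnorm r (fun x => Dm_EE (Es s h) x jl)).
exact: le_trans (EE_norm l _) (ler_wpM2l (ler0n R 8) IH).
Qed.

(** Once every coordinate has been treated, only the total sum of [h] is left, times a product of
    profiles; for data of mean zero this is 0, so the correction of one coordinate after another
    ends with nothing left over. *)
Lemma Es_full s h x : uniq s ->
  Es s h x = (\prod_(l <- s) th (x l)) * \sum_(y : V | [forall j, (j \in s) || (y j == x j)]) h y.
Proof.
elim: s x => [|l s IH] x /=.
  rewrite big_nil mul1r => _; rewrite (big_pred1 x)// => y /=.
  apply/forallP/eqP => [h1|-> j]; last exact: eqxx.
  by apply/ffunP => j; exact/eqP/h1.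
move=> /andP[ls us]; rewrite /EE big_cons -mulrA; congr (_ * _).
rewrite /line -/(Es s h) (eq_bigr _ (fun t _ => IH (upd x l t) us)).
have E t : \prod_(l' <- s) th (upd x l t l') = \prod_(l' <- s) th (x l').
  rewrite big_seq [RHS]big_seq; apply: eq_bigr => l' l's; rewrite updN//.
  by apply: contraNneq ls => <-.
rewrite (eq_bigr (fun t => \prod_(l' <- s) th (x l') * \sum_(y : V | [forall j, (j \in s) || (y j == upd x l t j)]) h y)); last by move=> t _; rewrite E.
rewrite -mulr_sumr; congr (_ * _).
rewrite [RHS](partition_big (fun y : V => y l) xpredT)//=.
apply: eq_bigr => t _; apply: eq_bigl => y.
apply/forallP/andP => [h1|[/forallP h1 /eqP yl] j].
  split; last by have := h1 l; rewrite (negPf ls) updE.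
  apply/forallP => j; have := h1 j; rewrite in_cons.
  have [->//|jl] := eqVneq j l; by rewrite updN.
have := h1 j; rewrite in_cons; have [->|jl] := eqVneq j l.
  by rewrite updE yl eqxx orbT.
by rewrite updN.
Qed.

Lemma Es_enum0 h x : \sum_y h y = 0 -> Es (enum 'I_n) h x = 0.
Proof.
move=> h0; rewrite (Es_full h x (enum_uniq _)).
have <- : \sum_y h y = \sum_(y : V | [forall j, (j \in enum 'I_n) || (y j == x j)]) h y.
  by apply: eq_bigl => y; apply/esym/forallP => j; rewrite mem_enum.
by rewrite h0 mulr0.
Qed.

Definition inbox x := [forall j, (N <= x j <= 6 * N)%N].
Definition suppb h := forall x, ~~ inbox x -> h x = 0.

Lemma inboxP x : ~~ inbox x -> exists j, ~~ (N <= x j <= 6 * N)%N.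
Proof. by rewrite negb_forall => /existsP. Qed.

Lemma bad_inbox x j : ~~ (N <= x j <= 6 * N)%N -> ~~ inbox x.
Proof. by move=> h; rewrite negb_forall; apply/existsP; exists j. Qed.

Lemma suppb_EE l h : suppb h -> suppb (EE l h).
Proof.
move=> sh x /inboxP[j jx]; have [jl|jl] := eqVneq j l.
  rewrite /EE /th; move: jx; rewrite -jl negb_and -!ltnNge => /orP[h1|h1].
    by rewrite tent_lt ?mul0r.
  by rewrite tent_ge ?mul0r//; lia.
rewrite /EE /line big1 ?mulr0// => t _; apply: sh; apply: (@bad_inbox _ j).
by rewrite updN.
Qed.

(** Before the box the partial sums have only zero terms; after it they have exhausted a line sum,
    which is zero. *)
Lemma suppb_II l h : suppb h -> suppb (II l h).
Proof.
move=> sh x /inboxP[j jx].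
have sE := suppb_EE l sh.
have hz y : ~~ inbox y -> h y - EE l h y = 0 by move=> yb; rewrite sh// sE// subrr.
have [jl|jl] := eqVneq j l; last first.
  by rewrite /II big1// => t _; apply: hz; apply: (@bad_inbox _ j); rewrite updN.
move: jx; rewrite jl negb_and -!ltnNge => /orP[h1|h1].
  rewrite /II big1// => t tx; apply: hz; apply: (@bad_inbox _ l).
  by rewrite updE negb_and -ltnNge (leq_ltn_trans tx).
have : line l (fun y => h y - EE l h y) x = 0.
  by rewrite /line sumrB -/(line l h x) -/(line l (EE l h) x) line_EE subrr.
rewrite /line (bigID (fun t : 'I_M.+1 => (t <= x l)%N))/= [X in _ + X]big1 ?addr0// => t.
rewrite -ltnNge => tx; apply: hz; apply: (@bad_inbox _ l).
by rewrite updE negb_and -!ltnNge (ltn_trans h1 tx) orbT.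
Qed.

Lemma suppb_Es s h : suppb h -> suppb (Es s h).
Proof. by move=> sh; elim: s => //= l s IH; exact: suppb_EE. Qed.

(* Solves the divergence equation with a loss of one derivative, which the
   factor [N] in front of [Dm g] accounts for. *)
Lemma crude_divergence g : suppb g -> \sum_x g x = 0 ->
  exists z : 'I_n -> V -> R, [/\
    forall x, g x = \sum_l Dm ev l (z l) x,
    forall l, suppb (z l),
    forall l, lrnorm r (z l) <= n%:R * (72 * 8 ^+ n) * N%:R * lrnorm r g &
    forall l j, lrnorm r (Dm ev j (z l)) <=
      n%:R * (72 * 8 ^+ n) * (N%:R * lrnorm r (Dm ev j g) + lrnorm r g)].
Proof.
move=> sg g0.
suff [z [zE zs zn zd]] : exists z : 'I_n -> V -> R, [/\
    forall x, g x - Es (enum 'I_n) g x = \sum_l Dm ev l (z l) x,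
    forall l, suppb (z l),
    forall l, lrnorm r (z l) <= (size (enum 'I_n))%:R * (72 * 8 ^+ n) * N%:R * lrnorm r g &
    forall l j, lrnorm r (Dm ev j (z l)) <=
      (size (enum 'I_n))%:R * (72 * 8 ^+ n) * (N%:R * lrnorm r (Dm ev j g) + lrnorm r g)].
  move: zn zd; rewrite size_enum_ord => zn zd.
  by exists z; split => // x; rewrite -zE Es_enum0// subr0.
have : (size (enum 'I_n) <= n)%N by rewrite size_enum_ord.
elim: (enum 'I_n) => [|l s IH] sn.
  have z0 : lrnorm r (fun _ : V => 0 : R) = 0 :> R.
    have -> : lrnorm r (fun _ : V => 0 : R) = lrnorm r (fun x : V => 0 * 0 : R).
      by apply: eq_lrnorm => x; rewrite mulr0.
    by rewrite (lrnormZ r1) normr0 mul0r.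
  exists (fun=> fun=> 0); split => //.
  - by move=> x; rewrite subrr big1// => l _; rewrite /Dm subrr.
  - by move=> l; rewrite !mul0r /= z0.
  - move=> l j; rewrite !mul0r /=.
    have -> : lrnorm r (Dm ev j (fun=> 0)) = lrnorm r (fun _ : V => 0 : R).
      by apply: eq_lrnorm => x; rewrite /Dm subrr.
    by rewrite z0.
have [z [zE zs zn zd]] := IH (ltnW sn).
have p8 : 8 ^+ size s <= 8 ^+ n :> R by apply: ler_weXn2l; [rewrite ler1n|exact: ltnW].
have g0' := lrnorm_ge0 r g.
have p8g := ler_pM (exprn_ge0 _ (ler0n R 8)) g0' p8 (lexx (lrnorm r g)).
have e8 := exprn_ge0 n (ler0n R 8).
pose w k x := (k == l)%:R * II l (Es s g) x.
have wn k : lrnorm r (w k) <= 72 * 8 ^+ n * N%:R * lrnorm r g.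
  rewrite (lrnormZ r1); apply: (@le_trans _ _ (1 * lrnorm r (II l (Es s g)))).
    by rewrite ler_wpM2r ?lrnorm_ge0//; case: (k == l); rewrite ?normr1 ?normr0.
  rewrite mul1r; apply: le_trans (II_norm _ _) _.
  rewrite -!mulrA; apply: (ler_wpM2l (ler0n R 72)).
  rewrite [leRHS]mulrCA; apply: (ler_wpM2l (ltW N1)).
  exact: le_trans (Es_norm _ _) p8g.
have wd k j : lrnorm r (Dm ev j (w k)) <= 72 * 8 ^+ n * (N%:R * lrnorm r (Dm ev j g) + lrnorm r g).
  have Dg0 := lrnorm_ge0 r (Dm ev j g).
  have -> : lrnorm r (Dm ev j (w k)) = lrnorm r (fun x => (k == l)%:R * Dm ev j (II l (Es s g)) x).
    by apply: eq_lrnorm => x; rewrite /Dm /w; ring.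
  rewrite (lrnormZ r1); apply: (@le_trans _ _ (1 * lrnorm r (Dm ev j (II l (Es s g))))).
    by rewrite ler_wpM2r ?lrnorm_ge0//; case: (k == l); rewrite ?normr1 ?normr0.
  rewrite mul1r; have [->|jl] := eqVneq j l.
    have -> : lrnorm r (Dm ev l (II l (Es s g))) = lrnorm r (fun x => Es s g x + -1 * EE l (Es s g) x).
      by apply: eq_lrnorm => x; rewrite Dm_II mulN1r.
    apply: le_trans (lrnorm_add r1 _ _) _; rewrite (lrnormZ r1) normrN1 mul1r.
    apply: (@le_trans _ _ (9 * lrnorm r (Es s g))).
      exact: add8 (EE_norm l (Es s g)).
    apply: (@le_trans _ _ (9 * (8 ^+ n * lrnorm r g))).
      exact: ler_wpM2l (ler0n R 9) _ _ (le_trans (Es_norm _ _) p8g).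
    have h9 : 9 * 8 ^+ n <= 72 * 8 ^+ n :> R.
      by apply: ler_pM e8 _ (lexx _) => //; rewrite ler_nat.
    rewrite mulrA; apply: ler_pM (mulr_ge0 (ler0n R 9) e8) g0' h9 _.
    exact: (le_mulDl _ (ltW N1) (lrnorm_ge0 _ _)).
  rewrite (eq_lrnorm r (fun x => Dm_II_ne (Es s g) x jl)).
  apply: le_trans (II_norm _ _) _; rewrite -!mulrA; apply: (ler_wpM2l (ler0n R 72)).
  apply: le_trans (ler_wpM2l (ltW N1) (Dm_Es_norm _ _ _)) _.
  rewrite mulrCA (absorb _ _ N1).
  have a0 := addr_ge0 (mulr_ge0 (ltW N1) Dg0) g0'.
  exact: ler_pM (exprn_ge0 _ (ler0n R 8)) a0 p8 (lexx _).
exists (fun k x => z k x + w k x); split => [x|k|k|k j].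
- have -> : g x - Es (l :: s) g x = (g x - Es s g x) + (Es s g x - EE l (Es s g) x).
    by rewrite /=; ring.
  rewrite zE -Dm_II.
  have -> : Dm ev l (II l (Es s g)) x = \sum_k Dm ev k (w k) x.
    rewrite (bigD1 l)//= big1 ?addr0; first by rewrite /Dm /w eqxx !mul1r.
    by move=> k /negPf kl; rewrite /Dm /w kl !mul0r subrr.
  by rewrite -big_split/=; apply: eq_bigr => k _; rewrite /Dm; ring.
- move=> x xb; rewrite zs// /w suppb_II ?mulr0 ?addr0//; exact: suppb_Es.
- apply: le_trans (lrnorm_add r1 _ _) _.
  apply: le_trans (lerD (zn k) (wn k)) _; rewrite -[(size (l :: s))%:R]natr1 le_eqVlt.
  by apply/orP; left; apply/eqP; ring.
- have -> : lrnorm r (Dm ev j (fun x => z k x + w k x)) = lrnorm r (fun x => Dm ev j (z k) x + Dm ev j (w k) x).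
    by apply: eq_lrnorm => x; rewrite /Dm; ring.
  apply: le_trans (lrnorm_add r1 _ _) _.
  apply: le_trans (lerD (zd k j) (wd k j)) _; rewrite -[(size (l :: s))%:R]natr1.
  exact: add1_mul.
Qed.

End torus.

Lemma window_in_box N k : (3 * N <= k < 4 * N)%N -> (N <= k <= 6 * N)%N.
Proof. lia. Qed.

Section cutoff_function.
Context {R : realType}.
Variables (n N M : nat).
Hypotheses (N0 : (0 < N)%N) (MN : M.+1 = (8 * N)%N).
Notation V := {ffun 'I_n -> 'I_M.+1}.
Notation e := (@ev n M).
Implicit Types (x y : V) (i j l : 'I_n) (f g h : V -> R) (t : 'I_M.+1).

Let N1 : 0 < N%:R :> R. Proof. by rewrite ltr0n. Qed.
Let Ni : 0 <= N%:R^-1 :> R. Proof. by rewrite invr_ge0 ltW. Qed.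

Definition tau (t : nat) : R := tent N N t - tent N (4 * N) t.

Lemma cutoff_step t : cutoff N t - cutoff N (t - one_step M)%R = tau t.
Proof.
rewrite (sub_one N0 MN); have [t0|t0] := eqVneq (nat_of_ord t) 0%N.
  rewrite t0 /tau !cutoff0// ?subrr; last 2 first.
  - by rewrite MN; lia.
  - by rewrite N0.
  by rewrite !tent_lt ?subrr//; lia.
have {1 3}-> : nat_of_ord t = t.-1.+1 by rewrite prednK// lt0n.
exact: cutoff_diff.
Qed.

Lemma tau_le (t : nat) : `|tau t| <= N%:R^-1.
Proof. exact: tent2_le. Qed.

Lemma tau_step t : `|tau t - tau (t - one_step M)%R| <= 2 * N%:R ^- 2.
Proof.
have d a : (0 < a)%N -> (a + 2 * N <= M)%N ->
    `|tent N a t - tent N a (t - one_step M)%R| <= N%:R ^- 2 :> R.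
  move=> a0 aM; rewrite (sub_one N0 MN); have [t0|t0] := eqVneq (nat_of_ord t) 0%N.
    rewrite t0 tent_lt// tent_ge//.
    by rewrite subrr normr0 invr_ge0 exprn_ge0.
  have {1}-> : nat_of_ord t = t.-1.+1 by rewrite prednK// lt0n.
  exact: tent_diff.
have d1 : `|tent N N t - tent N N (t - one_step M)%R| <= N%:R ^- 2 :> R by apply: d => //; lia.
have d2 : `|tent N (4 * N) t - tent N (4 * N) (t - one_step M)%R| <= N%:R ^- 2 :> R by apply: d => //; lia.
rewrite /tau; set a := tent N N t in d1 *; set b := tent N N _ in d1 *.
set c := tent N _ t in d2 *; set d' := tent N _ _ in d2 *.
rewrite (_ : a - c - (b - d') = (a - b) - (c - d')); last by ring.
apply: le_trans (ler_normB _ _) _; rewrite mulr_natl mulr2n; exact: lerD.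
Qed.

Definition cprod (A : pred 'I_n) x : R := \prod_(l | A l) cutoff N (x l).

Lemma cprod_bound A x : 0 <= cprod A x <= 1.
Proof.
apply/andP; split; first by apply: prodr_ge0 => l _; have /andP[] := @cutoff_bound R N N0 (x l).
by apply: prodr_ile1 => l _; exact: cutoff_bound.
Qed.

Lemma cprod_norm A x : `|cprod A x| <= 1.
Proof. by have /andP[h1 h2] := cprod_bound A x; rewrite ger0_norm. Qed.

Lemma Dm_cprod A j x : Dm e j (cprod A) x =
  if A j then tau (x j) * cprod (fun l => A l && (l != j)) x else 0.
Proof.
rewrite /Dm /cprod.
have off B : ~~ B j -> \prod_(l | B l) cutoff N ((x - e j)%R l) = \prod_(l | B l) cutoff N (x l) :> R.
  move=> Bj; apply: eq_bigr => l Bl; rewrite sub_ev.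
  by case: eqP => // lj; rewrite -lj Bl in Bj.
case: ifPn => Aj; last by rewrite off// subrr.
rewrite (bigD1 j)//= [X in _ - X](bigD1 j)//= off; last by rewrite eqxx andbF.
by rewrite sub_ev eqxx -mulrBl cutoff_step.
Qed.

Definition chi x : R := cprod xpredT x.

Lemma Dm_chi i x : Dm e i chi x = tau (x i) * cprod (fun l => l != i) x.
Proof. by rewrite /chi Dm_cprod. Qed.

Lemma Dm_chi_le i x : `|Dm e i chi x| <= N%:R^-1.
Proof.
rewrite Dm_chi normrM -[leRHS]mulr1; apply: ler_pM => //; first exact: tau_le.
exact: cprod_norm.
Qed.

Lemma DDm_chi_le i j x : `|Dm e j (Dm e i chi) x| <= 2 * N%:R ^- 2.
Proof.
have [->|ji] := eqVneq j i.
  have -> : Dm e i (Dm e i chi) x = (tau (x i) - tau (x i - one_step M)%R) * cprod (fun l => l != i) x.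
    have h : Dm e i (cprod (fun l => l != i)) x = 0 by rewrite Dm_cprod eqxx.
    have A : cprod (fun l => l != i) (x - e i) = cprod (fun l => l != i) x.
      by apply/eqP; rewrite eq_sym -subr_eq0 -/(Dm e i _ x) h.
    rewrite {1}/Dm !Dm_chi A -mulrBl.
    by rewrite sub_ev eqxx.
  rewrite normrM -[leRHS]mulr1; apply: ler_pM => //; first exact: tau_step.
  exact: cprod_norm.
have -> : Dm e j (Dm e i chi) x = tau (x i) * Dm e j (cprod (fun l => l != i)) x.
  by rewrite {1}/Dm !Dm_chi sub_ev eq_sym (negPf ji) -mulrBr.
rewrite Dm_cprod ji normrM.
apply: (@le_trans _ _ (N%:R^-1 * (N%:R^-1 * 1))).
  apply: ler_pM => //; first exact: tau_le.
  by rewrite normrM; apply: ler_pM => //; [exact: tau_le|exact: cprod_norm].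
by rewrite mulr1 -invfM -expr2 ler_peMl ?invr_ge0 ?exprn_ge0// ler1n.
Qed.

Lemma chi1 x : [forall j, (3 * N <= x j < 4 * N)%N] -> chi x = 1.
Proof.
move=> /forallP h; rewrite /chi /cprod big1// => l _; apply: cutoff1 => //.
by have /andP[h1 h2] := h l; rewrite (leq_trans h1)//=.
Qed.

Lemma chi0 x j : (x j < N)%N || (6 * N <= (x j).+1)%N -> chi x = 0.
Proof. by move=> h; rewrite /chi /cprod (bigD1 j)//= cutoff0 ?mul0r. Qed.

(** The vanishing one step back is there for [Dm], which looks at [x - e i]: both the cut field and
    its divergence then live in the box, away from the seam of the torus. *)
Lemma chi_outside x : ~~ inbox N x -> chi x = 0 /\ forall i, chi (x - e i) = 0.
Proof.
move=> /inboxP[j]; rewrite negb_and -!ltnNge => h; split.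
  by apply: (@chi0 _ j); case/orP: h => h; apply/orP; [left|right; lia].
move=> i; apply: (@chi0 _ j); rewrite sub_ev; have [ji|ji] := eqVneq j i; last first.
  by case/orP: h => h; apply/orP; [left|right; lia].
rewrite (sub_one N0 MN); have [xj|xj] := eqVneq (nat_of_ord (x j)) 0%N.
  by apply/orP; right; rewrite MN; lia.
by case/orP: h => h; apply/orP; [left|right]; lia.
Qed.

Variable r : R.
Hypothesis r1 : 1 < r.

Lemma lrnorm_mul (c : R) (a h : V -> R) : 0 <= c -> (forall x, `|a x| <= c) ->
  lrnorm r (fun x => a x * h x) <= c * lrnorm r h.
Proof.
move=> c0 ac; rewrite -[in leRHS](ger0_norm c0) -(lrnormZ r1 c h).
apply: ler_lrnorm => // x; rewrite normrM [leRHS]normrM; apply: ler_pM => //.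
exact: le_trans (ac x) (ler_norm c).
Qed.

Lemma lrnorm_Dm_mul (c1 c2 : R) (a h : V -> R) j :
  0 <= c1 -> 0 <= c2 -> (forall x, `|a x| <= c1) -> (forall x, `|Dm e j a x| <= c2) ->
  lrnorm r (Dm e j (fun x => a x * h x)) <= c1 * lrnorm r (Dm e j h) + c2 * lrnorm r h.
Proof.
move=> c10 c20 ac1 ac2.
have -> : lrnorm r (Dm e j (fun x => a x * h x)) =
    lrnorm r (fun x => a x * Dm e j h x + Dm e j a x * h (x - e j)).
  by apply: eq_lrnorm => x; rewrite /Dm; ring.
apply: le_trans (lrnorm_add r1 _ _) _; apply: lerD; first exact: lrnorm_mul.
apply: le_trans (lrnorm_mul (fun x => h (x - e j)) c20 ac2) _.
by rewrite (lrnorm_shift r h (- e j)).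
Qed.

End cutoff_function.

Section local_discrete.
Context {R : realType}.
Variables (n : nat) (q : R).
Hypothesis q1 : 1 < q.

Let arith1 (C K F nn N a : R) : 0 <= C -> 0 <= K -> 0 <= F -> 0 <= nn -> 0 < N ->
  a <= (1 + nn * C) * F ->
  C * N * F + K * N * a <= (2 * C + K * (2 + C + 4 * nn * C)) * N * F.
Proof.
move=> C0 K0 F0 n0 N0 aF.
have h1 : K * N * a <= K * N * ((1 + nn * C) * F).
  by apply: ler_wpM2l aF; exact: mulr_ge0 K0 (ltW N0).
have h2 : 0 <= C * N * F by rewrite !mulr_ge0// ltW.
have h3 : 0 <= K * N * F by rewrite !mulr_ge0// ltW.
have h4 : 0 <= K * N * F * C by rewrite mulr_ge0.
have h5 : 0 <= K * N * F * C * nn by rewrite mulr_ge0.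
by lra.
Qed.

Let arith2 (C K F nn N a b : R) : 0 <= C -> 0 <= K -> 0 <= F -> 0 <= nn -> 0 < N ->
  a <= (1 + nn * C) * F -> b <= (1 + C + 3 * nn * C) * F ->
  (C * F + N^-1 * (C * N * F)) + K * (b + a) <= (2 * C + K * (2 + C + 4 * nn * C)) * F.
Proof.
move=> C0 K0 F0 n0 N0 aF bF.
rewrite (_ : N^-1 * (C * N * F) = C * F); last by field; rewrite gt_eqF.
have h1 := ler_wpM2l K0 (lerD bF aF).
by lra.
Qed.

(** For [T = N ^ 2] the heat field [U] has size [N] and the remainder [G] has differences of order
    [1 / N]. Cutting [U] off by [chi] leaves an error [g] of the size of [f] whose differences are
    smaller by a factor [N]; that is exactly what [crude_divergence] can afford with its lost
    derivative. *)
Theorem local_discrete : exists2 C : R, 0 < C & forall N M : nat,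
  (0 < N)%N -> M.+1 = (8 * N)%N -> forall f : {ffun 'I_n -> 'I_M.+1} -> R,
  (forall x : {ffun 'I_n -> 'I_M.+1}, ~~ [forall j, (3 * N <= x j < 4 * N)%N] -> f x = 0) ->
  \sum_x f x = 0 ->
  exists W : 'I_n -> {ffun 'I_n -> 'I_M.+1} -> R, [/\
    forall x, f x = \sum_i Dm (@ev n M) i (W i) x,
    forall i, suppb N (W i),
    forall i, lrnorm q (W i) <= C * N%:R * lrnorm q f &
    forall i j, lrnorm q (Dm (@ev n M) j (W i)) <= C * lrnorm q f].
Proof.
have q0 : 0 < q by exact: lt_trans q1.
have qm : 0 < q - 1 by rewrite subr_gt0.
pose p := q / (q - 1).
have p1 : 1 < p by rewrite /p ltr_pdivlMr// mul1r gtrBl.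
have pq : p^-1 + q^-1 = 1 by rewrite /p; field; rewrite !gt_eqF.
have [C C0 hC] := @heat_divergence R n p q p1 q1 pq.
pose K : R := n%:R * (72 * 8 ^+ n).
have K0 : 0 <= K by rewrite mulr_ge0// mulr_ge0// exprn_ge0.
exists (2 * C + K * (2 + C + 4 * n%:R * C)).
  by rewrite ltr_wpDr ?mulr_gt0// mulr_ge0// !addr_ge0 ?mulr_ge0 ?(ltW C0).
move=> N M N0 MN f fs f0.
have N1 : 0 < N%:R :> R by rewrite ltr0n.
have Ni : 0 <= N%:R^-1 :> R by rewrite invr_ge0 ltW.
have T0 : (0 < N ^ 2)%N by rewrite expn_gt0 N0.
have [U [G [fE DU nU nG DG]]] := hC _ (@ev n M) (N ^ 2)%N f T0.
have sN : Num.sqrt ((N ^ 2)%N%:R : R) = N%:R by rewrite natrX sqrtr_sqr ger0_norm// ltW.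
rewrite sN in nU DG.
pose ch := @chi R n N M.
pose g x := f x - \sum_i Dm (@ev n M) i (fun y => ch y * U i y) x.
(* Since [chi = 1] on the support of [f], one has [f = chi * f]; the main parts cancel, and every
   remaining term carries either [G] or a difference of [chi]. *)
have gE x : g x = ch x * G x - \sum_i Dm (@ev n M) i ch x * U i (x - ev M i).
  have fch : f x = ch x * f x.
    have [h|h] := boolP [forall j, (3 * N <= x j < 4 * N)%N].
      by rewrite /ch (chi1 N0 h) mul1r.
    by rewrite fs// mulr0.
  rewrite /g fch {1}fE mulrDr mulr_sumr.
  rewrite [X in _ - X = _](_ : _ = \sum_i ch x * Dm (@ev n M) i (U i) x +
      \sum_i Dm (@ev n M) i ch x * U i (x - ev M i)); last first.
    by rewrite -big_split/=; apply: eq_bigr => i _; rewrite /Dm; ring.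
  by ring.
have sg : suppb N g.
  move=> x xb; have [h1 h2] := chi_outside (R := R) N0 MN xb.
  rewrite /g fs; last first.
    apply: contra xb => /forallP h; apply/forallP => j.
    exact: window_in_box (h j).
  rewrite big1 ?subr0// => i _.
  by rewrite /Dm /ch h1 h2 !mul0r subrr.
have g0 : \sum_x g x = 0.
  rewrite /g sumrB f0 sub0r exchange_big/= big1 ?oppr0// => i _.
  by rewrite /Dm sumrB (sum_shift (fun x => ch x * U i x) (- ev M i)) subrr.
have F0 := lrnorm_ge0 q f; move: DU nU nG DG; set F := lrnorm q f in F0 *; clearbody F.
move=> DU nU nG DG.
have nn : 0 <= n%:R :> R by [].
have gn : lrnorm q g <= (1 + n%:R * C) * F.
  have -> : lrnorm q g = lrnorm q (fun x => ch x * G x + \sum_i - Dm (@ev n M) i ch x * U i (x - ev M i)).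
    apply: eq_lrnorm => x; rewrite gE -sumrN; congr (_ + _).
    by apply: eq_bigr => i _; rewrite mulNr.
  apply: le_trans (lrnorm_add q1 _ _) _; rewrite mulrDl; apply: lerD.
    apply: le_trans (lrnorm_mul q1 G ler01 _) _; first by move=> x; exact: cprod_norm.
    by rewrite mul1r mul1r.
  apply: le_trans (lrnorm_sum q1 _ _ _) _.
  apply: (@le_trans _ _ (\sum_(i < n) C * F)); last by rewrite sumr_const card_ord -[(C * F) *+ n]mulr_natl mulrA.
  apply: ler_sum => i _.
  apply: le_trans (lrnorm_mul q1 (fun x => U i (x - ev M i)) Ni _) _.
    by move=> x; rewrite normrN; exact: Dm_chi_le.
  rewrite (lrnorm_shift q (U i) (- ev M i)).
  apply: le_trans (ler_wpM2l Ni (nU i)) _.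
  by rewrite -mulrA mulrCA mulKf ?gt_eqF.
have gd j : N%:R * lrnorm q (Dm (@ev n M) j g) <= (1 + C + 3 * n%:R * C) * F.
  have -> : lrnorm q (Dm (@ev n M) j g) = lrnorm q (fun x => Dm (@ev n M) j (fun y => ch y * G y) x +
      \sum_i -1 * Dm (@ev n M) j (fun y => Dm (@ev n M) i ch y * U i (y - ev M i)) x).
    apply: eq_lrnorm => x; rewrite -mulr_sumr {1}/Dm !gE.
    rewrite [X in _ = _ + -1 * X](_ : _ = \sum_i Dm (@ev n M) i ch x * U i (x - ev M i) -
      \sum_i Dm (@ev n M) i ch (x - ev M j) * U i (x - ev M j - ev M i)); last first.
      by rewrite -sumrB; apply: eq_bigr => i _; rewrite {1}/Dm.
    by rewrite [Dm _ j (fun y => ch y * G y) x]/Dm; ring.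
  have h1 : lrnorm q (Dm (@ev n M) j (fun y => ch y * G y)) <= 1 * (C / N%:R * F) + N%:R^-1 * F.
    apply: le_trans (lrnorm_Dm_mul q1 (c1 := 1) (c2 := N%:R^-1) G ler01 Ni _ _) _.
    - by move=> x; exact: cprod_norm.
    - by move=> x; exact: Dm_chi_le.
    by apply: lerD; [exact: ler_wpM2l (DG j)|exact: ler_wpM2l nG].
  have N2i : 0 <= 2 * N%:R ^- 2 :> R by rewrite mulr_ge0// invr_ge0 exprn_ge0.
  have h2 i : lrnorm q (fun x => -1 * Dm (@ev n M) j (fun y => Dm (@ev n M) i ch y * U i (y - ev M i)) x) <=
      N%:R^-1 * (C * F) + 2 * N%:R ^- 2 * (C * N%:R * F).
    rewrite (lrnormZ q1 (-1) (Dm (@ev n M) j _)) normrN1 mul1r.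
    apply: le_trans (lrnorm_Dm_mul q1 (fun y => U i (y - ev M i)) Ni N2i _ _) _.
    - by move=> x; exact: Dm_chi_le.
    - by move=> x; exact: DDm_chi_le.
    have -> : lrnorm q (Dm (@ev n M) j (fun y => U i (y - ev M i))) = lrnorm q (Dm (@ev n M) j (U i)).
      rewrite -[RHS](lrnorm_shift q _ (- ev M i)); apply: eq_lrnorm => x.
      by rewrite /Dm addrAC.
    rewrite (lrnorm_shift q (U i) (- ev M i)).
    by apply: lerD; [exact: ler_wpM2l (DU i j)|exact: ler_wpM2l (nU i)].
  have h3 := le_trans (lrnorm_sum q1 (index_enum _) xpredT _) (ler_sum _ (fun i _ => h2 i)).
  have h4 := le_trans (lrnorm_add q1 _ _) (lerD h1 h3).
  apply: le_trans (ler_wpM2l (ltW N1) h4) _.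
  rewrite sumr_const card_ord -[_ *+ n]mulr_natl le_eqVlt; apply/orP; left; apply/eqP.
  by field; rewrite gt_eqF.
have [z [zE zs zn zd]] := crude_divergence N0 MN q1 sg g0.
rewrite -/K in zn zd.
have Cp := ltW C0.
exists (fun i x => ch x * U i x + z i x); split => [x|i x xb|i|i j].
- have -> : f x = \sum_i Dm (@ev n M) i (fun y => ch y * U i y) x + g x.
    by rewrite /g addrC subrK.
  by rewrite zE -big_split/=; apply: eq_bigr => i _; rewrite /Dm; ring.
- have [h1 _] := chi_outside (R := R) N0 MN xb.
  by rewrite /ch h1 mul0r add0r zs.
- apply: le_trans (lrnorm_add q1 _ _) _.
  apply: le_trans (arith1 Cp K0 F0 nn N1 gn); apply: lerD (zn i).
  apply: le_trans (lrnorm_mul q1 (U i) ler01 _) _; first by move=> x; exact: cprod_norm.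
  by rewrite mul1r.
- have -> : lrnorm q (Dm (@ev n M) j (fun x => ch x * U i x + z i x)) =
    lrnorm q (fun x => Dm (@ev n M) j (fun y => ch y * U i y) x + Dm (@ev n M) j (z i) x).
    by apply: eq_lrnorm => x; rewrite /Dm; ring.
  apply: le_trans (lrnorm_add q1 _ _) _.
  apply: le_trans (arith2 Cp K0 F0 nn N1 gn (gd j)); apply: lerD (zd i j).
  apply: le_trans (lrnorm_Dm_mul q1 (c1 := 1) (c2 := N%:R^-1) (U i) ler01 Ni _ _) _.
  - by move=> x; exact: cprod_norm.
  - by move=> x; exact: Dm_chi_le.
  by rewrite mul1r; apply: lerD; [exact: DU|exact: ler_wpM2l (nU i)].
Qed.

End local_discrete.

(** * Smooth interpolation of discrete fields *)

Section smooth_line.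
Context {R : realType}.
Implicit Types (f g F G : R -> R) (x y : R).

(** The flat function [exp (- 1 / x)] together with the powers of [1 / x] that its derivatives
    produce: derivatives stay in the linear span of the family, see [is_derive_flat]. *)
Definition flat (k : nat) (x : R) : R := if 0 < x then x ^- k * expR (- x^-1) else 0.

Lemma flat_ge0 k x : 0 <= flat k x.
Proof.
rewrite /flat; case: ifPn => // x0.
by rewrite mulr_ge0 ?expR_ge0// invr_ge0 exprn_ge0 // ltW.
Qed.

Lemma flat_gt0 k x : 0 < x -> 0 < flat k x.
Proof. by move=> x0; rewrite /flat x0 mulr_gt0 ?expR_gt0// invr_gt0 exprn_gt0. Qed.

Lemma flat_le0 k x : x <= 0 -> flat k x = 0.
Proof. by rewrite /flat leNgt; case: ifP. Qed.

Lemma flat_le k x : flat k x <= (k.+1)`!%:R * `|x|.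
Proof.
have [x0|x0] := lerP x 0; first by rewrite flat_le0// mulr_ge0.
rewrite /flat x0 gtr0_norm// expRN.
have y0 : 0 < x^-1 by rewrite invr_gt0.
have h := expR_ge1Dxn k (ltW y0).
have h2 : x^-1 ^+ k.+1 / k.+1`!%:R <= expR x^-1 by apply: le_trans h; rewrite lerDr.
rewrite ler_pdivrMr ?expR_gt0// -exprVn.
move: h2; rewrite ler_pdivrMr ?ltr0n ?fact_gt0// exprS => h2.
have -> : x^-1 ^+ k = x * (x^-1 * x^-1 ^+ k) by rewrite mulVKf// gt_eqF.
rewrite [_%:R * x]mulrC -mulrA [_%:R * expR _]mulrC; exact: ler_wpM2l (ltW x0) _ _ h2.
Qed.

Lemma continuous_flat0 k : {for 0, continuous (flat k)}.
Proof.
apply/cvgrPdist_lt => e e0; near=> t.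
rewrite flat_le0// sub0r normrN ger0_norm ?flat_ge0//.
apply: le_lt_trans (flat_le k t) _.
rewrite mulrC -ltr_pdivlMr ?ltr0n ?fact_gt0//.
near: t; apply: (@nbhs0_lt R R); by rewrite divr_gt0// ltr0n fact_gt0.
Unshelve. all: by end_near. Qed.

Lemma is_derive_near0 f x : (\forall y \near x, f y = 0) -> is_derive x 1 f 0.
Proof.
move=> h; have h0 : is_derive x 1 (cst 0 : R -> R) 0 by exact: is_derive_cst.
by apply: near_eq_is_derive h0; near=> y; rewrite [RHS](near h).
Unshelve. all: by end_near. Qed.

Lemma is_derive_add f g x a b : is_derive x 1 f a -> is_derive x 1 g b ->
  is_derive x 1 (fun y => f y + g y) (a + b).
Proof. by move=> h1 h2; exact: (@is_deriveD R R R f g x 1 a b h1 h2). Qed.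

Lemma is_derive_scale f c x a : is_derive x 1 f a -> is_derive x 1 (fun y => c * f y) (c * a).
Proof. by move=> h1; exact: (@is_deriveZ R R R f c x 1 a h1). Qed.

Lemma is_derive_flat k x :
  is_derive x 1 (flat k) (flat k.+2 x - k%:R * flat k.+1 x).
Proof.
have [x0|x0|x0] := ltrgtP x 0.
- rewrite !flat_le0 ?(ltW x0)// mulr0 subr0.
  apply: is_derive_near0.
  by near=> y; rewrite flat_le0//; apply/ltW; near: y; exact: lt_nbhsl.
- have dV : is_derive x 1 (fun y : R => y^-1) (- x ^- 2).
    apply: is_derive_eq (is_deriveV _ (is_derive_id x 1)) _; first by rewrite gt_eqF.
    by rewrite [_ *: _]mulr1.
  have dE : is_derive x 1 (fun y : R => expR (- y^-1)) (expR (- x^-1) * (x ^- 2)).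
    have dN : is_derive x 1 (fun y : R => - y^-1) (x ^- 2).
      have h := @is_deriveN R R R (fun y : R => y^-1) x 1 _ dV.
      by apply: is_derive_eq h _; rewrite opprK.
    exact: (@is_derive1_comp R expR (fun y : R => - y^-1)).
  have dX : is_derive x 1 (fun y : R => (y^-1) ^+ k) (- k%:R * x^-1 ^+ k.+1).
    have -> : (fun y : R => (y^-1) ^+ k) = (fun y : R => y^-1) ^+ k.
      by apply/funext => y; rewrite exprfctE.
    apply: is_derive_eq (@is_deriveX R R (fun y : R => y^-1) k x 1 _ dV) _.
    rewrite /GRing.scale/= mulrN -exprVn [in RHS]mulNr; congr (- _).
    by case: k => [|k]; rewrite ?mul0r// -mulrA -exprD addn2.
  have dM := is_deriveM (f := fun y : R => y^-1 ^+ k) (g := fun y : R => expR (- y^-1))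
     (df := - k%:R * x^-1 ^+ k.+1) (dg := expR (- x^-1) * (x ^- 2)) (x := x) (v := 1).
  apply: (@near_eq_is_derive _ _ _ ((fun y : R => y^-1 ^+ k) * (fun y : R => expR (- y^-1)))).
    near=> y; have y0 : 0 < y by near: y; exact: lt_nbhsr.
    by rewrite /flat y0 -exprVn.
  apply: is_derive_eq (dM dX dE) _.
  rewrite /flat x0 -!exprVn /GRing.scale/= !exprS; ring.
- rewrite x0 !flat_le0// mulr0 subr0.
  (* At 0 Caratheodory's criterion applies: [flat k z = flat k.+1 z * z], and [flat k.+1] is
     continuous at 0 with value 0. *)
  apply/is_derive1_caratheodory; exists (flat k.+1); split.
  + move=> z; rewrite (flat_le0 k (lexx 0)) !subr0 /flat; case: ifPn => z0; last by rewrite mul0r.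
    by rewrite exprS invfM [RHS]mulrC !mulrA mulfV ?mul1r// gt_eqF.
  + exact: continuous_flat0.
  + by rewrite flat_le0.
Unshelve. all: by end_near. Qed.

(** A class closed by construction under the operations used, primitives included. Since it is also
    closed under derivatives, [smooth_line_derive], each member is infinitely differentiable by
    iteration. *)
Inductive smooth_line : (R -> R) -> Prop :=
| smooth_line_cst c : smooth_line (fun=> c)
| smooth_line_flat k : smooth_line (flat k)
| smooth_line_comp f a b : smooth_line f -> smooth_line (fun x => f (a * x + b))
| smooth_line_add f g : smooth_line f -> smooth_line g -> smooth_line (fun x => f x + g x)
| smooth_line_mul f g : smooth_line f -> smooth_line g -> smooth_line (fun x => f x * g x)
| smooth_line_prim f F : smooth_line f -> (forall x, is_derive x 1 F (f x)) -> smooth_line F.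

Lemma is_derive_affine f a b x df :
  is_derive (a * x + b) 1 f df -> is_derive x 1 (fun y => f (a * y + b)) (a * df).
Proof.
move=> h; have h1 : is_derive x 1 (fun y : R => a * y + b) a.
  have -> : (fun y : R => a * y + b) = ( *%R a) + cst b by [].
  have h2 := @is_deriveD R R R ( *%R a) (cst b) x 1 _ _ (@is_deriveZ R R R id a x 1 1 (is_derive_id x 1)) (is_derive_cst b x 1).
  by apply: is_derive_eq h2 _; rewrite addr0 [_ *: _]mulr1.
by rewrite mulrC; exact: (@is_derive1_comp R f (fun y => a * y + b)).
Qed.

Lemma smooth_line_derive f : smooth_line f ->
  exists2 g, smooth_line g & forall x, is_derive x 1 f (g x).
Proof.
elim=> {f} [c|k|f a b _ [g sg fg]|f1 f2 s1 [g1 sg1 fg1] s2 [g2 sg2 fg2]|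
  f1 f2 s1 [g1 sg1 fg1] s2 [g2 sg2 fg2]|f F sf _ FF]; last by exists f.
- by exists (fun=> 0); [exact: smooth_line_cst|move=> x; exact: is_derive_cst].
- exists (fun x => flat k.+2 x + (- k%:R) * flat k.+1 x).
    apply: smooth_line_add; first exact: smooth_line_flat.
    by apply: smooth_line_mul; [exact: smooth_line_cst|exact: smooth_line_flat].
  by move=> x; rewrite mulNr; exact: is_derive_flat.
- exists (fun x => a * g (a * x + b)).
    by apply: smooth_line_mul; [exact: smooth_line_cst|exact: smooth_line_comp].
  by move=> x; exact: is_derive_affine.
- exists (fun x => g1 x + g2 x); first exact: smooth_line_add.
  by move=> x; exact: is_deriveD.
- exists (fun x => f1 x * g2 x + f2 x * g1 x).
    by apply: smooth_line_add; exact: smooth_line_mul.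
  by move=> x; exact: is_deriveM.
Qed.

Lemma is_derive_continuous f x df : is_derive x 1 f df -> {for x, continuous f}.
Proof. by move=> [h _]; exact/differentiable_continuous/derivable1_diffP. Qed.

Lemma smooth_line_continuous f : smooth_line f -> continuous f.
Proof.
by move=> /smooth_line_derive[g _ fg] x; exact: is_derive_continuous (fg x).
Qed.

(** Starting the integral at -1, where [f] is still zero, puts 0 in the interior of the interval on
    which the fundamental theorem of calculus is applied. *)
Lemma smooth_line_primitive f : smooth_line f -> (forall x, x <= 0 -> f x = 0) ->
  exists F, [/\ smooth_line F, forall x, x <= 0 -> F x = 0 & forall x, is_derive x 1 F (f x)].
Proof.
move=> sf f0; have cf := smooth_line_continuous sf.
pose F x := (\int[@lebesgue_measure R]_(t in `[-1, x]) f t)%R.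
have F0 x : x <= 0 -> F x = 0.
  move=> x0; rewrite /F /Rintegral integral0_eq// => t /=; rewrite in_itv/= => /andP[_ tx].
  by rewrite f0// (le_trans tx).
have FF x : is_derive x 1 F (f x).
  have [x1|x1] := ltrP (-1) x.
    have int : (@lebesgue_measure R).-integrable `[-1, x + 1] (EFin \o f).
      apply: continuous_compact_integrable; first exact: segment_compact.
      exact: continuous_subspaceT.
    have [h1 h2] := @continuous_FTC1_closed R f (-1) x (x + 1) (ltr_pwDr ltr01 (lexx x)) int x1 (cf x).
    by rewrite -h2 derive1E; exact: derivableP h1.
  rewrite f0; last by lra.
  apply: is_derive_near0.
  near=> y; rewrite F0//; apply: ltW; near: y; apply: lt_nbhsl; lra.
exists F; split => //; exact: smooth_line_prim sf FF.
Unshelve. all: by end_near. Qed.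

Lemma derive_diff f df x y : (forall x, is_derive x 1 f (df x)) -> x <= y ->
  exists2 c, x <= c <= y & f y - f x = df c * (y - x).
Proof.
move=> h xy; have [c] := @MVT_segment R f df x y xy (fun z _ => h z)
  (continuous_subspaceT (fun z => is_derive_continuous (h z))).
by rewrite in_itv/=; exists c.
Qed.

Lemma is_derive_cont_bounded f g : smooth_line f ->
  (forall x, x <= 0 \/ 3 <= x -> f x = 0) -> exists B, forall x, `|f x| <= B.
Proof.
move=> sf f0; have cf : {within `[(0:R), 3], continuous (fun x => `|f x|)}.
  apply: continuous_subspaceT => x.
  exact: (continuous_comp (@smooth_line_continuous f sf x) (@norm_continuous _ _ _)).
have [c _ hc] := EVT_max (ler0n R 3) cf.
exists `|f c| => x.
have [x0|x0] := lerP x 0; first by rewrite f0 ?normr0//; left.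
have [x3|x3] := lerP 3 x; first by rewrite (f0 x) ?normr0//; right.
by apply: hc; rewrite in_itv/= (ltW x0) (ltW x3).
Qed.

(* [s] is a smooth step; [r2] is the second difference of a primitive of [s], so
   that [r2' = r1 - r1(. - 1)]. *)
Lemma blur_functions : exists r1 r2 s' : R -> R, exists B : R,
  [/\ [/\ smooth_line r1, smooth_line r2, smooth_line s' & 1 <= B],
      [/\ forall x, 0 <= r1 x <= 1, forall x, x <= 0 \/ 2 <= x -> r1 x = 0,
         forall x, x <= 0 \/ 3 <= x -> r2 x = 0, forall x, x <= 0 \/ 3 <= x -> s' x = 0 & r1 1 = 1],
      [/\ forall x, `|r1 x| <= B, forall x, `|r2 x| <= B & forall x, `|s' x| <= B],
      forall x, is_derive x 1 r1 (s' x - s' (x - 1)) &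
      forall x, is_derive x 1 r2 (r1 x - r1 (x - 1))].
Proof.
pose b x := flat 0 x * flat 0 (-1 * x + 1).
have sb : smooth_line b.
  by apply: smooth_line_mul; [|apply: (smooth_line_comp (-1) 1)]; exact: smooth_line_flat.
have b0 x : x <= 0 -> b x = 0 by move=> x0; rewrite /b flat_le0// mul0r.
have b1 x : 1 <= x -> b x = 0.
  by move=> x0; rewrite /b [X in _ * X]flat_le0 ?mulr0//; lra.
have bp x : 0 <= b x by rewrite mulr_ge0// flat_ge0.
have [s0 [ss0 s00 s0d]] := smooth_line_primitive sb b0.
have s0mono x y : x <= y -> s0 x <= s0 y.
  move=> xy; have [c _] := derive_diff s0d xy.
  by move/eqP; rewrite subr_eq => /eqP ->; rewrite lerDr mulr_ge0// subr_ge0.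
have s1p : 0 < s0 1.
  rewrite lt_neqAle (_ : 0 <= s0 1) ?andbT; last first.
    by rewrite -(s00 0 (lexx 0)) s0mono// ler01.
  apply/eqP => s10.
  have [c hc] := @MVT R s0 b 0 1 ltr01 (fun z _ => s0d z)
    (continuous_subspaceT (fun z => is_derive_continuous (s0d z))).
  rewrite -s10 s00// subr0 subr0 mulr1 /b => /esym/eqP; apply/negP.
  move: hc; rewrite in_itv/= => /andP[c0 c1].
  by rewrite mulf_neq0// gt_eqF// flat_gt0//; lra.
pose s x := (s0 1)^-1 * s0 x.
have s1i : 0 <= (s0 1)^-1 by rewrite invr_ge0 ltW.
pose s' x := (s0 1)^-1 * b x.
have sd x : is_derive x 1 s (s' x) by exact: (@is_deriveZ R R R s0 (s0 1)^-1 x 1 (b x)).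
have sms : smooth_line s by apply: smooth_line_mul => //; exact: smooth_line_cst.
have sms' : smooth_line s' by apply: smooth_line_mul => //; exact: smooth_line_cst.
have s_0 x : x <= 0 -> s x = 0 by move=> x0; rewrite /s (s00 x)// mulr0.
have s_1 x : 1 <= x -> s x = 1.
  move=> x1; rewrite /s; suff -> : s0 x = s0 1 by rewrite mulVf// gt_eqF.
  have [c /andP[hc _]] := derive_diff s0d x1.
  by rewrite b1// mul0r => /eqP; rewrite subr_eq0 => /eqP.
have smono x y : x <= y -> s x <= s y by move=> xy; apply: ler_wpM2l => //; exact: s0mono.
have s01 x : 0 <= s x <= 1.
  rewrite mulr_ge0//=; last first.
    have [x0|x0] := lerP x 0; first by rewrite s00.
    by rewrite -(s00 0 (lexx 0)); apply: s0mono; exact: ltW.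
  have [x1|/ltW x1] := lerP 1 x; first by rewrite s_1.
  by rewrite -(s_1 1 (lexx 1)); exact: smono.
have [S [sS S0 Sd]] := smooth_line_primitive sms s_0.
pose r1 x := s x + -1 * s (1 * x + -1).
pose r2 x := (S x + (-2) * S (1 * x + -1)) + S (1 * x + -2).
have shiftE x c : 1 * x + c = x + c by rewrite mul1r.
have sm1 : smooth_line r1.
  apply: smooth_line_add => //; apply: smooth_line_mul; first exact: smooth_line_cst.
  exact: (smooth_line_comp 1 (-1) sms).
have sm2 : smooth_line r2.
  apply: smooth_line_add; last exact: (smooth_line_comp 1 (-2) sS).
  apply: smooth_line_add => //; apply: smooth_line_mul; first exact: smooth_line_cst.
  exact: (smooth_line_comp 1 (-1) sS).
have r1b x : 0 <= r1 x <= 1.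
  rewrite /r1 mulN1r shiftE subr_ge0 smono ?lerBlDr/=; last by lra.
  by have /andP[_ h] := s01 x; have /andP[h2 _] := s01 (x - 1); lra.
have r10 x : x <= 0 \/ 2 <= x -> r1 x = 0.
  by rewrite /r1 shiftE => -[h|h]; [rewrite !s_0|rewrite !s_1]; lra.
have r1d x : is_derive x 1 r1 (s' x - s' (x - 1)).
  have -> : s' x - s' (x - 1) = s' x + -1 * (1 * s' (1 * x + -1)) by rewrite mul1r mulN1r mul1r.
  exact: is_derive_add (sd x) (is_derive_scale (-1) (is_derive_affine (sd (1 * x + -1)))).
have r2d x : is_derive x 1 r2 (r1 x - r1 (x - 1)).
  have -> : r1 x - r1 (x - 1) = (s x + -2 * (1 * s (1 * x + -1))) + 1 * s (1 * x + -2).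
    have e : 1 * x + -2 = 1 * (x - 1) + -1 by ring.
    by rewrite e /r1 !mul1r; ring.
  exact: is_derive_add (is_derive_add (Sd x) (is_derive_scale (-2) (is_derive_affine (Sd (1 * x + -1)))))
    (is_derive_affine (Sd (1 * x + -2))).
have r20 x : x <= 0 \/ 3 <= x -> r2 x = 0.
  move=> [h|h]; first by rewrite /r2 !S0; lra.
  have S1 y : 1 <= y -> S y = S 1 + (y - 1).
    move=> y1; have [c /andP[c1 _]] := derive_diff Sd y1.
    by rewrite s_1// mul1r => <-; rewrite addrC subrK.
  by rewrite /r2 (S1 x) ?(S1 (1 * x + -1)) ?(S1 (1 * x + -2)); lra.
have s'0 x : x <= 0 \/ 3 <= x -> s' x = 0.
  by rewrite /s' => -[h|h]; [rewrite b0|rewrite b1]; rewrite ?mulr0//; lra.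
have [B2 hB2] := @is_derive_cont_bounded r2 r2 sm2 r20.
have [B3 hB3] := @is_derive_cont_bounded s' s' sms' s'0.
have B2p := le_trans (normr_ge0 _) (hB2 0); have B3p := le_trans (normr_ge0 _) (hB3 0).
exists r1, r2, s', (1 + B2 + B3); split => //.
- by split => //; lra.
- split => //; rewrite /r1 shiftE subrr (s_0 0)// s_1//; lra.
- split=> x; [|by have := hB2 x; lra|by have := hB3 x; lra].
  by have /andP[h1 h2] := r1b x; rewrite ger0_norm//; lra.
Qed.

End smooth_line.

(** * Tensor splines and discrete fields *)

Section smooth_space.
Context {R : realType} {n : nat}.
Implicit Types (f g : 'rV[R]_n -> R).

Lemma is_derive_line f (v x : 'rV[R]_n) df :
  is_derive (0 : R) 1 (fun t : R => f (t *: v + x)) df -> is_derive x v (f : 'rV[R]_n -> R^o) df.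
Proof.
move=> [h1 h2].
have e : (fun h : R => h^-1 *: (((f : 'rV[R]_n -> R^o) \o shift x) (h *: v) - f x)) =
  (fun h : R => h^-1 *: (((fun t : R => f (t *: v + x)) \o shift 0) (h *: 1) - f (0 *: v + x))).
  by apply/funext => h /=; rewrite addr0 scale0r add0r [h *: 1]mulr1.
by apply: DeriveDef; rewrite /derivable /derive e.
Qed.

Inductive smooth_gen : ('rV[R]_n -> R) -> Prop :=
| smooth_gen_line (f : R -> R) a j b : smooth_line f -> smooth_gen (fun x => f (a * x ord0 j + b))
| smooth_gen_cst c : smooth_gen (fun=> c)
| smooth_gen_add f g : smooth_gen f -> smooth_gen g -> smooth_gen (fun x => f x + g x)
| smooth_gen_mul f g : smooth_gen f -> smooth_gen g -> smooth_gen (fun x => f x * g x).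

Lemma smooth_gen_sum I (s : seq I) (F : I -> 'rV[R]_n -> R) :
  (forall i, smooth_gen (F i)) -> smooth_gen (fun x => \sum_(i <- s) F i x).
Proof.
move=> h; elim: s => [|i s IH].
  have -> : (fun x => \sum_(i <- [::]) F i x) = (fun=> 0) by apply/funext => x; rewrite big_nil.
  exact: smooth_gen_cst.
have -> : (fun x => \sum_(j <- i :: s) F j x) = (fun x => F i x + \sum_(j <- s) F j x).
  by apply/funext => x; rewrite big_cons.
exact: smooth_gen_add.
Qed.

Lemma smooth_gen_prod I (s : seq I) (F : I -> 'rV[R]_n -> R) :
  (forall i, smooth_gen (F i)) -> smooth_gen (fun x => \prod_(i <- s) F i x).
Proof.
move=> h; elim: s => [|i s IH].
  have -> : (fun x => \prod_(i <- [::]) F i x) = (fun=> 1) by apply/funext => x; rewrite big_nil.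
  exact: smooth_gen_cst.
have -> : (fun x => \prod_(j <- i :: s) F j x) = (fun x => F i x * \prod_(j <- s) F j x).
  by apply/funext => x; rewrite big_cons.
exact: smooth_gen_mul.
Qed.

Lemma smooth_gen_derive f (i : 'I_n) : smooth_gen f ->
  exists2 g, smooth_gen g &
    forall x, is_derive (0 : R) 1 (fun t : R => f (t *: delta_mx ord0 i + x)) (g x).
Proof.
elim=> {f} [f a j b /smooth_line_derive[g sg fg]|c|f1 f2 s1 [g1 sg1 fg1] s2 [g2 sg2 fg2]|
  f1 f2 s1 [g1 sg1 fg1] s2 [g2 sg2 fg2]].
- exists (fun x => (a * (i == j)%:R) * g (a * x ord0 j + b)).
    by apply: smooth_gen_mul; [exact: smooth_gen_cst|exact: smooth_gen_line].
  move=> x.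
  have -> : (fun t : R => f (a * (t *: delta_mx ord0 i + x) ord0 j + b)) =
      (fun t => f ((a * (i == j)%:R) * t + (a * x ord0 j + b))).
    apply/funext => t; rewrite !mxE eqxx/= eq_sym; congr (f _).
    rewrite mulrDr addrA; congr (_ + _ + _); by rewrite -mulrA [t * _]mulrC.
  by apply: is_derive_affine; rewrite mulr0 add0r; exact: fg.
- by exists (fun=> 0); [exact: smooth_gen_cst|move=> x; exact: is_derive_cst].
- exists (fun x => g1 x + g2 x); first exact: smooth_gen_add.
  by move=> x; exact: is_derive_add.
- exists (fun x => f1 x * g2 x + f2 x * g1 x).
    by apply: smooth_gen_add; exact: smooth_gen_mul.
  move=> x; have h := @is_deriveM R R (fun t : R => f1 (t *: delta_mx ord0 i + x))
    (fun t : R => f2 (t *: delta_mx ord0 i + x)) 0 1 _ _ (fg1 x) (fg2 x).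
  by apply: is_derive_eq h _; rewrite scale0r add0r.
Qed.

Lemma smooth_gen_partial f i : smooth_gen f -> smooth_gen (partial i f).
Proof.
move=> /(@smooth_gen_derive f i)[g sg fg].
suff -> : partial i f = g by [].
by apply/funext => x; have [_ <-] := is_derive_line (fg x).
Qed.

Lemma smooth_gen_differentiable f x : smooth_gen f -> differentiable (f : 'rV[R]_n -> R^o) x.
Proof.
move=> sf; elim: sf x => {f} [f a j b /smooth_line_derive[g sg fg]|c|f1 f2 _ h1 _ h2|f1 f2 _ h1 _ h2] x.
- have h : forall y, differentiable (fun t : R => f (a * t + b)) y.
    move=> y; apply/derivable1_diffP.
    by have [] := is_derive_affine (a := a) (fg (a * y + b)).
  exact: (@differentiable_comp R _ _ _ (fun y : 'rV[R]_n => y ord0 j : R) (fun t : R => f (a * t + b))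
     x (differentiable_coord x ord0 j) (h (x ord0 j))).
- exact: differentiable_cst.
- exact: differentiableD.
- exact: differentiableM.
Qed.

Lemma smooth_gen_smooth f : smooth_gen f -> smooth f.
Proof.
move=> sf s x; apply: smooth_gen_differentiable.
by elim: s => //= i s; exact: smooth_gen_partial.
Qed.

Lemma is_derive_bigsum I (s : seq I) (F : I -> R -> R) (dF : I -> R) (x : R) :
  (forall i, is_derive x 1 (F i) (dF i)) ->
  is_derive x 1 (fun t => \sum_(i <- s) F i t) (\sum_(i <- s) dF i).
Proof.
move=> h; elim: s => [|i s IH].
  rewrite big_nil (_ : (fun t => _) = (fun=> 0)); last by apply/funext => t; rewrite big_nil.
  exact: is_derive_cst.
rewrite big_cons (_ : (fun t => _) = (fun t => F i t + \sum_(j <- s) F j t)).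
  exact: is_derive_add.
by apply/funext => t; rewrite big_cons.
Qed.

Lemma partial_sum_prod (I : finType) (fac dfac : 'I_n -> R -> R) (c : I -> R) (a : R)
    (b : I -> 'I_n -> R) (j : 'I_n) x :
  (forall t : R, is_derive t 1 (fac j) (dfac j t)) ->
  partial j (fun x : 'rV[R]_n => \sum_v c v * \prod_l fac l (a * x ord0 l + b v l)) x =
  \sum_v c v * (a * dfac j (a * x ord0 j + b v j)) * \prod_(l | l != j) fac l (a * x ord0 l + b v l).
Proof.
move=> hf; set F := fun x => _.
suff h : is_derive (0 : R) 1 (fun t : R => F (t *: delta_mx ord0 j + x))
  (\sum_v (c v * \prod_(l | l != j) fac l (a * x ord0 l + b v l)) * (a * dfac j (a * x ord0 j + b v j))).
  have [_ e] := is_derive_line h; rewrite /partial e.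
  by apply: eq_bigr => v _; rewrite mulrAC.
have -> : (fun t : R => F (t *: delta_mx ord0 j + x)) = (fun t => \sum_v
   (c v * \prod_(l | l != j) fac l (a * x ord0 l + b v l)) * fac j (a * t + (a * x ord0 j + b v j))).
  apply/funext => t; apply: eq_bigr => v _.
  rewrite (bigD1 j)//= [X in _ * X]mulrC mulrA; congr (_ * _ * _).
    by apply: eq_bigr => l lj; rewrite !mxE eqxx (negPf lj)/= mulr0 add0r.
  by rewrite !mxE !eqxx mulr1 mulrDr addrA.
apply: is_derive_bigsum => v; apply: is_derive_scale.
by apply: is_derive_affine; rewrite mulr0 add0r.
Qed.

End smooth_space.

Section counting.
Context {R : realType} {n : nat}.

(** The counts below reduce to this box: cells near a point, lattice points in a ball, cubes of one
    level near a point. *)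
Lemma size_box_le (s : seq {ffun 'I_n -> int}) (X : 'I_n -> R) (r : nat) : uniq s ->
  (forall z, z \in s -> forall l, X l - r%:R <= (z l)%:~R <= X l) -> (size s <= r.+1 ^ n)%N.
Proof.
move=> us hs.
pose f (z : {ffun 'I_n -> int}) : {ffun 'I_n -> 'I_r.+1} := [ffun l => inord (absz (Num.floor (X l) - z l))].
have bd z l : z \in s -> (0 <= Num.floor (X l) - z l <= r%:Z)%R.
  move=> /hs/(_ l)/andP[h1 h2].
  have h3 : (z l <= Num.floor (X l))%R by rewrite floor_ge_int.
  have h4 : (Num.floor (X l) - r%:Z <= z l)%R.
    rewrite -(ler_int R) rmorphB/=; apply: le_trans h1.
    by rewrite lerB// floor_le.
  by apply/andP; split; lia.
have inj : {in s &, injective f}.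
  have key (a b c : int) : (0 <= a - b <= r%:Z)%R -> (0 <= a - c <= r%:Z)%R ->
      (inord (absz (a - b)) : 'I_r.+1) = inord (absz (a - c)) -> b = c.
    move=> /andP[a1 a2] /andP[b1 b2] e.
    have h1 : (`|(a - b)%R| < r.+1)%N by lia.
    have h2 : (`|(a - c)%R| < r.+1)%N by lia.
    by have := congr1 (@nat_of_ord _) e; rewrite (inordK h1) (inordK h2); lia.
  move=> z z' zs z's /ffunP e; apply/ffunP => l.
  by have := e l; rewrite !ffunE => el; exact: (key _ _ _ (bd z l zs) (bd z' l z's) el).
have u : uniq (map f s) by rewrite map_inj_in_uniq.
rewrite -(size_map f) -(card_uniqP u).
by apply: leq_trans (max_card _) _; rewrite card_ffun !card_ord.
Qed.

Lemma count_near_le M (X : 'I_n -> R) (r : nat) (P : pred {ffun 'I_n -> 'I_M.+1}) :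
  (forall v, P v -> forall l, 0 <= X l - (v l)%:R <= r%:R) ->
  (count P (index_enum {ffun 'I_n -> 'I_M.+1}) <= r.+1 ^ n)%N.
Proof.
move=> hP; pose g (v : {ffun 'I_n -> 'I_M.+1}) : {ffun 'I_n -> int} := [ffun l => (v l : nat)%:Z].
have ginj : injective g.
  move=> v v' /ffunP e; apply/ffunP => l; have := e l; rewrite !ffunE => -[h].
  exact: ord_inj.
rewrite -size_filter -(size_map g).
apply: (@size_box_le _ X).
  by rewrite (map_inj_uniq ginj) filter_uniq// index_enum_uniq.
move=> z /mapP[v]; rewrite mem_filter => /andP[Pv _] -> l; rewrite ffunE.
by have := hP v Pv l; rewrite -pmulrn; lra.
Qed.

End counting.

Lemma near_support_arith {R : realFieldType} (z o v a b : R) : 0 < z + (- o - v) -> z + (- o - v) < 3 ->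
  a <= v -> v <= b -> (a <= z - o) && (z - o <= b + 3).
Proof. by move=> *; apply/andP; split; lra. Qed.

Section local_smooth.
Context {R : realType} {n : nat}.

(** The position of [x] in units of [h], measured from the corner of cell [v] in a grid with origin
    [o]. Spline factors live on [[0, 3]], which explains [near_cell]. *)
Definition pos_cell (M : nat) (h : R) (o : 'I_n -> R) (x : 'rV[R]_n) (v : {ffun 'I_n -> 'I_M.+1}) l : R :=
  h^-1 * x ord0 l + (- o l - (v l)%:R).

Definition near_cell M h o x v : bool := [forall l, 0 <= @pos_cell M h o x v l <= 3].

Lemma pred_wrap (N M a b : nat) : (0 < N)%N -> M.+1 = (8 * N)%N -> (a <= 6 * N)%N ->
  a = (if b == 0%N then M else b.-1) -> b = a.+1.
Proof. by move=> N0 MN a6; have [->|] := eqVneq b 0%N; lia. Qed.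

Lemma summand_scale (h w a b c : R) : 0 < h -> h * w * (h^-1 * (a - b)) * c = w * (a * c - b * c).
Proof. by move=> h0; field; rewrite gt_eqF. Qed.

Lemma box_weaken (N a : nat) : (N <= a <= 6 * N)%N -> (N <= a <= 6 * N + 1)%N.
Proof. lia. Qed.

Lemma box_pred (N M b : nat) : (0 < N)%N -> M.+1 = (8 * N)%N ->
  (N <= (if b == 0%N then M else b.-1) <= 6 * N)%N -> (N <= b <= 6 * N + 1)%N.
Proof. by have [->|] := eqVneq b 0%N; lia. Qed.

Lemma sumr_const_ord m (c : R) : \sum_(i < m) c = m%:R * c.
Proof. by rewrite sumr_const card_ord mulr_natl. Qed.

Lemma combine_bounds (K a b x y F : R) : 0 <= F -> 0 <= K -> x <= a * F -> y <= b * F ->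
  K * (x + y) <= (K * (a + b) + 1) * F.
Proof.
move=> F0 K0 hx hy; rewrite mulrDl mul1r -mulrA; apply: ler_wpDr => //; apply: ler_wpM2l => //.
by rewrite mulrDl; exact: lerD.
Qed.

Lemma powR_normM (h w q : R) : 0 < h -> `|h * w| `^ q = h `^ q * `|w| `^ q.
Proof. by move=> h0; rewrite normrM (gtr0_norm h0) powRM// ltW. Qed.

Lemma cancel_scale (a c f m : R) : 0 < a -> a^-1 * (m * (c * a * f)) = m * c * f.
Proof. by move=> a0; field; rewrite gt_eqF. Qed.

Lemma prod_norm_le (P : pred 'I_n) (F : 'I_n -> R) B : 1 <= B -> (forall l, `|F l| <= B) ->
  `|\prod_(l | P l) F l| <= B ^+ n.
Proof.
move=> B1 hF; have B0 : 0 <= B by apply: le_trans B1.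
rewrite normr_prod; apply: (@le_trans _ _ (\prod_(l | P l) B)).
  by apply: ler_prod => l _; rewrite normr_ge0 hF.
rewrite prodr_const; apply: ler_weXn2l => //.
by rewrite -[X in (_ <= X)%N]card_ord max_card.
Qed.

Lemma near_sum_powR M h o x (g : {ffun 'I_n -> 'I_M.+1} -> R) (T : {ffun 'I_n -> 'I_M.+1} -> R) (q B : R) :
  1 < q -> 0 <= B -> (forall v, `|T v| <= B) -> (forall v, ~~ near_cell h o x v -> T v = 0) ->
  `|\sum_v g v * T v| `^ q <=
  (4 ^ n)%:R `^ (q - 1) * B `^ q * \sum_(v | near_cell h o x v) `|g v| `^ q.
Proof.
move=> q1 B0 TB T0; have q0 : 0 <= q by lra.
have h1 : `|\sum_v g v * T v| <= \sum_(v | near_cell h o x v) B * `|g v|.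
  apply: le_trans (ler_norm_sum _ _ _) _.
  rewrite (bigID (fun v => near_cell h o x v))/= [X in _ + X]big1 ?addr0; last first.
    by move=> v hv; rewrite T0// mulr0 normr0.
  by apply: ler_sum => v _; rewrite normrM mulrC ler_wpM2r.
apply: le_trans (ge0_ler_powR q0 _ _ h1) _; rewrite ?nnegrE ?normr_ge0//.
  by apply: sumr_ge0 => v _; rewrite mulr_ge0.
apply: le_trans (powR_sum_le _ q1 _) _; first by move=> v _; rewrite mulr_ge0.
rewrite -mulrA; apply: ler_pM; rewrite ?powR_ge0//.
- by apply: sumr_ge0 => v _; rewrite powR_ge0.
- apply: ge0_ler_powR; rewrite ?nnegrE ?ler0n ?subr_ge0 ?(ltW q1)// ler_nat.
  apply: (count_near_le (R := R) (X := fun l => h^-1 * x ord0 l - o l)) => v /forallP hv l.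
  by have := hv l; rewrite /pos_cell; lra.
- rewrite mulr_sumr; apply: ler_sum => v _.
  by rewrite powRM.
Qed.

(** Each [u i] is a tensor spline, with factor [r2] in direction [i] and [r1] in the others. The
    derivative of a spline factor is a unit difference of a lower one, and summation by parts moves
    this difference onto [W], so the derivatives of [u] inherit the discrete bounds. In
    [partial i (u i)] the factor [r2] becomes [r1]; the divergence is therefore a spline of [f] with
    the same profile in all directions. [A] is an energy per cell that dominates [u] and its
    derivatives pointwise. *)
Theorem local_smooth (q : R) : 1 < q -> exists (rho : R -> R) (C : R),
  [/\ 0 < C, continuous rho, forall x, 0 <= rho x <= 1, forall x, x <= 0 \/ 2 <= x -> rho x = 0 & rho 1 = 1] /\
  forall (N M : nat) (h : R) (o : 'I_n -> R) (f : {ffun 'I_n -> 'I_M.+1} -> R),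
  (0 < N)%N -> M.+1 = (8 * N)%N -> 0 < h ->
  (forall x : {ffun 'I_n -> 'I_M.+1}, ~~ [forall j, (3 * N <= x j < 4 * N)%N] -> f x = 0) ->
  \sum_x f x = 0 ->
  exists (u : 'I_n -> 'rV[R]_n -> R) (A : {ffun 'I_n -> 'I_M.+1} -> R),
  [/\ forall i, smooth (u i),
      forall i x, u i x != 0 -> forall l, N%:R <= h^-1 * x ord0 l - o l <= (6 * N + 3)%:R,
      forall x, \sum_i partial i (u i) x = \sum_v f v * \prod_l rho (pos_cell h o x v l),
      [/\ forall v, 0 <= A v, forall v, A v != 0 -> forall l, (N <= v l <= 6 * N + 1)%N
        & \sum_v A v <= C * lrpow q f] &
      forall x i, (`|u i x| `^ q <= (h * N%:R) `^ q * \sum_(v | near_cell h o x v) A v) /\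
        forall j, `|partial j (u i) x| `^ q <= \sum_(v | near_cell h o x v) A v].
Proof.
move=> q1; have q0 : 0 < q by lra.
have [r1 [r2 [s' [B [[sr1 sr2 ss' B1] [r101 r10 r20 s'0 r11] [b1 b2 b3] d1 d2]]]]] := @blur_functions R.
have [C0 C0p hLD] := local_discrete n q1.
have B0 : 0 <= B by lra.
have Bn : 0 <= B ^+ n by exact: exprn_ge0.
pose K0 := (4 ^ n)%:R `^ (q - 1) * (B ^+ n) `^ q : R.
pose K := K0 + (4 ^ n)%:R `^ (q - 1) * (B ^+ n * B) `^ q.
have K0p : 0 <= K0 by rewrite mulr_ge0 ?powR_ge0.
have K1p : 0 <= (4 ^ n)%:R `^ (q - 1) * (B ^+ n * B) `^ q by rewrite mulr_ge0 ?powR_ge0.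
have Kp : 0 <= K by exact: addr_ge0.
pose C1 := C0 `^ q.
have C1p : 0 <= C1 by exact: powR_ge0.
exists r1, (K * (n%:R * C1 + n%:R * n%:R * C1) + 1); split.
  split => //; last exact: smooth_line_continuous.
  by rewrite ltr_wpDl// mulr_ge0// addr_ge0// !mulr_ge0.
move=> N M h o f N0 MN h0 f0 sf.
have [W [fE Ws Wn Wd]] := hLD N M N0 MN f f0 sf.
have N0r : 0 < N%:R :> R by rewrite ltr0n.
pose fac (i l : 'I_n) := if l == i then r2 else r1 : R -> R.
pose phi (i l : 'I_n) := if l == i then r1 else s' : R -> R.
pose b (v : {ffun 'I_n -> 'I_M.+1}) l := - o l - (v l)%:R.
(* The factor [h] compensates the [h^-1] that each derivative brings, so that [partial j (u i)]
   carries no power of the mesh. *)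
pose u i (x : 'rV[R]_n) := \sum_v (h * W i v) * \prod_l fac i l (h^-1 * x ord0 l + b v l).
have facd i l (t : R) : is_derive t 1 (fac i l) (phi i l t - phi i l (t - 1)).
  by rewrite /fac /phi; case: eqP.
have facB i l t : `|fac i l t| <= B by rewrite /fac; case: eqP.
have phiB i l t : `|phi i l t| <= B by rewrite /phi; case: eqP.
have r13 t : t <= 0 \/ 3 <= t -> r1 t = 0 by move=> H; apply: r10; lra.
have fac0 i l t : t <= 0 \/ 3 <= t -> fac i l t = 0 by rewrite /fac; case: eqP => _; auto.
have phi0 i l t : t <= 0 \/ 3 <= t -> phi i l t = 0 by rewrite /phi; case: eqP => _; auto.
have dE i j x : partial j (u i) x = \sum_v Dm (@ev n M) j (W i) v *
    (phi i j (pos_cell h o x v j) * \prod_(l | l != j) fac i l (pos_cell h o x v l)).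
  rewrite /u (@partial_sum_prod R n {ffun 'I_n -> 'I_M.+1} (fac i) (fun l t => phi i l t - phi i l (t - 1))
    (fun v => h * W i v) h^-1 b j x (facd i j)).
  pose T (v : {ffun 'I_n -> 'I_M.+1}) := phi i j (pos_cell h o x v j) * \prod_(l | l != j) fac i l (pos_cell h o x v l).
  transitivity (\sum_v W i v * (T v - T (v + ev M j))).
    apply: eq_bigr => v _.
    have [ib|nib] := boolP (inbox N v); last by rewrite (Ws i v nib) mulr0 !mul0r.
    (* Inside the box a step in direction [j] does not wrap around the torus, so it is a genuine
       translation of the cell in space. Outside the box [W i] vanishes. *)
    have vj : ((v + ev M j) j = (v j).+1 :> nat).
      have e := sub_ev (v + ev M j) j j; rewrite addrK eqxx in e.
      have := congr1 (@nat_of_ord _) e; rewrite (sub_one N0 MN).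
      have /forallP/(_ j)/andP[v1 v2] := ib.
      exact: pred_wrap N0 MN v2.
    have vl l : l != j -> (v + ev M j) l = v l.
      by move=> lj; have := sub_ev (v + ev M j) j l; rewrite addrK (negPf lj) => ->.
    have e1 : pos_cell h o x (v + ev M j) j = pos_cell h o x v j - 1.
      by rewrite /pos_cell vj -natr1; ring.
    rewrite /T e1 [X in _ - _ * X](_ : _ = \prod_(l | l != j) fac i l (pos_cell h o x v l)); last first.
      by apply: eq_bigr => l lj; rewrite /pos_cell vl.
    exact: summand_scale.
  under eq_bigr do rewrite mulrBr.
  rewrite sumrB; have -> : \sum_v W i v * T (v + ev M j) = \sum_v W i (v - ev M j) * T v.
    rewrite -(sum_shift (fun v => W i (v - ev M j) * T v) (ev M j)).
    by apply: eq_bigr => v _; rewrite addrK.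
  by rewrite -sumrB; apply: eq_bigr => v _; rewrite /Dm mulrBl.
(* The factor [N ^ (- q)] puts [W], whose bound is [N] times that of its differences, on the same
   footing as them. *)
pose A v := K * (N%:R `^ (- q) * \sum_i `|W i v| `^ q + \sum_i \sum_j `|Dm (@ev n M) j (W i) v| `^ q).
have notnear x v : ~~ near_cell h o x v -> exists l, pos_cell h o x v l <= 0 \/ 3 <= pos_cell h o x v l.
  rewrite /near_cell negb_forall => /existsP[l]; rewrite negb_and -!ltNge => /orP H.
  by exists l; lra.
have S1 v : 0 <= \sum_i `|W i v| `^ q by apply: sumr_ge0 => i _; exact: powR_ge0.
have S2 v : 0 <= \sum_i \sum_j `|Dm (@ev n M) j (W i) v| `^ q.
  by apply: sumr_ge0 => i _; apply: sumr_ge0 => j _; exact: powR_ge0.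
exists u, A; split.
- move=> i; apply: smooth_gen_smooth; apply: smooth_gen_sum => v.
  apply: smooth_gen_mul; first exact: smooth_gen_cst.
  by apply: smooth_gen_prod => l; apply: smooth_gen_line; rewrite /fac; case: eqP.
- move=> i x ux l.
  have /existsP[v /andP[Wv Pv]] : [exists v, (W i v != 0) && (\prod_l fac i l (pos_cell h o x v l) != 0)].
    apply: contra_neqT ux; rewrite negb_exists => /forallP H.
    apply: big1 => v _; apply/eqP; move: (H v).
    by rewrite negb_and !negbK => /orP[/eqP ->|/eqP P0]; rewrite ?mulr0 ?mul0r// mulf_eq0 P0 eqxx orbT.
  have ib : inbox N v by apply: contraNT Wv => /(Ws i v) ->.
  have /forallP/(_ l)/andP[v1 v2] := ib.
  have : fac i l (pos_cell h o x v l) != 0 by move/prodf_neq0: Pv; exact.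
  have [c1|c1] := lerP (pos_cell h o x v l) 0; first by rewrite fac0 ?eqxx//; left.
  have [c2|c2] := lerP 3 (pos_cell h o x v l); first by rewrite (fac0 i l) ?eqxx//; right.
  move=> _; move: c1 c2; rewrite /pos_cell => c1 c2.
  have v1r : N%:R <= (v l)%:R :> R by rewrite ler_nat.
  have v2r : (v l)%:R <= (6 * N)%:R :> R by rewrite ler_nat.
  by rewrite natrD; exact: near_support_arith c1 c2 v1r v2r.
- move=> x; under eq_bigr do rewrite dE.
  rewrite exchange_big/=; apply: eq_bigr => v _; rewrite fE mulr_suml; apply: eq_bigr => i _.
  congr (_ * _); rewrite [in RHS](bigD1 i)//= /phi eqxx; congr (_ * _).
  by apply: eq_bigr => l /negPf li; rewrite /fac li.
- split => [v|v|].
  + by rewrite mulr_ge0// addr_ge0// mulr_ge0// powR_ge0.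
  + move=> Av l; apply: contraT => hl; case/negP: Av; apply/eqP.
    have W0 i : W i v = 0.
      by apply: Ws; apply/negP => /forallP/(_ l) H; move/negP: hl; apply; exact: box_weaken.
    have D0 i j : Dm (@ev n M) j (W i) v = 0.
      rewrite /Dm W0 Ws ?subrr//; apply/negP => /forallP/(_ l) H; move/negP: hl; apply.
      move: H; rewrite sub_ev; case: eqP => [->|_] H; last exact: box_weaken.
      by apply: (box_pred N0 MN); rewrite -(sub_one N0 MN).
    rewrite /A big1 => [|i _]; last by rewrite W0 normr0 powR0// gt_eqF.
    rewrite big1 ?mulr0 ?addr0 ?mulr0// => i _; apply: big1 => j _.
    by rewrite D0 normr0 powR0// gt_eqF.
  + rewrite /A -mulr_sumr big_split/= -mulr_sumr exchange_big/=.
    have F0 : 0 <= lrpow q f by exact: lrpow_ge0.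
    have qn : q != 0 by rewrite gt_eqF.
    have e1 : N%:R `^ (- q) * \sum_i \sum_v `|W i v| `^ q <= n%:R * C1 * lrpow q f.
      have : \sum_i \sum_v `|W i v| `^ q <= \sum_(i < n) C1 * N%:R `^ q * lrpow q f.
        apply: ler_sum => i _; rewrite -/(lrpow q (W i)) -(lrnormK (W i) qn) -(lrnormK f qn).
        rewrite -!powRM ?lrnorm_ge0 ?(ltW C0p) ?ler0n//; last by rewrite mulr_ge0 ?(ltW C0p).
        by apply: ge0_ler_powR; rewrite ?nnegrE ?lrnorm_ge0 ?mulr_ge0 ?lrnorm_ge0 ?(ltW C0p) ?(ltW q0)//; exact: Wn.
      rewrite sumr_const_ord => H.
      apply: le_trans (ler_wpM2l (powR_ge0 _ _) H) _.
      by rewrite powRN cancel_scale// powR_gt0.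
    have e2 : \sum_v \sum_i \sum_j `|Dm (@ev n M) j (W i) v| `^ q <= n%:R * n%:R * C1 * lrpow q f.
      rewrite exchange_big/=.
      have : \sum_(i < n) \sum_v \sum_j `|Dm (@ev n M) j (W i) v| `^ q <= \sum_(i < n) \sum_(j < n) C1 * lrpow q f.
        apply: ler_sum => i _; rewrite exchange_big/=; apply: ler_sum => j _.
        rewrite -/(lrpow q (Dm (@ev n M) j (W i))) -(lrnormK (Dm _ j (W i)) qn) -(lrnormK f qn).
        rewrite -!powRM ?lrnorm_ge0 ?(ltW C0p)//.
        by apply: ge0_ler_powR; rewrite ?nnegrE ?lrnorm_ge0 ?mulr_ge0 ?lrnorm_ge0 ?(ltW C0p) ?(ltW q0)//; exact: Wd.
      rewrite !sumr_const_ord => H; apply: le_trans H _.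
      by rewrite [leRHS](_ : _ = n%:R * (n%:R * (C1 * lrpow q f)))//; ring.
    exact: combine_bounds F0 Kp e1 e2.
- move=> x i; split.
  + have H := @near_sum_powR M h o x (fun v => h * W i v) (fun v => \prod_l fac i l (pos_cell h o x v l)) q (B ^+ n) q1 Bn.
    apply: le_trans (H _ _) _.
    * by move=> v; exact: prod_norm_le.
    * move=> v /notnear[l hl]; apply/eqP; apply/prodf_eq0; exists l => //.
      by rewrite fac0.
    rewrite -/K0 mulr_sumr mulr_sumr; apply: ler_sum => v _.
    rewrite (powR_normM _ _ h0) (powRM q (ltW h0) (ler0n R N)).
    apply: (@le_trans _ _ ((h `^ q * N%:R `^ q) * (K0 * (N%:R `^ (- q) * `|W i v| `^ q)))).
      rewrite powRN le_eqVlt; apply/orP; left; apply/eqP.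
      by field; rewrite gt_eqF// powR_gt0.
    apply: ler_wpM2l; first by rewrite mulr_ge0 ?powR_ge0.
    apply: ler_pM => //; rewrite ?mulr_ge0 ?powR_ge0//; first by rewrite /K lerDl.
    apply: ler_wpDr => //; apply: ler_wpM2l; first exact: powR_ge0.
    rewrite (bigD1 i)//= lerDl; apply: sumr_ge0 => *; exact: powR_ge0.
  + move=> j; rewrite dE.
    have BB : 0 <= B ^+ n * B by rewrite mulr_ge0.
    apply: le_trans (@near_sum_powR M h o x _ _ q (B ^+ n * B) q1 BB _ _) _.
    * move=> v; rewrite normrM mulrC; apply: ler_pM => //.
      exact: prod_norm_le.
    * move=> v /notnear[l hl]; have [<-|lj] := eqVneq l j; first by rewrite phi0 ?mul0r.
      apply/eqP; rewrite mulf_eq0; apply/orP; right; apply/prodf_eq0; exists l => //.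
      by rewrite fac0.
    rewrite mulr_sumr; apply: ler_sum => v _.
    apply: (ler_pM K1p (powR_ge0 _ _) (ler_wpDl K0p (lexx _))).
    apply: ler_wpDl; first by rewrite mulr_ge0 ?powR_ge0.
    rewrite (bigD1 i)//= (bigD1 j)//= -addrA lerDl addr_ge0//; apply: sumr_ge0 => *; first exact: powR_ge0.
    by apply: sumr_ge0 => *; exact: powR_ge0.
Qed.

End local_smooth.

(** * John chains of Whitney cubes *)

Section euclidean_norm.
Context {R : realType} {n : nat}.
Implicit Types x y z : 'rV[R]_n.

(** Yields the triangle inequality for the Euclidean norm from Minkowski with exponent 2. *)
Lemma fnorm_lrnorm x : fnorm x = lrnorm 2 (fun j => x ord0 j).
Proof.
rewrite /fnorm /lrnorm big_ord1 powR12_sqrt ?lrpow_ge0//; congr Num.sqrt.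
by apply: eq_bigr => j _; rewrite (powR_mulrn 2) ?normr_ge0// real_normK ?num_real.
Qed.

Lemma fnorm_ge0 x : 0 <= fnorm x. Proof. exact: sqrtr_ge0. Qed.

Lemma fnormD x y : fnorm (x + y) <= fnorm x + fnorm y.
Proof.
rewrite !fnorm_lrnorm; apply: le_trans (lrnorm_add _ _ _); last by lra.
by rewrite le_eqVlt; apply/orP; left; apply/eqP/eq_lrnorm => j; rewrite mxE.
Qed.

Lemma fnormN x : fnorm (- x) = fnorm x.
Proof.
congr Num.sqrt; apply: eq_bigr => i _; apply: eq_bigr => j _.
by rewrite mxE sqrrN.
Qed.

Lemma fnormB x y : fnorm (x - y) = fnorm (y - x).
Proof. by rewrite -fnormN opprB. Qed.

Lemma fnorm_trans x y z : fnorm (x - z) <= fnorm (x - y) + fnorm (y - z).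
Proof. by apply: le_trans (fnormD _ _); rewrite addrA subrK. Qed.

Lemma fnorm_coord x j : `|x ord0 j| <= fnorm x.
Proof.
rewrite -sqrtr_sqr; apply: ler_wsqrtr; rewrite big_ord1 (bigD1 j)//= lerDl.
by apply: sumr_ge0 => i _; exact: sqr_ge0.
Qed.

Lemma fnorm_le_sum x : fnorm x <= \sum_j `|x ord0 j|.
Proof.
have s0 : 0 <= \sum_j `|x ord0 j| by apply: sumr_ge0.
rewrite -(ger0_norm s0) -sqrtr_sqr; apply: ler_wsqrtr.
rewrite big_ord1 expr2 mulr_suml; apply: ler_sum => j _.
rewrite -real_normK ?num_real// expr2; apply: ler_wpM2l => //.
by rewrite (bigD1 j)//= lerDl; apply: sumr_ge0.
Qed.

Lemma fnorm_le x c : (forall j, `|x ord0 j| <= c) -> fnorm x <= n%:R * c.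
Proof.
move=> h; apply: le_trans (fnorm_le_sum x) _.
by rewrite -sumr_const_ord; apply: ler_sum => j _; exact: h.
Qed.

Lemma fnorm0 : fnorm (0 : 'rV[R]_n) = 0.
Proof. by apply/eqP; rewrite eq_le fnorm_ge0 andbT -(mulr0 n%:R) fnorm_le// => j; rewrite mxE normr0. Qed.

Lemma fnormZ (t : R) x : fnorm (t *: x) = `|t| * fnorm x.
Proof.
rewrite /fnorm -sqrtr_sqr -sqrtrM ?sqr_ge0//; congr Num.sqrt.
rewrite mulr_sumr; apply: eq_bigr => i _; rewrite mulr_sumr; apply: eq_bigr => j _.
by rewrite mxE exprMn.
Qed.

Lemma fnorm_rV_le_norm x : fnorm x <= n%:R * `|x|.
Proof.
apply: fnorm_le => j; rewrite -[leRHS]/(mx_norm x) mx_normrE.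
exact: (le_bigmax _ (fun ij => `|x ij.1 ij.2|) (ord0, j)).
Qed.

Lemma norm_le_fnorm x : `|x| <= fnorm x.
Proof.
rewrite -[leLHS]/(mx_norm x) mx_normrE; apply/bigmax_leP; split; first exact: fnorm_ge0.
by move=> [i j] _ /=; rewrite ord1 fnorm_coord.
Qed.

Lemma open_fnorm (U : set 'rV[R]_n) x : open U -> U x ->
  exists2 e, 0 < e & forall y, fnorm (y - x) < e -> U y.
Proof.
move=> oU Ux; have /nbhs_ballP[e e0 he] : nbhs x U by exact: open_nbhs_nbhs.
exists e => // y hy; apply: he; rewrite -ball_normE /=.
by rewrite distrC; apply: le_lt_trans (norm_le_fnorm _) hy.
Qed.

Lemma nbhs_fnorm x e : 0 < e -> \forall y \near x, fnorm (y - x) < e.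
Proof.
move=> e0; have n0 : 0 < n%:R + 1 :> R by rewrite ltr_wpDl.
have : \forall y \near x, ball x (e / (n%:R + 1)) y by apply: nbhsx_ballx; rewrite divr_gt0.
apply: filterS => y; rewrite -ball_normE /= distrC => h.
apply: le_lt_trans (fnorm_rV_le_norm _) _.
have h0 : 0 <= `|y - x| by [].
rewrite ltr_pdivlMr// in h; apply: le_lt_trans h; rewrite mulrC; apply: ler_wpM2l => //; lra.
Qed.

End euclidean_norm.

Section distance.
Context {R : realType} {n : nat}.
Variables (Omega : set 'rV[R]_n).
Implicit Types x y z : 'rV[R]_n.
Hypothesis oO : open Omega.
Let bd := boundary Omega.
Let d := dist_bd Omega.
Hypothesis bd0 : bd !=set0.

Let S x := [set fnorm (x - y) | y in bd].

Lemma dist_set_lb x : has_lbound (S x).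
Proof. by exists 0 => _ [y _ <-]; exact: fnorm_ge0. Qed.

Lemma dist_set_ne x : S x !=set0.
Proof. by have [y hy] := bd0; exists (fnorm (x - y)), y. Qed.

Lemma dist_bd_le x y : bd y -> d x <= fnorm (x - y).
Proof. by move=> hy; apply: ge_inf; [exact: dist_set_lb|exists y]. Qed.

Lemma dist_bd_ge x c : (forall y, bd y -> c <= fnorm (x - y)) -> c <= d x.
Proof. by move=> h; apply: lb_le_inf; [exact: dist_set_ne|move=> _ [y hy <-]; exact: h]. Qed.

Lemma dist_bd_near x e : 0 < e -> exists2 y, bd y & fnorm (x - y) < d x + e.
Proof.
move=> e0; have hi : has_inf (S x) by split; [exact: dist_set_ne|exact: dist_set_lb].
by have [_ [y hy <-] h] := inf_adherent e0 hi; exists y.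
Qed.

Lemma dist_bd_ge0 x : 0 <= d x.
Proof. by apply: dist_bd_ge => y _; exact: fnorm_ge0. Qed.

Lemma dist_bd_lip x y : d x <= d y + fnorm (x - y).
Proof.
rewrite -lerBlDr; apply: dist_bd_ge => z hz.
by rewrite lerBlDr addrC; apply: le_trans (dist_bd_le _ hz) (fnorm_trans _ _ _).
Qed.

Lemma boundary_notin y : bd y -> ~ Omega y.
Proof. by move=> [_ h] Oy; apply: h; move: oO; rewrite openE; exact. Qed.

Lemma dist_bd_gt0 x : Omega x -> 0 < d x.
Proof.
move=> Ox; have [e e0 he] := open_fnorm oO Ox.
apply: lt_le_trans e0 _; apply: dist_bd_ge => y hy; rewrite leNgt; apply/negP => h.
by apply: (boundary_notin hy); apply: he; rewrite fnormB.
Qed.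

(** The segment from [x] to [y] does not meet the boundary, so along it membership in [Omega] and in
    its closure agree: the corresponding part of [[0, 1]] is open, closed and contains 0. *)
Lemma dist_bd_ball x y : Omega x -> fnorm (x - y) < d x -> Omega y.
Proof.
move=> Ox xy; pose phi (t : R) : 'rV[R]_n := x + t *: (y - x).
have cphi : continuous phi.
  move=> t; apply: cvgD; first exact: cvg_cst.
  by apply: cvgZr_tmp; exact: cvg_id.
have e : `[(0:R), 1] `&` (phi @^-1` Omega) = `[0, 1] `&` (phi @^-1` (closure Omega)).
  apply/seteqP; split => t [t01 /= ht]; split => //; first exact: subset_closure.
  apply: contrapT => nO; have hb : bd (phi t).
    by split => // /interior_subset.
  have := dist_bd_le x hb; rewrite /phi opprD addNKr fnormN fnormZ fnormB.
  move: t01; rewrite /= in_itv/= => /andP[t0 t1]; rewrite ger0_norm// => h.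
  have : t * fnorm (x - y) <= fnorm (x - y) by apply: ler_piMl => //; exact: fnorm_ge0.
  by move: h xy; rewrite -/(d x); lra.
suff H1 : (`[(0:R), 1] `&` (phi @^-1` Omega)) = `[(0:R), 1]%classic.
  have : (`[(0:R), 1] `&` (phi @^-1` Omega)) 1 by rewrite H1 /= in_itv/= ler01 lexx.
  by move=> [_] /=; rewrite /phi scale1r addrC subrK.
apply: (@segment_connected R 0 1 (`[0, 1] `&` (phi @^-1` Omega))).
- exists 0; split; first by rewrite /= in_itv/= lexx ler01.
  by rewrite /= /phi scale0r addr0.
- by exists (phi @^-1` Omega) => //; apply: open_comp => // t _; exact: cphi.
- exists (phi @^-1` (closure Omega)) => //.
  by apply: preimage_closed => [t _|]; [exact: cphi|exact: closed_closure].
Qed.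

Lemma dist_bd_continuous : continuous (d : 'rV[R]_n -> R).
Proof.
move=> x; apply: (proj2 (@cvgrPdist_lt _ _ _ (nbhs x) (nbhs_filter x) d (d x))) => e e0.
apply: filterS (nbhs_fnorm x e0) => y h.
apply: le_lt_trans h; rewrite ler_distl; apply/andP; split.
  by rewrite lerBlDr; have := dist_bd_lip y x.
by have := dist_bd_lip x y; rewrite fnormB.
Qed.

Lemma dist_bd_bounded : bounded_set Omega -> exists2 D, 0 < D & forall x, Omega x -> d x <= D.
Proof.
move=> /pinfty_ex_gt0[M _ hM]; have [b hb] := bd0.
have M0 : 0 <= `|M| by [].
exists (n%:R * `|M| + fnorm b + 1).
  by rewrite ltr_wpDl// addr_ge0 ?fnorm_ge0// mulr_ge0.
move=> x Ox; apply: le_trans (dist_bd_le x hb) _.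
apply: le_trans (fnormD _ _) _; rewrite fnormN.
have : fnorm x <= n%:R * `|M|.
  apply: le_trans (fnorm_rV_le_norm x) _; apply: ler_wpM2l => //.
  by apply: le_trans (hM x Ox) (ler_norm M).
lra.
Qed.

End distance.

Section john.
Context {R : realType} {n : nat}.
Implicit Types x y z : 'rV[R]_n.

(** A partition of [[0, s]] followed by [t] is a partition of [[0, t]], so the length grows by at
    least the chord; arc length parametrization turns lengths into parameters. *)
Lemma arc_lipschitz (Omega : set 'rV[R]_n) x y L gamma s t : arc_length_curve Omega x y L gamma ->
  0 <= s -> s <= t -> t <= L -> fnorm (gamma t - gamma s) <= t - s.
Proof.
move=> [L0 _ _ _ hl] s0 st tL; have [<-|st'] := eqVneq s t; first by rewrite !subrr fnorm0.
have {}st : s < t by rewrite lt_neqAle st' st.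
have t0 : 0 < t by exact: le_lt_trans st.
have ht : curve_length 0 t gamma = t%:E by apply: hl; rewrite (ltW t0).
have [sz|sz] := eqVneq s 0.
  rewrite sz subr0 -lee_fin -ht; apply: ereal_sup_ubound; exists [:: t].
    by split; rewrite /= ?t0.
  by rewrite big_nat1.
have {}s0 : 0 < s by rewrite lt_neqAle eq_sym sz.
have hs : curve_length 0 s gamma = s%:E by apply: hl; rewrite (ltW s0) (le_trans (ltW st)).
rewrite lerBrDl -lerBrDr -lee_fin -hs; apply: ge_ereal_sup => _ [p [pp /eqP lp] <-].
rewrite lee_fin lerBrDr -lee_fin -ht; apply: ereal_sup_ubound; exists (rcons p t).
  by split; rewrite ?last_rcons// rcons_path pp lp.
congr (_%:E); rewrite size_rcons big_nat_recr//=; congr (_ + _).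
  apply: eq_big_nat => k /andP[_ kp]; congr (fnorm (gamma _ - gamma _)).
    by rewrite nth_rcons kp; exact: set_nth_default.
  rewrite -[0 :: rcons p t]/(rcons (0 :: p) t) nth_rcons /= ltnS (ltnW kp).
  by apply: set_nth_default => /=; rewrite ltnS ltnW.
rewrite nth_rcons ltnn eqxx; congr (fnorm (gamma _ - gamma _)).
rewrite -[0 :: rcons p t]/(rcons (0 :: p) t) nth_rcons /= ltnS leqnn.
by rewrite -[RHS]lp (last_nth t).
Qed.

Lemma path_map_iota T (e : rel T) (f : nat -> T) a N :
  (forall i, (i < a + N)%N -> e (f i) (f i.+1)) -> path e (f a) (map f (iota a.+1 N)).
Proof.
elim: N a => //= N IH a h; rewrite h ?addnS ?ltnS ?leq_addr//= IH// => i hi.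
by apply: h; rewrite addnS -addSn.
Qed.

(** What is kept of the John condition: chains of arbitrarily fine step along which the distance to
    the boundary dominates, up to [c1], both the distance travelled and the initial distance to the
    boundary. *)
Definition chainable (Omega : set 'rV[R]_n) (c1 : R) x0 := forall x, Omega x -> forall e : R, 0 < e ->
  exists2 s : seq 'rV[R]_n, path (fun y z => fnorm (y - z) <= e) x s /\ last x s = x0 &
    forall y, y \in x :: s -> [/\ Omega y, fnorm (x - y) <= c1 * dist_bd Omega y &
      dist_bd Omega x <= c1 * dist_bd Omega y].

(** Along the curve [t <= (b0 / a0) * d (gamma t)] because [L <= b0]; moreover
    [fnorm (x - gamma t) <= t] and [d x <= d (gamma t) + t]. Hence [c1 = 2 * (b0 / a0)]. *)
Lemma john_chainable (Omega : set 'rV[R]_n) : (0 < n)%N -> john_domain Omega ->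
  [/\ open Omega, bounded_set Omega, boundary Omega !=set0 & exists c1 x0, [/\ 1 <= c1, Omega x0 & chainable Omega c1 x0]].
Proof.
move=> n0 [oO _ bO [a0 [b0 [x0 [a00 ab Ox0 hc]]]]].
have b00 : 0 < b0 by exact: lt_le_trans ab.
have Lpos x (L : R) gamma : x <> x0 -> arc_length_curve Omega x x0 L gamma -> 0 < L.
  move=> xx0 [L0 _ [g0 gL] _ _]; rewrite lt_neqAle L0 andbT; apply/eqP => L00.
  by apply: xx0; rewrite -g0 -gL -L00.
have bne : boundary Omega !=set0.
  have [e e0 he] := open_fnorm oO Ox0.
  pose x := x0 + (e / 2 : R) *: delta_mx ord0 (Ordinal n0).
  have xn : x - x0 = (e / 2 : R) *: delta_mx ord0 (Ordinal n0) by rewrite /x addrC addKr.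
  have fd : fnorm (delta_mx ord0 (Ordinal n0) : 'rV[R]_n) <= 1.
    rewrite -sqrtr1; apply: ler_wsqrtr; rewrite big_ord1 (bigD1 (Ordinal n0))//= big1 ?addr0.
      by rewrite mxE !eqxx expr1n.
    by move=> j /negPf jn; rewrite mxE jn andbF expr0n.
  have Ox : Omega x.
    apply: he; rewrite xn fnormZ ger0_norm; last by lra.
    have := fnorm_ge0 (delta_mx ord0 (Ordinal n0) : 'rV[R]_n); nra.
  have xx0 : x <> x0.
    move=> /eqP; rewrite -subr_eq0 xn => /eqP/rowP/(_ (Ordinal n0)).
    by rewrite !mxE !eqxx mulr1; lra.
  have [L [gamma [ha Lb hd]]] := hc x Ox xx0.
  have L0 := Lpos _ _ _ xx0 ha.
  have := hd L; rewrite (ltW L0) lexx => /(_ isT); rewrite divfK ?gt_eqF// => h.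
  (* With an empty boundary [dist_bd] would be the infimum of the empty set, 0 by convention, while
     the John condition at the end of a curve gives [a0 <= dist_bd]. A curve is available because
     [n > 0] provides a point other than [x0]. *)
  apply/set0P/negP => /eqP b0'; move: h; rewrite /dist_bd b0' image_set0 inf0; lra.
split => //; pose c1 := 2 * (b0 / a0).
have ba : 1 <= b0 / a0 by rewrite ler_pdivlMr// mul1r.
exists c1, x0; split => //; first by rewrite /c1; lra.
move=> x Ox e e0; have [->|/eqP xx0] := eqVneq x x0.
  exists [::] => // y; rewrite inE => /eqP ->; split => //.
    by rewrite subrr fnorm0 mulr_ge0// ?dist_bd_ge0 /c1//; lra.
  by apply: ler_peMl; [exact: dist_bd_ge0|rewrite /c1; lra].
have [L [gamma [ha Lb hd]]] := hc x Ox xx0.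
have L0 := Lpos _ _ _ xx0 ha.
have [_ _ [g0 gL] hO _] := ha.
pose N := (Num.truncn (L / e)).+1.
have N0 : 0 < N%:R :> R by rewrite ltr0n.
pose f i := gamma (i%:R / N%:R * L).
have rng (i : nat) : (i <= N)%N -> 0 <= i%:R / N%:R * L <= L.
  move=> iN; rewrite mulr_ge0 ?divr_ge0 ?(ltW L0)//=.
  by apply: ler_piMl (ltW L0) _; rewrite ler_pdivrMr// mul1r ler_nat.
exists (map f (iota 1 N)); last first.
  move=> y yin; have [t /andP[t0 tL] ->] : exists2 t, 0 <= t <= L & y = gamma t.
    move: yin; rewrite inE => /orP[/eqP ->|/mapP[i]].
      by exists 0; rewrite ?lexx ?(ltW L0).
    by rewrite mem_iota => /andP[_ iN] ->; exists (i%:R / N%:R * L) => //; apply: rng; rewrite -ltnS -add1n.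
  have dt : t <= b0 / a0 * dist_bd Omega (gamma t).
    have := hd t; rewrite t0 tL => /(_ isT) h.
    rewrite mulrAC ler_pdivlMr// ; have h2 : a0 * t <= dist_bd Omega (gamma t) * L.
      by move: h; rewrite mulrAC ler_pdivrMr.
    have h3 : dist_bd Omega (gamma t) * L <= dist_bd Omega (gamma t) * b0.
      by apply: ler_wpM2l => //; exact: dist_bd_ge0.
    by rewrite mulrC [b0 * _]mulrC; exact: le_trans h2 h3.
  have lip : fnorm (x - gamma t) <= t.
    by have := arc_lipschitz ha (lexx 0) t0 tL; rewrite g0 subr0 fnormB.
  have d0 := dist_bd_ge0 bne (gamma t).
  have bad : 1 * dist_bd Omega (gamma t) <= b0 / a0 * dist_bd Omega (gamma t) by exact: ler_wpM2r.
  split.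
  - by apply: hO; rewrite t0.
  - by rewrite /c1 -mulrA; lra.
  - by have := dist_bd_lip bne x (gamma t); rewrite /c1 -mulrA; lra.
have x_eq : x = f 0%N by rewrite /f mul0r mul0r g0.
split; last first.
  rewrite x_eq last_map (last_nth 0%N) size_iota -[0%N :: iota 1 N]/(iota 0 N.+1) nth_iota// add0n /f.
  by rewrite divff ?gt_eqF// mul1r.
rewrite [in path _ x]x_eq; apply: path_map_iota => i; rewrite add0n => iN.
have /andP[r1 r2] := rng _ iN; have /andP[r3 r4] := rng i (ltnW iN).
rewrite fnormB; apply: le_trans (arc_lipschitz ha r3 _ r2) _.
  by apply: ler_wpM2r (ltW L0) _ _ _; rewrite ler_pM2r ?invr_gt0// ler_nat.
have -> : i.+1%:R / N%:R * L - i%:R / N%:R * L = L / N%:R by rewrite -natr1; field; rewrite gt_eqF.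
by rewrite ler_pdivrMr// mulrC -ler_pdivrMr// ltW// truncnS_gt.
Qed.

End john.

(** * Dyadic cubes at the Whitney scale *)

Section whitney_cubes.
Context {R : realType} {n : nat}.
Variables (Omega : set 'rV[R]_n) (D : R).
Implicit Types x y z : 'rV[R]_n.
Local Notation d := (dist_bd Omega).
Local Notation cube := (nat * {ffun 'I_n -> int})%type.
Hypothesis oO : open Omega.
Hypothesis bd0 : boundary Omega !=set0.
Hypothesis D0 : 0 < D.
Hypothesis hD : forall x, Omega x -> d x <= D.

Definition mesh (k : nat) : R := D / 2 ^+ k.

Lemma mesh_gt0 k : 0 < mesh k. Proof. by rewrite divr_gt0// exprn_gt0. Qed.

Lemma mesh_add k j : mesh k = 2 ^+ j * mesh (k + j).
Proof. by rewrite /mesh exprD; field; rewrite !expf_neq0. Qed.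

Lemma mesh_le k j : (k <= j)%N -> mesh j <= mesh k.
Proof.
move=> kj; rewrite (mesh_add k (j - k)) subnKC// ler_peMl ?(ltW (mesh_gt0 _))//.
by rewrite exprn_ege1// ler1n.
Qed.

Lemma mesh_lt_leq k j (c : nat) : mesh k < 2 ^+ c.+1 * mesh j -> (j <= k + c)%N.
Proof.
move=> h; rewrite leqNgt; apply/negP => kcj.
have h2 := mesh_le kcj; have := mesh_add k c.+1; rewrite addnS => e.
have : 2 ^+ c.+1 * mesh j <= mesh k by rewrite e ler_wpM2l// exprn_ge0.
lra.
Qed.

(** Large compared with the dimension, so that a box of some 27 sides around a cube moves the
    distance to the boundary by a fraction only, see [region_near]. *)
Definition whitney_ratio : R := (100 * n.+1)%:R.
Local Notation A := whitney_ratio.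

Lemma whitney_ratio_ge : 100 <= A.
Proof. by rewrite /whitney_ratio natrM ler_peMr// ler1n. Qed.

Let Age := whitney_ratio_ge.

Lemma kappa_ex x : Omega x -> exists k, A * mesh k <= d x.
Proof.
move=> Ox; have dx := dist_bd_gt0 oO bd0 Ox.
have Ap : 0 < A * D by rewrite mulr_gt0//; lra.
exists (Num.truncn (A * D / d x)).+1.
rewrite /mesh mulrA ler_pdivrMr ?exprn_gt0// -ler_pdivrMl// mulrC.
apply: le_trans (ltW (truncnS_gt _)) _.
by rewrite -natrX ler_nat ltnW// ltn_expl.
Qed.

(** The Whitney scale of a point. Level 0 never qualifies inside [Omega], since
    [d x <= D < A * mesh 0]; the preceding level then exists and fails, which gives the upper bound
    in [kappaP]. The value 0 is a mere default. *)
Definition kappa x : nat :=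
  if pselect (exists k, A * mesh k <= d x) is left h then ex_minn h else 0%N.

Lemma kappaP x : Omega x -> A * mesh (kappa x) <= d x < 2 * A * mesh (kappa x).
Proof.
move=> Ox; rewrite /kappa; case: pselect => [h|/(_ (kappa_ex Ox))//].
case: ex_minnP => -[|k] hk mk; rewrite hk/=.
  have h2 := hD Ox; have D0' := D0; rewrite /mesh expr0 divr1.
  have : 100 * D <= A * D by rewrite ler_pM2r. 
  lra.
rewrite ltNge; apply/negP => h2; have := mk k.
have e := mesh_add k 1; rewrite addn1 expr1 in e.
by rewrite e mulrCA mulrA h2 ltnn => /(_ isT).
Qed.

Definition idx k x : {ffun 'I_n -> int} := [ffun l => Num.floor (x ord0 l / mesh k)].

Lemma idx_bounds k x l :
  (idx k x l)%:~R * mesh k <= x ord0 l < (idx k x l)%:~R * mesh k + mesh k.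
Proof.
rewrite ffunE; have /andP[h1 h2] := floor_itv (x ord0 l / mesh k).
have m0 := mesh_gt0 k; rewrite -ler_pdivlMr// h1 /=.
by rewrite -[X in _ + X]mul1r -mulrDl -ltr_pdivrMr//; move: h2; rewrite rmorphD.
Qed.

Definition wcube x : cube := (kappa x, idx (kappa x) x).

(** Not symmetric: a box reaching from -3 to +5 sides of [Q] has to contain all of [Q'], whose side
    may be twice as large. This box later becomes the window on which the local problem is
    solved. *)
Definition adjacent (Q Q' : cube) : bool :=
  [&& (Q.1 <= Q'.1.+1)%N, (Q'.1 <= Q.1.+1)%N &
   [forall l, (((Q.2 l)%:~R - 3) * mesh Q.1 <= (Q'.2 l)%:~R * mesh Q'.1) &&
     (((Q'.2 l)%:~R + 1) * mesh Q'.1 <= ((Q.2 l)%:~R + 5) * mesh Q.1)]].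

Lemma box_arith (z z' m m' u u' : R) : z * m <= u -> u < z * m + m -> z' * m' <= u' ->
  u' < z' * m' + m' -> - m <= u - u' -> u - u' <= m -> m' <= 2 * m -> 0 < m ->
  ((z - 3) * m <= z' * m') && ((z' + 1) * m' <= (z + 5) * m).
Proof. by move=> *; rewrite !mulrDl mulNr mul1r; apply/andP; split; lra. Qed.

Lemma adjacent_near y y' : Omega y -> Omega y' ->
  fnorm (y - y') <= mesh (kappa y) -> fnorm (y - y') <= mesh (kappa y') ->
  adjacent (wcube y) (wcube y').
Proof.
have lev u v : Omega u -> Omega v -> fnorm (u - v) <= mesh (kappa u) -> (kappa u <= (kappa v).+1)%N.
  move=> Ou Ov huv; have /andP[u1 u2] := kappaP Ou; have /andP[v1 v2] := kappaP Ov.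
  rewrite -addn1; apply: mesh_lt_leq; rewrite expr2.
  have lip := dist_bd_lip bd0 v u; rewrite fnormB in lip.
  have m0 := mesh_gt0 (kappa u).
  have h1 : A * mesh (kappa v) < (2 * A + 1) * mesh (kappa u) by lra.
  have A0 : 0 < A by apply: lt_le_trans Age; rewrite ltr0n.
  rewrite -(ltr_pM2l A0); apply: lt_trans h1 _.
  have -> : A * (2 * 2 * mesh (kappa u)) = (4 * A) * mesh (kappa u) by ring.
  by rewrite ltr_pM2r//; have := Age; lra.
move=> Oy Oy' h1 h2.
have l1 := lev _ _ Oy Oy' h1; have h2' := h2; rewrite fnormB in h2'.
have l2 := lev _ _ Oy' Oy h2'.
have m0 := mesh_gt0 (kappa y); have m0' := mesh_gt0 (kappa y').
have m2 : mesh (kappa y') <= 2 * mesh (kappa y).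
  have := mesh_le l1; have := mesh_add (kappa y') 1; rewrite addn1 expr1 => ->; lra.
apply/and3P; split => //; apply/forallP => l /=.
have /andP[a1 a2] := idx_bounds (kappa y) y l; have /andP[b1 b2] := idx_bounds (kappa y') y' l.
have := le_trans (fnorm_coord (y - y') l) h1; rewrite !mxE ler_norml => /andP[c1 c2].
exact: box_arith a1 a2 b1 b2 c1 c2 m2 m0.
Qed.

(** The step [e] of the point chain is below the mesh of each cube met, because [d x <= c1 * d y]
    along it; consecutive cubes are then adjacent. Loops are cut out so that each cube is crossed
    once. *)
Lemma whitney_chain (c1 : R) x0 : 1 <= c1 -> chainable Omega c1 x0 ->
  forall x, Omega x -> exists s : seq cube,
  [/\ uniq (wcube x :: s), path adjacent (wcube x) s, last (wcube x) s = wcube x0 &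
   forall Q, Q \in wcube x :: s -> exists y,
    [/\ Omega y, Q = wcube y, fnorm (x - y) <= c1 * d y & d x <= c1 * d y]].
Proof.
move=> c1p hc x Ox; have dx := dist_bd_gt0 oO bd0 Ox.
have A0 : 0 < A by have := Age; lra.
have c0 : 0 < c1 by lra.
pose e := d x / (c1 * (2 * A)).
have e0 : 0 < e by rewrite divr_gt0// !mulr_gt0.
have [s [ps ls] hs] := hc x Ox e e0.
have em y : Omega y -> d x <= c1 * d y -> e <= mesh (kappa y).
  move=> Oy h; have /andP[_ h2] := kappaP Oy.
  rewrite ler_pdivrMr ?mulr_gt0//; apply: le_trans h _.
  by rewrite mulrCA; apply: ler_wpM2l; [exact: ltW|rewrite mulrC ltW].
have pw : path adjacent (wcube x) (map wcube s).
  rewrite path_map; apply: (@sub_in_path _ [pred y | y \in x :: s] _ _ _ x s _ ps); last exact/allP.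
  move=> y z /hs[Oy _ hy] /hs[Oz _ hz] /= yz; apply: adjacent_near => //.
    exact: le_trans yz (em _ Oy hy).
  exact: le_trans yz (em _ Oz hz).
have lw : last (wcube x) (map wcube s) = wcube x0 by rewrite last_map ls.
case/shortenP: pw lw => s' ps' us' sub' ls'.
exists s'; split => // Q Qs.
have : Q \in map wcube (x :: s).
  by move: Qs; rewrite !inE => /orP[->//|/sub' ->]; rewrite orbT.
by move=> /mapP[y ys ->]; have [Oy h1 h2] := hs y ys; exists y.
Qed.

End whitney_cubes.

(** * Assouad dimension and sums over lattice points *)

Section assouad.
Context {R : realType} {n : nat}.
Variables (Omega : set 'rV[R]_n).
Implicit Types x y z : 'rV[R]_n.
Local Notation d := (dist_bd Omega).
Hypothesis bd0 : boundary Omega !=set0.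

Definition lattice_pt (h : R) (m : {ffun 'I_n -> int}) : 'rV[R]_n := \row_l (h * (m l)%:~R).

Lemma powR_ge1 (a e : R) : 1 <= a -> 0 <= e -> 1 <= a `^ e.
Proof. by move=> a1 e0; rewrite -[leLHS](powRr0 a); exact: ler_powR. Qed.

Lemma powR_lt1 (a e : R) : 1 < a -> e < 0 -> a `^ e < 1.
Proof. move=> a1 e0; have e1 : 0 < - e by lra.
rewrite -[e]opprK powRN invf_lt1 ?powR_gt0//; last by lra.
have <- : 1 `^ (- e) = 1 :> R by rewrite powR1.
by apply: gt0_ltr_powR => //; rewrite nnegrE; lra. Qed.

Lemma lattice_count (s : seq {ffun 'I_n -> int}) (h r : R) (c : 'rV[R]_n) : uniq s -> 0 < h -> h <= r ->
  (forall m, m \in s -> fnorm (lattice_pt h m - c) <= 3 * r) -> (size s)%:R <= (8 * r / h) ^+ n.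
Proof.
move=> us h0 hr hs; have r0 : 0 < r by lra.
pose t := (Num.truncn (6 * r / h)).+1.
have t1 : 6 * r / h <= t%:R by rewrite ltW// truncnS_gt.
have t2 : t.+1%:R <= 8 * r / h.
  have : (Num.truncn (6 * r / h))%:R <= 6 * r / h by rewrite truncn_le// divr_ge0//; lra.
  have : 1 <= r / h by rewrite ler_pdivlMr// mul1r.
  by rewrite /t -!natr1 -![_ * r / h]mulrA; lra.
apply: (@le_trans _ _ (t.+1%:R ^+ n)); last first.
  by apply: lerXn2r => //; rewrite nnegrE ?(le_trans _ t2).
rewrite -natrX ler_nat; apply: (size_box_le (X := fun l => (c ord0 l + 3 * r) / h)) => // m ms l.
have := le_trans (fnorm_coord _ l) (hs m ms); rewrite !mxE ler_norml => /andP[h1 h2].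
apply/andP; split; last by rewrite ler_pdivlMr// mulrC; lra.
rewrite lerBlDr; apply: le_trans (lerD (lexx _) t1).
have hn : h != 0 by rewrite gt_eqF.
have : 6 * r / h * h = 6 * r by exact: divfK.
set X := 6 * r / h => e; rewrite ler_pdivrMr//; lra.
Qed.

Variables (lambda C : R).
Hypothesis l0 : 0 <= lambda.
Hypothesis C0 : 0 < C.
Hypothesis hA : forall r s : R, 0 < r -> r < s ->
  (ereal_sup [set covering_number r (eball x s `&` boundary Omega) | x in boundary Omega] <=
          (C * (s / r) `^ lambda)%:E)%E.

(** The 1 in [C + 1] pays for passing from the infimum to an actual cover; it is affordable because
    [(s / r) ^ lambda >= 1]. *)
Lemma boundary_cover b r s : boundary Omega b -> 0 < r -> r < s ->
  exists k : nat, exists2 c : 'I_k -> 'rV[R]_n,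
    (eball b s `&` boundary Omega) `<=` \bigcup_(i in [set: 'I_k]) eball (c i) r &
    k%:R <= (C + 1) * (s / r) `^ lambda.
Proof.
move=> hb r0 rs; have X1 : 1 <= (s / r) `^ lambda.
  by apply: powR_ge1 => //; rewrite ler_pdivlMr// mul1r ltW.
have h : (covering_number r (eball b s `&` boundary Omega) < (C * (s / r) `^ lambda + 1)%:E)%E.
  apply: (@le_lt_trans _ _ (C * (s / r) `^ lambda)%:E); last by rewrite lte_fin ltrDl.
  by apply: le_trans (hA r0 rs); apply: ereal_sup_ubound; exists b.
have [_ [k [c hc] <-]] := ereal_inf_lt h.
rewrite lte_fin => hk; exists k, c => //.
by rewrite mulrDl mul1r; lra.
Qed.

(** Each point is within [2 * r] of a boundary point, and these boundary points lie in one ball of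
    radius [7 * rho]. They are covered by balls of radius [r], and lattice points are counted in the
    tripled balls. *)
Lemma count_level (s : seq {ffun 'I_n -> int}) (h r rho : R) y : uniq s -> 0 < h -> h <= r -> r <= rho ->
  d y <= rho -> (forall m, m \in s -> d (lattice_pt h m) <= r /\ fnorm (lattice_pt h m - y) <= rho) ->
  (size s)%:R <= (C + 1) * (7 * rho / r) `^ lambda * (8 * r / h) ^+ n.
Proof.
move=> us h0 hr rr dy hs; have r0 : 0 < r by lra.
have rho0 : 0 < rho by lra.
have [b hb yb] := dist_bd_near bd0 y rho0.
have [k [c hc hk]] := boundary_cover (s := 7 * rho) hb r0 ltac:(lra).
have P0 : 0 <= (8 * r / h) ^+ n by rewrite exprn_ge0// divr_ge0 ?mulr_ge0//; lra.
apply: (@le_trans _ _ (k%:R * (8 * r / h) ^+ n)); last exact: ler_wpM2r.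
have ex m : m \in s -> exists i, fnorm (lattice_pt h m - c i) <= 3 * r.
  move=> /hs[h1 h2]; have [b' hb' yb'] := dist_bd_near bd0 (lattice_pt h m) r0.
  have : (eball b (7 * rho) `&` boundary Omega) b'.
    split => //; rewrite /eball /=.
    have := fnorm_trans b' (lattice_pt h m) b; have := fnorm_trans (lattice_pt h m) y b.
    move=> t1 t2; rewrite [fnorm (b' - lattice_pt h m)]fnormB in t2.
    by clear - t1 t2 yb' h1 h2 yb dy rr rho0; lra.
  move=> /hc[i _ hi]; exists i.
  have := fnorm_trans (lattice_pt h m) b' (c i); move: hi; rewrite /eball /=; lra.
apply: (@le_trans _ _ (\sum_(i < k) (count (fun m => fnorm (lattice_pt h m - c i) <= 3 * r) s)%:R)).
  rewrite -natr_sum ler_nat -sum1_size.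
  under [X in (_ <= X)%N]eq_bigr do rewrite -sum1_count.
  rewrite (exchange_big_dep xpredT)//= [X in (X <= _)%N]big_seq [X in (_ <= X)%N]big_seq.
  apply: leq_sum => m ms; have [i hi] := ex m ms.
  by rewrite (bigD1 i)//= leq_addr.
rewrite -[leRHS](@sumr_const_ord R k); apply: ler_sum => i _.
rewrite -size_filter; apply: (lattice_count (c := c i)) => //; first exact: filter_uniq.
by move=> m; rewrite mem_filter => /andP[].
Qed.

Lemma powR_exprn (a e : R) j : 0 <= a -> (a ^+ j) `^ e = (a `^ e) ^+ j.
Proof.
move=> a0; rewrite -[in LHS]powR_mulrn// -powRrM mulrC powRrM powR_mulrn//.
exact: powR_ge0.
Qed.

Lemma geo_sum_le (x : R) J : 0 <= x -> x < 1 -> \sum_(j < J) x ^+ j <= (1 - x)^-1.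
Proof.
move=> x0 x1; have h : 0 < 1 - x by lra.
rewrite -[leRHS]mul1r ler_pdivlMr//.
have := subrX1 x J; have : 0 <= x ^+ J by exact: exprn_ge0.
move=> h1 h2; have -> : (\sum_(j < J) x ^+ j) * (1 - x) = 1 - x ^+ J.
  by rewrite -[RHS]opprB h2; ring.
lra.
Qed.

Lemma powR_comparable (a b e : R) : 0 < a -> a <= 2 * b -> b <= a -> b `^ e <= 2 `^ `|e| * a `^ e.
Proof.
move=> a0 ab ba; have b0 : 0 < b by lra.
have [e0|e0] := lerP 0 e.
  apply: (@le_trans _ _ (1 * a `^ e)).
    by rewrite mul1r; apply: ge0_ler_powR; rewrite ?nnegrE ?(ltW a0) ?(ltW b0).
  apply: ler_wpM2r; rewrite ?powR_ge0//; apply: powR_ge1 => //; lra.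
have e1 : 0 <= - e by lra.
rewrite ltr0_norm// -[e in b `^ e]opprK -[e in _ * a `^ e]opprK [b `^ _]powRN [a `^ _]powRN.
have H : a `^ (- e) <= 2 `^ (- e) * b `^ (- e).
  rewrite -powRM ?(ltW b0)//; apply: ge0_ler_powR; rewrite ?nnegrE ?(ltW a0)//.
  by rewrite mulr_ge0// ltW.
have ap : 0 < a `^ (- e) by exact: powR_gt0.
have bp : 0 < b `^ (- e) by exact: powR_gt0.
by rewrite -[(b `^ _)^-1]mul1r ler_pdivrMr// mulrAC ler_pdivlMr// mul1r.
Qed.

(** Shell by shell: for [r = rho / 2 ^ j] the count is of order [2 ^ (j * lambda) * (rho / (2 ^ j *
    h)) ^ n], and the factor [r ^ gamma] leaves a geometric series of ratio
    [2 ^ (lambda - gamma - n)]. This is where the hypothesis on [beta] is spent. *)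
Lemma whitney_sum (gamma : R) : lambda < n%:R + gamma -> exists2 K, 0 < K &
  forall (s : seq {ffun 'I_n -> int}) (h rho : R) y, uniq s -> 0 < h -> 0 < rho -> d y <= rho ->
  (forall m, m \in s -> h <= d (lattice_pt h m) <= rho /\ fnorm (lattice_pt h m - y) <= rho) ->
  \sum_(m <- s) d (lattice_pt h m) `^ gamma <= K * (rho `^ gamma * (rho / h) ^+ n).
Proof.
move=> lg; pose x : R := 2 `^ (lambda - gamma - n%:R).
have x0 : 0 <= x by exact: powR_ge0.
have x1 : x < 1 by apply: powR_lt1; lra.
have C1 : 0 < C + 1 by have := C0; lra.
pose K := 2 `^ `|gamma| * ((C + 1) * 7 `^ lambda * 8 ^+ n) * (1 - x)^-1.
have Kp : 0 < K.
  by rewrite !mulr_gt0 ?powR_gt0 ?invr_gt0 ?exprn_gt0//; lra.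
exists K => // s h rho y us h0 rho0 dy hs.
pose r j : R := rho / 2 ^+ j.
have r0 j : 0 < r j by rewrite divr_gt0// exprn_gt0.
pose J := (Num.truncn (rho / h)).+1.
have Jh : r J < h.
  rewrite /r ltr_pdivrMr ?exprn_gt0// -ltr_pdivrMl// mulrC.
  apply: lt_trans (truncnS_gt _) _; rewrite -natrX ltr_nat; exact: ltn_expl.
have rS j : r j = 2 * r j.+1 by rewrite /r exprS; field; rewrite expf_neq0.
pose P j m := r j.+1 < d (lattice_pt h m) <= r j.
have exj m : m \in s -> exists j : 'I_J, P j m.
  move=> /hs[/andP[h1 h2] _].
  have hex : exists j, r j < d (lattice_pt h m) by exists J; lra.
  case: (ex_minnP hex) => -[|j] hj mj.
    by move: hj; rewrite /r divr1; lra.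
  have jJ : (j < J)%N.
    by apply: mj; lra.
  exists (Ordinal jJ); rewrite /P /= hj /= leNgt; apply/negP => h3.
  by have := mj _ h3; rewrite ltnn.
apply: (@le_trans _ _ (\sum_(j < J) \sum_(m <- s | P j m) 2 `^ `|gamma| * r j `^ gamma)).
  rewrite (exchange_big_dep xpredT)//= big_seq [leRHS]big_seq; apply: ler_sum => m ms.
  have [j hj] := exj m ms; rewrite (bigD1 j)//=; apply: ler_wpDr.
    by apply: sumr_ge0 => i _; rewrite mulr_ge0 ?powR_ge0.
  by move/andP: hj => [p1 p2]; apply: powR_comparable => //; rewrite rS; lra.
apply: (@le_trans _ _ (\sum_(j < J) 2 `^ `|gamma| * ((C + 1) * 7 `^ lambda * 8 ^+ n) *
   (rho `^ gamma * (rho / h) ^+ n) * x ^+ j)); last first.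
  rewrite -mulr_sumr /K; set X := 2 `^ _ * _; set Y := rho `^ _ * _.
  rewrite -[X * (1 - x)^-1 * Y]mulrA [(1 - x)^-1 * Y]mulrC [X * (Y * _)]mulrA.
  apply: ler_wpM2l (geo_sum_le J x0 x1); rewrite /X /Y.
  rewrite !mulr_ge0 ?powR_ge0 ?exprn_ge0//; try lra.
  by rewrite divr_ge0//; lra.
apply: ler_sum => j _; rewrite big_const_seq iter_addr_0 -[_ *+ _]mulr_natr -!mulrA.
apply: ler_wpM2l; first exact: powR_ge0.
rewrite -size_filter.
have [->|hne] := eqVneq [seq m <- s | P j m] [::].
  rewrite /= mulr0 !mulr_ge0 ?powR_ge0 ?exprn_ge0//; try lra.
  by rewrite divr_ge0//; lra.
have hrj : h <= r j.
  case E : [seq m <- s | P j m] hne => [//|m s'] _.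
  have : m \in [seq m <- s | P j m] by rewrite E mem_head.
  by rewrite mem_filter => /andP[/andP[_ p2] /hs[/andP[p3 _] _]]; exact: le_trans p3 p2.
have rjr : r j <= rho.
  by rewrite /r ler_pdivrMr ?exprn_gt0// ler_peMr ?(ltW rho0)// exprn_ege1// ler1n.
have cl := @count_level [seq m <- s | P j m] h (r j) rho y (filter_uniq _ us) h0 hrj rjr dy.
have {}cl := cl (fun m => _).
apply: (@le_trans _ _ (r j `^ gamma * ((C + 1) * (7 * rho / r j) `^ lambda * (8 * r j / h) ^+ n))).
  apply: ler_wpM2l; first exact: powR_ge0.
  by apply: cl => m; rewrite mem_filter => /andP[/andP[_ p2] /hs[_ p3]].
have e1 : 7 * rho / r j = 7 * 2 ^+ j by rewrite /r; field; rewrite expf_neq0//= gt_eqF.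
have e2 : 8 * r j / h = 8 * (rho / h) * (2 ^+ j)^-1 by rewrite /r; field; rewrite expf_neq0//= gt_eqF.
have tj : 0 < 2 ^+ j :> R by rewrite exprn_gt0.
rewrite e1 e2 /r powRM//; last exact: ltW.
rewrite powRM ?invr_ge0 ?(ltW rho0) ?(ltW tj)//.
rewrite -[(2 ^+ j)^-1]powR_inv1 ?(ltW tj)// -powRrM mulN1r !exprMn powR_inv1 ?(ltW tj)//.
have -> : x ^+ j = (2 ^+ j) `^ (- gamma) * (2 ^+ j) `^ lambda * ((2 ^+ j)^-1) ^+ n.
  rewrite -powR_exprn// /x -[RHS]mulrC.
  have -> : ((2 ^+ j)^-1) ^+ n = (2 ^+ j) `^ (- n%:R) :> R by rewrite powRN powR_mulrn ?exprVn// ltW.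
  rewrite -!powRD ?(gt_eqF tj) ?implybT//; congr (_ `^ _); ring.
by rewrite le_eqVlt; apply/orP; left; apply/eqP; ring.
Qed.

End assouad.

(** * Transport of mass along chains *)

Section lattice_windows.
Context {R : realType} {n : nat}.
Variable K : nat.
Local Notation pt := {ffun 'I_n -> int}.
Local Notation cube := (nat * {ffun 'I_n -> int})%type.
Implicit Types (Q : cube) (phi : pt -> R).

(** In units of the finest lattice, of level [K]: from here on cubes and windows are sets of integer
    points. *)
Definition csize Q : nat := 2 ^ (K - Q.1).

Lemma csize_gt0 Q : (0 < csize Q)%N. Proof. by rewrite expn_gt0. Qed.

Definition cpt Q (t : {ffun 'I_n -> 'I_(csize Q)}) : pt := [ffun l => Q.2 l * (csize Q)%:Z + (t l : nat)%:Z].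

Definition cavg phi Q : R := (csize Q)%:R ^- n * \sum_t phi (cpt (Q := Q) t).

(** The lattice form of the box in [adjacent]; it contains [Q] and whichever cube a chain visits
    after [Q], hence all the mass moved in one step. *)
Definition window Q (a : pt) := forall l,
  (Q.2 l * (csize Q)%:Z - 3 * (csize Q)%:Z <= a l) && (a l < Q.2 l * (csize Q)%:Z + 5 * (csize Q)%:Z).

(** The torus has side [8 * N] with [N = 8 * csize Q]. The window is [8 * csize Q] wide, and the
    offset [toff] makes it the block [[3 * N, 4 * N)] that [local_discrete] expects:
    [27 = 24 + 3]. *)
Definition tsize Q : nat := (64 * csize Q).-1.

Lemma tsizeS Q : (tsize Q).+1 = (8 * (8 * csize Q))%N.
Proof. by rewrite /tsize prednK ?muln_gt0 ?csize_gt0// mulnA. Qed.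

Definition toff Q : pt := [ffun l => Q.2 l * (csize Q)%:Z - 27 * (csize Q)%:Z].

Definition tshift Q (v : {ffun 'I_n -> 'I_(tsize Q).+1}) : pt := [ffun l => (v l : nat)%:Z + toff Q l].

Lemma tshift_inj Q : injective (@tshift Q).
Proof.
move=> v w /ffunP e; apply/ffunP => l; have := e l; rewrite !ffunE => /addIr[h].
exact: ord_inj.
Qed.

Lemma cpt_inj Q : injective (@cpt Q).
Proof.
move=> v w /ffunP e; apply/ffunP => l; have := e l; rewrite !ffunE => /addrI[h].
exact: ord_inj.
Qed.

Lemma tshift_window Q v : window Q (tshift (Q := Q) v) =
  [forall j, (3 * (8 * csize Q) <= v j < 4 * (8 * csize Q))%N] :> Prop.
Proof.
have key (a b : int) (S v' : nat) : a = v'%:Z + (b * S%:Z - 27 * S%:Z) ->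
  (b * S%:Z - 3 * S%:Z <= a) && (a < b * S%:Z + 5 * S%:Z) = (3 * (8 * S) <= v' < 4 * (8 * S))%N by lia.
rewrite propeqE; split => [h|/forallP h l].
  by apply/forallP => l; have := h l; rewrite !ffunE (key _ (Q.2 l) _ (v l)).
by have := h l; rewrite !ffunE (key _ (Q.2 l) _ (v l)).
Qed.

Lemma window_tshift Q a : window Q a -> exists v, tshift (Q := Q) v = a.
Proof.
move=> h; pose S := csize Q.
have key (b c : int) : (b * S%:Z - 3 * S%:Z <= c) && (c < b * S%:Z + 5 * S%:Z) ->
  (absz (c - (b * S%:Z - 27 * S%:Z))%R < 64 * S)%N /\ (absz (c - (b * S%:Z - 27 * S%:Z))%R)%:Z + (b * S%:Z - 27 * S%:Z) = c.
  lia.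
have h2 l : (absz (a l - (Q.2 l * S%:Z - 27 * S%:Z))%R < (tsize Q).+1)%N.
  by rewrite tsizeS mulnA; case: (key _ _ (h l)).
exists [ffun l => Ordinal (h2 l)]; apply/ffunP => l; rewrite !ffunE /=.
by case: (key _ _ (h l)).
Qed.

Lemma sum_tshift Q a (G : pt -> R) : window Q a ->
  \sum_v (tshift (Q := Q) v == a)%:R * G (tshift v) = G a.
Proof.
move=> /window_tshift[v <-]; rewrite (bigD1 v)//= eqxx mul1r big1 ?addr0// => w wv.
by rewrite (inj_eq (@tshift_inj Q)) (negPf wv) mul0r.
Qed.

Lemma sum_tshift_le Q a : \sum_v (tshift (Q := Q) v == a)%:R <= 1 :> R.
Proof.
have [[v <-]|h] := pselect (exists v, tshift (Q := Q) v = a).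
  rewrite (bigD1 v)//= eqxx big1 ?addr0// => w wv.
  by rewrite (inj_eq (@tshift_inj Q)) (negPf wv).
rewrite big1 ?ler01// => v _; case: eqP => // e; by case: h; exists v.
Qed.

Lemma sizeQ_gt0 Q : 0 < (csize Q)%:R ^- n :> R.
Proof. by rewrite invr_gt0 exprn_gt0// ltr0n csize_gt0. Qed.

Lemma cavg_cst Q : cavg (fun=> 1) Q = 1.
Proof.
rewrite /cavg (_ : \sum_t _ = (csize Q)%:R ^+ n); last by rewrite sumr_const card_ffun !card_ord natrX.
by apply: mulVf; rewrite expf_neq0// pnatr_eq0 -lt0n csize_gt0.
Qed.

Lemma cavg_delta_ge0 z Q : 0 <= cavg (fun a => (z == a)%:R) Q.
Proof. by rewrite mulr_ge0 ?(ltW (sizeQ_gt0 Q))//; apply: sumr_ge0. Qed.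

Lemma cavg_delta_le z Q : cavg (fun a => (z == a)%:R) Q <= (csize Q)%:R ^- n.
Proof.
rewrite /cavg ler_piMr ?(ltW (sizeQ_gt0 Q))//.
have [[t <-]|h] := pselect (exists t, cpt (Q := Q) t = z).
  rewrite (bigD1 t)//= eqxx big1 ?addr0// => w wv.
  by rewrite (inj_eq (@cpt_inj Q)) eq_sym (negPf wv).
rewrite big1 ?ler01// => v _; case: eqP => // e; by case: h; exists v.
Qed.

Lemma sum_cavg Q Q' (G : pt -> R) : (forall t, window Q (cpt (Q := Q') t)) ->
  \sum_v cavg (fun a => (tshift (Q := Q) v == a)%:R) Q' * G (tshift v) = cavg G Q'.
Proof.
move=> h; rewrite /cavg.
under eq_bigr do rewrite -mulrA mulr_suml.
rewrite -mulr_sumr exchange_big/=; congr (_ * _); apply: eq_bigr => t _.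
exact: sum_tshift.
Qed.

End lattice_windows.

Section decomposition.
Context {R : realType} {n : nat}.
Variables (Omega : set 'rV[R]_n) (D : R).
Local Notation pt := {ffun 'I_n -> int}.
Local Notation cube := (nat * {ffun 'I_n -> int})%type.
Local Notation d := (dist_bd Omega).
Local Notation A := (@whitney_ratio R n).
Local Notation mesh := (mesh D).
Local Notation wcube := (wcube Omega D).
Hypothesis D0 : 0 < D.

Lemma window_arith (a : int) (t s : nat) : (t < s)%N -> (a - 3 * s%:Z <= a + t%:Z) && (a + t%:Z < a + 5 * s%:Z).
Proof. lia. Qed.

Lemma window_arith3 (z b : int) (s : nat) : (z * s%:Z <= b)%R -> (b < z * s%:Z + s%:Z)%R ->
  (z * s%:Z - 3 * s%:Z <= b) && (b < z * s%:Z + 5 * s%:Z).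
Proof. by move: (z * _) => a; lia. Qed.

Lemma window_arith2 (z z' : int) (s s' t : nat) : ((z - 3) * s%:Z <= z' * s'%:Z)%R ->
  ((z' + 1) * s'%:Z <= (z + 5) * s%:Z)%R -> (t < s')%N ->
  (z * s%:Z - 3 * s%:Z <= z' * s'%:Z + t%:Z) && (z' * s'%:Z + t%:Z < z * s%:Z + 5 * s%:Z).
Proof. by rewrite !mulrDl mulNr mul1r; move: (z * _) (z' * _) => a b; lia. Qed.

Lemma adjacent_window K Q Q' t : (Q.1 <= K)%N -> (Q'.1 <= K)%N -> @adjacent R n D Q Q' ->
  window K Q (@cpt n K Q' t).
Proof.
move=> kK kK' /and3P[_ _ /forallP h] l; have /andP[h1 h2] := h l.
have m0 := mesh_gt0 D0 K.
have E k : (k <= K)%N -> mesh k = (2 ^ (K - k))%:R * mesh K.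
  by move=> kk; rewrite (mesh_add D k (K - k)) subnKC// natrX.
have E' k (a : R) : (k <= K)%N -> a * mesh k = a * (2 ^ (K - k))%:R * mesh K.
  by move=> kk; rewrite (E _ kk) mulrA.
rewrite (E' _ _ kK) (E' _ _ kK') (ler_pM2r m0) in h1.
rewrite (E' _ _ kK) (E' _ _ kK') (ler_pM2r m0) in h2.
rewrite !ffunE -/(csize K Q) -/(csize K Q') in h1 h2 *.
have tl := ltn_ord (t l).
have {}h1 : ((Q.2 l - 3) * (csize K Q)%:Z <= Q'.2 l * (csize K Q')%:Z)%R.
  by rewrite -(ler_int R) !rmorphM rmorphB/=.
have {}h2 : ((Q'.2 l + 1) * (csize K Q')%:Z <= (Q.2 l + 5) * (csize K Q)%:Z)%R.
  by rewrite -(ler_int R) !rmorphM !rmorphD/=.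
exact: window_arith2 h1 h2 tl.
Qed.

Lemma self_window K Q t : window K Q (@cpt n K Q t).
Proof.
move=> l; rewrite !ffunE; have tl := ltn_ord (t l).
exact: window_arith.
Qed.

Lemma own_window K m : (kappa Omega D (lattice_pt (mesh K) m) <= K)%N ->
  window K (wcube (lattice_pt (mesh K) m)) m.
Proof.
set x := lattice_pt _ _; move=> kK l.
have /andP[h1 h2] := idx_bounds D0 (kappa Omega D x) x l.
rewrite mxE in h1 h2; set z := idx _ _ _ l in h1 h2.
have m0 := mesh_gt0 D0 K.
have E : mesh (kappa Omega D x) = (csize K (wcube x))%:R * mesh K.
  by rewrite (mesh_add D _ (K - kappa Omega D x)) subnKC// natrX.
rewrite E mulrA [mesh K * _]mulrC in h1 h2.
rewrite (ler_pM2r m0) in h1; rewrite -mulrDl (ltr_pM2r m0) in h2.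
have {}h1 : (z * (csize K (wcube x))%:Z <= m l)%R by rewrite -(ler_int R) rmorphM.
have {}h2 : (m l < z * (csize K (wcube x))%:Z + (csize K (wcube x))%:Z)%R.
  by rewrite -(ltr_int R) rmorphD rmorphM.
rewrite -[(wcube x).2 l]/z.
exact: window_arith3.
Qed.

Section chain_steps.
Variables (phi : pt -> R) (K : nat) (m : pt) (Q0 : cube) (p : seq cube).

(** After the last cube the default of [nth] returns that cube again, so no mass leaves it and the
    telescoping sum stops there. *)
Definition cnext Q : cube := nth (last Q0 p) (Q0 :: p) (index Q (Q0 :: p)).+1.

(** A functional of [phi]. At the indicator of [z] it is the density at [z] of the mass moved at
    [Q]; at [phi = 1] it says that the step has mean zero. The first step starts from the point mass
    at [m], the later ones from a uniform mass on a cube. *)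
Definition cstep Q : R := (if Q == Q0 then phi m else cavg K phi Q) - cavg K phi (cnext Q).

Lemma sum_cstep : uniq (Q0 :: p) -> \sum_(Q <- Q0 :: p) cstep Q = phi m - cavg K phi (last Q0 p).
Proof.
move=> us; pose a i := if i == 0%N then phi m else cavg K phi (nth (last Q0 p) (Q0 :: p) i).
have -> : phi m - cavg K phi (last Q0 p) = a 0%N - a (size (Q0 :: p)).
  by rewrite /a /= nth_default.
rewrite (big_nth (last Q0 p)) -[RHS]opprB -telescope_sumr//= -sumrN.
apply: eq_big_nat => i /andP[_ ip]; rewrite opprB /cstep /a /cnext index_uniq//; congr (_ - _).
have e : (nth (last Q0 p) (Q0 :: p) i == Q0) = (i == 0%N).
  by rewrite -[X in _ == X]/(nth (last Q0 p) (Q0 :: p) 0) nth_uniq.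
by rewrite e.
Qed.

Lemma cnext_adjacent Q : path (@adjacent R n D) Q0 p -> Q \in Q0 :: p ->
  cnext Q = Q \/ @adjacent R n D Q (cnext Q).
Proof.
move=> pp Qp; rewrite /cnext; have hi : (index Q (Q0 :: p) < size (Q0 :: p))%N by rewrite index_mem.
have [h|h] := ltnP (index Q (Q0 :: p)) (size p).
  by right; have /(pathP (last Q0 p))/(_ _ h) := pp; rewrite nth_index.
have e : index Q (Q0 :: p) = size p by apply/eqP; rewrite eqn_leq h andbT -ltnS.
by left; rewrite e nth_default// (last_nth Q0) -e nth_index.
Qed.

Lemma cnext_mem Q : Q \in Q0 :: p -> cnext Q \in Q0 :: p.
Proof.
move=> Qp; rewrite /cnext; have [h|h] := ltnP (index Q (Q0 :: p)).+1 (size (Q0 :: p)).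
  exact: mem_nth.
by rewrite nth_default// mem_last.
Qed.

End chain_steps.

Lemma max_level (P : seq cube) Q1 : Q1 \in P -> exists2 Qm, Qm \in P & forall Q, Q \in P -> (Q.1 <= Qm.1)%N.
Proof.
elim: P Q1 => // Q' P IH Q1; case: P IH => [|Q2 P] IH _.
  by exists Q'; rewrite ?mem_head// => Q; rewrite inE => /eqP ->.
have [Qm QmP hm] := IH Q2 (mem_head _ _).
have [h|/ltnW h] := leqP Q'.1 Qm.1.
  by exists Qm => [|Q]; rewrite inE ?QmP ?orbT// => /orP[/eqP ->//|/hm].
exists Q' => [|Q]; first exact: mem_head.
by rewrite inE => /orP[/eqP ->//|/hm/leq_trans]; exact.
Qed.

(** The cubes lie near [x] relative to their size, so each level contributes boundedly many; none is
    much smaller than [r], so the levels, counted from the finest, form a geometric series. This is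
    the decay that the excess [kap] buys. *)
Lemma chain_sum (kap B : R) : 0 < kap -> 1 <= B -> exists2 C, 0 < C &
  forall (P : seq cube) (x : 'rV[R]_n) (r : R), uniq P -> 0 < r ->
  (forall Q, Q \in P -> r <= B * mesh Q.1 /\ forall l, `|x ord0 l - (Q.2 l)%:~R * mesh Q.1| <= B * mesh Q.1) ->
  \sum_(Q <- P) (r / mesh Q.1) `^ kap <= C.
Proof.
move=> k0 B1; pose t := (Num.truncn (2 * B)).+1; pose N1 := (t.+1 ^ n)%N.
pose X : R := 2 `^ (- kap).
have X0 : 0 <= X by exact: powR_ge0.
have X1 : X < 1 by apply: powR_lt1; lra.
have N10 : 0 < N1%:R :> R by rewrite ltr0n expn_gt0.
have C0 : 0 < N1%:R * (B `^ kap * (1 - X)^-1).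
  by rewrite !mulr_gt0 ?powR_gt0 ?invr_gt0//; lra.
exists (N1%:R * (B `^ kap * (1 - X)^-1)) => // P x r uP r0 hP.
case EP : P => [|Q1 P']; first by rewrite big_nil ltW.
rewrite -EP; have Q1P : Q1 \in P by rewrite EP mem_head.
have [Qm QmP ler_k] := max_level Q1P; pose k := Qm.1.
have cnt j : (count (fun Q => Q.1 == j) P <= N1)%N.
  rewrite -size_filter -(size_map snd).
  apply: (size_box_le (X := fun l => x ord0 l / mesh j + B)).
    rewrite map_inj_in_uniq ?filter_uniq// => -[a b] [a' b'].
    by rewrite !mem_filter /= => /andP[/eqP -> _] /andP[/eqP -> _] ->.
  move=> z /mapP[Q]; rewrite mem_filter => /andP[/eqP Qj QP] -> l.
  have [_ /(_ l)] := hP Q QP; rewrite Qj ler_norml => /andP[h1 h2].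
  have mj := mesh_gt0 D0 j.
  have tB : 2 * B <= t%:R by rewrite ltW// truncnS_gt.
  have e : x ord0 l / mesh j * mesh j = x ord0 l by rewrite divfK// gt_eqF.
  move: e; set y := x ord0 l / _ => e; apply/andP; split.
    have h3 : 2 * B * mesh j <= t%:R * mesh j by rewrite ler_pM2r.
    by rewrite -(ler_pM2r mj); lra.
  by rewrite -(ler_pM2r mj); lra.
apply: (@le_trans _ _ (\sum_(j < k.+1) \sum_(Q <- P | Q.1 == j) (r / mesh j) `^ kap)).
  rewrite (exchange_big_dep xpredT)//= big_seq [leRHS]big_seq; apply: ler_sum => Q QP.
  have hj : (Q.1 < k.+1)%N by rewrite ltnS ler_k.
  rewrite (bigD1 (Ordinal hj))//=; apply: ler_wpDr => //.
  by apply: sumr_ge0 => *; exact: powR_ge0.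
apply: (@le_trans _ _ (\sum_(j < k.+1) N1%:R * B `^ kap * X ^+ (k - j))).
  apply: ler_sum => j _; rewrite big_const_seq iter_addr_0 -[_ *+ _]mulr_natr mulrC -mulrA.
  apply: ler_pM; rewrite ?powR_ge0 ?ler_nat//.
  have jk : (j <= k)%N by rewrite -ltnS.
  have [h _] := hP Qm QmP; rewrite -/k in h.
  have mk := mesh_gt0 D0 k; have mj := mesh_gt0 D0 j.
  have e : mesh j = 2 ^+ (k - j) * mesh k by rewrite (mesh_add D j (k - j)) subnKC.
  have tp : 0 < 2 ^+ (k - j) :> R by rewrite exprn_gt0.
  have e2 : r / mesh j <= B * (2 ^+ (k - j))^-1.
    rewrite e ler_pdivrMr ?mulr_gt0// mulrA -[B * _ * _]mulrA mulVf ?gt_eqF// mulr1//.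
  apply: le_trans (ge0_ler_powR (ltW k0) _ _ e2) _; rewrite ?nnegrE.
  - by rewrite divr_ge0 ?ltW.
  - by rewrite mulr_ge0 ?invr_ge0 ?(ltW tp)//; lra.
  rewrite powRM ?invr_ge0 ?(ltW tp)//; last by lra.
  by rewrite -exprVn powR_exprn ?invr_ge0// -powR_inv1// -powRrM mulN1r.
rewrite -mulr_sumr -mulrA ler_pM2l// ler_pM2l ?powR_gt0//; last by lra.
apply: le_trans (geo_sum_le k.+1 X0 X1).
rewrite [leRHS](reindex_inj rev_ord_inj)/= le_eqVlt; apply/orP; left; apply/eqP.
by apply: eq_bigr => j _; rewrite subSS.
Qed.

End decomposition.

Section step_pairing.
Context {R : realType} {n : nat}.
Variables (D : R) (K : nat) (m : {ffun 'I_n -> int}) (Q0 : nat * {ffun 'I_n -> int}) (p : seq (nat * {ffun 'I_n -> int})).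
Local Notation pt := {ffun 'I_n -> int}.
Local Notation cube := (nat * {ffun 'I_n -> int})%type.
Local Notation delta z := (fun a : pt => (z == a)%:R : R).
Hypothesis D0 : 0 < D.
Hypothesis pp : path (@adjacent R n D) Q0 p.
Hypothesis lev : forall Q, Q \in Q0 :: p -> (Q.1 <= K)%N.
Hypothesis own : window K Q0 m.

Let win_next Q : Q \in Q0 :: p -> forall t, window K Q (@cpt n K (cnext Q0 p Q) t).
Proof.
move=> Qp; have H Q' : Q' = Q -> forall t, window K Q (@cpt n K Q' t).
  by move=> -> t; exact: (self_window D0).
have [e|h] := cnext_adjacent pp Qp; first exact: H.
move=> t; exact: (adjacent_window D0 t (lev Qp) (lev (cnext_mem Qp)) h).
Qed.

Lemma sum_cstep_tshift Q (G : pt -> R) : Q \in Q0 :: p ->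
  \sum_v cstep (delta (tshift (K := K) (Q := Q) v)) K m Q0 p Q * G (tshift v) = cstep G K m Q0 p Q.
Proof.
move=> Qp; rewrite /cstep.
under eq_bigr do rewrite mulrBl.
rewrite sumrB (sum_cavg G (win_next Qp)); congr (_ - _).
case: eqP => [e|_]; last by apply: sum_cavg => t; exact: (self_window D0).
by apply: sum_tshift; rewrite e.
Qed.

Lemma cavg_delta0 Q Q' z : (forall t, window K Q (@cpt n K Q' t)) -> ~ window K Q z ->
  cavg K (delta z) Q' = 0.
Proof.
move=> h nz; rewrite /cavg big1 ?mulr0// => t _; case: eqP => // e.
by case: nz; rewrite e.
Qed.

Lemma cstep_delta0 Q z : Q \in Q0 :: p -> ~ window K Q z -> cstep (delta z) K m Q0 p Q = 0.
Proof.
move=> Qp nz; rewrite /cstep (cavg_delta0 (win_next Qp) nz) subr0.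
case: eqP => [e|_]; last by apply: cavg_delta0 nz => t; exact: (self_window D0).
by case: eqP => // e2; case: nz; rewrite e2 e.
Qed.

Lemma cstep_cst Q : cstep (fun=> 1 : R) K m Q0 p Q = 0.
Proof. by rewrite /cstep !cavg_cst; case: ifP; rewrite subrr. Qed.

(** Averages over [Q] and over the next cube have comparable densities, as their sides differ by a
    factor at most 2; only the first step contains a point mass. *)
Lemma cstep_delta_le Q z : Q \in Q0 :: p -> `|cstep (delta z) K m Q0 p Q| <=
  (Q == Q0)%:R * (z == m)%:R + (2 ^+ n.+1) * (csize K Q)%:R ^- n.
Proof.
move=> Qp; have c1 := cavg_delta_ge0 (R := R) K z Q; have c2 := cavg_delta_le (R := R) K z Q.
have c3 := cavg_delta_ge0 (R := R) K z (cnext Q0 p Q); have c4 := cavg_delta_le (R := R) K z (cnext Q0 p Q).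
have lQ := lev Qp; have lQ' := lev (cnext_mem Qp).
have c5 : (csize K (cnext Q0 p Q))%:R ^- n <= 2 ^+ n * (csize K Q)%:R ^- n :> R.
  have h : (csize K Q <= 2 * csize K (cnext Q0 p Q))%N.
    have [->|/and3P[h1 h2 _]] := cnext_adjacent pp Qp; first by rewrite leq_pmull.
    by rewrite /csize -expnS leq_exp2l//; lia.
  have s0 : 0 < (csize K Q)%:R :> R by rewrite ltr0n csize_gt0.
  have s1 : 0 < (csize K (cnext Q0 p Q))%:R :> R by rewrite ltr0n csize_gt0.
  rewrite -[2 ^+ n]invrK -invfM lef_pV2 ?posrE ?exprn_gt0// ?mulr_gt0 ?invr_gt0 ?exprn_gt0//.
  rewrite -exprVn -exprMn; apply: lerXn2r; rewrite ?nnegrE ?mulr_ge0 ?invr_ge0 ?(ltW s0) ?(ltW s1)//.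
  by rewrite ler_pdivrMl// -natrM ler_nat.
have c6 : (csize K Q)%:R ^- n <= 2 ^+ n * (csize K Q)%:R ^- n :> R.
  by rewrite ler_peMl ?(ltW (sizeQ_gt0 _ _))// exprn_ege1// ler1n.
have c7 := sizeQ_gt0 (R := R) K Q.
rewrite /cstep exprS -mulrA; move: c1 c2 c3 c4 c5 c6 c7.
move: (cavg K _ Q) (cavg K _ (cnext _ _ _)) ((csize K Q)%:R ^- n) ((csize K (cnext Q0 p Q))%:R ^- n) => a b s s'.
set X := 2 ^+ n * s => c1 c2 c3 c4 c5 c6 c7.
case: eqP => _; rewrite ?mul1r ?mul0r ler_norml; last by apply/andP; split; lra.
by case: eqP => _ /=; apply/andP; split; lra.
Qed.

End step_pairing.

Lemma corner_arith {R : realFieldType} (x y z M r b : R) : z <= y -> y < z + M ->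
  - r <= x - y -> x - y <= r -> r <= b -> (- (b + M) <= x - z) && (x - z <= b + M).
Proof. by move=> *; apply/andP; split; lra. Qed.

Lemma same_cell_arith {R : realFieldType} (y y' z M : R) : z <= y -> y < z + M ->
  z <= y' -> y' < z + M -> `|y' - y| <= M.
Proof. by move=> *; rewrite ler_norml; apply/andP; split; lra. Qed.

Lemma chain_dist_arith {R : realFieldType} (a b c r s t : R) :
  a <= b + c -> b <= r -> c <= s -> t = r + s -> a <= t.
Proof. by move=> *; lra. Qed.

Section whitney_decomposition.
Context {R : realType} {n : nat}.
Variables (Omega : set 'rV[R]_n) (D : R).
Local Notation pt := {ffun 'I_n -> int}.
Local Notation cube := (nat * {ffun 'I_n -> int})%type.
Local Notation d := (dist_bd Omega).
Local Notation A := (@whitney_ratio R n).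
Local Notation mesh := (mesh D).
Local Notation wcube := (wcube Omega D).
Local Notation delta z := (fun a : pt => (z == a)%:R : R).
Hypothesis oO : open Omega.
Hypothesis bd0 : boundary Omega !=set0.
Hypothesis D0 : 0 < D.
Hypothesis hD : forall x, Omega x -> d x <= D.
Variables (c1 : R) (x0 : 'rV[R]_n).
Hypothesis c1p : 1 <= c1.
Hypothesis hchain : chainable Omega c1 x0.
Variables (lambda C0 : R).
Hypothesis l0 : 0 <= lambda.
Hypothesis C00 : 0 < C0.
Hypothesis hA : forall r s : R, 0 < r -> r < s ->
  (ereal_sup [set covering_number r (eball x s `&` boundary Omega) | x in boundary Omega] <=
          (C0 * (s / r) `^ lambda)%:E)%E.
Variables (q e gamma kap : R).
Hypothesis q1 : 1 < q.
Hypothesis kap0 : 0 < kap.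
Hypothesis lg : lambda < n%:R + gamma.
Hypothesis egk : e + gamma * (q - 1) = - kap.

(** At most one [m] equals [z], so the power enters the sum with constant 1. *)
Lemma powR_pick_le (s : seq pt) (P : pred pt) (a : pt -> R) z : uniq s -> (forall m, 0 <= a m) ->
  (\sum_(m <- s | P m) a m * (z == m)%:R) `^ q <= \sum_(m <- s | P m) a m `^ q * (z == m)%:R.
Proof.
move=> us a0; have E (b : pt -> R) : \sum_(m <- s | P m) b m * (z == m)%:R = \sum_(m <- s | P m && (z == m)) b m.
  rewrite big_mkcondr; apply: eq_bigr => m _; by case: eqP => _; rewrite ?mulr1 ?mulr0.
rewrite !E; apply: le_trans (powR_sum_le s q1 (fun m _ => a0 m)) _.
apply: ler_piMl; first by apply: sumr_ge0 => *; exact: powR_ge0.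
have h : (count (fun m => P m && (z == m)) s <= 1)%N.
  apply: (@leq_trans (count (pred1 z) s)); last by rewrite count_uniq_mem// leq_b1.
  by apply: sub_count => m /= /andP[_]; rewrite eq_sym.
apply: (@le_trans _ _ (1 `^ (q - 1))); last by rewrite powR1.
by apply: ge0_ler_powR; rewrite ?nnegrE ?subr_ge0 ?(ltW q1)// lern1.
Qed.

Lemma bump_sum_bound (V : finType) (F : V -> R) (X1 Y G : R) : 0 < Y -> 0 <= G ->
  #|V|%:R <= 64 ^+ n * Y -> (forall v, 0 <= F v) ->
  \sum_v F v `^ q <= X1 ->
  \sum_v (F v + 2 ^+ n.+1 * Y^-1 * G) `^ q <=
  2 `^ (q - 1) * X1 + 2 `^ (q - 1) * (64 ^+ n * (2 ^+ n.+1) `^ q) * (Y `^ (1 - q) * G `^ q).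
Proof.
move=> Y0 G0 cV F0 hF; have Yi : 0 <= Y^-1 by rewrite invr_ge0 ltW.
have t0 : 0 <= 2 ^+ n.+1 :> R by rewrite exprn_ge0.
have b0 : 0 <= 2 ^+ n.+1 * Y^-1 * G by rewrite !mulr_ge0.
apply: (@le_trans _ _ (\sum_v 2 `^ (q - 1) * (F v `^ q + (2 ^+ n.+1 * Y^-1 * G) `^ q))).
  by apply: ler_sum => v _; exact: powR_add_le.
rewrite -mulr_sumr big_split/= sumr_const mulrDr -[X in _ <= _ + X]mulrA; apply: lerD.
  by apply: ler_wpM2l; rewrite ?powR_ge0.
apply: ler_wpM2l; rewrite ?powR_ge0// -[_ *+ _]mulr_natl.
rewrite !powRM ?mulr_ge0//.
apply: (@le_trans _ _ ((64 ^+ n * Y) * ((2 ^+ n.+1) `^ q * Y^-1 `^ q * G `^ q))).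
  by apply: ler_wpM2r => //; rewrite !mulr_ge0 ?powR_ge0.
rewrite -[in X in X <= _](powR_inv1 (ltW Y0)) -powRrM mulN1r.
rewrite powRD ?(gt_eqF Y0) ?implybT// powRr1 ?(ltW Y0)//.
by rewrite le_eqVlt; apply/orP; left; apply/eqP; ring.
Qed.

(** Jensen with weights [dd ^ gamma], whose sum is the hypothesis. The relation
    [e + gamma * (q - 1) = - kap] is what makes the powers of [M] and [dd] combine into
    [(dd / M) ^ kap]. *)
Lemma hardy_step (s : seq pt) (P : pred pt) (a dd : pt -> R) (M Y CK : R) :
  (forall m, 0 <= a m) -> (forall m, P m -> 0 < dd m) -> 0 < M -> 0 < Y -> 0 < CK ->
  \sum_(m <- s | P m) dd m `^ gamma <= CK * (M `^ gamma * Y) ->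
  M `^ e * (Y `^ (1 - q) * (\sum_(m <- s | P m) a m) `^ q) <=
  \sum_(m <- s | P m) CK `^ (q - 1) * ((a m `^ q * dd m `^ e) * (dd m / M) `^ kap).
Proof.
move=> a0 d0 M0 Y0 CK0 hs; have qm : 0 <= q - 1 by have := q1; lra.
have -> : \sum_(m <- s | P m) a m = \sum_(m <- s | P m) dd m `^ gamma * (a m * dd m `^ (- gamma)).
  apply: eq_bigr => m Pm; rewrite mulrCA -powRD ?(gt_eqF (d0 m Pm)) ?implybT//.
  by rewrite subrr powRr0 mulr1.
have J := @powR_jensen R _ s P (fun m => dd m `^ gamma) (fun m => a m * dd m `^ (- gamma)) q q1
   (fun m _ => powR_ge0 _ _) (fun m _ => mulr_ge0 (a0 m) (powR_ge0 _ _)).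
have h1 : (\sum_(m <- s | P m) dd m `^ gamma) `^ (q - 1) <= (CK * (M `^ gamma * Y)) `^ (q - 1).
  apply: ge0_ler_powR => //; rewrite nnegrE; first by apply: sumr_ge0 => *; exact: powR_ge0.
  by rewrite !mulr_ge0 ?powR_ge0 ?ltW.
have S0 : 0 <= \sum_(m <- s | P m) dd m `^ gamma * (a m * dd m `^ (- gamma)) `^ q.
  by apply: sumr_ge0 => m _; rewrite mulr_ge0 ?powR_ge0.
have {}J := le_trans J (ler_wpM2r S0 h1).
apply: le_trans (ler_wpM2l (powR_ge0 _ _) (ler_wpM2l (powR_ge0 _ _) J)) _.
rewrite !mulr_sumr le_eqVlt; apply/orP; left; apply/eqP; apply: eq_bigr => m Pm.
have dm := d0 m Pm; have a0m := a0 m.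
rewrite !powRM ?mulr_ge0 ?powR_ge0 ?invr_ge0 ?(ltW M0) ?(ltW Y0) ?(ltW CK0) ?(ltW dm)//.
rewrite -!powRrM -[M^-1](powR_inv1 (ltW M0)) -powRrM mulN1r.
have E1 : M `^ e * M `^ (gamma * (q - 1)) = M `^ (- kap).
  by rewrite -powRD ?(gt_eqF M0) ?implybT// egk.
have E2 : Y `^ (1 - q) * Y `^ (q - 1) = 1.
  by rewrite -powRD ?(gt_eqF Y0) ?implybT// subrKA subrr powRr0.
have E3 : dd m `^ gamma * dd m `^ (- gamma * q) = dd m `^ e * dd m `^ kap.
  rewrite -!powRD ?(gt_eqF dm) ?implybT//; congr (_ `^ _); have := egk; lra.
transitivity ((M `^ e * M `^ (gamma * (q - 1))) * (Y `^ (1 - q) * Y `^ (q - 1)) * CK `^ (q - 1) * a m `^ q *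
  (dd m `^ gamma * dd m `^ (- gamma * q))); first by ring.
by rewrite E1 E2 E3; ring.
Qed.

Lemma big_chain_sub (T P : seq cube) (F : cube -> R) : uniq T -> uniq P -> {subset P <= T} ->
  \sum_(Q <- T | Q \in P) F Q = \sum_(Q <- P) F Q.
Proof.
move=> uT uP sub; rewrite -big_filter; apply: perm_big; apply: uniq_perm => //.
  exact: filter_uniq.
by move=> Q; rewrite mem_filter andb_idr//; exact: sub.
Qed.

(** [f Q] superposes the steps that all chains make at [Q]. Point masses occur only at the head of a
    chain, whence two bounds: [E1] for these, which is local, and [E2] for [GQ Q], the total mass
    crossing [Q], where [hardy_step] and then [chain_sum] are applied. The lower bound on [d] in
    terms of [mesh K] keeps every cube of every chain at level at most [K]. *)
Theorem decomposition : exists2 C, 0 < C & forall K (s : seq pt) (c : pt -> R), uniq s ->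
  (forall m, m \in s -> Omega (lattice_pt (mesh K) m) /\ 2 * c1 * A * mesh K <= d (lattice_pt (mesh K) m)) ->
  \sum_(m <- s) c m = 0 ->
  exists (T : seq cube) (f : forall Q, {ffun 'I_n -> 'I_(tsize K Q).+1} -> R),
  [/\ uniq T, forall Q, Q \in T -> (Q.1 <= K)%N /\ exists2 y, Omega y & Q = wcube y,
    forall Q, Q \in T -> \sum_v f Q v = 0 /\
      forall v : {ffun 'I_n -> 'I_(tsize K Q).+1},
        ~~ [forall j, (3 * (8 * csize K Q) <= v j < 4 * (8 * csize K Q))%N] -> f Q v = 0,
    forall G : pt -> R, \sum_(Q <- T) \sum_v f Q v * G (tshift v) = \sum_(m <- s) c m * G m &
    \sum_(Q <- T) mesh Q.1 `^ e * lrpow q (f Q) <=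
      C * \sum_(m <- s) `|c m| `^ q * d (lattice_pt (mesh K) m) `^ e].
Proof.
have Age : 100 <= A by exact: whitney_ratio_ge.
have A0 : 0 < A by lra.
have A1 : 1 <= A by lra.
have A2 : 1 <= 2 * A by lra.
have c0 : 0 < c1 by have := c1p; lra.
pose B0' := 2 * A * c1.
pose B := B0' + n%:R.
have B00 : 0 < B0' by rewrite !mulr_gt0.
have B0 : 0 < B by rewrite ltr_wpDr.
have B01 : 1 <= B0' by rewrite /B0' -[1]mulr1; apply: ler_pM => //; lra.
have B1 : 1 <= B by apply: le_trans B01 _; rewrite lerDl.
have [K1 K10 hW] := whitney_sum bd0 l0 C00 hA lg.
have BB1 : 1 <= B + 1 by lra.
have [C2 C20 hCS] := @chain_sum R n D D0 kap (B + 1) kap0 BB1.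
pose CK := K1 * (B `^ gamma * B ^+ n).
have CK0 : 0 < CK by rewrite !mulr_gt0 ?powR_gt0 ?exprn_gt0.
pose a1 : R := 2 `^ (q - 1).
pose a2 : R := 2 `^ (q - 1) * (64 ^+ n * (2 ^+ n.+1) `^ q).
pose ce' : R := ((2 `^ `|e|) * (2 * A) `^ `|e|).
have a10 : 0 < a1 by rewrite powR_gt0.
have a20 : 0 < a2 by rewrite !mulr_gt0 ?powR_gt0 ?exprn_gt0.
have ce0 : 0 < ce' by rewrite mulr_gt0 ?powR_gt0// mulr_gt0.
exists (a1 * ce' + a2 * (CK `^ (q - 1) * C2)).
  by apply: addr_gt0; rewrite mulr_gt0// mulr_gt0// powR_gt0.
move=> K s c us hs sc; pose x (m : pt) := lattice_pt (mesh K) m.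
have mK := mesh_gt0 D0 K.
have H m : exists p : seq cube, m \in s ->
  [/\ uniq (wcube (x m) :: p), path (@adjacent R n D) (wcube (x m)) p, last (wcube (x m)) p = wcube x0 &
   forall Q, Q \in wcube (x m) :: p -> exists y,
    [/\ Omega y, Q = wcube y, fnorm (x m - y) <= c1 * d y & d (x m) <= c1 * d y]].
  have [ms|nms] := boolP (m \in s); last by exists [::].
  have [Om _] := hs m ms.
  by have [p hp] := whitney_chain oO bd0 D0 hD c1p hchain Om; exists p.
have [ch hch] := choice H.
pose P m := wcube (x m) :: ch m.
have lev m Q : m \in s -> Q \in P m -> (Q.1 <= K)%N.
  move=> ms QP; have [_ _ _ /(_ Q QP)[y [Oy -> _ h]]] := hch m ms.
  have [_ h2] := hs m ms; have /andP[_ h3] := kappaP oO bd0 D0 hD Oy.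
  rewrite -[K]addn0 -[(wcube y).1]/(kappa Omega D y); apply: (mesh_lt_leq D0); rewrite expr1.
  have my := mesh_gt0 D0 (kappa Omega D y).
  have h4 : 2 * c1 * A * mesh K < c1 * (2 * A * mesh (kappa Omega D y)).
    by apply: le_lt_trans h2 _; apply: le_lt_trans h _; rewrite ltr_pM2l.
  have : (2 * c1 * A) * mesh K < (2 * c1 * A) * mesh (kappa Omega D y) by lra.
  rewrite ltr_pM2l; last by rewrite !mulr_gt0.
  lra.
have own m : m \in s -> window K (wcube (x m)) m.
  move=> ms; apply: (own_window D0); apply: (lev m (wcube (x m)) ms); exact: mem_head.
pose f Q (v : {ffun 'I_n -> 'I_(tsize K Q).+1}) :=
  \sum_(m <- s | Q \in P m) c m * cstep (delta (tshift v)) K m (wcube (x m)) (ch m) Q.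
pose T := undup (flatten (map P s)).
have uT : uniq T by exact: undup_uniq.
have memT Q : Q \in T -> exists2 m, m \in s & Q \in P m.
  by rewrite mem_undup => /flattenP[p /mapP[m ms ->] Qp]; exists m.
have subT m : m \in s -> {subset P m <= T}.
  by move=> ms Q Qp; rewrite mem_undup; apply/flattenP; exists (P m) => //; exact: map_f.
have fG (G : pt -> R) Q : \sum_v f Q v * G (tshift v) =
    \sum_(m <- s | Q \in P m) c m * cstep G K m (wcube (x m)) (ch m) Q.
  rewrite /f; under eq_bigr do rewrite mulr_suml.
  rewrite exchange_big/= big_seq_cond [RHS]big_seq_cond; apply: eq_bigr => m /andP[ms QP].
  have [_ pp _ _] := hch m ms.
  rewrite -(sum_cstep_tshift D0 pp (fun Q => lev m Q ms) (own m ms) G QP) mulr_sumr.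
  by apply: eq_bigr => v _; rewrite mulrA.
exists T, f; split => //.
- move=> Q /memT[m ms QP]; split; first exact: lev ms QP.
  by have [_ _ _ /(_ Q QP)[y [Oy -> _ _]]] := hch m ms; exists y.
- move=> Q /memT[m0 m0s QP0]; split.
    have := fG (fun=> 1) Q; under eq_bigr do rewrite mulr1.
    by move=> ->; rewrite big1// => m _; rewrite cstep_cst mulr0.
  move=> v hv; rewrite /f big_seq_cond big1// => m /andP[ms QP].
  have [_ pp _ _] := hch m ms.
  rewrite (cstep_delta0 D0 pp (fun Q => lev m Q ms) (own m ms) QP) ?mulr0//.
  by rewrite tshift_window; exact/negP.
(* All masses end uniformly spread over the cube of [x0], where they cancel because [c] has sum
   zero. *)
- move=> G; under eq_bigr do rewrite fG.
  rewrite (exchange_big_dep xpredT)//=.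
  transitivity (\sum_(m <- s) (c m * G m - c m * cavg K G (wcube x0))).
    rewrite big_seq [RHS]big_seq; apply: eq_bigr => m ms.
    have [um _ lm _] := hch m ms.
    by rewrite -mulr_sumr (big_chain_sub _ uT um (subT m ms)) sum_cstep// lm mulrBr.
  by rewrite sumrB -mulr_suml sc mul0r subr0.
pose GQ Q := \sum_(m <- s | Q \in P m) `|c m|.
have G0 Q : 0 <= GQ Q by apply: sumr_ge0.
pose Y (Q : cube) : R := (csize K Q)%:R ^+ n.
have Y0 Q : 0 < Y Q by rewrite exprn_gt0// ltr0n csize_gt0.
pose S1 Q := \sum_(m <- s | Q == wcube (x m)) `|c m| `^ q.
have fQ Q : Q \in T -> lrpow q (f Q) <= a1 * S1 Q + a2 * (Y Q `^ (1 - q) * GQ Q `^ q).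
  move=> QT; pose F (v : {ffun 'I_n -> 'I_(tsize K Q).+1}) := \sum_(m <- s | Q == wcube (x m)) `|c m| * (tshift v == m)%:R.
  have F0 v : 0 <= F v by apply: sumr_ge0 => m _; rewrite mulr_ge0.
  apply: (@le_trans _ _ (\sum_v (F v + 2 ^+ n.+1 * (Y Q)^-1 * GQ Q) `^ q)).
    apply: ler_sum => v _; apply: ge0_ler_powR; rewrite ?nnegrE//; first exact: ltW (lt_trans ltr01 q1).
      by rewrite addr_ge0// !mulr_ge0 ?invr_ge0 ?(ltW (Y0 Q))// exprn_ge0.
    apply: le_trans (ler_norm_sum _ _ _) _; rewrite /F /GQ mulr_sumr.
    have -> : \sum_(m <- s | Q == wcube (x m)) `|c m| * (tshift v == m)%:R =
      \sum_(m <- s | Q \in P m) `|c m| * ((Q == wcube (x m))%:R * (tshift v == m)%:R).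
      rewrite big_mkcond [RHS]big_mkcond; apply: eq_bigr => m _; rewrite /P inE.
      by case: eqP => _ /=; rewrite ?mul1r// mul0r mulr0 if_same.
    rewrite -big_split/= big_seq_cond [leRHS]big_seq_cond; apply: ler_sum => m /andP[ms QP].
    have [_ pp _ _] := hch m ms.
    rewrite normrM [2 ^+ n.+1 * _ * _]mulrC -mulrDr; apply: ler_wpM2l => //.
    by have := @cstep_delta_le R n D K m (wcube (x m)) (ch m) D0 pp (fun Q => lev m Q ms) Q (tshift v) QP.
  apply: bump_sum_bound => //.
  - rewrite card_ffun !card_ord tsizeS natrX /Y mulnA -exprMn natrM.
    by rewrite le_eqVlt eqxx.
  - apply: (@le_trans _ _ (\sum_v \sum_(m <- s | Q == wcube (x m)) `|c m| `^ q * (tshift (K := K) (Q := Q) v == m)%:R)).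
      by apply: ler_sum => v _; exact: powR_pick_le.
    rewrite exchange_big/=; apply: ler_sum => m _; rewrite -mulr_sumr.
    by apply: ler_piMr; [exact: powR_ge0|exact: sum_tshift_le].
pose t m := `|c m| `^ q * d (x m) `^ e.
have t0 m : 0 <= t m by rewrite mulr_ge0 ?powR_ge0.
have dx m : m \in s -> 0 < d (x m) by move=> /hs[Om _]; exact: dist_bd_gt0.
have E1 : \sum_(Q <- T) mesh Q.1 `^ e * S1 Q <= ce' * \sum_(m <- s) t m.
  under eq_bigr do rewrite mulr_sumr.
  rewrite (exchange_big_dep xpredT)//= mulr_sumr big_seq [leRHS]big_seq; apply: ler_sum => m ms.
  have WT : wcube (x m) \in T by apply: (subT m ms); exact: mem_head.
  have -> : \sum_(Q <- T | Q == wcube (x m)) mesh Q.1 `^ e * `|c m| `^ q = mesh (kappa Omega D (x m)) `^ e * `|c m| `^ q.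
    by rewrite -big_filter filter_pred1_uniq// big_seq1.
  rewrite /t mulrC mulrCA; apply: ler_wpM2l; first exact: powR_ge0.
  have [Om _] := hs m ms; have /andP[k1 k2] := kappaP oO bd0 D0 hD Om.
  set M := mesh (kappa Omega D (x m)); have M0 : 0 < M by exact: mesh_gt0.
  rewrite -/M in k1 k2; have dm := dx m ms.
  have h1 : (A * M) `^ e <= 2 `^ `|e| * d (x m) `^ e.
    by apply: powR_comparable => //; rewrite mulrA ltW.
  rewrite powRM ?(ltW A0) ?(ltW M0)// in h1.
  have Ae : 0 < A `^ e by exact: powR_gt0.
  rewrite -(ler_pM2l Ae); apply: le_trans h1 _.
  rewrite (_ : A `^ e * (ce' * d (x m) `^ e) = 2 `^ `|e| * d (x m) `^ e * (A `^ e * (2 * A) `^ `|e|)); last by rewrite /ce'; ring.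
  rewrite ler_peMr ?mulr_ge0 ?powR_ge0//.
  have [e0|e0] := lerP 0 e.
    exact: (mulr_ege1 (powR_ge1 A1 e0) (powR_ge1 A2 (normr_ge0 e))).
  rewrite (ltr0_norm e0) [(2 * A) `^ _]powRM ?(ltW A0)// mulrCA -powRD ?(gt_eqF A0) ?implybT//.
  rewrite subrr powRr0 mulr1; apply: powR_ge1; last by rewrite oppr_ge0 ltW.
  by rewrite ler1n.
have E2 : \sum_(Q <- T) mesh Q.1 `^ e * (Y Q `^ (1 - q) * GQ Q `^ q) <= CK `^ (q - 1) * C2 * \sum_(m <- s) t m.
  apply: (@le_trans _ _ (\sum_(Q <- T) \sum_(m <- s | Q \in P m) CK `^ (q - 1) * (t m * (d (x m) / mesh Q.1) `^ kap))); last first.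
    rewrite (exchange_big_dep xpredT)//= mulr_sumr big_seq [leRHS]big_seq; apply: ler_sum => m ms.
    have [um _ _ hm] := hch m ms.
    rewrite (big_chain_sub _ uT um (subT m ms)) -mulr_sumr -mulrA; apply: ler_wpM2l; first exact: powR_ge0.
    rewrite -mulr_sumr [C2 * _]mulrC; apply: ler_wpM2l => //.
    apply: (hCS (P m) (x m) (d (x m)) um (dx m ms)) => Q QP.
    have [y [Oy -> h1 h2]] := hm Q QP; have /andP[k1 k2] := kappaP oO bd0 D0 hD Oy.
    rewrite -[(wcube y).1]/(kappa Omega D y) -[(wcube y).2]/(idx D (kappa Omega D y) y).
    set M := mesh (kappa Omega D y) in k1 k2 *; have M0 : 0 < M by exact: mesh_gt0.
    have h3 : c1 * d y <= B * M.
      apply: (@le_trans _ _ (B0' * M)); first by rewrite /B0' [2 * A * c1]mulrC -mulrA ler_pM2l// ltW.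
      by rewrite ler_pM2r// lerDl.
    split; first by rewrite mulrDl mul1r; apply: (le_trans _ (lerD h3 (lexx M))); apply: le_trans h2 _; rewrite lerDl ltW.
    move=> l; have /andP[i1 i2] := idx_bounds D0 (kappa Omega D y) y l.
    have := le_trans (fnorm_coord (x m - y) l) h1; rewrite !mxE ler_norml => /andP[j1 j2].
    by rewrite mulrDl mul1r ler_norml; exact: corner_arith i1 i2 j1 j2 h3.
  rewrite big_seq [leRHS]big_seq; apply: ler_sum => Q QT.
  have [m0 m0s QP0] := memT Q QT.
  have [_ _ _ /(_ Q QP0)[y [Oy Qy _ _]]] := hch m0 m0s.
  have /andP[k1 k2] := kappaP oO bd0 D0 hD Oy.
  set M := mesh Q.1; have M0 : 0 < M by exact: mesh_gt0.
  have {}k2 : d y < 2 * A * M by rewrite /M Qy.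
  have lQ := lev m0 Q m0s QP0.
  have MY : M / mesh K = (csize K Q)%:R.
    have -> : M = (csize K Q)%:R * mesh K by rewrite /M (mesh_add D _ (K - Q.1)) subnKC// natrX.
    by rewrite mulfK// gt_eqF.
  have dy0 : 0 < d y by exact: dist_bd_gt0.
  have BM : d y <= B * M.
    apply: (@le_trans _ _ (B0' * M)); last by rewrite ler_pM2r// lerDl.
    have : 2 * A * M <= B0' * M by rewrite ler_pM2r// /B0' ler_peMr// mulr_ge0// ltW.
    exact: le_trans (ltW k2).
  have sumG : \sum_(m <- s | Q \in P m) d (x m) `^ gamma <= CK * (M `^ gamma * Y Q).
    rewrite -big_filter; apply: le_trans (hW _ (mesh K) (B * M) y (filter_uniq _ us) mK _ BM _) _.
    - by rewrite mulr_gt0.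
    - move=> m; rewrite mem_filter => /andP[QP ms]; have [_ h6] := hs m ms.
      have [_ _ _ /(_ Q QP)[y' [Oy' Qy' h4 h5]]] := hch m ms.
      have /andP[_ k4] := kappaP oO bd0 D0 hD Oy'.
      have {}k4 : d y' < 2 * A * M by rewrite /M Qy'.
      have h3 : c1 * d y' <= B0' * M by rewrite /B0' [2 * A * c1]mulrC -mulrA ler_pM2l// ltW.
      have yy' : fnorm (y' - y) <= n%:R * M.
        apply: fnorm_le => l; rewrite !mxE.
        have /andP[i1 i2] := idx_bounds D0 (kappa Omega D y) y l.
        have /andP[i3 i4] := idx_bounds D0 (kappa Omega D y') y' l.
        have eQ : wcube y = wcube y' by rewrite -Qy.
        have ek : kappa Omega D y' = kappa Omega D y by rewrite -[LHS]/((wcube y').1) -eQ.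
        have ei : idx D (kappa Omega D y') y' = idx D (kappa Omega D y) y.
          by rewrite -[LHS]/((wcube y').2) -eQ.
        rewrite ei ek in i3 i4; have Me : mesh (kappa Omega D y) = M by rewrite /M Qy.
        rewrite Me in i1 i2 i3 i4; exact: same_cell_arith i1 i2 i3 i4.
      have n0 : 0 <= n%:R * M by rewrite mulr_ge0// ltW.
      have tri := fnorm_trans (x m) y' y.
      have eB : B * M = B0' * M + n%:R * M by rewrite /B mulrDl.
      split; last exact: chain_dist_arith tri (le_trans h4 h3) yy' eB.
      rewrite -/(x m) in h6 *; apply/andP; split; last by rewrite eB; apply: le_trans (le_trans h5 h3) _; rewrite lerDl.
      by apply: le_trans h6; rewrite ler_peMl ?(ltW mK)// mulrAC.
    - rewrite -mulrA MY powRM ?(ltW B0) ?(ltW M0)// exprMn /CK /Y.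
      by rewrite le_eqVlt; apply/orP; left; apply/eqP; ring.
  rewrite /GQ [X in X `^ q]big_seq_cond [leRHS]big_seq_cond.
  rewrite big_seq_cond in sumG.
  apply: (hardy_step (dd := fun m => d (x m))) => //.
  by move=> m /andP[ms _]; exact: dx.
rewrite mulrDl -[a1 * ce' * _]mulrA -[a2 * _ * _]mulrA.
apply: (@le_trans _ _ (a1 * (\sum_(Q <- T) mesh Q.1 `^ e * S1 Q) + a2 * \sum_(Q <- T) mesh Q.1 `^ e * (Y Q `^ (1 - q) * GQ Q `^ q))).
  rewrite !mulr_sumr -big_split/= big_seq [leRHS]big_seq; apply: ler_sum => Q QT.
  apply: le_trans (ler_wpM2l (powR_ge0 _ _) (fQ Q QT)) _.
  by rewrite mulrDr le_eqVlt; apply/orP; left; apply/eqP; ring.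
exact: (lerD (ler_wpM2l (ltW a10) E1) (ler_wpM2l (ltW a20) E2)).
Qed.

End whitney_decomposition.

(** * Step functions *)

Section borel_space.
Context {R : realType} {n : nat}.
Local Notation mu := (@lebesgue_rV R n).
Local Notation cube := (nat * {ffun 'I_n -> int})%type.

Definition gcell (D : R) (Q : cube) : set 'rV[R]_n :=
  [set x | forall l, (Q.2 l)%:~R * mesh D Q.1 <= x ord0 l < (Q.2 l)%:~R * mesh D Q.1 + mesh D Q.1].

Lemma measurable_box (A : 'I_n -> set (measurableTypeR R)) : (forall i, measurable (A i)) ->
  measurable [set x : 'rV[R]_n | forall i, A i (x ord0 i)].
Proof.
move=> mA; rewrite (_ : [set x : 'rV[R]_n | _] = \bigcap_(i in [set: 'I_n])
      ((fun x : 'rV[R]_n => x ord0 i : measurableTypeR R) @^-1` A i)).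
  apply: fin_bigcap_measurable => // i _.
  by rewrite -[X in measurable X]setTI; exact: measurable_coor.
by apply/seteqP; split => x /= h i; [move=> _|]; exact: h.
Qed.

Lemma measurable_gcell D Q : measurable (gcell D Q).
Proof.
rewrite (_ : gcell D Q = [set x : 'rV[R]_n | forall i,
   `[(Q.2 i)%:~R * mesh D Q.1, (Q.2 i)%:~R * mesh D Q.1 + mesh D Q.1[%classic (x ord0 i)]).
  by apply: (@measurable_box (fun i => `[(Q.2 i)%:~R * mesh D Q.1, (Q.2 i)%:~R * mesh D Q.1 + mesh D Q.1[%classic)) => i; exact: measurable_itv.
by apply/seteqP; split => x /= h l; have := h l; rewrite /= in_itv.
Qed.

Lemma gcell_idx D k x : 0 < D -> gcell D (k, idx D k x) x.
Proof. by move=> D0 l; exact: idx_bounds. Qed.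

Lemma gcell_dist D Q x y : gcell D Q x -> gcell D Q y -> fnorm (x - y) <= n%:R * mesh D Q.1.
Proof.
move=> hx hy; apply: fnorm_le => l; rewrite !mxE.
have /andP[a1 a2] := hx l; have /andP[b1 b2] := hy l.
by move: a1 a2 b1 b2; set z := _ * _ => *; rewrite ler_norml; apply/andP; split; lra.
Qed.

(** The sigma-algebra is the one generated by coordinates, so an open set is exhibited as the
    countable union of the dyadic cells that it contains, enumerated through [unpickle]. *)
Lemma open_measurable_rV (U : set 'rV[R]_n) : open U -> measurable U.
Proof.
move=> oU; have D0 : 0 < 1 :> R by [].
rewrite (_ : U = \bigcup_i (if (unpickle i : option cube) is Some Q then
    if `[< gcell 1 Q `<=` U >] then gcell 1 Q else set0 else set0)).
  apply: bigcupT_measurable => i; case: (unpickle i : option cube) => [Q|] //.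
  by case: ifP => _ //; exact: measurable_gcell.
apply/seteqP; split => x; last first.
  move=> [i _]; case: (unpickle i : option cube) => [Q|] //.
  by case: ifPn => // /asboolP h /h.
move=> Ux; have [e e0 he] := open_fnorm oU Ux.
pose k := (Num.truncn ((n%:R + 1) / e)).+1.
have hk : n%:R * mesh 1 k < e.
  have h1 : (n%:R + 1) / e < 2 ^+ k.
    by apply: lt_trans (truncnS_gt _) _; rewrite -natrX ltr_nat ltn_expl.
  rewrite /mesh mul1r ltr_pdivrMr ?exprn_gt0// mulrC.
  by move: h1; rewrite ltr_pdivrMr//; lra.
exists (pickle ((k, idx 1 k x) : cube)) => //; rewrite pickleK ifT; first exact: gcell_idx.
apply/asboolP => y hy; apply: he; apply: le_lt_trans hk.
by apply: gcell_dist hy _; exact: gcell_idx.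
Qed.

Lemma continuous_measurable_rV (f : 'rV[R]_n -> R) : continuous f -> measurable_fun setT f.
Proof.
move=> cf; apply: (measurability _ (measurable_realfun.RGenOInfty.measurableE R)).
move=> _ [_ [r ->] <-]; rewrite setTI; apply: open_measurable_rV.
by apply: open_comp => [x _|]; [exact: cf|exact: interval_open].
Qed.

Lemma smooth_differentiable (f : 'rV[R]_n -> R) x : smooth f -> differentiable (f : 'rV[R]_n -> R^o) x.
Proof. by move=> /(_ [::] x). Qed.

Lemma smooth_continuous (f : 'rV[R]_n -> R) : smooth f -> continuous f.
Proof. by move=> sf x; exact: differentiable_continuous (smooth_differentiable x sf). Qed.

Lemma smooth_partial (f : 'rV[R]_n -> R) i : smooth f -> smooth (partial i f).
Proof. by move=> sf s x; have := sf (rcons s i) x; rewrite foldr_rcons. Qed.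

Lemma partial_add (f g : 'rV[R]_n -> R) i : (forall x, differentiable (f : 'rV[R]_n -> R^o) x) ->
  (forall x, differentiable (g : 'rV[R]_n -> R^o) x) ->
  partial i (fun x => f x + g x) = (fun x => partial i f x + partial i g x).
Proof.
move=> df dg; apply/funext => x; rewrite /partial.
by apply: deriveD; apply: diff_derivable.
Qed.

Lemma smooth_add (f g : 'rV[R]_n -> R) : smooth f -> smooth g -> smooth (fun x => f x + g x).
Proof.
move=> sf sg s x; suff -> : foldr partial (fun x => f x + g x) s =
    (fun x => foldr partial f s x + foldr partial g s x).
  by apply: differentiableD; [exact: sf|exact: sg].
elim: s => //= i s ->; apply: partial_add; [exact: sf|exact: sg].
Qed.

Lemma smooth0 : smooth ((fun=> 0) : 'rV[R]_n -> R).
Proof. by apply: smooth_gen_smooth; exact: smooth_gen_cst. Qed.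

Variable Omega : set 'rV[R]_n.

Lemma test_fun0 : test_fun Omega (fun=> 0).
Proof.
have -> : test_fun Omega (fun=> 0) = [/\ smooth ((fun=> 0) : 'rV[R]_n -> R), compact (@set0 'rV[R]_n) & set0 `<=` Omega].
  rewrite /test_fun /= (_ : [set x : 'rV[R]_n | (0 : R) != 0] = set0) ?closure0//.
  by apply/seteqP; split => x //=; rewrite eqxx.
by split; [exact: smooth0|exact: compact0|].
Qed.

Lemma test_fun_sub (f : 'rV[R]_n -> R) B : smooth f -> compact B -> closed B -> B `<=` Omega ->
  (forall x, f x != 0 -> B x) -> test_fun Omega f.
Proof.
move=> sf cB clB BO fB; have h : closure [set x | f x != 0] `<=` B.
  by move/closure_id : clB => ->; exact: closureS.
split => //; last exact: subset_trans h BO.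
by apply: subclosed_compact cB h; exact: closed_closure.
Qed.

Lemma test_fun_add f g : test_fun Omega f -> test_fun Omega g -> test_fun Omega (fun x => f x + g x).
Proof.
move=> [sf cf fO] [sg cg gO].
apply: (@test_fun_sub _ (closure [set x | f x != 0] `|` closure [set x | g x != 0])).
- exact: smooth_add.
- exact: compactU.
- by apply: closedU; exact: closed_closure.
- by move=> x [/fO|/gO].
- move=> x; have [-> h|h _] := eqVneq (f x) 0; last by left; exact: subset_closure.
  by right; apply: subset_closure; move: h; rewrite /= add0r.
Qed.

Lemma test_fun_sum I (s : seq I) (F : I -> 'rV[R]_n -> R) : (forall i, test_fun Omega (F i)) ->
  test_fun Omega (fun x => \sum_(i <- s) F i x).
Proof.
move=> h; elim: s => [|i s IH].
  rewrite (_ : (fun x => _) = (fun=> 0)); first exact: test_fun0.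
  by apply/funext => x; rewrite big_nil.
rewrite (_ : (fun x => _) = (fun x => F i x + \sum_(j <- s) F j x)).
  exact: test_fun_add.
by apply/funext => x; rewrite big_cons.
Qed.

Lemma partial_sum I (s : seq I) (F : I -> 'rV[R]_n -> R) j : (forall i, smooth (F i)) ->
  partial j (fun x => \sum_(i <- s) F i x) = (fun x => \sum_(i <- s) partial j (F i) x).
Proof.
move=> h; elim: s => [|i s IH].
  rewrite (_ : (fun x => _) = (fun=> 0)); last by apply/funext => x; rewrite big_nil.
  by apply/funext => x; rewrite big_nil /partial; exact: derive_cst.
have hs : smooth (fun x => \sum_(j <- s) F j x).
  elim: (s) => [|i' s' IH'].
    rewrite (_ : (fun x => _) = (fun=> 0)); first exact: smooth0.
    by apply/funext => x; rewrite big_nil.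
  rewrite (_ : (fun x => _) = (fun x => F i' x + \sum_(j <- s') F j x)); first exact: smooth_add.
  by apply/funext => x; rewrite big_cons.
rewrite (_ : (fun x => _) = (fun x => F i x + \sum_(j <- s) F j x)); last by apply/funext => x; rewrite big_cons.
rewrite partial_add ?IH; try by move=> x; exact: smooth_differentiable.
by apply/funext => x; rewrite big_cons.
Qed.

Lemma compact_box (a b : 'I_n -> R) : compact [set x : 'rV[R]_n | forall l, a l <= x ord0 l <= b l].
Proof.
rewrite (_ : [set x | _] = [set x : 'rV[R]_n | forall l, `[a l, b l]%classic (x ord0 l)]).
  by apply: (@rV_compact R n (fun l => `[a l, b l]%classic)) => l; exact: segment_compact.
by apply/seteqP; split => x /= h l; have := h l; rewrite /= in_itv.
Qed.

Lemma norm_box_closed (a b : 'I_n -> R) : closed [set x : 'rV[R]_n | forall l, a l <= x ord0 l <= b l].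
Proof.
apply: compact_closed; last exact: compact_box.
exact: norm_hausdorff.
Qed.

Lemma lebesgue_cube (a : 'I_n -> R) (r : R) : 0 <= r ->
  mu [set x : 'rV[R]_n | forall l, a l <= x ord0 l <= a l + r] = (r ^+ n)%:E.
Proof.
move=> r0; rewrite (_ : [set x | _] = [set x : 'rV[R]_n | forall l, `[a l, a l + r]%classic (x ord0 l)]); last first.
  by apply/seteqP; split => x /= h l; have := h l; rewrite /= in_itv.
rewrite (@lebesgue_rV_box R n (fun l => `[a l, a l + r]%classic)); last by move=> i; exact: measurable_itv.
rewrite (eq_bigr (fun=> r%:E)) ?prodEFin ?prodr_const ?card_ord// => i _.
rewrite lebesgue_measure_itv/= lte_fin; case: ltrP => h; first by rewrite -EFinB addrC addKr.
by congr (_%:E); lra.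
Qed.

Lemma lebesgue_gcell D Q : 0 < D -> mu (gcell D Q) = (mesh D Q.1 ^+ n)%:E.
Proof.
move=> D0; have m0 := mesh_gt0 D0 Q.1.
rewrite (_ : gcell D Q = [set x : 'rV[R]_n | forall i,
   `[(Q.2 i)%:~R * mesh D Q.1, (Q.2 i)%:~R * mesh D Q.1 + mesh D Q.1[%classic (x ord0 i)]); last first.
  by apply/seteqP; split => x /= h l; have := h l; rewrite /= in_itv.
rewrite (@lebesgue_rV_box R n (fun i => `[(Q.2 i)%:~R * mesh D Q.1, (Q.2 i)%:~R * mesh D Q.1 + mesh D Q.1[%classic)); last by move=> i; exact: measurable_itv.
rewrite (eq_bigr (fun=> (mesh D Q.1)%:E)) ?prodEFin ?prodr_const ?card_ord// => i _.
by rewrite lebesgue_measure_itv/= lte_fin ltrDl m0 -EFinB addrC addKr.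
Qed.

End borel_space.

Section weighted_integral.
Context {R : realType} {n : nat}.
Local Notation mu := (@lebesgue_rV R n).

(** The [q]-th power of [wnorm], an integral and hence additive; roots are taken only at the end. *)
Definition weighted_int (Omega : set 'rV[R]_n) (q : R) (w f : 'rV[R]_n -> R) : \bar R :=
  (\int[mu]_(x in Omega) (`|f x| `^ q * w x)%:E)%E.

End weighted_integral.

(** * Smooth fields for step data *)

Section step_solution.
Context {R : realType} {n : nat}.
Variables (Omega : set 'rV[R]_n) (D : R).
Local Notation mu := (@lebesgue_rV R n).
Local Notation pt := {ffun 'I_n -> int}.
Local Notation cube := (nat * {ffun 'I_n -> int})%type.
Local Notation d := (dist_bd Omega).
Local Notation A := (@whitney_ratio R n).
Local Notation mesh := (mesh D).
Local Notation wcube := (wcube Omega D).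
Hypothesis oO : open Omega.
Hypothesis bd0 : boundary Omega !=set0.
Hypothesis D0 : 0 < D.
Hypothesis hD : forall x, Omega x -> d x <= D.
Variables (q e : R).
Hypothesis q1 : 1 < q.
Local Notation w := (fun x => d x `^ e).

(** Contains the support of the smooth field built on the torus of [Q]: torus coordinates between
    [8 * csize Q] and [48 * csize Q + 4], recentred by [27 * csize Q], stay within 26 sides. *)
Definition region (Q : cube) (x : 'rV[R]_n) : bool :=
  [forall l, `|x ord0 l - (Q.2 l)%:~R * mesh Q.1| <= 26 * mesh Q.1].

(** A point of the region is at most [27 * n] sides from [y], which is below [27 * A / 100] sides;
    with [A <= d y / mesh < 2 * A] this gives 73 and 227. *)
Lemma region_near Q y x : Omega y -> Q = wcube y -> region Q x ->
  Omega x /\ 73 * A * mesh Q.1 <= 100 * d x <= 227 * A * mesh Q.1.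
Proof.
move=> Oy Qy /forallP hx; have /andP[k1 k2] := kappaP oO bd0 D0 hD Oy.
have Me : mesh (kappa Omega D y) = mesh Q.1 by rewrite Qy.
rewrite Me in k1 k2; set M := mesh Q.1 in hx k1 k2 *.
have M0 : 0 < M by exact: mesh_gt0.
have xy : fnorm (x - y) <= n%:R * (27 * M).
  apply: fnorm_le => l; rewrite !mxE; have := hx l.
  have /andP[i1 i2] := idx_bounds D0 (kappa Omega D y) y l.
  rewrite Me -/M in i1 i2; rewrite Qy /=; move: i1 i2; set zz := _%:~R * _ => i1 i2.
  by rewrite !ler_norml => /andP[j1 j2]; apply/andP; split; lra.
have An : 100 * n%:R * M <= A * M.
  by rewrite ler_pM2r// /whitney_ratio natrM ler_pM2l// ler_nat.
have A0 : 100 * M <= A * M by rewrite ler_pM2r// whitney_ratio_ge.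
have l1 := dist_bd_lip bd0 x y; have l2 := dist_bd_lip bd0 y x.
rewrite fnormB in l2.
split; last by apply/andP; split; lra.
by apply: (dist_bd_ball oO Oy); rewrite fnormB -/d; lra.
Qed.

Lemma region_weight : exists2 Cw, 0 < Cw & forall Q y x, Omega y -> Q = wcube y -> region Q x ->
  w x <= Cw * mesh Q.1 `^ e.
Proof.
have Age : 100 <= A by exact: whitney_ratio_ge.
exists ((3 * A) `^ e + (A / 2) `^ e).
  by rewrite addr_gt0// powR_gt0//; lra.
move=> Q y x Oy Qy rx; have [_ /andP[h1 h2]] := region_near Oy Qy rx.
set M := mesh Q.1 in h1 h2 *; have M0 : 0 < M by exact: mesh_gt0.
have AM : 0 < A * M by rewrite mulr_gt0//; lra.
have d0 : 0 < d x by lra.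
rewrite mulrDl -!powRM ?(ltW M0)//; try lra.
have [e0|e0] := lerP 0 e.
  apply: ler_wpDr; first exact: powR_ge0.
  by apply: ge0_ler_powR; rewrite ?nnegrE ?(ltW d0)//; lra.
apply: ler_wpDl; first exact: powR_ge0.
have b0 : 0 < A / 2 * M by lra.
rewrite -[e]opprK [leLHS]powRN [leRHS]powRN lef_pV2 ?posrE ?powR_gt0//.
by apply: ge0_ler_powR; rewrite ?nnegrE ?(ltW b0) ?(ltW d0)//; lra.
Qed.

Lemma succ_levels (a b : nat) : (a <= b)%N -> (b <= a + 1)%N -> (a == b) || (a == b.-1).
Proof. lia. Qed.

(** Cubes whose region contains [x] have their mesh within a factor [227 / 73 < 4] of each other,
    hence at most two levels; each level offers 53 positions per coordinate. *)
Lemma region_overlap (T : seq cube) x : uniq T ->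
  (forall Q, Q \in T -> exists2 y, Omega y & Q = wcube y) ->
  (count (region^~ x) T <= 2 * 53 ^ n)%N.
Proof.
move=> uT hT; rewrite -size_filter; set T' := [seq Q <- T | region Q x].
have uT' : uniq T' by exact: filter_uniq.
have hT' Q : Q \in T' -> region Q x /\ 73 * A * mesh Q.1 <= 100 * d x <= 227 * A * mesh Q.1.
  rewrite mem_filter => /andP[rx QT]; have [y Oy Qy] := hT Q QT.
  by have [_ h] := region_near Oy Qy rx.
case E : T' => [//|Q1 T'']; rewrite -E.
have [Qm QmT hm] := @max_level n T' Q1 ltac:(by rewrite E mem_head).
have cnt j : (count (fun Q => Q.1 == j) T' <= 53 ^ n)%N.
  rewrite -size_filter -(size_map snd).
  apply: (size_box_le (X := fun l => x ord0 l / mesh j + 26)).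
    rewrite map_inj_in_uniq ?filter_uniq// => -[a b] [a' b'].
    by rewrite !mem_filter /= => /andP[/eqP -> _] /andP[/eqP -> _] ->.
  move=> z /mapP[Q]; rewrite mem_filter => /andP[/eqP Qj QP] -> l.
  have [/forallP/(_ l) h _] := hT' Q QP; rewrite Qj ler_norml in h; move/andP: h => [h1 h2].
  have mj := mesh_gt0 D0 j.
  have e0 : x ord0 l / mesh j * mesh j = x ord0 l by rewrite divfK// gt_eqF.
  move: e0; set y := x ord0 l / _ => e0; apply/andP; split.
    by rewrite -(ler_pM2r mj); lra.
  by rewrite -(ler_pM2r mj); lra.
have lvl Q : Q \in T' -> (Q.1 == Qm.1) || (Q.1 == Qm.1.-1).
  move=> QT; have h := hm Q QT.
  have [_ /andP[a1 a2]] := hT' Q QT; have [_ /andP[b1 b2]] := hT' Qm QmT.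
  have A0 : 0 < A by have := @whitney_ratio_ge R n; lra.
  have mm := mesh_gt0 D0 Qm.1.
  have : mesh Q.1 < 2 ^+ 2 * mesh Qm.1.
    rewrite -(ltr_pM2l A0); have : 0 < A * mesh Qm.1 by rewrite mulr_gt0.
    lra.
  by move=> /(mesh_lt_leq D0); exact: succ_levels.
rewrite -(@count_predT _ T').
apply: (@leq_trans (count (fun Q => Q.1 == Qm.1) T' + count (fun Q => Q.1 == Qm.1.-1) T')%N).
  rewrite -count_predUI; apply: leq_trans (leq_addr _ _).
  rewrite -!size_filter -[X in (size X <= _)%N](_ : [seq Q <- T' | (Q.1 == Qm.1) || (Q.1 == Qm.1.-1)] = _) //.
  by apply: eq_in_filter => Q /lvl ->.
by rewrite mul2n -addnn; apply: leq_add.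
Qed.

Variables (rho : R -> R) (CL : R).
Hypothesis CL0 : 0 < CL.
(** The conclusion of [local_smooth], held fixed so that a single profile [rho] serves all cubes and
    the local divergences add up to one spline. *)
Hypothesis hloc : forall (N M : nat) (h : R) (o : 'I_n -> R) (f : {ffun 'I_n -> 'I_M.+1} -> R),
  (0 < N)%N -> M.+1 = (8 * N)%N -> 0 < h ->
  (forall x : {ffun 'I_n -> 'I_M.+1}, ~~ [forall j, (3 * N <= x j < 4 * N)%N] -> f x = 0) ->
  \sum_x f x = 0 ->
  exists (u : 'I_n -> 'rV[R]_n -> R) (A : {ffun 'I_n -> 'I_M.+1} -> R),
  [/\ forall i, smooth (u i),
      forall i x, u i x != 0 -> forall l, N%:R <= h^-1 * x ord0 l - o l <= (6 * N + 3)%:R,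
      forall x, \sum_i partial i (u i) x = \sum_v f v * \prod_l rho (pos_cell h o x v l),
      [/\ forall v, 0 <= A v, forall v, A v != 0 -> forall l, (N <= v l <= 6 * N + 1)%N
        & \sum_v A v <= CL * lrpow q f] &
      forall x i, (`|u i x| `^ q <= (h * N%:R) `^ q * \sum_(v | near_cell h o x v) A v) /\
        forall j, `|partial j (u i) x| `^ q <= \sum_(v | near_cell h o x v) A v].

Lemma region_arith (x h z S t M : R) : 0 < h -> 1 <= S -> M = S * h -> h^-1 * x - (z * S - 27 * S) = t ->
  8 * S <= t -> t <= 48 * S + 4 -> `|x - z * M| <= 26 * M.
Proof.
move=> h0 S1 -> ht t1 t2; have -> : x = h * (t + (z * S - 27 * S)).
  by rewrite -ht subrK mulVKf// gt_eqF.
have -> : h * (t + (z * S - 27 * S)) - z * (S * h) = h * (t - 27 * S) by ring.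
have -> : 26 * (S * h) = h * (26 * S) by ring.
by rewrite normrM gtr0_norm// ler_pM2l// ler_norml; apply/andP; split; lra.
Qed.

Lemma near_cell_box M h o v : 0 < h -> [set x | @near_cell R n M h o x v] =
  [set x : 'rV[R]_n | forall l, h * (o l + (v l)%:R) <= x ord0 l <= h * (o l + (v l)%:R) + 3 * h].
Proof.
move=> h0; have hn : h != 0 by rewrite gt_eqF.
have E (x a : R) : (0 <= h^-1 * x + a <= 3) = (h * - a <= x <= h * - a + 3 * h).
  have -> : x = h * (h^-1 * x) by rewrite mulVKf.
  rewrite mulKf//; move: (h^-1 * x) => y.
  have -> : h * - a + 3 * h = h * (3 - a) by ring.
  by rewrite !(ler_pM2l h0); congr andb; apply/idP/idP; lra.
apply/seteqP; split => x /=.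
  by move=> /forallP h1 l; have := h1 l; rewrite /pos_cell E opprB opprK addrC.
by move=> h1; apply/forallP => l; rewrite /pos_cell E opprB opprK addrC.
Qed.

(** [H] is the cell energy of the local solution times the weight frozen at the scale of the cube,
    [mesh Q.1 ^ e]. Its integral counts boxes of side [3 * mesh K]. *)
Lemma cube_solution : exists2 C, 0 < C & forall K Q y (f : {ffun 'I_n -> 'I_(tsize K Q).+1} -> R),
  Omega y -> Q = wcube y -> (Q.1 <= K)%N -> \sum_v f v = 0 ->
  (forall v : {ffun 'I_n -> 'I_(tsize K Q).+1},
        ~~ [forall j, (3 * (8 * csize K Q) <= v j < 4 * (8 * csize K Q))%N] -> f v = 0) ->
  exists (u : 'I_n -> 'rV[R]_n -> R) (H : 'rV[R]_n -> R),
  [/\ forall i, test_fun Omega (u i),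
    forall x, \sum_i partial i (u i) x = \sum_v f v * \prod_l rho ((mesh K)^-1 * x ord0 l - (tshift v l)%:~R),
    forall x i, (`|u i x| `^ q * w x <= (8 * D) `^ q * H x) /\ forall j, `|partial j (u i) x| `^ q * w x <= H x,
    [/\ forall x, 0 <= H x, forall x, ~~ region Q x -> H x = 0 & measurable_fun setT H] &
    (\int[mu]_x (H x)%:E <= (C * mesh K ^+ n * (mesh Q.1 `^ e * lrpow q f))%:E)%E].
Proof.
have [Cw Cw0 hw] := region_weight.
exists (Cw * 3 ^+ n * CL); first by rewrite !mulr_gt0// exprn_gt0.
move=> K Q y f Oy Qy QK sf f0.
set h := mesh K; have h0 : 0 < h by exact: mesh_gt0.
set S := csize K Q; have S0 : (0 < S)%N by exact: csize_gt0.
have S1 : 1 <= S%:R :> R by rewrite ler1n.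
pose N := (8 * S)%N; have N0 : (0 < N)%N by rewrite muln_gt0.
set M := mesh Q.1; have M0 : 0 < M by exact: mesh_gt0.
have MS : M = S%:R * h by rewrite /M (mesh_add D _ (K - Q.1)) subnKC// /S /csize natrX.
pose o l : R := (Q.2 l)%:~R * S%:R - 27 * S%:R.
have [u [B [us usupp uE [B0 Bs sB] ub]]] := hloc o N0 (tsizeS K Q) h0 f0 sf.
pose Me := Cw * M `^ e.
have Me0 : 0 <= Me by rewrite mulr_ge0 ?powR_ge0// ltW.
pose H x := \sum_v (Me * B v) * (near_cell h o x v)%:R.
have H0 x : 0 <= H x by apply: sumr_ge0 => v _; rewrite mulr_ge0// mulr_ge0.
have mbox v : measurable [set x | @near_cell R n _ h o x v].
  rewrite near_cell_box//.
  rewrite (_ : [set x | _] = [set x : 'rV[R]_n | forall l, `[h * (o l + (v l)%:R), h * (o l + (v l)%:R) + 3 * h]%classic (x ord0 l)]).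
    by apply: (@measurable_box R n (fun l => `[h * (o l + (v l)%:R), h * (o l + (v l)%:R) + 3 * h]%classic)) => l; exact: measurable_itv.
  by apply/seteqP; split => x /= hx l; have := hx l; rewrite /= in_itv.
have nearE v : (fun x => (near_cell h o x v)%:R : R) = \1_[set x | @near_cell R n _ h o x v].
  apply/funext => x; rewrite indicE; suff -> : near_cell h o x v = (x \in [set x | @near_cell R n _ h o x v]) by [].
  by apply/idP/idP; rewrite inE.
have regB x v : near_cell h o x v -> B v != 0 -> region Q x.
  move=> /forallP nv Bv; apply/forallP => l; have := nv l; rewrite /pos_cell => /andP[n1 n2].
  have /andP[v1 v2] := Bs v Bv l.
  have v1r : (8 * S)%:R <= (v l)%:R :> R by rewrite ler_nat.
  have v2r : (v l)%:R <= (6 * (8 * S) + 1)%:R :> R by rewrite ler_nat.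
  rewrite natrM in v1r; rewrite natrD !natrM in v2r.
  by apply: (region_arith h0 S1 MS erefl); rewrite -/(o l); lra.
have regu i x : u i x != 0 -> region Q x.
  move=> ux; apply/forallP => l; have /andP[n1 n2] := usupp i x ux l.
  rewrite /N natrM in n1; rewrite /N natrD !natrM in n2.
  by apply: (region_arith h0 S1 MS erefl); rewrite -/(o l); lra.
have HE x : \sum_(v | near_cell h o x v) B v * Me = H x.
  rewrite /H big_mkcond; apply: eq_bigr => v _; case: ifP => _.
    by rewrite mulr1 mulrC.
  by rewrite mulr0.
have bnd x : (\sum_(v | near_cell h o x v) B v) * w x <= H x.
  have [rx|nrx] := boolP (region Q x).
    by rewrite -HE -mulr_suml; apply: ler_wpM2l; [by apply: sumr_ge0 => v _; exact: B0|exact: hw Oy Qy rx].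
  rewrite big1 ?mul0r// => v nv; apply/eqP; apply: contraNT nrx; exact: regB.
exists u, H; split.
- move=> i; apply: (@test_fun_sub _ _ _ _ [set x : 'rV[R]_n | forall l,
     (Q.2 l)%:~R * M - 26 * M <= x ord0 l <= (Q.2 l)%:~R * M + 26 * M]) => //.
  + exact: compact_box.
  + exact: norm_box_closed.
  + move=> x /= hx; have rx : region Q x.
      apply/forallP => l; have /andP[x1 x2] := hx l.
      by rewrite -/M ler_norml; apply/andP; split; lra.
    by have [] := region_near Oy Qy rx.
  + move=> x /regu/forallP rx l; have := rx l; rewrite -/M ler_norml => /andP[r1 r2].
    by apply/andP; split; lra.
- move=> x; rewrite uE; apply: eq_bigr => v _; congr (_ * _); apply: eq_bigr => l _.
  congr rho; rewrite /pos_cell !ffunE rmorphD rmorphB !rmorphM/= /o -/S; ring.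
- move=> x i; have [u1 u2] := ub x i; split.
    apply: le_trans (ler_wpM2r (powR_ge0 _ _) u1) _; rewrite -mulrA.
    apply: ler_pM; rewrite ?powR_ge0 ?mulr_ge0 ?powR_ge0//; first exact: sumr_ge0.
    apply: ge0_ler_powR; rewrite ?nnegrE//; first by have := q1; lra.
    - by rewrite mulr_ge0// ltW.
    - by rewrite mulr_ge0// ltW.
    have -> : h * N%:R = 8 * M by rewrite MS /N natrM; ring.
    rewrite ler_pM2l//; have := mesh_le D0 (leq0n Q.1).
    by rewrite -/M /(mesh 0) /mesh expr0 divr1.
  by move=> j; apply: le_trans (ler_wpM2r (powR_ge0 _ _) (u2 j)) (bnd x).
- split => //.
    move=> x nrx; rewrite -HE big1// => v nv.
    have [->|Bv] := eqVneq (B v) 0; first by rewrite mul0r.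
    by move: nrx; rewrite (regB x v).
  rewrite /H; apply: measurable_sum => v.
  apply: measurable_funM => //.
  by rewrite nearE; exact: measurable_indic.
have -> : (\int[mu]_x (H x)%:E = \sum_v (Me * B v * (3 * h) ^+ n)%:E)%E.
  under eq_integral => x _ do rewrite /H -sumEFin.
  rewrite ge0_integral_sum//; last 2 first.
  - move=> v; apply/measurable_EFinP; apply: measurable_funM => //.
    by rewrite nearE; exact: measurable_indic.
  - by move=> v x _; rewrite lee_fin mulr_ge0// mulr_ge0.
  apply: eq_bigr => v _.
  under eq_integral => x _ do rewrite EFinM.
  rewrite ge0_integralZl_EFin//; last 2 first.
  - by apply/measurable_EFinP; rewrite nearE; exact: measurable_indic.
  - by rewrite mulr_ge0.
  rewrite [RHS]EFinM; congr (_ * _)%E.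
  have -> : (\int[mu]_x (near_cell h o x v)%:R%:E = \int[mu]_x (\1_[set x | @near_cell R n _ h o x v] x)%:E)%E.
    by apply: eq_integral => x _; rewrite -nearE.
  rewrite integral_indic// setIT near_cell_box//.
  by apply: (lebesgue_cube (fun l => h * (o l + (v l)%:R))); rewrite mulr_ge0// ltW.
rewrite sumEFin lee_fin.
have -> : \sum_v Me * B v * (3 * h) ^+ n = Me * (3 * h) ^+ n * \sum_v B v.
  by rewrite mulr_sumr; apply: eq_bigr => v _; rewrite mulrAC.
apply: le_trans (ler_wpM2l _ sB) _; first by rewrite mulr_ge0// exprn_ge0// mulr_ge0// ltW.
by rewrite /Me exprMn le_eqVlt; apply/orP; left; apply/eqP; ring.
Qed.

Lemma overlap_powR (T : seq cube) x (a H : cube -> R) : uniq T ->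
  (forall Q, Q \in T -> exists2 y, Omega y & Q = wcube y) -> 0 < w x ->
  (forall Q, Q \in T -> `|a Q| `^ q * w x <= H Q) -> (forall Q, Q \in T -> ~~ region Q x -> H Q = 0) ->
  (forall Q, 0 <= H Q) ->
  `|\sum_(Q <- T) a Q| `^ q * w x <= (2 * 53 ^ n)%:R `^ (q - 1) * \sum_(Q <- T) H Q.
Proof.
move=> uT hT w0 aH H0 Hp; have q0 : 0 < q by have := q1; lra.
have e1 : \sum_(Q <- T) a Q = \sum_(Q <- T | region Q x) a Q.
  rewrite [LHS](bigID (region^~ x))/= [X in _ + X]big_seq_cond [X in _ + X]big1 ?addr0// => Q /andP[QT nr].
  have := aH Q QT; rewrite (H0 Q QT nr) pmulr_lle0// => h.
  have /eqP : `|a Q| `^ q = 0 by apply/eqP; rewrite eq_le h powR_ge0.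
  by move=> /eqP/(@powR_eq0_eq0 _ _ _)/eqP; rewrite normr_eq0 => /eqP.
have S0 : 0 <= \sum_(Q <- T | region Q x) `|a Q| by apply: sumr_ge0.
have h1 : `|\sum_(Q <- T) a Q| `^ q <= (2 * 53 ^ n)%:R `^ (q - 1) * \sum_(Q <- T | region Q x) `|a Q| `^ q.
  rewrite e1; apply: (@le_trans _ _ ((\sum_(Q <- T | region Q x) `|a Q|) `^ q)).
    by apply: ge0_ler_powR; rewrite ?nnegrE ?(ltW q0)//; exact: ler_norm_sum.
  apply: le_trans (powR_sum_le T q1 (fun Q _ => normr_ge0 (a Q))) _.
  apply: ler_wpM2r; first by apply: sumr_ge0 => *; exact: powR_ge0.
  apply: ge0_ler_powR; rewrite ?nnegrE ?subr_ge0 ?(ltW q1)// ler_nat.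
  exact: region_overlap.
apply: le_trans (ler_wpM2r (ltW w0) h1) _; rewrite -mulrA; apply: ler_wpM2l; first exact: powR_ge0.
rewrite mulr_suml [leRHS](bigID (region^~ x))/=; apply: ler_wpDr; first by apply: sumr_ge0.
rewrite big_seq_cond [leRHS]big_seq_cond; apply: ler_sum => Q /andP[QT _]; exact: aH.
Qed.

Lemma wint_overlap (T : seq cube) (a H : cube -> 'rV[R]_n -> R) (c : R) (t : cube -> R) : uniq T -> 0 <= c ->
  (forall Q, Q \in T -> exists2 y, Omega y & Q = wcube y) ->
  (forall Q, Q \in T -> continuous (a Q)) ->
  (forall Q x, Q \in T -> `|a Q x| `^ q * w x <= c * H Q x) ->
  (forall Q x, Q \in T -> ~~ region Q x -> H Q x = 0) ->
  (forall Q x, 0 <= H Q x) -> (forall Q, measurable_fun setT (H Q)) ->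
  (forall Q, Q \in T -> (\int[mu]_x (H Q x)%:E <= (t Q)%:E)%E) ->
  (weighted_int Omega q w (fun x => \sum_(Q <- T) a Q x)%R <=
    ((2 * 53 ^ n)%:R `^ (q - 1) * c * (\sum_(Q <- T) t Q)%R)%:E)%E.
Proof.
move=> uT c0 hT ca aH H0 Hp mH It; set Co := _ `^ (q - 1).
have Co0 : 0 <= Co by exact: powR_ge0.
have mO : measurable Omega by exact: open_measurable_rV.
have mS : measurable_fun setT (fun x => \sum_(Q <- T) H Q x) by apply: measurable_sum.
have mw : measurable_fun setT w.
  apply: (measurableT_comp (measurable_powR e)); apply: continuous_measurable_rV.
  exact: dist_bd_continuous.
have ma : measurable_fun setT (fun x => \sum_(Q <- T) a Q x).
  rewrite (_ : (fun x => _) = (fun x => \sum_(Q <- T) (if Q \in T then a Q x else 0))); last first.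
    by apply/funext => x; rewrite big_seq [RHS]big_seq; apply: eq_bigr => Q ->.
  apply: measurable_sum => Q; have [QT|nQT] := boolP (Q \in T); last exact: measurable_cst.
  by apply: continuous_measurable_rV; exact: ca.
apply: (@le_trans _ _ (\int[mu]_(x in Omega) ((Co * c)%:E * (\sum_(Q <- T) H Q x)%:E))%E).
  apply: ge0_le_integral => //.
  - by move=> x _; rewrite lee_fin mulr_ge0 ?powR_ge0.
  - apply: (measurable_funS measurableT) => //; apply/measurable_EFinP; apply: measurable_funM => //.
    apply: (measurableT_comp (measurable_powR q)); exact: measurableT_comp.
  - apply: (measurable_funS measurableT) => //; apply: measurable_funeM; exact/measurable_EFinP.
  - move=> x Ox; rewrite -EFinM lee_fin -mulrA mulr_sumr.
    apply: (overlap_powR (a := fun Q => a Q x) (H := fun Q => c * H Q x) (x := x)) => //.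
    + by rewrite powR_gt0// dist_bd_gt0.
    + by move=> Q QT; exact: aH.
    + by move=> Q QT nr; rewrite H0// mulr0.
    + by move=> Q; rewrite mulr_ge0.
rewrite ge0_integralZl_EFin//; last 3 first.
- by move=> x _; rewrite lee_fin; apply: sumr_ge0.
- by apply: (measurable_funS measurableT) => //; apply/measurable_EFinP.
- by rewrite mulr_ge0.
rewrite [leRHS]EFinM; apply: lee_wpmul2l; first by rewrite lee_fin mulr_ge0.
apply: (@le_trans _ _ (\int[mu]_x (\sum_(Q <- T) H Q x)%:E)%E).
  apply: ge0_subset_integral => //; first exact/measurable_EFinP.
  by move=> x _; rewrite lee_fin; apply: sumr_ge0.
under eq_integral => x _ do rewrite -sumEFin.
rewrite ge0_integral_sum//; last 2 first.
- by move=> Q; apply/measurable_EFinP.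
- by move=> Q x _; rewrite lee_fin.
rewrite -sumEFin big_seq [leRHS]big_seq; apply: lee_sum => Q QT; exact: It.
Qed.

Variables (c1 : R) (x0 : 'rV[R]_n).
Hypothesis c1p : 1 <= c1.
Hypothesis hchain : chainable Omega c1 x0.
Variables (lambda C0 : R).
Hypothesis l0 : 0 <= lambda.
Hypothesis C00 : 0 < C0.
Hypothesis hA : forall r s : R, 0 < r -> r < s ->
  (ereal_sup [set covering_number r (eball x s `&` boundary Omega) | x in boundary Omega] <=
          (C0 * (s / r) `^ lambda)%:E)%E.
Variables (gamma kap : R).
Hypothesis kap0 : 0 < kap.
Hypothesis lg : lambda < n%:R + gamma.
Hypothesis egk : e + gamma * (q - 1) = - kap.

(** The pieces of [decomposition] are solved one by one. As the regions overlap boundedly, the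
    energies add up at the price of a constant, and linearity of the pairing in [decomposition]
    reassembles the divergence. *)
Theorem step_solution : exists2 C, 0 < C & forall K (s : seq pt) (c : pt -> R), uniq s ->
  (forall m, m \in s -> Omega (lattice_pt (mesh K) m) /\ 2 * c1 * A * mesh K <= d (lattice_pt (mesh K) m)) ->
  \sum_(m <- s) c m = 0 ->
  let E := mesh K ^+ n * \sum_(m <- s) `|c m| `^ q * w (lattice_pt (mesh K) m) in
  exists u : 'I_n -> 'rV[R]_n -> R,
  [/\ forall i, test_fun Omega (u i),
    forall x, \sum_i partial i (u i) x = \sum_(m <- s) c m * \prod_l rho ((mesh K)^-1 * x ord0 l - (m l)%:~R),
    forall i, (weighted_int Omega q w (u i) <= (C * E)%:E)%E &
    forall i j, (weighted_int Omega q w (partial j (u i)) <= (C * E)%:E)%E].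
Proof.
have [C1 C10 hdec] := decomposition oO bd0 D0 hD c1p hchain l0 C00 hA q1 kap0 lg egk.
have [C2 C20 hcube] := cube_solution.
pose Co : R := (2 * 53 ^ n)%:R `^ (q - 1).
have Co0 : 0 <= Co by exact: powR_ge0.
pose D8 : R := (8 * D) `^ q + 1.
have D80 : 0 <= D8 by rewrite addr_ge0// powR_ge0.
exists (Co * D8 * (C2 * C1) + 1).
  by rewrite ltr_wpDl// !mulr_ge0// ltW.
move=> K s c us hs sc E; have mK := mesh_gt0 D0 K.
have [T [f [uT hT fT fG fn]]] := hdec K s c us hs sc.
have H Q : exists uH : ('I_n -> 'rV[R]_n -> R) * ('rV[R]_n -> R),
  [/\ forall i, test_fun Omega (uH.1 i), forall x, 0 <= uH.2 x, measurable_fun setT uH.2 &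
   Q \in T -> [/\
    forall x, \sum_i partial i (uH.1 i) x = \sum_v f Q v * \prod_l rho ((mesh K)^-1 * x ord0 l - (tshift v l)%:~R),
    forall x i, (`|uH.1 i x| `^ q * w x <= (8 * D) `^ q * uH.2 x) /\ forall j, `|partial j (uH.1 i) x| `^ q * w x <= uH.2 x,
    forall x, ~~ region Q x -> uH.2 x = 0 &
    (\int[mu]_x (uH.2 x)%:E <= (C2 * mesh K ^+ n * (mesh Q.1 `^ e * lrpow q (f Q)))%:E)%E]].
  have [QT|nQT] := boolP (Q \in T); last first.
    by exists (fun=> fun=> 0, fun=> 0); split => //= i; exact: test_fun0.
  have [QK [y Oy Qy]] := hT Q QT; have [sf f0] := fT Q QT.
  have [u [Hq [h1 h2 h3 [h4 h5 h6] h7]]] := hcube K Q y (f Q) Oy Qy QK sf f0.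
  by exists (u, Hq); split.
have [UH hUH] := choice H.
pose u i x := \sum_(Q <- T) (UH Q).1 i x.
have tf Q i : test_fun Omega ((UH Q).1 i) by have [] := hUH Q.
have sm Q i : smooth ((UH Q).1 i) by have [] := tf Q i.
have hT2 Q : Q \in T -> exists2 y, Omega y & Q = wcube y by move=> /hT[].
have uP i j : partial j (u i) = (fun x => \sum_(Q <- T) partial j ((UH Q).1 i) x).
  by apply: (partial_sum T j) => Q; exact: sm.
pose t Q := C2 * mesh K ^+ n * (mesh Q.1 `^ e * lrpow q (f Q)).
have st : \sum_(Q <- T) t Q <= C2 * C1 * E.
  rewrite -mulr_sumr; have p0 : 0 <= C2 * mesh K ^+ n by rewrite mulr_ge0 ?exprn_ge0 ?ltW.
  by apply: le_trans (ler_wpM2l p0 fn) _; rewrite le_eqVlt; apply/orP; left; apply/eqP; rewrite /E; ring.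
have E0 : 0 <= E.
  rewrite /E mulr_ge0 ?exprn_ge0 ?(ltW mK)//; apply: sumr_ge0 => m _.
  by rewrite mulr_ge0 ?powR_ge0.
have fin (cc : R) : 0 <= cc -> cc <= D8 -> Co * cc * \sum_(Q <- T) t Q <= (Co * D8 * (C2 * C1) + 1) * E.
  move=> c0 cD; rewrite mulrDl mul1r; apply: ler_wpDr => //.
  have t0 : 0 <= \sum_(Q <- T) t Q.
    apply: sumr_ge0 => Q _; rewrite !mulr_ge0 ?powR_ge0 ?lrpow_ge0 ?exprn_ge0 ?(ltW mK) ?(ltW C20)//.
  apply: (@le_trans _ _ (Co * D8 * \sum_(Q <- T) t Q)).
    by apply: ler_wpM2r => //; apply: ler_wpM2l.
  by rewrite -[Co * D8 * _ * E]mulrA; apply: ler_wpM2l; rewrite ?mulr_ge0.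
exists u; split.
- by move=> i; apply: test_fun_sum.
- move=> x; under eq_bigr do rewrite uP.
  rewrite exchange_big/=.
  transitivity (\sum_(Q <- T) \sum_v f Q v * (fun z : pt => \prod_l rho ((mesh K)^-1 * x ord0 l - (z l)%:~R)) (tshift v)).
    rewrite big_seq [RHS]big_seq; apply: eq_bigr => Q QT.
    by have [_ _ _ /(_ QT)[h _ _ _]] := hUH Q.
  exact: (fG (fun z : pt => \prod_l rho ((mesh K)^-1 * x ord0 l - (z l)%:~R))).
- move=> i; have P0 : 0 <= (8 * D) `^ q by exact: powR_ge0.
  apply: le_trans (@wint_overlap T (fun Q => (UH Q).1 i) (fun Q => (UH Q).2) ((8 * D) `^ q) t uT P0 hT2 _ _ _ _ _ _) _.
  + by move=> Q _; exact: smooth_continuous.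
  + by move=> Q x QT; have [_ _ _ /(_ QT)[_ /(_ x i)[h _] _ _]] := hUH Q.
  + by move=> Q x QT; have [_ _ _ /(_ QT)[_ _ h _]] := hUH Q; exact: h.
  + by move=> Q x; have [_ h _ _] := hUH Q.
  + by move=> Q; have [_ _ h _] := hUH Q.
  + by move=> Q QT; have [_ _ _ /(_ QT)[_ _ _ h]] := hUH Q.
  by rewrite lee_fin fin// /D8 lerDl.
- move=> i j; rewrite uP.
  apply: le_trans (@wint_overlap T (fun Q => partial j ((UH Q).1 i)) (fun Q => (UH Q).2) 1 t uT ler01 hT2 _ _ _ _ _ _) _.
  + by move=> Q _; apply: smooth_continuous; exact: smooth_partial.
  + by move=> Q x QT; rewrite mul1r; have [_ _ _ /(_ QT)[_ /(_ x i)[_ h] _ _]] := hUH Q; exact: h.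
  + by move=> Q x QT; have [_ _ _ /(_ QT)[_ _ h _]] := hUH Q; exact: h.
  + by move=> Q x; have [_ h _ _] := hUH Q.
  + by move=> Q; have [_ _ h _] := hUH Q.
  + by move=> Q QT; have [_ _ _ /(_ QT)[_ _ _ h]] := hUH Q.
  by rewrite lee_fin fin// /D8 lerDr powR_ge0.
Qed.

End step_solution.

(** * Approximation by step functions *)

Lemma cvge0_lt {R : realType} (u : nat -> \bar R) (e : R) : u @ \oo --> 0%E -> 0 < e ->
  exists N, forall k, (N <= k)%N -> (u k < e%:E)%E.
Proof.
move=> cu e0; have h : (0 < e%:E :> \bar R)%E by rewrite lte_fin.
by have [N _ hN] := cu _ (open_ereal_lt' h); exists N => k Nk; exact: hN.
Qed.

Lemma double_window_inj (a b f : int) : 2 * a < f + 1 -> f < 2 * a + 2 ->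
  2 * b < f + 1 -> f < 2 * b + 2 -> a = b.
Proof. lia. Qed.

Section step_approximation.
Context {R : realType} {n : nat}.
Variables (Omega : set 'rV[R]_n) (D : R).
Local Notation mu := (@lebesgue_rV R n).
Local Notation mesh := (mesh D).
Hypothesis D0 : 0 < D.

Definition step_at (T : Type) (K : nat) (h : 'rV[R]_n -> T) : Prop :=
  forall x y, idx D K x = idx D K y -> h x = h y.

(** The dyadic grids are nested: the index at one level is determined by the index at the next. *)
Lemma step_at_leq (T : Type) K K' (h : 'rV[R]_n -> T) : (K <= K')%N -> step_at K h -> step_at K' h.
Proof.
move=> /subnKC <-; elim: (K' - K)%N => [|j IH] sh; first by rewrite addn0.
move=> x y xy; apply: (IH sh); apply/ffunP => l; move/ffunP : xy => /(_ l); rewrite !ffunE.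
have Me : mesh (K + j) = 2 * mesh (K + j.+1) by rewrite [LHS](mesh_add D (K + j) 1) expr1 addn1 addnS.
have m0 : 0 < mesh (K + j.+1) by exact: mesh_gt0.
have h2 z : z / mesh (K + j.+1) = 2 * (z / mesh (K + j)) by rewrite Me; field; exact: lt0r_neq0.
rewrite !h2; set a := x _ _ / _; set b := y _ _ / _ => eab.
have /andP[a1 a2] := floor_itv a; have /andP[b1 b2] := floor_itv b.
have /andP[A1 A2] := floor_itv (2 * a); have /andP[B1 B2] := floor_itv (2 * b).
move: A1 A2 B1 B2; rewrite eab; set f := Num.floor (2 * b); rewrite !intrD => A1 A2 B1 B2.
rewrite !intrD in a2 b2.
have X1 : ((2 * Num.floor a)%:~R < (f + 1)%:~R :> R) by rewrite intrM intrD; lra.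
have X2 : (f%:~R < (2 * Num.floor a + 2)%:~R :> R) by rewrite intrD intrM; lra.
have X3 : ((2 * Num.floor b)%:~R < (f + 1)%:~R :> R) by rewrite intrM intrD; lra.
have X4 : (f%:~R < (2 * Num.floor b + 2)%:~R :> R) by rewrite intrD intrM; lra.
rewrite !ltr_int in X1 X2 X3 X4; exact: double_window_inj X1 X2 X3 X4.
Qed.

Lemma step_at_measurable_set K (A : set 'rV[R]_n) : step_at K A -> measurable A.
Proof.
move=> sA.
rewrite (_ : A = \bigcup_i (if (unpickle i : option {ffun 'I_n -> int}) is Some m then
    if `[< A (lattice_pt (mesh K) m) >] then gcell D (K, m) else set0 else set0)).
  apply: bigcupT_measurable => i; case: (unpickle i : option {ffun 'I_n -> int}) => [m|] //.
  by case: ifP => _ //; exact: measurable_gcell.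
have m0 : 0 < mesh K by exact: mesh_gt0.
have il m : idx D K (lattice_pt (mesh K) m) = m.
  apply/ffunP => l; rewrite !ffunE !mxE mulrAC mulfV ?mul1r ?intrKfloor//; exact: lt0r_neq0.
apply/seteqP; split => x.
  move=> Ax; exists (pickle (idx D K x)) => //=; rewrite pickleK.
  rewrite (sA _ x) ?il// asboolT//; exact: gcell_idx.
move=> [i _]; case: (unpickle i : option {ffun 'I_n -> int}) => [m|] //.
case: ifP => // /asboolP Am cx; rewrite (sA _ (lattice_pt (mesh K) m))// il.
apply/ffunP => l; rewrite ffunE; apply: floor_def; rewrite intrD.
have /= /andP[h1 h2] := cx l.
by rewrite ler_pdivlMr// ltr_pdivrMr// mulrDl mul1r h1.
Qed.

Lemma step_at_measurable K (h : 'rV[R]_n -> R) : step_at K h -> measurable_fun setT h.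
Proof.
move=> sh _ Y mY; rewrite setTI; apply: (@step_at_measurable_set K) => x y xy.
by rewrite /preimage/= (sh _ _ xy).
Qed.

Hypothesis mO : measurable Omega.
Hypothesis muO : (mu Omega < +oo)%E.

Definition step_approx (g : 'rV[R]_n -> R) : Prop := measurable_fun setT g /\
  forall e : R, 0 < e -> exists K h, step_at K h /\
    (\int[mu]_(x in Omega) `|g x - h x|%:E < e%:E)%E.

Lemma measurable_dist (g h : 'rV[R]_n -> R) : measurable_fun setT g -> measurable_fun setT h ->
  measurable_fun Omega (fun x => `|g x - h x|%:E).
Proof.
move=> mg mh; apply: (measurable_funS measurableT) => //.
apply/measurable_EFinP; apply: measurableT_comp => //; exact: measurable_funB.
Qed.

Lemma int_tri (g1 g2 h1 h2 h3 h4 : 'rV[R]_n -> R) :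
  measurable_fun setT g1 -> measurable_fun setT g2 ->
  measurable_fun setT h1 -> measurable_fun setT h2 -> measurable_fun setT h3 -> measurable_fun setT h4 ->
  (forall x, Omega x -> `|g1 x - g2 x| <= `|h1 x - h2 x| + `|h3 x - h4 x|) ->
  (\int[mu]_(x in Omega) `|g1 x - g2 x|%:E <=
   \int[mu]_(x in Omega) `|h1 x - h2 x|%:E + \int[mu]_(x in Omega) `|h3 x - h4 x|%:E)%E.
Proof.
move=> m1 m2 n1 n2 n3 n4 hx; rewrite -ge0_integralD//; try exact: measurable_dist.
apply: ge0_le_integral => //; try exact: measurable_dist.
by apply: emeasurable_funD; exact: measurable_dist.
Qed.

Lemma step_approx_op (op : R -> R -> R) (g1 g2 : 'rV[R]_n -> R) :
  (forall a b a' b', `|op a b - op a' b'| <= `|a - a'| + `|b - b'|) ->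
  measurable_fun setT (fun x => op (g1 x) (g2 x)) ->
  step_approx g1 -> step_approx g2 -> step_approx (fun x => op (g1 x) (g2 x)).
Proof.
move=> hop mop [m1 a1] [m2 a2]; split=> // e e0.
have e2 : 0 < e / 2 by rewrite divr_gt0.
have [K1 [h1 [s1 i1]]] := a1 _ e2; have [K2 [h2 [s2 i2]]] := a2 _ e2.
have sh : step_at (maxn K1 K2) (fun x => op (h1 x) (h2 x)).
  move=> x y xy; rewrite (step_at_leq (leq_maxl K1 K2) s1 xy).
  by rewrite (step_at_leq (leq_maxr K1 K2) s2 xy).
exists (maxn K1 K2), (fun x => op (h1 x) (h2 x)); split=> //.
apply: (@le_lt_trans _ _ (\int[mu]_(x in Omega) `|g1 x - h1 x|%:E +
    \int[mu]_(x in Omega) `|g2 x - h2 x|%:E)%E).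
  apply: int_tri => //; try exact: step_at_measurable s1; try exact: step_at_measurable s2.
  exact: step_at_measurable sh.
by rewrite [e]splitr EFinD; exact: lteD.
Qed.

Lemma step_approx_lim (g : 'rV[R]_n -> R) (G : nat -> 'rV[R]_n -> R) :
  measurable_fun setT g -> (forall k, step_approx (G k)) ->
  (fun k => \int[mu]_(x in Omega) `|g x - G k x|%:E)%E @ \oo --> 0%E -> step_approx g.
Proof.
move=> mg aG cG; split=> // e e0.
have e2 : 0 < e / 2 by rewrite divr_gt0.
have [N hN] := cvge0_lt cG e2.
have [mG /(_ _ e2)[K [h [sh ih]]]] := aG N; exists K, h; split=> //.
have mh := step_at_measurable sh.
apply: (@le_lt_trans _ _ (\int[mu]_(x in Omega) `|g x - G N x|%:E +
    \int[mu]_(x in Omega) `|G N x - h x|%:E)%E).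
  by apply: int_tri => // x _; rewrite ler_distD.
by rewrite [e]splitr EFinD; apply: lteD => //; exact: hN.
Qed.

Lemma step_approx_step K (h : 'rV[R]_n -> R) : step_at K h -> step_approx h.
Proof.
move=> sh; split; first exact: step_at_measurable sh.
move=> e e0; exists K, h; split=> //.
by under eq_integral do rewrite subrr normr0; rewrite integral0 lte_fin.
Qed.

Lemma step_approx_scale (c : R) (g : 'rV[R]_n -> R) : step_approx g -> step_approx (fun x => c * g x).
Proof.
move=> [mg ag]; split; first exact: measurable_funM.
move=> e e0; have c0 : 0 < `|c| + 1 by rewrite ltr_wpDl.
have [K [h [sh ih]]] := ag (e / (`|c| + 1)) (divr_gt0 e0 c0).
exists K, (fun x => c * h x); split; first by move=> x y xy; rewrite (sh _ _ xy).
have mh := step_at_measurable sh.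
under eq_integral do rewrite -mulrBr normrM EFinM.
rewrite ge0_integralZl//; last exact: measurable_dist.
apply: (@le_lt_trans _ _ ((`|c| + 1)%:E * \int[mu]_(x in Omega) `|g x - h x|%:E)%E).
  by apply: lee_pmul => //; [exact: integral_ge0 | rewrite lee_fin lerDl].
by rewrite -lte_pdivlMl// mulrC -EFinM in ih *.
Qed.

Lemma step_approx_cvg (g : 'rV[R]_n -> R) (G : nat -> 'rV[R]_n -> R) (B : R) :
  (forall k, step_approx (G k)) -> (forall k x, `|G k x| <= B) ->
  (forall x, G ^~ x @ \oo --> g x) -> measurable_fun setT g -> step_approx g.
Proof.
move=> aG bG cG mg; apply: (step_approx_lim mg aG).
have iB : mu.-integrable Omega (cst B%:E).
  apply/integrableP; split => //; rewrite integral_cst//= lte_mul_pinfty//.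
have [||||_ h _] := @dominated_convergence _ _ R mu Omega mO (fun k x => (G k x)%:E) (EFin \o g) (cst B%:E) _ _ _ iB.
- move=> k; apply: (measurable_funS measurableT) => //; apply/measurable_EFinP; exact: (aG k).1.
- by apply: (measurable_funS measurableT) => //; apply/measurable_EFinP.
- by apply: aeW => x _; apply/fine_cvgP; split; [exact: nearW | exact: cG].
- by apply: aeW => x k _; rewrite lee_fin.
rewrite (_ : (fun k => _) = (fun k => \int[mu]_(x in Omega) `|(G k x)%:E - (EFin \o g) x|)%E)//.
by apply/funext => k; apply: eq_integral => x _; rewrite /= distrC.
Qed.

(** The measurable approximable sets form a sigma-algebra. It contains each half-space [x i > a],
    which is the union over [K] of the sets where the dyadic lower approximation of [x i] at level
    [K] exceeds [a]. *)
Lemma step_approx_measurable (A : set 'rV[R]_n) : measurable A -> step_approx (\1_A).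
Proof.
pose M := [set B : set 'rV[R]_n | measurable B /\ step_approx (\1_B)].
have M0 : M set0.
  by split=> //; apply: (@step_approx_step 0) => x y _; rewrite !indicE !in_set0.
have MC B : M B -> M (~` B).
  move=> [mB aB]; split; first exact: measurableC.
  have := step_approx_op (op := fun a b => a - b) _ _
    (@step_approx_step 0 (fun=> 1) (fun _ _ _ => erefl)) aB.
  rewrite (_ : \1_(~` B) = (fun x => 1 - \1_B x)); last first.
    by apply/funext => x; rewrite !indicE in_setC; case: (_ \in _); rewrite ?subrr ?subr0.
  apply; last by apply: measurable_funB => //; exact: measurable_indic.
  by move=> a b a' b'; rewrite (_ : a - b - (a' - b') = (a - a') - (b - b')) ?ler_normB//; ring.
have MU B B' : M B -> M B' -> M (B `|` B').
  move=> [mB aB] [mB' aB']; split; first exact: measurableU.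
  have := step_approx_op (op := fun a b => Num.max a b) _ _ aB aB'.
  rewrite (_ : \1_(B `|` B') = (fun x => Num.max (\1_B x) (\1_B' x))); last first.
    apply/funext => x; rewrite !indicE in_setU.
    by case: (x \in B); case: (x \in B') => /=; rewrite ?maxxx// /Num.max ?ltxx ?ltr01// ltr10.
  apply; last by apply: measurable_maxr; exact: measurable_indic.
  move=> a b a' b'; rewrite /Num.max; case: ltP => h1; case: ltP => h2;
    have := ler_norm (a - a'); have := ler_norm (b - b'); have := ler_norm (- (a - a'));
    have := ler_norm (- (b - b')); rewrite !normrN ler_norml => *; apply/andP; split;
    have := normr_ge0 (a - a'); have := normr_ge0 (b - b'); lra.
have MS (F : nat -> set 'rV[R]_n) : (forall k, M (F k)) -> M (\bigcup_k F k).
  move=> hF; have mF : measurable (\bigcup_k F k) by apply: bigcupT_measurable => k; exact: (hF k).1.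
  split=> //; apply: (@step_approx_cvg _ (fun k => \1_(\big[setU/set0]_(i < k) F i)) 1).
  - by move=> k; suff [] : M (\big[setU/set0]_(i < k) F i) by []; apply: (big_ind M) => // i _.
  - by move=> k x; rewrite indicE; case: (_ \in _); rewrite ?normr1 ?normr0.
  - move=> x; apply: cvg_near_cst; rewrite !indicE.
    have [xF|xF] := pselect ((\bigcup_k F k) x).
      have [j _ Fj] := xF; exists j.+1 => // k /= jk; rewrite indicE !mem_set//.
      by rewrite -bigcup_mkord; exists j.
    exists 0%N => // k _; rewrite /= indicE !memNset//.
    by rewrite -bigcup_mkord => -[j _ Fj]; apply: xF; exists j.
  - exact: measurable_indic.
have sM : sigma_algebra setT M.
  by split; [exact: M0 | move=> B MB; rewrite setTD; exact: MC | exact: MS].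
suff h : measurable `<=` M by move=> /h[].
apply: smallest_sub => // B; rewrite -bigcup_seq => -[i _ [Y mY <-]]; rewrite setTI.
pose N := [set Z : set (measurableTypeR R) | M ((fun x : 'rV[R]_n => x ord0 i) @^-1` Z)].
have sN : sigma_algebra setT N.
  split => [|Z NZ|F hF]; rewrite /N/=.
  - by rewrite preimage_set0.
  - by rewrite setTD preimage_setC; exact: MC.
  - by rewrite preimage_bigcup; exact: MS.
have : (@measurable _ (measurableTypeR R)) `<=` N; last exact.
rewrite RGenOInfty.measurableE; apply: smallest_sub => // _ [a ->]; rewrite /N/=.
pose F K := [set x : 'rV[R]_n | a < (idx D K x i)%:~R * mesh K].
rewrite (_ : _ @^-1` _ = \bigcup_K F K).
  apply: MS => K; have sF : step_at K (F K) by move=> x y xy; rewrite /F/= xy.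
  split; first exact: step_at_measurable_set sF.
  by apply: (@step_approx_step K) => x y xy; rewrite !indicE; congr (_%:R); rewrite /in_mem/= /in_set/= (sF _ _ xy).
apply/seteqP; split => x /=.
  rewrite in_itv/= andbT => ax; pose t := x ord0 i - a.
  have t0 : 0 < t by rewrite subr_gt0.
  have [K hK] : exists K, mesh K < t.
    exists (Num.truncn (D / t)).+1; rewrite /mesh ltr_pdivrMr ?exprn_gt0// mulrC -ltr_pdivrMr//.
    apply: lt_trans (truncnS_gt _) _; rewrite -natrX ltr_nat; exact: ltn_expl.
  exists K => //; rewrite /F/=; have /andP[_] := idx_bounds D0 K x i; rewrite /t in hK; lra.
move=> [K _]; rewrite /F/= in_itv/= andbT => h; have /andP[h1 _] := idx_bounds D0 K x i.
exact: lt_le_trans h h1.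
Qed.

Import HBSimple.

Lemma step_approx_bounded (g : 'rV[R]_n -> R) (B : R) : measurable_fun setT g ->
  (forall x, `|g x| <= B) -> step_approx g.
Proof.
move=> mg bg.
have ig : mu.-integrable Omega (EFin \o g).
  apply/integrableP; split.
    by apply: (measurable_funS measurableT) => //; apply/measurable_EFinP.
  apply: (@le_lt_trans _ _ (\int[mu]_(x in Omega) B%:E)%E).
    apply: ge0_le_integral => //.
    - apply: (measurable_funS measurableT) => //; apply/measurable_EFinP; exact: measurableT_comp.
    - by move=> x _; rewrite lee_fin.
  by rewrite integral_cst//= lte_mul_pinfty// lee_fin (le_trans _ (bg 0)).
have [G [iG _ cG]] := approximation_sfun_integrable mO ig.
apply: step_approx_lim cG => // k.
pose g' := HBSimple.SimpleFun.sort (G k); suff : step_approx g' by [].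
have e1 : g' = (fun x => \sum_(y <- finmap.enum_fset (fset_set (range g'))) (y * \1_(g' @^-1` [set y]) x)).
  by apply/funext => x; rewrite /g' fimfunE fsbig_finite.
have mk z : measurable (g' @^-1` [set z]) by rewrite -[X in measurable X]setTI; exact: measurable_funP.
rewrite e1; move: (finmap.enum_fset _) => S.
elim: S => [|y s IH].
  by apply: (@step_approx_step 0) => x x' _; rewrite !big_nil.
have := step_approx_op (op := fun a b => a + b) _ _
  (@step_approx_scale y _ (@step_approx_measurable (g' @^-1` [set y]) (mk y))) IH.
rewrite (_ : (fun x => \sum_(_ <- _ :: _) _) =
  (fun x => y * \1_(g' @^-1` [set y]) x + \sum_(j <- s) (j * \1_(g' @^-1` [set j]) x))); last first.
  by apply/funext => x; rewrite big_cons.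
apply => //.
- by move=> a b a' b'; rewrite opprD addrACA ler_normD.
- apply: measurable_funD; last exact: IH.1.
  by apply: measurable_funM => //; exact: measurable_indic.
Qed.

End step_approximation.

(** * Weighted energies *)

Lemma ereal_add3 {R : realType} (k : R) (a b c Y : \bar R) : 1 <= k ->
  (0 <= a)%E -> (0 <= b)%E -> (0 <= c)%E -> (Y <= k%:E * b + k%:E * c)%E ->
  (k%:E * a + k%:E * Y <= (k * k)%:E * (a + (b + c)))%E.
Proof.
move=> k1 a0 b0 c0 hY; have k0 : 0 <= k by lra.
rewrite EFinM -muleA (ge0_muleDr _ a0) ?adde_ge0// ge0_muleDr ?mule_ge0 ?adde_ge0 ?lee_fin//.
apply: leeD; last by rewrite lee_wpmul2l ?lee_fin// ge0_muleDr.
by rewrite lee_wpmul2l ?lee_fin// -[leLHS]mul1e lee_wpmul2r ?lee_fin.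
Qed.

Lemma clip_bound {R : realType} (B b : R) : 0 < B -> `|Num.max (- B) (Num.min B b)| <= B.
Proof.
by move=> B0; rewrite /Num.max /Num.min ler_norml; case: (ltP B b) => ?; case: ltP => ?; apply/andP; split; lra.
Qed.

Lemma clip_dist {R : realType} (a b B : R) : `|a| <= B ->
  `|a - Num.max (- B) (Num.min B b)| <= `|a - b|.
Proof.
rewrite ler_norml => /andP[u1 u2].
have v1 := ler_norm (a - b); have v2 : - (a - b) <= `|a - b| by rewrite -normrN ler_norm.
by rewrite /Num.max /Num.min ler_norml; case: (ltP B b) => ?; case: ltP => ?; apply/andP; split; lra.
Qed.

Lemma mesh_split {R : realType} (a n1 L t mm : R) : 0 < a -> 0 < n1 -> 0 < L -> mm <= t ->
  a <= mm / (2 * (n1 + L)) -> a <= t / (2 * n1) /\ L * a <= t / 2.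
Proof.
move=> a0 n0 L0 mt; rewrite !ler_pdivlMr ?mulr_gt0 ?addr_gt0//; nra.
Qed.

Lemma three_quarters {R : realType} (A0 ep : R) : 0 < ep -> 0 < A0 ->
  A0 * (ep / (4 * A0) + (ep / (4 * A0) + ep / (4 * A0))) < ep.
Proof.
move=> h1 h2.
have -> : A0 * (ep / (4 * A0) + (ep / (4 * A0) + ep / (4 * A0))) = 3 / 4 * ep by field; exact: lt0r_neq0.
lra.
Qed.

Lemma eta_bound {R : realType} (X eta ep : R) : 0 < X * 2 + 1 -> 0 <= X -> 0 < eta -> eta <= ep / (X * 2 + 1) ->
  X * (2 * eta) <= ep.
Proof. by move=> h X0 e0; rewrite ler_pdivlMr//; nra. Qed.

Lemma lee_scaled_add3 {R : realType} (k b : R) (x y z : \bar R) : 0 <= k ->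
  (x <= b%:E -> y <= b%:E -> z <= b%:E -> k%:E * (x + (y + z)) <= k%:E * (b%:E + (b%:E + b%:E)))%E.
Proof. by move=> k0 xb yb zb; rewrite lee_wpmul2l ?lee_fin//; do 2?[apply: leeD => //]. Qed.

Section weighted_integral_theory.
Context {R : realType} {n : nat}.
Local Notation mu := (@lebesgue_rV R n).
Variables (Omega : set 'rV[R]_n) (w : 'rV[R]_n -> R) (q : R).
Hypothesis mO : measurable Omega.
Hypothesis mw : measurable_fun setT w.
Hypothesis w0 : forall x, 0 <= w x.
Hypothesis q1 : 1 < q.
Local Notation wint := (weighted_int Omega q w).
Implicit Types f g h : 'rV[R]_n -> R.

Lemma measurable_wint f : measurable_fun Omega f ->
  measurable_fun Omega (fun x => (`|f x| `^ q * w x)%:E).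
Proof.
move=> mf; apply/measurable_EFinP; apply: measurable_funM; last exact: (measurable_funS measurableT).
apply: (@measurableT_comp _ _ _ _ _ _ (fun y : R => y `^ q)); first exact: measurable_powR.
exact: measurableT_comp.
Qed.

Lemma wint_ge0 f : (0 <= wint f)%E.
Proof. by apply: integral_ge0 => x _; rewrite lee_fin mulr_ge0 ?powR_ge0. Qed.

Lemma wint_eq f g : (forall x, Omega x -> `|f x| = `|g x|) -> wint f = wint g.
Proof. by move=> fg; apply: eq_integral => x /set_mem Ox; rewrite fg. Qed.

(** The parameter matters: with [t] close to 1 the first constant is close to 1, so that adding a
    small error does not spoil a contraction factor. *)
Lemma wint_convex (t : R) f g : 0 < t < 1 -> measurable_fun Omega f -> measurable_fun Omega g ->
  (wint (fun x => f x + g x)%R <= (t `^ (1 - q))%:E * wint f + ((1 - t) `^ (1 - q))%:E * wint g)%E.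
Proof.
move=> /andP[t0 t1] mf mg; have s0 : 0 < 1 - t by lra.
rewrite /weighted_int -!ge0_integralZl//; try exact: measurable_wint;
  try (by move=> x _; rewrite lee_fin mulr_ge0 ?powR_ge0); try by rewrite lee_fin powR_ge0.
have mZ (c : R) h : measurable_fun Omega h ->
    measurable_fun Omega (fun x => c%:E * (`|h x| `^ q * w x)%:E)%E.
  by move=> mh; apply: measurable_funeM; exact: measurable_wint.
rewrite -ge0_integralD//; try exact: mZ; try (by move=> x _; rewrite -EFinM lee_fin !mulr_ge0 ?powR_ge0).
apply: ge0_le_integral => //.
- by move=> x _; rewrite lee_fin mulr_ge0 ?powR_ge0.
- by apply: measurable_wint; exact: measurable_funD.
- by apply: emeasurable_funD; exact: mZ.
- move=> x Ox; rewrite -!EFinM -EFinD lee_fin !mulrA -mulrDl ler_wpM2r//.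
  apply: le_trans (_ : (t * (t^-1 * `|f x|) + (1 - t) * ((1 - t)^-1 * `|g x|)) `^ q <= _).
    rewrite ge0_ler_powR ?nnegrE//; first by have := q1; lra.
      by rewrite addr_ge0// !mulr_ge0// ?invr_ge0 ltW.
    by rewrite !mulrA !mulfV ?lt0r_neq0// !mul1r ler_normD.
  apply: le_trans (powR_convex2 q1 _ _ _) _; rewrite ?(ltW t0) ?(ltW t1)//.
  - by rewrite mulr_ge0 ?invr_ge0 ?(ltW t0).
  - by rewrite mulr_ge0 ?invr_ge0 ?(ltW s0).
  have hp (a b : R) : 0 < a -> 0 <= b -> a * (a^-1 * b) `^ q = a `^ (1 - q) * b `^ q.
    move=> a0 b0; rewrite powRM ?invr_ge0 ?(ltW a0)// mulrA; congr (_ * _).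
    by rewrite -powR_inv1 ?(ltW a0)// -powRrM mulN1r powRD ?(gt_eqF a0) ?implybT// powRr1// ltW.
  by rewrite !hp.
Qed.

Lemma wint_add3 f g h : measurable_fun Omega f -> measurable_fun Omega g -> measurable_fun Omega h ->
  (wint (fun x => f x + (g x + h x))%R <= (2^-1 `^ (1 - q) * 2^-1 `^ (1 - q))%:E * (wint f + (wint g + wint h)))%E.
Proof.
move=> mf mg mh; have h2 : (0 < 2^-1 :> R) && (2^-1 < 1 :> R) by lra.
have eh : 1 - 2^-1 = 2^-1 :> R by lra.
set k := 2^-1 `^ (1 - q); have k1 : 1 <= k.
  by rewrite /k -powR_inv1// -powRrM mulN1r opprB powR_ge1//; have := q1; lra.
have k0 : 0 <= k by lra.
apply: le_trans (wint_convex h2 mf (measurable_funD mg mh)) _.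
have h1 := wint_convex h2 mg mh; rewrite eh -/k in h1; rewrite eh -/k.
exact: ereal_add3 k1 (wint_ge0 _) (wint_ge0 _) (wint_ge0 _) h1.
Qed.

(** Converts smallness in [L^1], which the approximation by step functions provides, into smallness
    of the energy, for bounded functions living where the weight is bounded. *)
Lemma wint_bounded (B W : R) g : measurable_fun Omega g -> 0 <= B -> 0 <= W ->
  (forall x, Omega x -> `|g x| <= B) -> (forall x, Omega x -> g x != 0 -> w x <= W) ->
  (wint g <= (B `^ (q - 1) * W)%:E * \int[mu]_(x in Omega) `|g x|%:E)%E.
Proof.
move=> mg B0 W0 gB gW; have ma : measurable_fun Omega (fun x => `|g x|%:E).
  by apply/measurable_EFinP; exact: measurableT_comp.
have c0 : 0 <= B `^ (q - 1) * W by rewrite mulr_ge0 ?powR_ge0.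
rewrite -ge0_integralZl// ?lee_fin//; apply: ge0_le_integral => //.
- by move=> x _; rewrite lee_fin mulr_ge0 ?powR_ge0.
- exact: measurable_wint.
- exact: measurable_funeM.
- move=> x Ox; rewrite -EFinM lee_fin; have [->|g0] := eqVneq (g x) 0.
    by rewrite normr0 powR0 ?mul0r ?mulr0//; have := q1; lra.
  have a0 : 0 < `|g x| by rewrite normr_gt0.
  have -> : `|g x| `^ q = `|g x| `^ (q - 1) * `|g x|.
    by rewrite -[X in _ * X]powRr1 ?(ltW a0)// -powRD ?(gt_eqF a0) ?implybT// subrK.
  rewrite mulrAC ler_wpM2r// ler_pM ?powR_ge0 ?gW//.
  by rewrite ge0_ler_powR ?nnegrE ?gB//; have := q1; lra.
Qed.

Lemma int_eventually0 (H : 'rV[R]_n -> R) (a : nat -> 'rV[R]_n -> R) (e : R) :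
  mu.-integrable Omega (EFin \o H) ->
  (forall k, measurable_fun Omega (a k)) -> (forall k x, Omega x -> 0 <= a k x <= H x) ->
  (forall x, Omega x -> exists N, forall k, (N <= k)%N -> a k x = 0) -> 0 < e ->
  exists N, forall k, (N <= k)%N -> (\int[mu]_(x in Omega) (a k x)%:E < e%:E)%E.
Proof.
move=> iH ma aH a0 e0; apply: cvge0_lt e0.
have [] := @dominated_convergence _ _ R mu Omega mO (fun k x => (a k x)%:E) (cst 0%E) (EFin \o H) _ _ _ iH.
- by move=> k; apply/measurable_EFinP.
- exact: measurable_cst.
- apply: aeW => x Ox; have [N hN] := a0 x Ox.
  by apply: cvg_near_cst; exists N => // k /= Nk; rewrite hN.
- by apply: aeW => x k Ox; have /andP[h1 h2] := aH k x Ox; rewrite /= ger0_norm// lee_fin.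
- by move=> _ _; rewrite integral0.
Qed.

End weighted_integral_theory.

(** * Density of step functions of mean zero *)

Section density.
Context {R : realType} {n : nat}.
Variables (Omega : set 'rV[R]_n) (D : R).
Local Notation mu := (@lebesgue_rV R n).
Local Notation pt := {ffun 'I_n -> int}.
Local Notation d := (dist_bd Omega).
Local Notation mesh := (mesh D).
Hypothesis oO : open Omega.
Hypothesis bO : bounded_set Omega.
Hypothesis bd0 : boundary Omega !=set0.
Hypothesis D0 : 0 < D.
Hypothesis hD : forall x, Omega x -> d x <= D.
Variables (q e : R).
Hypothesis q1 : 1 < q.
Variable x0 : 'rV[R]_n.
Hypothesis Ox0 : Omega x0.
Local Notation w := (fun x => d x `^ e).
Local Notation wint := (weighted_int Omega q w).

Lemma measurable_Omega : measurable Omega. Proof. exact: open_measurable_rV. Qed.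
Let mO := measurable_Omega.

Lemma measurable_dist_bd : measurable_fun setT (d : 'rV[R]_n -> R).
Proof. by apply: continuous_measurable_rV => x; exact: dist_bd_continuous. Qed.

Lemma measurable_weight : measurable_fun setT w.
Proof.
by apply: (measurableT_comp (@measurable_powR R e)); exact: measurable_dist_bd.
Qed.
Let mw := measurable_weight.
Let w0 (x : 'rV[R]_n) : 0 <= w x := powR_ge0 (d x) e.

Lemma domain_box : exists2 B : R, 0 < B & forall x, Omega x -> forall l, `|x ord0 l| <= B.
Proof.
have [M [Mr hM]] := bO; exists (`|M| + 1); first by rewrite ltr_wpDl.
move=> x Ox l; apply: le_trans (_ : `|x| <= _); last first.
  apply: hM => //; rewrite (le_lt_trans (ler_norm M))// ltrDl//.
rewrite -[leRHS]/(mx_norm x) mx_normrE.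
exact: (le_bigmax _ (fun ij => `|x ij.1 ij.2|) (ord0, l)).
Qed.

Lemma domain_finite : (mu Omega < +oo)%E.
Proof.
have [B B0 hB] := domain_box.
apply: (@le_lt_trans _ _ (mu [set x | forall l, - B <= x ord0 l <= - B + 2 * B])).
  apply: le_measure; rewrite ?inE//; last first.
    by move=> x Ox l; have := hB x Ox l; rewrite ler_norml => /andP[h1 h2]; apply/andP; split; lra.
  rewrite -[X in measurable X]setCK; apply: measurableC; apply: open_measurable_rV; apply: closed_openC.
  exact: (@norm_box_closed R n (fun=> - B) (fun=> - B + 2 * B)).
rewrite (lebesgue_cube (fun=> - B)) ?ltry//; lra.
Qed.

Lemma finite_cells K (P : pt -> Prop) : (forall m, P m -> Omega (lattice_pt (mesh K) m)) ->
  exists s : seq pt, uniq s /\ forall m, m \in s <-> P m.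
Proof.
move=> hP; have [B B0 hB] := domain_box; have m0 : 0 < mesh K by exact: mesh_gt0.
pose N := (Num.truncn (B / mesh K)).+1.
pose g (v : {ffun 'I_n -> 'I_(2 * N).+1}) : pt := [ffun l => (v l)%:Z - N%:Z].
pose s := [seq m <- undup [seq g v | v <- enum {ffun 'I_n -> 'I_(2 * N).+1}] | `[< P m >]].
exists s; split; first by rewrite filter_uniq// undup_uniq.
move=> m; rewrite mem_filter; split; first by move=> /andP[/asboolP].
move=> Pm; rewrite (asboolT Pm) /= mem_undup; apply/mapP.
have hm l : (- N%:Z <= m l)%R /\ (m l <= N%:Z)%R.
  have := hB _ (hP m Pm) l; rewrite mxE ler_norml => /andP[h1 h2].
  have hN : B < N%:R * mesh K by rewrite -ltr_pdivrMr//; exact: truncnS_gt.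
  have a1 : ((m l)%:~R < (N%:Z)%:~R :> R) by rewrite -(ltr_pM2r m0) mulrC (le_lt_trans h2).
  have a2 : ((- N%:Z)%:~R < (m l)%:~R :> R).
    by rewrite -(ltr_pM2r m0) [ltRHS]mulrC (lt_le_trans _ h1)// mulrNz mulNr ltrN2.
  by move: a1 a2; rewrite !ltr_int; lia.
exists [ffun l => inord (absz (m l + N%:Z))]; first by rewrite mem_enum.
apply/ffunP => l; rewrite !ffunE; have [h1 h2] := hm l.
rewrite inordK; first by lia.
lia.
Qed.

Lemma idx_cell K (x : 'rV[R]_n) (m : pt) : gcell D (K, m) x <-> idx D K x = m.
Proof.
have m0 : 0 < mesh K by exact: mesh_gt0.
split; last by move=> <-; exact: gcell_idx.
move=> h; apply/ffunP => l; rewrite ffunE; apply: floor_def; rewrite intrD.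
by have /= /andP[h1 h2] := h l; rewrite ler_pdivlMr// ltr_pdivrMr// mulrDl mul1r h1.
Qed.

Lemma lattice_cell K (m : pt) : gcell D (K, m) (lattice_pt (mesh K) m).
Proof.
by move=> l; rewrite /= mxE mulrC lexx ltrDl; exact: mesh_gt0.
Qed.

Lemma mesh_small (t : R) : 0 < t -> exists K, forall k, (K <= k)%N -> mesh k <= t.
Proof.
move=> t0; exists (Num.truncn (D / t)).+1 => k Kk; apply: le_trans (mesh_le D0 Kk) _.
rewrite /mesh ler_pdivrMr ?exprn_gt0// mulrC -ler_pdivrMr//; apply/ltW.
apply: lt_trans (truncnS_gt _) _; rewrite -natrX ltr_nat; exact: ltn_expl.
Qed.

Lemma weight_bound (r x : R) : 0 < r -> r <= x -> x <= D -> x `^ e <= r `^ e + D `^ e.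
Proof.
move=> r0 rx xD; have [e0|e0] := leP 0 e.
  by rewrite ler_wpDl ?powR_ge0// ge0_ler_powR// nnegrE; lra.
rewrite ler_wpDr ?powR_ge0//.
rewrite -[e]opprK (powRN x (- e)) (powRN r (- e)) lef_pV2 ?posrE ?powR_gt0//; try by lra.
by rewrite ge0_ler_powR// ?nnegrE; lra.
Qed.

(** Truncation at height [k] and at distance [1 / (k + 1)] from the boundary. The [L^1] bound is
    asked besides the energy bound because it controls the mean that is lost. *)
Lemma truncate (f : 'rV[R]_n -> R) (ep eta : R) : measurable_fun Omega f ->
  (wint f < +oo)%E -> (\int[mu]_(x in Omega) `|f x|%:E < +oo)%E -> 0 < ep -> 0 < eta ->
  exists (F : 'rV[R]_n -> R) (B r : R), [/\ measurable_fun setT F, 0 < B & 0 < r] /\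
   [/\ forall x, `|F x| <= B, forall x, F x != 0 -> Omega x /\ r <= d x,
      (wint (fun x => f x - F x)%R < ep%:E)%E &
      (\int[mu]_(x in Omega) `|f x - F x|%:E < eta%:E)%E].
Proof.
move=> mf wf fi ep0 eta0.
have mg : measurable_fun setT (f \_ Omega) by exact/(measurable_restrictT f mO).
pose A k := [set x : 'rV[R]_n | `|(f \_ Omega) x| <= k%:R] `&` [set x | k.+1%:R^-1 <= d x].
have mA k : measurable (A k).
  apply: measurableI.
    rewrite (_ : [set x : 'rV[R]_n | _] = (fun x => `|(f \_ Omega) x|) @^-1` `]-oo, k%:R]%classic); last first.
      by apply/seteqP; split => x /=; rewrite in_itv.
    rewrite -[X in measurable X]setTI; apply: measurableT_comp => //; exact: measurable_itv.
  rewrite (_ : [set x : 'rV[R]_n | _] = d @^-1` `[k.+1%:R^-1, +oo[%classic); last first.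
    by apply/seteqP; split => x /=; rewrite in_itv/= andbT.
  by rewrite -[X in measurable X]setTI; apply: measurable_dist_bd => //; exact: measurable_itv.
pose F k x := (f \_ Omega) x * \1_(A k) x.
have mF k : measurable_fun setT (F k) by apply: measurable_funM => //; exact: measurable_indic.
have mfF k : measurable_fun Omega (fun x => f x - F k x).
  by apply: measurable_funB => //; exact: (measurable_funS measurableT).
have rf x : Omega x -> (f \_ Omega) x = f x by move=> Ox; rewrite patchE mem_set.
have FE k x : Omega x -> f x - F k x = (if x \in A k then 0 else f x).
  by move=> Ox; rewrite /F rf// indicE; case: (_ \in _); rewrite ?mulr1 ?mulr0 ?subrr ?subr0.
have ev x : Omega x -> exists N, forall k, (N <= k)%N -> x \in A k.
  move=> Ox; have dx := dist_bd_gt0 oO bd0 Ox.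
  exists (maxn (Num.truncn `|f x|).+1 (Num.truncn (d x)^-1)) => k; rewrite geq_max => /andP[k1 k2].
  apply/mem_set; split => /=.
    by rewrite rf// (le_trans (ltW (truncnS_gt _)))// ler_nat.
  rewrite invf_ple ?posrE//; apply: le_trans (ltW (truncnS_gt _)) _; by rewrite ler_nat ltnS.
have [||||N1 hN1] := @int_eventually0 R n Omega mO (fun x => `|f x| `^ q * w x)
   (fun k x => `|f x - F k x| `^ q * w x) ep _ _ _ _ ep0.
- apply/integrableP; split; first exact: measurable_wint.
  by under eq_integral do rewrite /= ger0_norm ?mulr_ge0 ?powR_ge0//.
- by move=> k; have /measurable_EFinP := measurable_wint q mw (mfF k).
- move=> k x Ox; rewrite mulr_ge0 ?powR_ge0//= FE//; case: ifP => // _.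
  by rewrite normr0 powR0 ?mul0r ?mulr_ge0 ?powR_ge0//; have := q1; lra.
- move=> x Ox; have [N hN] := ev x Ox; exists N => k Nk; rewrite FE// hN// normr0 powR0 ?mul0r//; have := q1; lra.
have [||||N2 hN2] := @int_eventually0 R n Omega mO (fun x => `|f x|)
   (fun k x => `|f x - F k x|) eta _ _ _ _ eta0.
- apply/integrableP; split; first by apply/measurable_EFinP; exact: measurableT_comp.
  by under eq_integral do rewrite /= normr_id.
- by move=> k; apply: measurableT_comp => //; exact: mfF.
- by move=> k x Ox; rewrite normr_ge0 /= FE//; case: ifP => _; rewrite ?normr0.
- by move=> x Ox; have [N hN] := ev x Ox; exists N => k Nk; rewrite FE// hN// normr0.
- pose N := maxn N1 N2; exists (F N), N.+1%:R, N.+1%:R^-1; split.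
    by split; rewrite ?invr_gt0 ?ltr0n.
  split.
  + move=> x; rewrite /F indicE; case: (boolP (_ \in _)) => [/set_mem[/= h _]|_]; last by rewrite mulr0 normr0.
    by rewrite mulr1 (le_trans h)// ler_nat.
  + move=> x; rewrite /F patchE indicE; case: (boolP (x \in Omega)) => [/set_mem Ox|_]; last by rewrite mul0r eqxx.
    by case: (boolP (_ \in _)) => [/set_mem[/= _ h]|_]; rewrite ?mulr0 ?eqxx.
  + by apply: hN1; exact: leq_maxl.
  + by apply: hN2; exact: leq_maxr.
Qed.

(** The approximating step function [h] has a small but nonzero mean [I], which is removed on one
    fixed cell [Q0] at [x0]. The order of choices matters: [Q0] precedes the tolerances [eta] and
    [eta'], since the energy of the correction depends on the measure of [Q0] and on the weight
    there; the level [K] comes last. *)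
Lemma density (f : 'rV[R]_n -> R) (ep L : R) : measurable_fun Omega f -> (wint f < +oo)%E ->
  (\int[mu]_(x in Omega) (f x)%:E = 0)%E -> 0 < ep -> n%:R + 1 <= L ->
  exists K (G : 'rV[R]_n -> R) (s : seq pt), [/\ step_at D K G, uniq s,
     forall m, m \in s -> Omega (lattice_pt (mesh K) m) /\ L * mesh K <= d (lattice_pt (mesh K) m),
     forall x, idx D K x \notin s -> G x = 0 & \sum_(m <- s) G (lattice_pt (mesh K) m) = 0] /\
     (wint (fun x => f x - G x)%R < ep%:E)%E.
Proof.
move=> mf wf f0 ep0 nL; have L0 : 0 < L by apply: lt_le_trans nL; rewrite ltr_wpDl.
have q0 : 0 < q by have := q1; lra.
have fi : (\int[mu]_(x in Omega) `|f x|%:E < +oo)%E by rewrite (integral_fin_num_abs _ mO mf) f0.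
pose A0 := 2^-1 `^ (1 - q) * 2^-1 `^ (1 - q) : R.
have A00 : 0 < A0 by rewrite mulr_gt0// powR_gt0.
pose ep' := ep / (4 * A0); have ep'0 : 0 < ep' by rewrite divr_gt0// mulr_gt0.
have dx0 := dist_bd_gt0 oO bd0 Ox0.
pose n1 : R := n%:R + 1; have n10 : 0 < n1 by rewrite /n1 ltr_wpDl.
have [K0 /(_ K0 (leqnn _)) hK0] := mesh_small (divr_gt0 dx0 (mulr_gt0 (ltr0n R 2) n10)).
pose Q0 := gcell D (K0, idx D K0 x0).
have mQ0 : measurable Q0 by exact: measurable_gcell.
have near (x y : 'rV[R]_n) (t : R) k : Omega y -> t <= d y -> mesh k <= t / (2 * n1) -> idx D k x = idx D k y -> 0 < t ->
    Omega x /\ t / 2 <= d x.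
  move=> Oy ty mk xy t0; have cx : gcell D (k, idx D k y) x by apply/idx_cell.
  have := gcell_dist cx (gcell_idx k y D0) => /= h1; have h2 := gcell_dist (gcell_idx k y D0) cx; rewrite /= in h2.
  have h3 : n%:R * mesh k <= t / 2.
    apply: (@le_trans _ _ (n1 * mesh k)); first by rewrite ler_wpM2r ?(ltW (mesh_gt0 D0 _))// /n1; lra.
    apply: le_trans (ler_wpM2l (ltW n10) mk) _.
    by rewrite le_eqVlt; apply/orP; left; apply/eqP; field; apply: lt0r_neq0.
  split; first by apply: (dist_bd_ball oO Oy); apply: le_lt_trans h2 _; apply: le_lt_trans h3 _; lra.
  by have := dist_bd_lip bd0 y x; lra.
have Q0O x : Q0 x -> Omega x /\ d x0 / 2 <= d x.
  move=> /idx_cell xQ; exact: (near x x0 (d x0) K0).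
pose m0 := mesh K0 ^+ n; have m00 : 0 < m0 by rewrite exprn_gt0// mesh_gt0.
have muQ0 : mu Q0 = m0%:E by rewrite /Q0 lebesgue_gcell.
pose W0 := (d x0 / 2) `^ e + D `^ e; have W00 : 0 <= W0 by rewrite addr_ge0 ?powR_ge0.
pose eta := Num.min 1 (ep' / ((2 / m0) `^ (q - 1) * W0 * 2 + 1)).
have hX : 0 < (2 / m0) `^ (q - 1) * W0 * 2 + 1.
  by rewrite ltr_wpDl// mulr_ge0// mulr_ge0 ?powR_ge0.
have eta0 : 0 < eta by rewrite /eta !lt_min ltr01 divr_gt0.
have eta1 : eta <= 1 by rewrite /eta ge_min lexx.
have eta2 : (2 / m0) `^ (q - 1) * W0 * (2 * eta) <= ep'.
  have : eta <= ep' / ((2 / m0) `^ (q - 1) * W0 * 2 + 1) by rewrite /eta !ge_min lexx !orbT.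
  by apply: eta_bound => //; rewrite mulr_ge0 ?powR_ge0.
have [F [B [r [[mF B0 r0] [bF sF wF iF]]]]] := truncate mf wf fi ep'0 eta0.
pose W1 := (r / 2) `^ e + D `^ e; have W10 : 0 <= W1 by rewrite addr_ge0 ?powR_ge0.
pose X1 := (2 * B) `^ (q - 1) * W1; have X10 : 0 <= X1 by rewrite mulr_ge0 ?powR_ge0.
pose eta' := Num.min eta (ep' / (X1 + 1)).
have eta'0 : 0 < eta' by rewrite lt_min eta0 divr_gt0// ltr_wpDl.
have [_ /(_ _ eta'0)[K1 [h0 [sh0 ih0]]]] := step_approx_bounded D0 mO domain_finite mF bF.
have rn : 0 < Num.min r (d x0) by rewrite lt_min r0.
have [K2 hK2] := mesh_small (divr_gt0 rn (mulr_gt0 (ltr0n R 2) (addr_gt0 n10 L0))).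
pose K := maxn K0 (maxn K1 K2).
have mK : mesh K <= Num.min r (d x0) / (2 * (n1 + L)) by apply: hK2; rewrite /K !leq_max leqnn !orbT.
have mK0 : 0 < mesh K by exact: mesh_gt0.
have mKt (t : R) : 0 < t -> Num.min r (d x0) <= t -> mesh K <= t / (2 * n1) /\ L * mesh K <= t / 2.
  by move=> t0 ht; exact: mesh_split mK.
pose V (m : pt) := exists y : 'rV[R]_n, [/\ idx D K y = m, Omega y & r <= d y].
(* Clipping at [B] brings [h0] no further from [F] and makes [wint_bounded] applicable. Cells with
   no point of [Omega] at distance [r] or more from the boundary are dropped, so that the weight
   stays bounded on the support. *)
pose h (x : 'rV[R]_n) : R := if `[< V (idx D K x) >] then Num.max (- B) (Num.min B (h0 x)) else 0.
have sh : step_at D K h.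
  by move=> x y xy; rewrite /h xy (step_at_leq D0 _ sh0 xy)// /K !leq_max leqnn !orbT.
have mh : measurable_fun setT h := step_at_measurable D0 sh.
have bh x : `|h x| <= B.
  rewrite /h; case: ifP => _; last by rewrite normr0 ltW.
  exact: clip_bound.
have hF x : `|F x - h x| <= `|F x - h0 x|.
  rewrite /h; case: ifP => [_|/asboolP nV].
    exact: clip_dist.
  have [->|Fx] := eqVneq (F x) 0; first by rewrite subrr normr0.
  by have [Ox rx] := sF x Fx; case: nV; exists x.
have hV x : h x != 0 -> V (idx D K x) by rewrite /h; case: ifP => [/asboolP//|]; rewrite eqxx.
have [|mKr LKr] := mKt r r0 (_ : Num.min r (d x0) <= r); first by rewrite ge_min lexx.
have [|mKx LKx] := mKt (d x0) dx0 (_ : Num.min r (d x0) <= d x0); first by rewrite ge_min lexx orbT.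
have nearV x m : V m -> idx D K x = m -> Omega x /\ r / 2 <= d x.
  by move=> [y [ym Oy ry]] xm; apply: (near x y r K) => //; rewrite xm ym.
have mfF : measurable_fun Omega (fun x => f x - F x) by apply: measurable_funB => //; exact: (measurable_funS measurableT).
have mFh : measurable_fun Omega (fun x => F x - h x).
  by apply: measurable_funB => //; exact: (measurable_funS measurableT).
have mhO : measurable_fun Omega h by exact: (measurable_funS measurableT).
have absm g : measurable_fun Omega g -> measurable_fun Omega (fun x => `|g x : R|%:E).
  by move=> mg; apply/measurable_EFinP; exact: measurableT_comp.
have iFh : (\int[mu]_(x in Omega) `|F x - h x|%:E < eta'%:E)%E.
  apply: le_lt_trans ih0; apply: ge0_le_integral => //; try exact: absm.
  - apply: absm; apply: measurable_funB => //; apply: (measurable_funS measurableT) => //.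
    exact: step_at_measurable sh0.
  - by move=> x _; rewrite lee_fin.
have wFh : (wint (fun x => F x - h x)%R <= ep'%:E)%E.
  apply: le_trans (@wint_bounded R n Omega w q mO mw w0 q1 (2 * B) W1 _ mFh _ W10 _ _) _.
  - by rewrite mulr_ge0// ltW.
  - by move=> x _; apply: le_trans (ler_normB _ _) _; rewrite mulrDl mul1r lerD.
  - move=> x Ox Fh; apply: weight_bound; rewrite ?hD ?divr_gt0//.
    have [hx|hx] := eqVneq (h x) 0; last by have [] := nearV x _ (hV _ hx) erefl.
    have : F x != 0 by apply: contraNneq Fh => ->; rewrite hx subrr.
    by move=> /sF[_ rx]; apply: le_trans rx; rewrite ler_pdivrMr// ler_peMr ?ler1n// ltW.
  apply: (@le_trans _ _ (X1%:E * eta'%:E)%E); first by rewrite lee_wpmul2l ?lee_fin// ltW.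
  rewrite -EFinM lee_fin.
  apply: le_trans (_ : X1 * (ep' / (X1 + 1)) <= _); first by rewrite ler_wpM2l// ge_min lexx orbT.
  by rewrite mulrA ler_pdivrMr ?ltr_wpDl// mulrC ler_wpM2l ?(ltW ep'0)// lerDl.
have intf : mu.-integrable Omega (EFin \o f) by apply/integrableP; split => //; apply/measurable_EFinP.
have inth : mu.-integrable Omega (EFin \o h).
  apply/integrableP; split; first by apply/measurable_EFinP.
  apply: (@le_lt_trans _ _ (\int[mu]_(x in Omega) B%:E)%E).
    by apply: ge0_le_integral => //; [exact: absm | move=> x _; rewrite lee_fin].
  by rewrite integral_cst//= lte_mul_pinfty// ?lee_fin ?ltW// domain_finite.
pose I := fine (\int[mu]_(x in Omega) (h x)%:E).
have IE : (\int[mu]_(x in Omega) (h x)%:E = I%:E)%E by rewrite /I fineK//; exact: integrable_fin_num inth.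
have Ib : `|I| <= 2 * eta.
  rewrite -lee_fin (_ : `|I|%:E = (`|(- I%:E)|)%E); last by rewrite abseN.
  have e1 : (\int[mu]_(x in Omega) ((f x)%:E - (h x)%:E) = - I%:E)%E.
    by rewrite integralB_EFin// f0 IE sub0e.
  rewrite -e1; apply: le_trans (le_abse_integral _ mO _) _.
    by apply: measurable_int; exact: integrableB intf inth.
  apply: (@le_trans _ _ (\int[mu]_(x in Omega) (`|f x - F x|%:E + `|F x - h x|%:E))%E).
    apply: ge0_le_integral => //.
    - by apply: measurableT_comp => //; apply: measurable_int; exact: integrableB intf inth.
    - by apply: emeasurable_funD; exact: absm.
    - by move=> x _; rewrite -EFinB -EFinD lee_fin ler_distD.
  rewrite ge0_integralD//; try exact: absm.
  have -> : 2 * eta = eta + eta by rewrite mulr_natl.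
  rewrite EFinD; apply: leeD; first exact: ltW.
  by apply: le_trans (ltW iFh) _; rewrite lee_fin ge_min lexx.
pose G (x : 'rV[R]_n) : R := h x - I / m0 * \1_Q0 x.
have sQ0 : step_at D K (\1_Q0 : _ -> R).
  move=> x y xy; rewrite !indicE; congr (_%:R).
  have h1 := step_at_leq (T := pt) D0 (_ : (K0 <= K)%N) (fun _ _ => id) xy.
  rewrite /K leq_maxl in h1; have {}h1 := h1 erefl.
  by congr nat_of_bool; apply/idP/idP => /set_mem/idx_cell xq; apply/mem_set/idx_cell; rewrite -xq ?h1// -h1.
have sG : step_at D K G by move=> x y xy; rewrite /G (sh _ _ xy) (sQ0 _ _ xy).
have mG : measurable_fun setT G := step_at_measurable D0 sG.
have mi : measurable_fun Omega (fun x => I / m0 * \1_Q0 x : R).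
  by apply: measurable_funM => //; exact: measurable_indic.
have inti : mu.-integrable Omega (EFin \o (\1_Q0 : _ -> R)).
  apply/integrableP; split; first by apply/measurable_EFinP; exact: measurable_indic.
  under eq_integral do rewrite /= ger0_norm//.
  rewrite integral_indic//; apply: (@le_lt_trans _ _ (mu Q0)); last by rewrite muQ0 ltry.
  by apply: le_measure; rewrite ?inE//; exact: measurableI.
have iG0 : (\int[mu]_(x in Omega) (G x)%:E = 0)%E.
  under eq_integral do rewrite EFinB EFinM.
  rewrite integralB//; last exact: integrableZl inti.
  rewrite integralZl// integral_indic// setIidl; last by move=> x /Q0O[].
  by rewrite IE [X in (_ * X)%E]muQ0 -EFinM divfK ?(lt0r_neq0 m00)// subee.
pose P m := Omega (lattice_pt (mesh K) m) /\ L * mesh K <= d (lattice_pt (mesh K) m).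
have [s [us hs]] := @finite_cells K P (fun m => @proj1 _ _).
have lpi (m : pt) : idx D K (lattice_pt (mesh K) m) = m by apply/idx_cell; exact: lattice_cell.
have Gs x : idx D K x \notin s -> G x = 0.
  move=> xs; apply/eqP; apply: contraNT xs => Gx; apply/hs.
  have [hx|hx] := eqVneq (h x) 0; last first.
    have [Om r1] := nearV (lattice_pt (mesh K) (idx D K x)) _ (hV x hx) (lpi _).
    by split=> //; exact: le_trans r1.
  have Qx : \1_Q0 (lattice_pt (mesh K) (idx D K x)) != 0 :> R.
    by rewrite (sQ0 _ x) ?lpi//; apply: contraNneq Gx => Q0x; rewrite /G hx Q0x mulr0 subrr.
  have [Om r1] : Omega (lattice_pt (mesh K) (idx D K x)) /\ d x0 / 2 <= d (lattice_pt (mesh K) (idx D K x)).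
    by apply: Q0O; apply/set_mem; move: Qx; rewrite indicE; case: (_ \in _); rewrite ?eqxx.
  by split=> //; exact: le_trans r1.
have cO m : m \in s -> gcell D (K, m) `<=` Omega.
  move=> /hs[Om r1] x /idx_cell xm.
  have [//|nO] := pselect (Omega x).
  have h1 := gcell_dist (lattice_cell K m) ((idx_cell K x m).2 xm).
  have h2 : fnorm (lattice_pt (mesh K) m - x) < d (lattice_pt (mesh K) m).
    apply: le_lt_trans h1 _.
    apply: lt_le_trans (_ : n1 * mesh K <= _); first by rewrite ltr_pM2r// /n1 ltrDl.
    apply: le_trans r1; rewrite ler_wpM2r ?(ltW mK0)//.
  by have := dist_bd_ball oO Om h2.
exists K, G, s; split; last first.
  rewrite (_ : wint (fun x => f x - G x) = wint (fun x => (f x - F x) + ((F x - h x) + I / m0 * \1_Q0 x))); last first.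
    by congr weighted_int; apply/funext => x; rewrite /G; ring.
  have wi : (wint (fun x => I / m0 * \1_Q0 x)%R <= ep'%:E)%E.
    have Im : `|I / m0| <= 2 / m0.
      rewrite normrM (ger0_norm (_ : 0 <= m0^-1)) ?invr_ge0 ?(ltW m00)// ler_wpM2r ?invr_ge0 ?(ltW m00)//.
      by apply: le_trans Ib _; rewrite -[leRHS]mulr1 ler_wpM2l.
    have i1 x : `|\1_Q0 x : R| <= 1 by rewrite indicE; case: (_ \in _); rewrite ?normr1 ?normr0.
    apply: le_trans (@wint_bounded R n Omega w q mO mw w0 q1 (2 / m0) W0 _ mi _ W00 _ _) _.
    - by rewrite divr_ge0// ltW.
    - by move=> x _; rewrite normrM; apply: le_trans (ler_pM _ _ Im (i1 x)) _; rewrite ?mulr1.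
    - move=> x Ox Ix; apply: weight_bound; rewrite ?hD ?divr_gt0//.
      suff /Q0O[] : Q0 x by [].
      by apply/set_mem; move: Ix; rewrite indicE; case: (_ \in _); rewrite ?mulr0 ?eqxx.
    under eq_integral do rewrite normrM EFinM.
    rewrite ge0_integralZl//; last by apply: absm; exact: measurable_indic.
    under eq_integral do rewrite ger0_norm//.
    rewrite integral_indic// setIidl; last by move=> x /Q0O[].
    rewrite [X in (_ * (_ * X))%E]muQ0 -!EFinM lee_fin normrM (ger0_norm (_ : 0 <= m0^-1)) ?invr_ge0 ?(ltW m00)//.
    by rewrite divfK ?(lt0r_neq0 m00)// (le_trans _ eta2)// ler_wpM2l// mulr_ge0 ?powR_ge0.
  apply: le_lt_trans (wint_add3 mO mw w0 q1 mfF mFh mi) _.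
  apply: (@le_lt_trans _ _ (A0%:E * (ep'%:E + (ep'%:E + ep'%:E)))%E).
    exact: (lee_scaled_add3 (ltW A00) (ltW wF) wFh wi).
  by rewrite -!EFinD -EFinM lte_fin; exact: three_quarters.
split=> //; first by move=> m /hs.
have Gsum x : G x = \sum_(m <- s) G (lattice_pt (mesh K) m) * \1_(gcell D (K, m)) x.
  case: (boolP (idx D K x \in s)) => xs; last first.
    rewrite Gs// big_seq big1// => m ms; rewrite indicE memNset ?mulr0// => /idx_cell xm.
    by rewrite xm ms in xs.
  rewrite (bigD1_seq _ xs us)/= big1 ?addr0 => [|m mx].
    by rewrite indicE mem_set ?mulr1; [exact/sG/esym/lpi | exact: gcell_idx].
  by rewrite indicE memNset ?mulr0// => /idx_cell xm; rewrite xm eqxx in mx.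
have mcell (m : pt) : measurable (gcell D (K, m)) := measurable_gcell _ _.
(* All cells of [s] have the same volume and lie in [Omega], so the vanishing integral of [G]
   becomes a vanishing sum of its values. *)
move: iG0; under eq_integral do rewrite Gsum -sumEFin.
rewrite integral_sum//; last first.
  move=> m; apply/integrableP; split.
    by apply/measurable_EFinP; apply: measurable_funM => //; exact: measurable_indic.
  apply: (@le_lt_trans _ _ (\int[mu]_(x in Omega) `|G (lattice_pt (mesh K) m)|%:E)%E).
    apply: ge0_le_integral => //.
    - by apply: absm; apply: measurable_funM => //; exact: measurable_indic.
    - by move=> x _; rewrite lee_fin normrM ler_piMr// indicE; case: (_ \in _); rewrite ?normr1 ?normr0.
  by rewrite integral_cst//= lte_mul_pinfty// domain_finite.
have Ie m : m \in s -> (\int[mu]_(x in Omega) (G (lattice_pt (mesh K) m) * \1_(gcell D (K, m)) x)%:E =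
    (G (lattice_pt (mesh K) m) * mesh K ^+ n)%:E)%E.
  move=> ms; under eq_integral do rewrite EFinM.
  rewrite integralZl//; last first.
    apply/integrableP; split; first by apply/measurable_EFinP; exact: measurable_indic.
    under eq_integral do rewrite /= ger0_norm//.
    rewrite integral_indic//; apply: (@le_lt_trans _ _ (mu (gcell D (K, m)))); last by rewrite lebesgue_gcell ?ltry.
    by apply: le_measure; rewrite ?inE//; exact: measurableI.
  rewrite integral_indic// setIidl; last exact: cO.
  by rewrite [X in (_ * X)%E]lebesgue_gcell.
rewrite big_seq (eq_bigr _ Ie) -big_seq sumEFin => -[]; rewrite -mulr_suml => /eqP.
by rewrite mulf_eq0 expf_eq0 (gt_eqF mK0) andbF orbF => /eqP.
Qed.

End density.

Lemma powR_comparable2 {R : realType} (a b e : R) : 0 < a -> 0 < b -> a <= 2 * b -> b <= 2 * a ->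
  b `^ e <= 2 `^ `|e| * a `^ e.
Proof.
move=> a0 b0 ab ba; have [h|/ltW h] := leP b a; first exact: powR_comparable.
have := powR_comparable (- e) b0 ba h; rewrite normrN !powRN.
by rewrite ler_pdivlMr ?powR_gt0// mulrC ler_pdivrMr ?powR_gt0.
Qed.

Lemma powR_le_self {R : realType} (a q : R) : 1 < q -> 0 <= a <= 1 -> a `^ q <= a.
Proof.
move=> q1 /andP[a0 a1]; have [->|an0] := eqVneq a 0; first by rewrite powR0//; lra.
have ap : 0 < a by rewrite lt_def an0.
have -> : a `^ q = a `^ (q - 1) * a by rewrite -[X in _ * X]powRr1// -powRD ?an0 ?implybT// subrK.
rewrite -[leRHS]mul1r ler_wpM2r//; have := @ge0_ler_powR R (q - 1) _ a 1.
by rewrite powR1; apply; rewrite ?nnegrE//; lra.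
Qed.

(** [t] is the root of [s = (1 - k) / (1 - k / 2)] for which [t ^ (1 - q) * t ^ (1 - q) = 1 / s]:
    two uses of [wint_convex] with this [t] give away only half of the gain [k]. *)
Lemma powR_weight {R : realType} (q k : R) : 1 < q -> 0 < k < 1 ->
  exists t : R, 0 < t < 1 /\ t `^ (1 - q) * t `^ (1 - q) * (1 - k) <= 1 - k / 2.
Proof.
move=> q1 /andP[k0 k1]; pose s := (1 - k) / (1 - k / 2).
have s0 : 0 < s by rewrite divr_gt0; lra.
have s1 : s < 1 by rewrite ltr_pdivrMr; lra.
have r0 : 0 < (2 * (q - 1))^-1 by rewrite invr_gt0; lra.
exists (s `^ (2 * (q - 1))^-1); split.
  apply/andP; split; first exact: powR_gt0.
  by have := @gt0_ltr_powR R _ r0 s 1; rewrite powR1; apply; rewrite ?nnegrE// ltW.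
rewrite -!powRrM -powRD ?(gt_eqF s0) ?implybT//.
have -> : (2 * (q - 1))^-1 * (1 - q) + (2 * (q - 1))^-1 * (1 - q) = - 1.
  by field; rewrite lt0r_neq0//; lra.
rewrite powR_inv1 ?(ltW s0)// /s invf_div -mulrA mulVf ?mulr1//.
by rewrite lt0r_neq0//; lra.
Qed.

Lemma bump_pointwise {R : realType} (q c wx wp b i b0 Z : R) : 1 < q -> 0 < b0 -> 0 < Z -> wp <= Z * wx ->
  0 <= b <= 1 -> b0 * i <= b -> 0 <= wx -> 0 <= wp ->
  `|c * (1 - b)| `^ q * wx + b0 * Z^-1 * (`|c| `^ q * wp * i) <= `|c| `^ q * wx.
Proof.
move=> q1 b00 Z0 wz /andP[bu0 bu1] ib wx0 wp0.
have u0 : 0 <= 1 - b by rewrite subr_ge0.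
rewrite normrM (ger0_norm u0) powRM//.
have v1 : (1 - b) `^ q <= 1 - b by apply: powR_le_self => //; apply/andP; split; lra.
have g0 : 0 <= `|c| `^ q * wx by rewrite mulr_ge0 ?powR_ge0.
have Zi : Z^-1 * wp <= wx by rewrite mulrC ler_pdivrMr// mulrC.
have k0 : 0 <= `|c| `^ q by exact: powR_ge0.
have v3 : b0 * Z^-1 * (`|c| `^ q * wp * i) <= `|c| `^ q * wx * b.
  have -> : b0 * Z^-1 * (`|c| `^ q * wp * i) = `|c| `^ q * (Z^-1 * wp) * (b0 * i) by ring.
  have zw0 : 0 <= Z^-1 * wp by rewrite mulr_ge0 ?invr_ge0 ?(ltW Z0).
  apply: le_trans (_ : `|c| `^ q * (Z^-1 * wp) * b <= _); first by rewrite ler_wpM2l// mulr_ge0.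
  by rewrite ler_wpM2r// ler_wpM2l.
have v2 : `|c| `^ q * (1 - b) `^ q * wx <= `|c| `^ q * wx * (1 - b).
  by rewrite mulrAC ler_wpM2l.
by lra.
Qed.

Lemma bump_conclude {R : realType} (wG wF : \bar R) (b0 Z tn A E k : R) :
  (0 <= wG)%E -> (0 <= wF)%E -> (wG < +oo)%E -> 0 < b0 -> 0 < Z -> 0 < tn -> 0 <= A ->
  (wG <= (Z * A)%:E)%E -> ((Z^-1 * A)%:E <= wG)%E -> (wF + (b0 * Z^-1 * (tn * A))%:E <= wG)%E ->
  k = b0 * Z^-1 * tn * Z^-1 / 2 -> E <= A ->
  (wF <= (1 - k)%:E * wG)%E /\ (E%:E <= Z%:E * wG)%E.
Proof.
move=> G0 F0 Goo b00 Z0 t0 A0 wup wlo wmid -> EA.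
have fG : wG \is a fin_num by rewrite ge0_fin_numE.
have b0' := ltW b00; have Z' := ltW Z0; have t' := ltW t0.
have X0 : 0 <= b0 * Z^-1 * (tn * A) by rewrite !mulr_ge0 ?invr_ge0.
have fF : wF \is a fin_num.
  rewrite ge0_fin_numE//; apply: le_lt_trans Goo; apply: le_trans wmid.
  by rewrite leeDl.
move: wup wlo wmid; rewrite -(fineK fG) -(fineK fF) -EFinD -!EFinM !lee_fin.
have g0 : 0 <= fine wG by rewrite fine_ge0.
move: (fine wG) (fine wF) g0 => g f g0 u1 u2 u3; split.
  suff : b0 * Z^-1 * tn * Z^-1 / 2 * g <= b0 * Z^-1 * (tn * A) by lra.
  apply: (@le_trans _ _ (b0 * Z^-1 * tn * Z^-1 / 2 * (Z * A))).
    by rewrite ler_wpM2l// !mulr_ge0 ?invr_ge0.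
  have -> : b0 * Z^-1 * tn * Z^-1 / 2 * (Z * A) = (b0 * Z^-1 * (tn * A)) / 2 by field; rewrite lt0r_neq0.
  by lra.
rewrite -ler_pdivrMl//; apply: le_trans u2; by rewrite ler_wpM2l ?invr_ge0.
Qed.

(** * Contraction and iteration *)

Section bump.
Context {R : realType} {n : nat}.
Variables (Omega : set 'rV[R]_n) (D : R).
Local Notation mu := (@lebesgue_rV R n).
Local Notation pt := {ffun 'I_n -> int}.
Local Notation d := (dist_bd Omega).
Local Notation mesh := (mesh D).
Hypothesis oO : open Omega.
Hypothesis bO : bounded_set Omega.
Hypothesis bd0 : boundary Omega !=set0.
Hypothesis D0 : 0 < D.
Hypothesis hD : forall x, Omega x -> d x <= D.
Variables (q e : R).
Hypothesis q1 : 1 < q.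
Local Notation w := (fun x => d x `^ e).
Local Notation wint := (weighted_int Omega q w).
Variable rho : R -> R.
Hypothesis crho : continuous rho.
Hypothesis rho01 : forall x, 0 <= rho x <= 1.
Hypothesis rho_out : forall x, x <= 0 \/ 2 <= x -> rho x = 0.
Hypothesis rho1 : rho 1 = 1.

(** The mesh is halved because [rho] lives on [[0, 2]]: placed at the doubled index, the product
    fits in the cell [m] of level [K], and distinct cells have disjoint bumps. *)
Definition bump K (m : pt) (x : 'rV[R]_n) : R :=
  \prod_l rho ((mesh K.+1)^-1 * x ord0 l - (2 * m l)%:~R).

Lemma bump01 K m x : 0 <= bump K m x <= 1.
Proof.
rewrite /bump; elim/big_ind : _ => [|a b /andP[a0 a1] /andP[b0 b1]|i _]; last exact: rho01.
  by rewrite ler01 lexx.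
by rewrite mulr_ge0// mulr_ile1.
Qed.

Lemma mesh_half K : mesh K = 2 * mesh K.+1.
Proof. by rewrite (mesh_add D K 1) expr1 addn1. Qed.

Lemma bump_out K (m : pt) x : idx D K x != m -> bump K m x = 0.
Proof.
move=> xm; have m0 : 0 < mesh K.+1 by exact: mesh_gt0.
have [l hl] : exists l, idx D K x l != m l.
  by apply/existsP; rewrite -negb_forall; apply: contra xm => /forallP h; apply/eqP/ffunP => l; exact/eqP.
rewrite /bump (bigD1 l)//= rho_out ?mul0r//.
have /andP[h1 h2] := idx_bounds D0 K x l; rewrite mesh_half in h1 h2.
pose z := (mesh K.+1)^-1 * x ord0 l.
have E : x ord0 l = mesh K.+1 * z by rewrite mulrA mulfV ?mul1r ?lt0r_neq0.
rewrite E in h1 h2; rewrite -/z intrM.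
have {}h1 : (idx D K x l)%:~R * 2 <= z by rewrite -(ler_pM2l m0); lra.
have {}h2 : z < (idx D K x l)%:~R * 2 + 2 by rewrite -(ltr_pM2l m0); lra.
have [lt|le] := ltrP (idx D K x l) (m l).
  left; have : ((idx D K x l + 1)%:~R <= (m l)%:~R :> R) by rewrite ler_int; lia.
  by rewrite intrD; lra.
right; have : ((m l + 1)%:~R <= (idx D K x l)%:~R :> R) by rewrite ler_int; move/eqP: hl; lia.
by rewrite intrD; lra.
Qed.

Lemma measurable_bump K m : measurable_fun setT (bump K m).
Proof.
suff h (s : seq 'I_n) : measurable_fun setT (fun x : 'rV[R]_n => \prod_(l <- s) rho ((mesh K.+1)^-1 * x ord0 l - (2 * m l)%:~R)).
  exact: h.
elim: s => [|l s IH].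
  rewrite (_ : (fun x => _) = cst 1); first exact: measurable_cst.
  by apply/funext => y; rewrite big_nil.
rewrite (_ : (fun x => _) = (fun x : 'rV[R]_n => rho ((mesh K.+1)^-1 * x ord0 l - (2 * m l)%:~R) *
  \prod_(l <- s) rho ((mesh K.+1)^-1 * x ord0 l - (2 * m l)%:~R))); last by apply/funext => y; rewrite big_cons.
apply: measurable_funM => //.
apply: (measurableT_comp (continuous_measurable_fun crho)).
by apply: measurable_funB => //; apply: measurable_funM => //; exact: measurable_coor.
Qed.

Lemma rho_near : exists t : R, 0 < t < 1 /\ forall z, `|z - 1| <= t -> 2^-1 <= rho z.
Proof.
have /cvgrPdist_lt/(_ 2^-1) := @crho 1; rewrite invr_gt0 ltr0n => /(_ isT)/nbhs_ballP[r /= r0 hr].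
exists (Num.min (r / 2) 2^-1); split.
  by rewrite lt_min divr_gt0// invr_gt0 ltr0n /= gt_min; apply/orP; right; lra.
move=> z; rewrite le_min => /andP[z1 _].
have /hr : ball (1 : R) r z by rewrite /ball/= distrC (le_lt_trans z1)// ltr_pdivrMr//; lra.
by rewrite /= rho1 ltr_norml => /andP[_]; lra.
Qed.

Let mO : measurable Omega := open_measurable_rV oO.
Let mw : measurable_fun setT w := measurable_weight bd0 e.
Let w0 (x : 'rV[R]_n) : 0 <= w x := powR_ge0 (d x) e.

Lemma int_cells (s : seq pt) (a : pt -> R) (B : pt -> set 'rV[R]_n) (r : R) :
  (forall m, measurable (B m)) -> (forall m, 0 <= a m) ->
  (forall m, m \in s -> B m `<=` Omega /\ mu (B m) = r%:E) ->
  (\int[mu]_(x in Omega) (\sum_(m <- s) a m * \1_(B m) x)%:E = (r * \sum_(m <- s) a m)%:E)%E.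
Proof.
move=> mB a0 hB; under eq_integral do rewrite -sumEFin.
have ma m : measurable_fun Omega (fun x => (a m * \1_(B m) x)%:E).
  by apply/measurable_EFinP; apply: measurable_funM => //; exact: measurable_indic.
rewrite ge0_integral_sum//; last first.
  by move=> m x _; rewrite lee_fin mulr_ge0// indicE.
rewrite mulr_sumr -sumEFin big_seq [RHS]big_seq; apply: eq_bigr => m ms.
have [h1 h2] := hB m ms; under eq_integral do rewrite EFinM.
rewrite ge0_integralZl ?lee_fin//; last by apply/measurable_EFinP; exact: measurable_indic.
by rewrite integral_indic// setIidl// [X in (_ * X)%E]h2 -EFinM mulrC.
Qed.

(** On the concentric box [B m], of relative side [t], the bump is at least [2 ^ (- n)], so the
    residual loses there a fixed part of the energy of its cell; [Z] allows for the variation of the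
    weight over a cell. The second bound concerns the discrete energy that [step_solution] takes as
    its right side. *)
Lemma bump_step : exists (k C : R), [/\ 0 < k < 1, 0 < C & forall K (G : 'rV[R]_n -> R) (s : seq pt),
  step_at D K G -> uniq s ->
  (forall m, m \in s -> Omega (lattice_pt (mesh K) m) /\ (2 * n%:R + 2) * mesh K <= d (lattice_pt (mesh K) m)) ->
  (forall x, idx D K x \notin s -> G x = 0) -> (wint G < +oo)%E ->
  (wint (fun x => G x - \sum_(m <- s) G (lattice_pt (mesh K) m) * bump K m x)%R <= (1 - k)%:E * wint G)%E /\
  ((mesh K.+1 ^+ n * \sum_(m <- s) `|G (lattice_pt (mesh K) m)| `^ q * w (lattice_pt (mesh K) m))%:E <= C%:E * wint G)%E].
Proof.
have [t [/andP[t0 t1] ht]] := rho_near; pose Z : R := 2 `^ `|e|.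
have Z1 : 1 <= Z by rewrite powR_ge1// ler1n.
have Z0 : 0 < Z by lra.
pose b0 : R := 2^-1 ^+ n; have b00 : 0 < b0 by rewrite exprn_gt0.
have b01 : b0 <= 1 by rewrite exprn_ile1//; lra.
have t0n : 0 < t ^+ n by rewrite exprn_gt0.
have t1n : t ^+ n <= 1 by rewrite exprn_ile1// ltW.
pose k := b0 * Z^-1 * t ^+ n * Z^-1 / 2.
have k0 : 0 < k by rewrite /k !mulr_gt0// ?invr_gt0.
have k1 : k < 1.
  have Zi : Z^-1 <= 1 by rewrite invf_le1.
  have Zi0 : 0 < Z^-1 by rewrite invr_gt0.
  rewrite /k ltr_pdivrMr// mul1r (@le_lt_trans _ _ 1)//; last by rewrite ltr1n.
  by rewrite !mulr_ile1// ?mulr_ge0// ltW.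
exists k, Z; split; rewrite ?k0 ?k1//.
move=> K G s sG us hs Gs wG; set M := mesh K.
have M0 : 0 < M by exact: mesh_gt0.
pose p (m : pt) := lattice_pt M m; pose c (m : pt) := G (p m); pose a (m : pt) := `|c m| `^ q * w (p m).
have a0 m : 0 <= a m by rewrite mulr_ge0 ?powR_ge0.
have xin x m : m \in s -> gcell D (K, m) x -> Omega x /\ (w (p m) <= Z * w x /\ w x <= Z * w (p m)).
  move=> ms xm; have [Om dm] := hs m ms; rewrite -/(p m) -/M in Om dm.
  have h1 := gcell_dist (lattice_cell D0 K m) xm; rewrite /= -/(p m) -/M in h1.
  have h1' := gcell_dist xm (lattice_cell D0 K m); rewrite /= -/(p m) -/M in h1'.
  have dp0 : 0 < d (p m) by exact: dist_bd_gt0.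
  have nM : n%:R * M <= d (p m) / 2.
    by rewrite ler_pdivlMr//; move: dm M0; set N := n%:R; nra.
  have Ox : Omega x by apply: (dist_bd_ball oO Om); lra.
  have dx0 : 0 < d x by exact: dist_bd_gt0.
  have l1 := dist_bd_lip bd0 x (p m); have l2 := dist_bd_lip bd0 (p m) x.
  by split=> //; split; apply: powR_comparable2 => //; lra.
pose B (m : pt) := [set x : 'rV[R]_n | forall l, M * (m l)%:~R + (1 - t) * M / 2 <= x ord0 l <= M * (m l)%:~R + (1 - t) * M / 2 + t * M].
have Bcell m : B m `<=` gcell D (K, m).
  move=> x Bx l /=; have /andP[h1 h2] := Bx l; rewrite -/M mulrC.
  move: h1 h2; move: (M * _) => z h1 h2; apply/andP; split; nra.
have mB m : measurable (B m).
  rewrite -[X in measurable X]setCK; apply: measurableC; apply: open_measurable_rV; apply: closed_openC.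
  exact: (@norm_box_closed R n (fun l => M * (m l)%:~R + (1 - t) * M / 2) (fun l => M * (m l)%:~R + (1 - t) * M / 2 + t * M)).
pose S (x : 'rV[R]_n) := \sum_(m <- s) a m * \1_(gcell D (K, m)) x.
pose T (x : 'rV[R]_n) := \sum_(m <- s) a m * \1_(B m) x.
have cO m : m \in s -> gcell D (K, m) `<=` Omega by move=> ms x xm; have [] := xin x m ms xm.
have mcell (m : pt) : measurable (gcell D (K, m)) by exact: measurable_gcell.
have IS : (\int[mu]_(x in Omega) (S x)%:E = (M ^+ n * \sum_(m <- s) a m)%:E)%E.
  by apply: int_cells => // m ms; split; [exact: cO | rewrite [LHS]lebesgue_gcell].
have IT : (\int[mu]_(x in Omega) (T x)%:E = ((t * M) ^+ n * \sum_(m <- s) a m)%:E)%E.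
  apply: int_cells => // m ms; split; first by move=> x /Bcell; exact: cO.
  by apply: (lebesgue_cube (fun l => M * (m l)%:~R + (1 - t) * M / 2)); rewrite mulr_ge0 ?ltW.
have mS : measurable_fun Omega (fun x => (S x)%:E).
  by apply/measurable_EFinP; apply: measurable_sum => m; apply: measurable_funM => //; exact: measurable_indic.
have mT : measurable_fun Omega (fun x => (T x)%:E).
  by apply/measurable_EFinP; apply: measurable_sum => m; apply: measurable_funM => //; exact: measurable_indic.
have S0 x : 0 <= S x by apply: sumr_ge0 => m _; rewrite mulr_ge0// indicE.
have T0 x : 0 <= T x by apply: sumr_ge0 => m _; rewrite mulr_ge0// indicE.
pose F (x : 'rV[R]_n) := G x - \sum_(m <- s) c m * bump K m x.
have one x m (g : pt -> R) : m \in s -> idx D K x = m -> (forall m', m' != m -> g m' = 0) -> \sum_(m' <- s) g m' = g m.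
  by move=> ms xm g0; rewrite (bigD1_seq _ ms us)/= big1 ?addr0// => m' /g0.
have none x : idx D K x \notin s -> [/\ G x = 0, S x = 0, T x = 0 & F x = 0].
  move=> xs; have g0 := Gs x xs.
  have z m : m \in s -> idx D K x != m by move=> ms; apply: contraNneq xs => ->.
  split=> //.
  - rewrite /S big_seq big1// => m ms; rewrite indicE memNset ?mulr0// => /(idx_cell D0) xm.
    by have := z m ms; rewrite xm eqxx.
  - rewrite /T big_seq big1// => m ms; rewrite indicE memNset ?mulr0// => /Bcell/(idx_cell D0) xm.
    by have := z m ms; rewrite xm eqxx.
  - by rewrite /F g0 big_seq big1 ?subrr// => m ms; rewrite bump_out ?mulr0// z.
have some x m : m \in s -> idx D K x = m ->
    [/\ G x = c m, S x = a m, T x = a m * \1_(B m) x & F x = c m * (1 - bump K m x)].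
  move=> ms xm; have xc : gcell D (K, m) x by apply/(idx_cell D0).
  have Gx : G x = c m.
    by apply: sG; rewrite xm; apply/esym/(idx_cell D0); exact: lattice_cell.
  split=> //.
  - rewrite /S (one x m)// => [|m' m'm]; first by rewrite indicE mem_set ?mulr1.
    by rewrite indicE memNset ?mulr0// => /(idx_cell D0) xm'; move: m'm; rewrite -xm' xm eqxx.
  - rewrite /T (one x m)// => m' m'm.
    by rewrite indicE memNset ?mulr0// => /Bcell/(idx_cell D0) xm'; move: m'm; rewrite -xm' xm eqxx.
  - rewrite /F (one x m)// => [|m' m'm]; first by rewrite Gx; ring.
    by rewrite bump_out ?mulr0// xm eq_sym.
have bB m x : B m x -> b0 <= bump K m x.
  move=> Bx; rewrite /bump; have -> : b0 = \prod_(l < n) 2^-1 :> R by rewrite prodr_const card_ord.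
  apply: ler_prod => l _; rewrite invr_ge0 ler0n /=; apply: ht.
  have /andP[h1 h2] := Bx l; have h0 : 0 < mesh K.+1 by exact: mesh_gt0.
  move: h1 h2; rewrite /M mesh_half intrM; set h := mesh K.+1 in h0 *.
  have E : x ord0 l = h * (h^-1 * x ord0 l) by rewrite mulrA mulfV ?mul1r ?lt0r_neq0.
  rewrite [X in _ <= X]E [X in X <= _ + _]E; set z := h^-1 * _; move: ((m l)%:~R : R) => y h1 h2.
  rewrite ler_norml; apply/andP; split.
    by rewrite -(ler_pM2l h0); lra.
  by rewrite -(ler_pM2l h0); lra.
have up x : Omega x -> `|G x| `^ q * w x <= Z * S x.
  move=> Ox; have [xs|xs] := boolP (idx D K x \in s); last first.
    have [-> -> _ _] := none x xs; rewrite normr0 powR0 ?mul0r ?mulr0//; have := q1; lra.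
  have [-> -> _ _] := some x _ xs erefl; rewrite /a mulrCA ler_wpM2l ?powR_ge0//.
  exact: (xin x _ xs (gcell_idx K x D0)).2.2.
have lo x : Omega x -> Z^-1 * S x <= `|G x| `^ q * w x.
  move=> Ox; have [xs|xs] := boolP (idx D K x \in s); last first.
    have [-> -> _ _] := none x xs; rewrite normr0 powR0 ?mul0r ?mulr0//; have := q1; lra.
  have [-> -> _ _] := some x _ xs erefl; rewrite mulrC ler_pdivrMr// /a -mulrA ler_wpM2l ?powR_ge0// mulrC.
  exact: (xin x _ xs (gcell_idx K x D0)).2.1.
have mid x : Omega x -> `|F x| `^ q * w x + b0 * Z^-1 * T x <= `|G x| `^ q * w x.
  move=> Ox; have [xs|xs] := boolP (idx D K x \in s); last first.
    have [-> _ -> ->] := none x xs; rewrite normr0 powR0 ?mul0r ?mulr0 ?addr0//; have := q1; lra.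
  have [-> _ -> ->] := some x _ xs erefl; set m := idx D K x.
  have wp := (xin x m xs (gcell_idx K x D0)).2.1.
  apply: bump_pointwise => //; [exact: bump01 |].
  rewrite indicE; case: (boolP (x \in B m)) => [/set_mem/bB|_]; first by rewrite mulr1.
  by rewrite mulr0; have /andP[] := bump01 K m x.
have mG : measurable_fun Omega G.
  by apply: (measurable_funS measurableT) => //; exact: (step_at_measurable D0 sG).
have mF : measurable_fun Omega F.
  apply: measurable_funB => //; apply: measurable_sum => m; apply: measurable_funM => //.
  apply: (measurable_funS measurableT) => //; exact: measurable_bump.
have mGw := measurable_wint q mw mG; have mFw := measurable_wint q mw mF.
have ps x : 0 <= `|G x| `^ q * w x by rewrite mulr_ge0 ?powR_ge0.
pose A := M ^+ n * \sum_(m <- s) a m.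
have A0 : 0 <= A by rewrite mulr_ge0 ?exprn_ge0 ?(ltW M0)// sumr_ge0.
have wup : (wint G <= (Z * A)%:E)%E.
  rewrite EFinM /A -IS -ge0_integralZl ?lee_fin ?(ltW Z0)//; last by move=> x _; rewrite lee_fin.
  apply: ge0_le_integral => //.
  - by move=> x _; rewrite lee_fin.
  - exact: measurable_funeM.
have wlo : ((Z^-1 * A)%:E <= wint G)%E.
  rewrite EFinM /A -IS -ge0_integralZl ?lee_fin ?invr_ge0 ?(ltW Z0)//; last by move=> x _; rewrite lee_fin.
  apply: ge0_le_integral => //.
  - by move=> x _; rewrite -EFinM lee_fin mulr_ge0 ?invr_ge0 ?(ltW Z0).
  - exact: measurable_funeM.
have wmid : (wint F + (b0 * Z^-1 * (t ^+ n * A))%:E <= wint G)%E.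
  have -> : b0 * Z^-1 * (t ^+ n * A) = (b0 * Z^-1) * ((t * M) ^+ n * \sum_(m <- s) a m).
    by congr (_ * _); rewrite exprMn /A mulrA.
  have bz : 0 <= b0 * Z^-1 by rewrite mulr_ge0 ?invr_ge0 ?ltW.
  rewrite EFinM -IT -ge0_integralZl ?lee_fin//; last by move=> x _; rewrite lee_fin.
  rewrite -ge0_integralD//; first last.
  - exact: measurable_funeM.
  - by move=> x _; rewrite -EFinM lee_fin mulr_ge0.
  - by move=> x _; rewrite lee_fin mulr_ge0 ?powR_ge0.
  apply: ge0_le_integral => //.
  - by move=> x _; rewrite -EFinM -EFinD lee_fin addr_ge0// mulr_ge0 ?powR_ge0.
  - by apply: emeasurable_funD => //; exact: measurable_funeM.
pose E0 := mesh K.+1 ^+ n * \sum_(m <- s) a m.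
have EA : E0 <= A.
  rewrite /A; apply: ler_wpM2r; first exact: sumr_ge0.
  have h0 : 0 < mesh K.+1 by exact: mesh_gt0.
  by apply: lerXn2r; rewrite ?nnegrE ?(ltW h0) ?(ltW M0)//; exact: (mesh_le D0 (leqnSn K)).
have [r1 r2] := bump_conclude (wint_ge0 Omega q w0 G) (wint_ge0 Omega q w0 F) wG b00 Z0 t0n A0 wup wlo wmid (erefl k) EA.
by split; [exact: r1 | exact: r2].
Qed.

End bump.

Lemma energy_bound {R : realType} (CS CB g W X : R) (wG : \bar R) : 0 < CS -> 0 < CB ->
  (X%:E <= CB%:E * wG)%E -> (wG <= (g * W)%:E)%E -> ((CS * X)%:E <= (CS * CB * g)%:E * W%:E)%E.
Proof.
move=> CS0 CB0 h1 h2; have h3 : (X%:E <= (CB * (g * W))%:E)%E.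
  by apply: le_trans h1 _; rewrite EFinM lee_wpmul2l// lee_fin ltW.
by rewrite -EFinM lee_fin -!mulrA ler_pM2l// -lee_fin.
Qed.

Lemma residual_bound {R : realType} (P1 P2 eta k W : R) (wF wG wfG : \bar R) :
  0 < P1 -> 0 < P2 -> 0 < W -> k < 1 -> P1 * P1 * (1 - k) <= 1 - k / 2 ->
  (P1 * (1 - k) * P2 + P2) * eta = k / 4 ->
  (wF <= (1 - k)%:E * wG)%E -> (wG <= ((P1 + P2 * eta) * W)%:E)%E -> (wfG <= (eta * W)%:E)%E ->
  (P1%:E * wF + P2%:E * wfG <= (1 - k / 4)%:E * W%:E)%E.
Proof.
move=> P10 P20 W0 k1 hP he h1 h2 h3.
have k0 : 0 <= 1 - k by lra.
have P1' := ltW P10; have P2' := ltW P20.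
apply: (@le_trans _ _ (P1%:E * ((1 - k)%:E * ((P1 + P2 * eta) * W)%:E) + P2%:E * (eta * W)%:E)%E).
  apply: leeD; last by rewrite lee_wpmul2l ?lee_fin.
  rewrite lee_wpmul2l ?lee_fin//; apply: le_trans h1 _; by rewrite lee_wpmul2l ?lee_fin.
rewrite -!EFinM -EFinD lee_fin.
have -> : P1 * ((1 - k) * ((P1 + P2 * eta) * W)) + P2 * (eta * W) =
   (P1 * P1 * (1 - k) + (P1 * (1 - k) * P2 + P2) * eta) * W by ring.
by rewrite ler_pM2r// he; lra.
Qed.

Lemma measurable_residual {R : realType} {n : nat} (Omega : set 'rV[R]_n) (D : R) (rho : R -> R)
  (crho : continuous rho) K (s : seq {ffun 'I_n -> int}) (c : {ffun 'I_n -> int} -> R) (G : 'rV[R]_n -> R) :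
  measurable_fun Omega G ->
  measurable_fun Omega (fun x => G x - \sum_(m <- s) c m * bump D rho K m x).
Proof.
move=> mG; apply: measurable_funB => //; apply: measurable_sum => m; apply: measurable_funM => //.
by apply: (measurable_funS measurableT) => //; exact: (measurable_bump D crho).
Qed.

Section contraction_step.
Context {R : realType} {n : nat}.
Variables (Omega : set 'rV[R]_n) (D : R).
Local Notation mu := (@lebesgue_rV R n).
Local Notation pt := {ffun 'I_n -> int}.
Local Notation d := (dist_bd Omega).
Local Notation mesh := (mesh D).
Hypothesis oO : open Omega.
Hypothesis bO : bounded_set Omega.
Hypothesis bd0 : boundary Omega !=set0.
Hypothesis D0 : 0 < D.
Hypothesis hD : forall x, Omega x -> d x <= D.
Variables (q e : R).
Hypothesis q1 : 1 < q.
Local Notation w := (fun x => d x `^ e).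
Local Notation wint := (weighted_int Omega q w).
Variables (c1 : R) (x0 : 'rV[R]_n).
Hypothesis c1p : 1 <= c1.
Hypothesis Ox0 : Omega x0.
Hypothesis hchain : chainable Omega c1 x0.
Variables (lambda C0 : R).
Hypothesis l0 : 0 <= lambda.
Hypothesis C00 : 0 < C0.
Hypothesis hA : forall r s : R, 0 < r -> r < s ->
   (ereal_sup [set covering_number r (eball x s `&` boundary Omega) | x in boundary Omega] <=
          (C0 * (s / r) `^ lambda)%:E)%E.
Variables (gamma kap : R).
Hypothesis kap0 : 0 < kap.
Hypothesis lg : lambda < n%:R + gamma.
Hypothesis egk : e + gamma * (q - 1) = - kap.

Let mO : measurable Omega := open_measurable_rV oO.
Let mw : measurable_fun setT w := measurable_weight bd0 e.
Let w0 (x : 'rV[R]_n) : 0 <= w x := powR_ge0 (d x) e.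

Definition divergence (u : 'I_n -> 'rV[R]_n -> R) (x : 'rV[R]_n) : R := \sum_i partial i (u i) x.

Lemma measurable_smooth (f : 'rV[R]_n -> R) : smooth f -> measurable_fun setT f.
Proof. by move=> sf; apply: continuous_measurable_rV; exact: smooth_continuous. Qed.

(** The passage from [f] to the step function [G] and back costs a factor [t ^ (1 - q)] each way,
    which raises [1 - k] to at most [1 - k / 2]; the errors, through the choice of [eta], raise it
    further to [1 - k / 4]. *)
Lemma contraction_step : exists (C th : R), [/\ 0 < C, 0 <= th < 1 & forall f : 'rV[R]_n -> R,
  measurable_fun Omega f -> (wint f < +oo)%E -> (\int[mu]_(x in Omega) (f x)%:E = 0)%E ->
  exists u : 'I_n -> 'rV[R]_n -> R,
  [/\ forall i, test_fun Omega (u i),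
      forall i, (wint (u i) <= C%:E * wint f)%E,
      forall i j, (wint (partial j (u i)) <= C%:E * wint f)%E &
      (wint (fun x => f x - divergence u x)%R <= th%:E * wint f)%E]].
Proof.
have [rho [CL [[CL0 crho rho01 rho_out rho1] hloc]]] := @local_smooth R n q q1.
have [CS CS0 hS] := step_solution oO bd0 D0 hD q1 CL0 hloc c1p hchain l0 C00 hA kap0 lg egk.
have [k [CB [k01 CB0 hB]]] := bump_step oO bd0 D0 e q1 crho rho01 rho_out rho1.
have [t [t01 ht]] := powR_weight q1 k01.
have /andP[k0 k1] := k01; have /andP[t0 t1] := t01.
pose P1 : R := t `^ (1 - q); pose P2 : R := (1 - t) `^ (1 - q).
have P10 : 0 < P1 by rewrite powR_gt0.
have P20 : 0 < P2 by rewrite powR_gt0; lra.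
pose eta := k / 4 / (P1 * (1 - k) * P2 + P2).
have den0 : 0 < P1 * (1 - k) * P2 + P2.
  by rewrite addr_gt0// mulr_gt0// mulr_gt0//; lra.
have eta0 : 0 < eta by rewrite /eta divr_gt0//; lra.
have eta1 : (P1 * (1 - k) * P2 + P2) * eta = k / 4.
  by rewrite mulrC /eta divfK ?lt0r_neq0.
pose C := CS * CB * (P1 + P2 * eta).
have C_0 : 0 < C by rewrite /C mulr_gt0 ?addr_gt0// mulr_gt0.
exists C, (1 - k / 4); split=> //; first by apply/andP; split; lra.
move=> f mf wf f0.
have fW : wint f \is a fin_num by rewrite ge0_fin_numE ?wint_ge0.
(* [density] takes a positive tolerance, here [eta * W]; a datum of zero energy is served by the
   zero field. *)
have [W0|W0] := eqVneq (wint f) 0%E.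
  exists (fun _ => fun=> 0); rewrite W0 !mule0.
  have p0 j : partial j ((fun=> 0) : 'rV[R]_n -> R) = fun=> 0.
    by apply/funext => x; rewrite /partial; exact: derive_cst.
  have z0 : wint (fun=> 0) = 0%E.
    rewrite /weighted_int; under eq_integral do rewrite normr0 powR0 ?mul0r ?(gt_eqF (lt_trans ltr01 q1))//.
    by rewrite integral0.
  split=> [i|i|i j|]; rewrite ?p0 ?z0//; first exact: test_fun0.
  rewrite -[leRHS]W0 le_eqVlt; apply/orP; left; apply/eqP; apply: wint_eq => x _.
  by rewrite /divergence big1 ?subr0// => i _; rewrite p0.
pose W := fine (wint f); have WE : wint f = W%:E by rewrite fineK.
have Wp : 0 < W by rewrite fine_gt0// wf lt0e W0 wint_ge0.
pose L := 2 * c1 * @whitney_ratio R n + (2 * n%:R + 2).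
have A1 : 1 <= @whitney_ratio R n by rewrite /whitney_ratio ler1n.
have cA0 : 0 <= 2 * c1 * @whitney_ratio R n.
  by rewrite !mulr_ge0// ?(le_trans ler01 c1p)// (le_trans ler01 A1).
have L1 : 2 * n%:R + 2 <= L by rewrite /L lerDr.
have nn : 0 <= n%:R :> R by [].
have L2 : n%:R + 1 <= L by apply: le_trans L1; rewrite lerD ?ler1n// ler_peMl ?ler1n.
have [K [G [s [[sG us hs Gs sum0] hG]]]] := density oO bO bd0 D0 hD q1 Ox0 mf wf f0 (mulr_gt0 eta0 Wp) L2.
have mesh0 j : 0 < mesh j by exact: mesh_gt0.
have mG : measurable_fun Omega G by apply: (measurable_funS measurableT) => //; exact: (step_at_measurable D0 sG).
have mfG : measurable_fun Omega (fun x => f x - G x) by exact: measurable_funB.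
have hG' : (wint (fun x => G x - f x)%R <= (eta * W)%:E)%E.
  rewrite (@wint_eq R n Omega w q _ (fun x => f x - G x)); first exact: ltW.
  by move=> x _; rewrite distrC.
have wG : (wint G <= ((P1 + P2 * eta) * W)%:E)%E.
  rewrite (@wint_eq R n Omega w q _ (fun x => f x + (G x - f x))); last by move=> x _; congr `|_|; ring.
  apply: le_trans (wint_convex mO mw w0 q1 t01 mf (measurable_funB mG mf)) _.
  rewrite WE -/P1 -/P2; apply: (@le_trans _ _ (P1%:E * W%:E + P2%:E * (eta * W)%:E)%E).
    by rewrite leeD2l// lee_wpmul2l// lee_fin ltW.
  by rewrite -!EFinM -EFinD lee_fin mulrDl mulrA.
have wGoo : (wint G < +oo)%E by apply: le_lt_trans wG _; rewrite ltry.
have [|hB1 hB2] := hB K G s sG us _ Gs wGoo.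
  move=> m ms; have [Om dm] := hs m ms; split=> //.
  by apply: le_trans dm; rewrite ler_wpM2r ?(ltW (mesh0 _)).
(* A bump of level [K] is a product of factors [rho] on the lattice of level [K.+1] at an even
   index; the data are carried there before [step_solution] is applied. *)
pose dbl (m : pt) : pt := [ffun l => 2 * m l].
have dblI : injective dbl.
  move=> m m' /ffunP h; apply/ffunP => l; have := h l; rewrite !ffunE; exact: mulfI.
have lpd m : lattice_pt (mesh K.+1) (dbl m) = lattice_pt (mesh K) m.
  by apply/rowP => l; rewrite !mxE ffunE (mesh_half D K) intrM mulrA [_ * 2%:~R]mulrC.
pose half (m : pt) : pt := [ffun l => (m l %/ 2)%Z].
have halfK m : half (dbl m) = m by apply/ffunP => l; rewrite !ffunE mulKz.
pose c (m : pt) := G (lattice_pt (mesh K) (half m)).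
have [|||u [tu du wu wdu]] := hS K.+1 [seq dbl m | m <- s] c.
- by rewrite map_inj_uniq.
- move=> _ /mapP[m ms ->]; rewrite lpd; have [Om dm] := hs m ms; split=> //.
  apply: le_trans dm; apply: ler_pM; rewrite ?(ltW (mesh0 _))//.
  + by rewrite /L lerDl addr_ge0// mulr_ge0.
  + by apply: mesh_le.
- rewrite big_map; under eq_bigr do rewrite /c halfK; exact: sum0.
have Esum : \sum_(m <- [seq dbl m | m <- s]) `|c m| `^ q * d (lattice_pt (mesh K.+1) m) `^ e =
    \sum_(m <- s) `|G (lattice_pt (mesh K) m)| `^ q * d (lattice_pt (mesh K) m) `^ e.
  by rewrite big_map; apply: eq_bigr => m _; rewrite /c halfK lpd.
have duE x : divergence u x = \sum_(m <- s) G (lattice_pt (mesh K) m) * bump D rho K m x.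
  rewrite /divergence du big_map; apply: eq_bigr => m _; rewrite /c halfK; congr (_ * _).
  by apply: eq_bigr => l _; rewrite ffunE.
rewrite /= Esum in wu wdu.
have Ef : ((CS * (mesh K.+1 ^+ n * \sum_(m <- s) `|G (lattice_pt (mesh K) m)| `^ q * d (lattice_pt (mesh K) m) `^ e))%:E <= C%:E * wint f)%E.
  by rewrite WE; exact: energy_bound hB2 wG.
exists u; split; first exact: tu.
- by move=> i; exact: le_trans (wu i) Ef.
- by move=> i j; exact: le_trans (wdu i j) Ef.
have mF : measurable_fun Omega (fun x => G x - \sum_(m <- s) G (lattice_pt (mesh K) m) * bump D rho K m x).
  exact: (measurable_residual D crho K s (fun m => G (lattice_pt (mesh K) m)) mG).
rewrite (@wint_eq R n Omega w q _ (fun x => (G x - \sum_(m <- s) G (lattice_pt (mesh K) m) * bump D rho K m x) + (f x - G x))); last first.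
  by move=> x _; rewrite duE; congr `|_|; ring.
apply: le_trans (wint_convex mO mw w0 q1 t01 mF mfG) _; rewrite -/P1 -/P2 WE.
exact: (residual_bound P10 P20 Wp k1 ht eta1 hB1 wG (ltW hG)).
Qed.

End contraction_step.

(** * Integration by parts *)

Section slices.
Context {R : realType}.

Lemma rV_cons_shift0 n (h t : R) (y : 'rV[R]_n) :
  rV_cons (h + t, y) = h *: delta_mx ord0 ord0 + rV_cons (t, y).
Proof.
apply/rowP => i; case: (unliftP ord0 i) => [j ->|->].
  by rewrite rV_cons_lift [RHS]mxE rV_cons_lift !mxE/= mulr0 add0r.
by rewrite rV_cons0 [RHS]mxE rV_cons0 !mxE/= mulr1.
Qed.

Lemma rV_cons_shift_lift n (h t : R) (y : 'rV[R]_n) j :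
  rV_cons (t, h *: delta_mx ord0 j + y) = h *: delta_mx ord0 (lift ord0 j) + rV_cons (t, y).
Proof.
apply/rowP => i; case: (unliftP ord0 i) => [l ->|->].
  by rewrite rV_cons_lift [RHS]mxE rV_cons_lift !mxE/= (inj_eq lift_inj).
by rewrite rV_cons0 [RHS]mxE rV_cons0 !mxE/= mulr0 add0r.
Qed.

Lemma partial_slice n (g : 'rV[R]_n.+1 -> R) (t : R) (y : 'rV[R]_n) j :
  partial j (fun y => g (rV_cons (t, y))) y = partial (lift ord0 j) g (rV_cons (t, y)).
Proof.
have e : (fun h : R => h^-1 *: (((fun y : 'rV[R]_n => g (rV_cons (t, y)) : R^o) \o shift y) (h *: delta_mx ord0 j) - g (rV_cons (t, y)))) =
  (fun h : R => h^-1 *: (((g : _ -> R^o) \o shift (rV_cons (t, y))) (h *: delta_mx ord0 (lift ord0 j)) - g (rV_cons (t, y)))).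
  by apply/funext => h /=; rewrite rV_cons_shift_lift.
by rewrite /partial /derive e.
Qed.

(** Regularity is asked in the direction [i] alone: this passes to the slices where another
    coordinate is frozen, which permits induction on the dimension. *)
Definition tame n (i : 'I_n) (B M : R) (g : 'rV[R]_n -> R) : Prop :=
  [/\ forall x, derivable (g : 'rV[R]_n -> R^o) x (delta_mx ord0 i),
      forall x, continuous (fun t : R => partial i g (t *: delta_mx ord0 i + x)),
      measurable_fun setT (partial i g),
      forall x, `|partial i g x| <= M &
      forall (x : 'rV[R]_n) (l : 'I_n), B < `|x ord0 l| -> g x = 0 /\ partial i g x = 0].

Lemma tame_slice n (j : 'I_n) B M (g : 'rV[R]_n.+1 -> R) t : tame (lift ord0 j) B M g ->
  tame j B M (fun y => g (rV_cons (t, y))).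
Proof.
have pE : partial j (fun y => g (rV_cons (t, y))) = fun y => partial (lift ord0 j) g (rV_cons (t, y)).
  by apply/funext => y; exact: partial_slice.
move=> [dg cg mg bg vg]; split; rewrite ?pE.
- move=> y; have := dg (rV_cons (t, y)); rewrite /derivable.
  rewrite (_ : (fun h => _) = (fun h : R => h^-1 *:
   (((fun y : 'rV[R]_n => g (rV_cons (t, y)) : R^o) \o shift y) (h *: delta_mx ord0 j) - g (rV_cons (t, y)))))//.
  by apply/funext => h /=; rewrite rV_cons_shift_lift.
- move=> y; rewrite (_ : (fun s => _) = (fun s : R => partial (lift ord0 j) g (s *: delta_mx ord0 (lift ord0 j) + rV_cons (t, y)))) //.
  by apply/funext => s; rewrite rV_cons_shift_lift.
- apply: measurableT_comp => //; apply: (measurableT_comp (@measurable_rV_cons R n)).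
  exact: pair1_measurable.
- by move=> y; exact: bg.
- by move=> y l h; apply: (vg _ (lift ord0 l)); rewrite rV_cons_lift.
Qed.

Lemma tame_integrable n (i : 'I_n) B M (g : 'rV[R]_n -> R) : 0 < B -> tame i B M g ->
  (@lebesgue_rV R n).-integrable setT (EFin \o partial i g).
Proof.
move=> B0 [_ _ mg bg vg].
have M0 : 0 <= M by apply: le_trans (bg 0).
pose K := [set x : 'rV[R]_n | forall l, - B <= x ord0 l <= - B + 2 * B].
have mK : measurable K.
  rewrite -[X in measurable X]setCK; apply: measurableC; apply: open_measurable_rV; apply: closed_openC.
  exact: (@norm_box_closed R n (fun=> - B) (fun=> - B + 2 * B)).
apply/integrableP; split; first exact/measurable_EFinP.
apply: (@le_lt_trans _ _ (\int[@lebesgue_rV R n]_x (M%:E * (\1_K x)%:E))%E).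
  apply: ge0_le_integral => //.
  - by apply: measurableT_comp => //; exact/measurable_EFinP.
  - by apply: measurable_funeM; apply/measurable_EFinP; exact: measurable_indic.
  - move=> x _; rewrite -EFinM lee_fin indicE; case: (boolP (x \in K)) => [_|/negP xK]; first by rewrite mulr1.
    have [l hl] : exists l, B < `|x ord0 l|.
      apply: contrapT => h; apply: xK; apply/mem_set => l.
      have : `|x ord0 l| <= B by rewrite leNgt; apply/negP => hh; apply: h; exists l.
      by rewrite ler_norml => /andP[h1 h2]; apply/andP; split; lra.
    by rewrite (vg x l hl).2 normr0 mulr0.
rewrite ge0_integralZl//; last by apply/measurable_EFinP; exact: measurable_indic.
rewrite integral_indic// setIT [X in (_ * X)%E](_ : _ = ((2 * B) ^+ n)%:E); first by rewrite -EFinM ltry.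
by apply: (lebesgue_cube (fun=> - B)); lra.
Qed.

Lemma int_line_derivative (f F : R -> R) (B : R) : 0 < B -> continuous f ->
  (forall t, derivable F t 1 /\ 'D_1 F t = f t) -> (forall t, B < `|t| -> F t = 0 /\ f t = 0) ->
  (\int[@lebesgue_measure R]_t (f t)%:E = 0)%E.
Proof.
move=> B0 cf dF vF; pose b := B + 1.
have -> : (\int[@lebesgue_measure R]_t (f t)%:E = \int[@lebesgue_measure R]_(t in `[(- b)%R, b%R]) (f t)%:E)%E.
  rewrite [RHS]integral_mkcond; apply: eq_integral => t _; rewrite patchE.
  case: ifPn => // /negP h; rewrite (vF t _).2//; rewrite ltNge; apply/negP => tB; apply: h.
  apply/mem_set; rewrite /= in_itv /=; move: tB; rewrite ler_norml /b => /andP[h1 h2]; apply/andP; split; lra.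
have cF t : {for t, continuous F}.
  by apply: differentiable_continuous; apply/derivable1_diffP; exact: (dF t).1.
rewrite (@continuous_FTC2 R f F (- b) b).
- have bB : B < `|b| by rewrite ger0_norm /b; lra.
  by rewrite (vF b bB).1 (vF (- b) _).1 ?normrN// sube0.
- by rewrite /b; lra.
- exact: continuous_subspaceT.
- split; [by move=> t _; exact: (dF t).1 | apply: cvg_at_right_filter; exact: cF | apply: cvg_at_left_filter; exact: cF].
- by move=> t _; rewrite derive1E (dF t).2.
Qed.

(** Fubini on the first coordinate: if [i] is a later direction, the inner integral vanishes by
    induction; if it is the first, the inner integral is that of a derivative over a line. *)
Lemma int_partial0 n (i : 'I_n) B M (g : 'rV[R]_n -> R) : 0 < B -> tame i B M g ->
  (\int[@lebesgue_rV R n]_x (partial i g x)%:E = 0)%E.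
Proof.
elim: n i g => [[]//|n IH] i g B0 tg; have [dg cg mg bg vg] := tg.
have ig := tame_integrable B0 tg.
have mE : measurable_fun setT (EFin \o partial i g) by apply/measurable_EFinP.
have ip : (@lebesgue_measure R \x lebesgue_rV n)%E.-integrable setT ((EFin \o partial i g) \o @rV_cons R n).
  apply/integrableP; split; first by apply: measurableT_comp => //; exact: measurable_rV_cons.
  move/integrableP : ig => [_]; rewrite /= /lebesgue_rV_step.
  have mab : measurable_fun setT (fun x => `|partial i g x|%:E) by apply/measurable_EFinP; exact: measurableT_comp.
  by rewrite (ge0_integral_pushforward (@measurable_rV_cons R n) _ measurableT mab).
rewrite [LHS](integral_pushforward (@measurable_rV_cons R n))//.
rewrite preimage_setT; case: (unliftP ord0 i) => [j ij|i0].
  rewrite -(integral12_prod_meas1 ip) /fubini_F /=.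
  transitivity (\int[@lebesgue_measure R]_t (0%E : \bar R))%E; last by rewrite integral0.
  apply: eq_integral => t _; have ts : tame j B M (fun y => g (rV_cons (t, y))) by apply: tame_slice; rewrite -ij.
  rewrite -[RHS](IH j _ B0 ts); apply: eq_integral => y _.
  by rewrite ij -partial_slice.
rewrite -(integral21_prod_meas1 ip) /fubini_G /=.
under eq_integral => y _.
  rewrite (@int_line_derivative (fun t => partial i g (rV_cons (t, y))) (fun t => g (rV_cons (t, y))) B B0).
  - over.
  - rewrite (_ : (fun t => _) = (fun t : R => partial i g (t *: delta_mx ord0 i + rV_cons (0, y)))); first exact: cg.
    by apply/funext => t; rewrite i0 -rV_cons_shift0 addr0.
  - move=> t; have e : (fun h : R => h^-1 *: (((fun t => g (rV_cons (t, y)) : R^o) \o shift t) (h *: 1) - g (rV_cons (t, y)))) =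
      (fun h : R => h^-1 *: ((((g : _ -> R^o)) \o shift (rV_cons (t, y))) (h *: delta_mx ord0 i) - g (rV_cons (t, y)))).
      by apply/funext => h /=; rewrite [h *: 1]mulr1 rV_cons_shift0 i0.
    split; first by rewrite /derivable e; exact: dg.
    by rewrite /derive e.
  - by move=> t Bt; apply: (vg _ ord0); rewrite rV_cons0.
by rewrite integral0.
Qed.

End slices.

Section integration_by_parts.
Context {R : realType} {n : nat}.
Local Notation mu := (@lebesgue_rV R n).
Variable Omega : set 'rV[R]_n.
Hypothesis oO : open Omega.
Hypothesis bO : bounded_set Omega.
Implicit Types g f U phi : 'rV[R]_n -> R.

Lemma partial_vanish (S : set 'rV[R]_n) g i x : closed S -> (forall y, ~ S y -> g y = 0) -> ~ S x ->
  partial i g x = 0.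
Proof.
move=> cS gS xS; rewrite /partial (@near_eq_derive _ _ _ _ (fun=> 0 : R^o)); first exact: derive_cst.
near=> y; apply: gS; near: y.
by apply: open_nbhs_nbhs; split; [exact: closed_openC | ].
Unshelve. all: by end_near. Qed.

Lemma continuous_bounded_support (S : set 'rV[R]_n) f : compact S -> continuous f ->
  (forall y, ~ S y -> f y = 0) -> exists2 M, 0 < M & forall x, `|f x| <= M.
Proof.
move=> cS cf fS; have [S0|S0] := pselect (S !=set0); last first.
  exists 1 => // x; rewrite fS ?normr0// => Sx; apply: S0; by exists x.
have [|c _ hc] := compact_EVT_max (f := fun x => `|f x|) S0 cS.
  by apply: continuous_subspaceT => x; apply: continuous_comp; [exact: cf | exact: norm_continuous].
exists (`|f c| + 1); first by rewrite ltr_wpDl.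
move=> x; have [Sx|Sx] := pselect (S x); last by rewrite fS// normr0 addr_ge0.
by apply: le_trans (hc x (mem_set Sx)) _; rewrite lerDl.
Qed.

Lemma compact_box_bound (S : set 'rV[R]_n) : compact S -> exists2 B : R, 0 < B & forall (x : 'rV[R]_n) (l : 'I_n), B < `|x ord0 l| -> ~ S x.
Proof.
move=> cS; have [M [Mr hM]] := compact_bounded cS; exists (`|M| + 1); first by rewrite ltr_wpDl.
move=> x l h Sx; have : `|x| <= `|M| + 1.
  by apply: (hM _ _ x Sx); rewrite (le_lt_trans (ler_norm M))// ltrDl.
apply/negP; rewrite -ltNge (lt_le_trans h)//.
rewrite -[leRHS]/(mx_norm x) mx_normrE; exact: (le_bigmax _ (fun ij => `|x ij.1 ij.2|) (ord0, l)).
Qed.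

Lemma int_partial_support (S : set 'rV[R]_n) g i : compact S -> (forall x, differentiable (g : 'rV[R]_n -> R^o) x) ->
  continuous (partial i g) -> (forall y, ~ S y -> g y = 0) -> S `<=` Omega ->
  (\int[mu]_(x in Omega) (partial i g x)%:E = 0)%E.
Proof.
move=> cS dg cg gS SO.
have clS : closed S by apply: compact_closed => //; exact: norm_hausdorff.
have pS x : ~ S x -> partial i g x = 0 by exact: (partial_vanish _ clS gS).
have [M M0 hM] := continuous_bounded_support cS cg pS.
have [B B0 hB] := compact_box_bound cS.
rewrite integral_mkcond -[RHS](@int_partial0 R n i B M g B0).
  apply: eq_integral => x _; rewrite patchE; case: ifPn => // /negP xO.
  by rewrite pS// => /SO Ox; apply: xO; exact: mem_set.
split => //.
- by move=> x; apply: diff_derivable; exact: dg.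
- move=> x t; apply: continuous_comp; last exact: cg.
  apply: cvgD; last exact: cvg_cst.
  by apply: cvgZr_tmp; exact: cvg_id.
- exact: continuous_measurable_rV.
- by move=> x l h; split; [apply: gS; exact: (hB x l) | apply: pS; exact: (hB x l)].
Qed.

Lemma test_support phi : test_fun Omega phi -> exists S, [/\ compact S, S `<=` Omega & forall y, ~ S y -> phi y = 0].
Proof.
move=> [_ cS SO]; exists (closure [set x | phi x != 0]); split => // y nS.
by apply/eqP; apply: contra_notT nS => h; exact: subset_closure.
Qed.

Lemma test_partial_support phi : test_fun Omega phi ->
  exists S, [/\ compact S, S `<=` Omega, forall y, ~ S y -> phi y = 0 & forall i y, ~ S y -> partial i phi y = 0].
Proof.
move=> tp; have [S [cS SO pS]] := test_support tp; exists S; split => // i y.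
by apply: partial_vanish => //; apply: compact_closed => //; exact: norm_hausdorff.
Qed.

Lemma int_test_partial0 phi i : test_fun Omega phi -> (\int[mu]_(x in Omega) (partial i phi x)%:E = 0)%E.
Proof.
move=> tp; have [S [cS SO pS]] := test_support tp.
have [sp _ _] := tp.
apply: (int_partial_support cS) => //.
- by move=> x; exact: smooth_differentiable.
- by apply: smooth_continuous; exact: smooth_partial.
Qed.

Lemma int_by_parts U phi i : smooth U -> test_fun Omega phi ->
  (\int[mu]_(x in Omega) (U x * partial i phi x + partial i U x * phi x)%:E = 0)%E.
Proof.
move=> sU tp; have [S [cS SO pS]] := test_support tp; have [sp _ _] := tp.
have dU x : differentiable (U : 'rV[R]_n -> R^o) x by exact: smooth_differentiable.
have dp x : differentiable (phi : 'rV[R]_n -> R^o) x by exact: smooth_differentiable.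
have pE : partial i (fun x => U x * phi x) = fun x => U x * partial i phi x + partial i U x * phi x.
  apply/funext => x; rewrite /partial.
  have := @deriveM _ _ (U : 'rV[R]_n -> R^o) (phi : 'rV[R]_n -> R^o) x (delta_mx ord0 i) (diff_derivable (dU x)) (diff_derivable (dp x)).
  by move=> ->; congr (_ + _); exact: mulrC.
have -> : (\int[mu]_(x in Omega) (U x * partial i phi x + partial i U x * phi x)%:E =
   \int[mu]_(x in Omega) (partial i (fun x => U x * phi x)%R x)%:E)%E by rewrite pE.
apply: (int_partial_support cS) => //.
- by move=> x; apply: differentiableM.
- rewrite pE => x.
  have k1 := @smooth_continuous _ _ _ sU x; have k2 := @smooth_continuous _ _ _ (smooth_partial i sp) x.
  have k3 := @smooth_continuous _ _ _ (smooth_partial i sU) x; have k4 := @smooth_continuous _ _ _ sp x.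
  exact: (continuousD (continuousM k1 k2) (continuousM k3 k4)).
- by move=> y /pS ->; rewrite mulr0.
Qed.

Lemma integrable_bounded_fun f (M : R) : (mu Omega < +oo)%E -> measurable_fun Omega f ->
  (forall x, `|f x| <= M) -> mu.-integrable Omega (EFin \o f).
Proof.
move=> muO mf bf; have mO := open_measurable_rV oO.
apply/integrableP; split; first exact/measurable_EFinP.
apply: (@le_lt_trans _ _ (\int[mu]_(x in Omega) M%:E)%E).
  apply: ge0_le_integral => //; last by move=> x _; rewrite lee_fin.
  by apply: measurableT_comp => //; exact/measurable_EFinP.
by rewrite integral_cst//= lte_mul_pinfty// lee_fin (le_trans _ (bf 0)).
Qed.

Lemma test_bounded phi : test_fun Omega phi ->
  exists2 M, 0 < M & forall x, `|phi x| <= M /\ forall i, `|partial i phi x| <= M.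
Proof.
move=> tp; have [S [cS SO pS qS]] := test_partial_support tp; have [sp _ _] := tp.
have [M M0 hM] := continuous_bounded_support cS (smooth_continuous sp) pS.
have /choice[N hN] : forall i, exists N, 0 < N /\ forall x, `|partial i phi x| <= N.
  by move=> i; have [N N0 hN] := continuous_bounded_support cS (smooth_continuous (smooth_partial i sp)) (qS i); exists N.
exists (M + \sum_i N i).
  by rewrite ltr_wpDr// sumr_ge0// => i _; exact: ltW (hN i).1.
move=> x; split; first by rewrite (le_trans (hM x))// lerDl sumr_ge0// => i _; exact: ltW (hN i).1.
move=> i; rewrite (le_trans ((hN i).2 x))// (bigD1 i)//= addrCA lerDl addr_ge0 ?(ltW M0)//.
by rewrite sumr_ge0// => j _; exact: ltW (hN j).1.
Qed.

End integration_by_parts.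

(** * Series with geometrically decaying energies *)

Section series_limit.
Context {R : realType}.
Implicit Types a : nat -> R.

(** An upper limit, which is measurable in a parameter whether or not the series converges, and
    equals the sum where it does. *)
Definition series_lim a : R := fine (limn_esup (fun m => (series a m)%:E)).

Lemma series_limE a (l : R) : series a @ \oo --> l -> series_lim a = l.
Proof.
move=> h; have h' : (fun m => (series a m)%:E) @ \oo --> l%:E.
  by apply/fine_cvgP; split; [exact: nearW | exact: h].
by rewrite /series_lim (cvg_limn_einf_sup h').2.
Qed.

Lemma series_bounded_cvg a (M : R) : (forall m, \sum_(0 <= k < m) `|a k| <= M) -> cvgn (series a).
Proof.
move=> hM; apply: normed_cvg; apply: nondecreasing_is_cvgn.
  have e k : [normed series a] k = \sum_(0 <= j < k) `|a j| by [].
  by apply/nondecreasing_seqP => k; rewrite !e big_nat_recr//= lerDl.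
by exists M => _ [k _ <-]; exact: hM.
Qed.

Lemma series_shift a N m : series a (N + m)%N = series a N + \sum_(0 <= k < m) a (N + k)%N.
Proof.
rewrite /series/= (@big_cat_nat _ _ _ N)//= ?leq_addr//; congr (_ + _).
by rewrite -{1}[N]add0n big_addn addKn; apply: eq_bigr => k _; rewrite addnC.
Qed.

Lemma geometric_sum_le (s : R) m : 0 <= s < 1 -> \sum_(0 <= k < m) s ^+ k <= (1 - s)^-1.
Proof.
move=> /andP[s0 s1]; have h : 0 < 1 - s by lra.
rewrite -[leRHS]mul1r ler_pdivlMr//; elim: m => [|m IH]; first by rewrite big_geq// mul0r.
suff : (\sum_(0 <= k < m.+1) s ^+ k) * (1 - s) = 1 - s ^+ m.+1.
  by move=> ->; rewrite gerBl exprn_ge0.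
elim: (m.+1) => [|j IHj]; first by rewrite big_geq// mul0r expr0 subrr.
by rewrite big_nat_recr//= mulrDl IHj exprS; ring.
Qed.

(** Jensen with weights [lam ^ k]. An infinite right side makes the claim trivial; a finite one
    forces absolute convergence, because [om > 0]. The estimate thus holds at every point with
    positive weight. *)
Lemma series_tail (a : nat -> R) (lam q om : R) N : 0 < lam < 1 -> 1 < q -> 0 < om ->
  ((`|series_lim a - series a N| `^ q * om)%:E <= (((1 - lam)^-1) `^ (q - 1))%:E *
    \sum_(0 <= k <oo) (lam ^+ k * ((lam ^+ k)^-1 * `|a (N + k)%N|) `^ q * om)%:E)%E.
Proof.
move=> /andP[l0 l1] q1 om0; pose c k := lam ^+ k * ((lam ^+ k)^-1 * `|a (N + k)%N|) `^ q * om.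
have c0 k : 0 <= c k by rewrite /c !mulr_ge0 ?powR_ge0 ?exprn_ge0 ?ltW.
have L0 : 0 < (1 - lam)^-1 by rewrite invr_gt0; lra.
have q0 : 0 < q by lra.
have X0 : 0 < (1 - lam)^-1 `^ (q - 1) by rewrite powR_gt0.
have [h|h] := eqVneq (\sum_(0 <= k <oo) (c k)%:E)%E +oo%E.
  by rewrite [X in (_ * X)%E](_ : _ = +oo%E)// gt0_muley ?leey// lte_fin.
have Hge0 : (0 <= \sum_(0 <= k <oo) (c k)%:E)%E by apply: nneseries_ge0 => k _ _; rewrite lee_fin.
have Hfin : (\sum_(0 <= k <oo) (c k)%:E)%E \is a fin_num by rewrite ge0_fin_numE// ltey.
set H := fine (\sum_(0 <= k <oo) (c k)%:E)%E.
have HE : (\sum_(0 <= k <oo) (c k)%:E = H%:E)%E by rewrite fineK.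
have H0 : 0 <= H by rewrite fine_ge0.
have cH m : \sum_(0 <= k < m) c k <= H.
  rewrite -lee_fin -HE -sumEFin; apply: nneseries_lim_ge => k _ _; by rewrite lee_fin.
pose X := (1 - lam)^-1 `^ (q - 1) * H; have XX : 0 <= X by rewrite mulr_ge0 ?(ltW X0).
have jen m : (\sum_(0 <= k < m) `|a (N + k)%N|) `^ q * om <= X.
  have e1 : \sum_(0 <= k < m) `|a (N + k)%N| = \sum_(0 <= k < m) lam ^+ k * ((lam ^+ k)^-1 * `|a (N + k)%N|).
    by apply: eq_bigr => k _; rewrite mulrA mulfV ?mul1r// expf_neq0// lt0r_neq0.
  rewrite e1; apply: le_trans (_ : (\sum_(0 <= k < m) lam ^+ k) `^ (q - 1) * (\sum_(0 <= k < m) lam ^+ k * ((lam ^+ k)^-1 * `|a (N + k)%N|) `^ q) * om <= _).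
    rewrite ler_wpM2r ?(ltW om0)//; apply: powR_jensen => // k _; first by rewrite exprn_ge0 ?ltW.
    by rewrite mulr_ge0 ?invr_ge0 ?exprn_ge0 ?(ltW l0).
  have A1 : 0 <= (\sum_(0 <= k < m) lam ^+ k * ((lam ^+ k)^-1 * `|a (N + k)%N|) `^ q) * om <= H.
    rewrite mulr_suml (cH m) andbT; apply: sumr_ge0 => k _; exact: c0.
  have A2 : (\sum_(0 <= k < m) lam ^+ k) `^ (q - 1) <= (1 - lam)^-1 `^ (q - 1).
    rewrite ge0_ler_powR ?nnegrE ?(ltW L0)//; first by lra.
      by apply: sumr_ge0 => k _; rewrite exprn_ge0 ?ltW.
    by apply: geometric_sum_le; rewrite (ltW l0).
  by move/andP: A1 => [A1 A1']; rewrite -mulrA; apply: ler_pM; rewrite ?powR_ge0.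
pose B := (X / om) `^ q^-1.
have Bq : B `^ q * om = X.
  rewrite /B -powRrM mulVf ?lt0r_neq0// powRr1 ?divr_ge0 ?(ltW om0)//.
  by rewrite divfK ?lt0r_neq0.
have B0 : 0 <= B by exact: powR_ge0.
have sB m : \sum_(0 <= k < m) `|a (N + k)%N| <= B.
  have s0 : 0 <= \sum_(0 <= k < m) `|a (N + k)%N| by exact: sumr_ge0.
  rewrite leNgt; apply/negP => Bs; have := jen m; apply/negP; rewrite -ltNge -Bq.
  by rewrite ltr_pM2r// gt0_ltr_powR// nnegrE.
have cv : cvgn (series a).
  apply: (@series_bounded_cvg _ (\sum_(0 <= k < N) `|a k| + B)) => m.
  have h1 : \sum_(0 <= k < m) `|a k| <= \sum_(0 <= k < N + m) `|a k|.
    by rewrite [leRHS](@big_cat_nat _ _ _ m)//= ?leq_addl// lerDl sumr_ge0.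
  apply: le_trans h1 _; have := series_shift (fun k => `|a k|) N m; rewrite /series/= => ->.
  by rewrite lerD2l.
have lB : `|series_lim a - series a N| <= B.
  rewrite (series_limE cv); apply/ler_addgt0Pr => e e0.
  have /cvgrPdist_lt/(_ _ e0)[M _ hM] := cv.
  have h1 : (M <= N + M)%N by rewrite leq_addl.
  have := hM _ h1 => /= h2; have := series_shift a N M => h3.
  have h4 : `|series a (N + M)%N - series a N| <= B.
    by rewrite h3 addrAC subrr add0r (le_trans (ler_norm_sum _ _ _)).
  apply: le_trans (ler_distD (series a (N + M)%N) _ _) _.
  by rewrite addrC lerD// ltW.
rewrite [X in (_ * X)%E]HE -EFinM lee_fin -/X -Bq ler_pM2r//.
by rewrite ge0_ler_powR ?nnegrE// ltW.
Qed.

End series_limit.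

Section weighted_series.
Context {R : realType} {n : nat}.
Local Notation mu := (@lebesgue_rV R n).
Variables (Omega : set 'rV[R]_n) (w : 'rV[R]_n -> R) (q th : R).
Hypothesis mO : measurable Omega.
Hypothesis mw : measurable_fun setT w.
Hypothesis wpos : forall x, Omega x -> 0 < w x.
Hypothesis w0 : forall x, 0 <= w x.
Hypothesis q1 : 1 < q.
Hypothesis th01 : 0 < th < 1.
Local Notation wint := (weighted_int Omega q w).

Lemma measurable_series_lim (a : nat -> 'rV[R]_n -> R) : (forall k, measurable_fun Omega (a k)) ->
  measurable_fun Omega (fun x => series_lim (fun k => a k x)).
Proof.
move=> ma; apply: (measurableT_comp (@fine_measurable R setT measurableT)).
apply: (@measurable_fun_limn_esup _ _ _ Omega (fun m x => (series (fun k => a k x) m)%:E)) => m.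
by apply/measurable_EFinP; apply: measurable_sum.
Qed.

(** [lam ^ q = th ^ (1/2)]: the loss [lam ^ (- k * q)] from Jensen takes only half of the decay
    [th ^ k] of the energies, and a geometric series of ratio [s] remains. *)
Lemma wint_series : exists2 C : R, 0 < C & forall (a : nat -> 'rV[R]_n -> R) (V : R), 0 <= V ->
  (forall k, measurable_fun Omega (a k)) -> (forall k, (wint (a k) <= (th ^+ k * V)%:E)%E) ->
  forall N, (wint (fun x => series_lim (fun k => a k x) - \sum_(0 <= k < N) a k x)%R <= (C * th ^+ N * V)%:E)%E.
Proof.
have /andP[t0 t1] := th01; have q0 : 0 < q by have := q1; lra.
pose lam := th `^ (2 * q)^-1; pose s := lam * th `^ 2^-1.
have pw (e : R) : 0 < e -> 0 < th `^ e < 1.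
  move=> e0; rewrite powR_gt0//=; have := @gt0_ltr_powR R e e0 th 1.
  by rewrite powR1; apply; rewrite ?nnegrE// ltW.
have /andP[l0 l1] : 0 < lam < 1 by apply: pw; rewrite invr_gt0 mulr_gt0.
have /andP[r0 r1] : 0 < th `^ 2^-1 < 1 by apply: pw; rewrite invr_gt0.
have s01 : 0 <= s < 1.
  by rewrite mulr_ge0 ?(ltW l0) ?(ltW r0)//= mulr_ilt1 ?(ltW l0) ?(ltW r0).
have s1 : 0 < 1 - s by move/andP: s01 => [_]; lra.
have L0 : 0 < (1 - lam)^-1 by rewrite invr_gt0; lra.
pose C := (1 - lam)^-1 `^ (q - 1) * (1 - s)^-1.
have C0 : 0 < C by apply: mulr_gt0; [exact: powR_gt0 | rewrite invr_gt0].
exists C => // a V V0 ma wa N.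
pose c k x := lam ^+ k * ((lam ^+ k)^-1 * `|a (N + k)%N x|) `^ q * w x.
have c0 k x : 0 <= c k x by rewrite /c !mulr_ge0 ?powR_ge0 ?exprn_ge0 ?(ltW l0).
pose g k := lam ^+ k * ((lam ^+ k)^-1) `^ q.
have g0 k : 0 <= g k by rewrite mulr_ge0 ?powR_ge0 ?exprn_ge0 ?ltW.
have cE k x : c k x = g k * (`|a (N + k)%N x| `^ q * w x).
  by rewrite /c powRM ?invr_ge0 ?exprn_ge0 ?(ltW l0)// /g !mulrA.
have gE k : g k * th ^+ k = s ^+ k.
  rewrite /g /s exprMn -mulrA; congr (_ * _).
  rewrite -exprVn -[(lam^-1) ^+ k]powR_mulrn ?invr_ge0 ?(ltW l0)// -powRrM mulrC [k%:R * q]mulrC powRrM.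
  have -> : lam^-1 `^ q = (th `^ 2^-1)^-1.
    rewrite -(powR_inv1 (ltW l0)) /lam -!powRrM -powRN; congr (_ `^ _).
    by field; rewrite lt0r_neq0.
  rewrite powR_mulrn ?invr_ge0 ?(ltW r0)// -exprMn; congr (_ ^+ _).
  have {1}-> : th = th `^ 2^-1 * th `^ 2^-1.
    by rewrite -powRD ?(gt_eqF t0) ?implybT// -mulr2n -[X in th `^ X]mulr_natl mulfV// powRr1 ?ltW.
  by rewrite mulfK// lt0r_neq0.
have mc k : measurable_fun Omega (fun x => (c k x)%:E).
  apply: (eq_measurable_fun (fun x => (g k)%:E * (`|a (N + k)%N x| `^ q * w x)%:E)%E).
    by move=> x _; rewrite cE EFinM.
  by apply: measurable_funeM; exact: measurable_wint.
have Ic k : (\int[mu]_(x in Omega) (c k x)%:E <= (s ^+ k * (th ^+ N * V))%:E)%E.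
  under eq_integral do rewrite cE EFinM.
  rewrite ge0_integralZl ?lee_fin//; last 2 first.
  - exact: measurable_wint.
  - by move=> x _; rewrite lee_fin mulr_ge0 ?powR_ge0.
  apply: le_trans (lee_wpmul2l _ (wa (N + k)%N)) _; rewrite ?lee_fin//.
  have -> : g k * (th ^+ (N + k) * V) = s ^+ k * (th ^+ N * V).
    by rewrite -(gE k) exprD; move: (g k) (th ^+ k) (th ^+ N) => y1 y2 y3; ring.
  exact: lexx.
have Isum : (\int[mu]_(x in Omega) \sum_(0 <= k <oo) (c k x)%:E <= ((1 - s)^-1 * (th ^+ N * V))%:E)%E.
  rewrite integral_nneseries//; last by move=> k x _; rewrite lee_fin.
  apply: lime_le; first by apply: is_cvg_nneseries => k _ _; apply: integral_ge0 => x _; rewrite lee_fin.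
  apply: nearW => m; apply: (@le_trans _ _ (\sum_(0 <= k < m) (s ^+ k * (th ^+ N * V))%:E)%E).
    by apply: lee_sum => k _; exact: Ic.
  rewrite sumEFin -mulr_suml lee_fin ler_wpM2r ?mulr_ge0 ?exprn_ge0 ?(ltW t0)//.
  exact: geometric_sum_le.
have msum : measurable_fun Omega (fun x => \sum_(0 <= k <oo) (c k x)%:E)%E.
  by apply: ge0_emeasurable_sum => // k x _ _; rewrite lee_fin.
have -> : C * th ^+ N * V = (1 - lam)^-1 `^ (q - 1) * ((1 - s)^-1 * (th ^+ N * V)) by rewrite /C !mulrA.
rewrite EFinM; apply: le_trans (lee_wpmul2l _ Isum); last by rewrite lee_fin powR_ge0.
rewrite -ge0_integralZl//; last 2 first.
- by move=> x _; apply: nneseries_ge0 => k _ _; rewrite lee_fin.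
- by rewrite lee_fin powR_ge0.
apply: ge0_le_integral => //.
- by move=> x _; rewrite lee_fin mulr_ge0 ?powR_ge0.
- apply: measurable_wint => //; apply: measurable_funB; first exact: measurable_series_lim.
  exact: measurable_sum.
- exact: measurable_funeM.
- move=> x Ox; apply: series_tail => //; [by rewrite l0 | exact: wpos].
Qed.

End weighted_series.

(** The pointwise bound behind [pairing_bound]: the constant part is integrated over the finite
    measure of [Omega], the power part against the weight, and [eta] is free. *)
Lemma young_split {R : realType} (g eta q : R) : 0 < eta -> 1 < q -> 0 <= g ->
  g <= eta + eta `^ (1 - q) * g `^ q.
Proof.
move=> e0 q1 g0; have [h|h] := leP g eta; first by rewrite ler_wpDr// mulr_ge0 ?powR_ge0.
have gp : 0 < g by apply: lt_trans h.
rewrite ler_wpDl ?(ltW e0)//.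
have {1}-> : g = g `^ (1 - q) * g `^ q.
  by rewrite -powRD ?(gt_eqF gp) ?implybT// subrK powRr1.
rewrite ler_wpM2r ?powR_ge0//.
rewrite -[1 - q]opprK opprB !(powRN _ (q - 1)) lef_pV2 ?posrE ?powR_gt0//.
by rewrite ge0_ler_powR ?nnegrE ?(ltW gp) ?(ltW e0)//; [lra | exact: ltW].
Qed.

Lemma sum_sqr_le {R : realType} I (s : seq I) (x : I -> R) : (forall i, 0 <= x i) ->
  \sum_(i <- s) x i ^+ 2 <= (\sum_(i <- s) x i) ^+ 2.
Proof.
move=> x0; elim: s => [|i s IH]; first by rewrite !big_nil expr0n.
rewrite !big_cons sqrrD; apply: le_trans (lerD (lexx _) IH) _.
by rewrite addrAC -addrA lerD2l lerDl mulrn_wge0// mulr_ge0// sumr_ge0.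
Qed.

Lemma fnorm_le_entries {R : realType} (m n : nat) (A : 'M[R]_(m, n)) : fnorm A <= \sum_i \sum_j `|A i j|.
Proof.
have s0 : 0 <= \sum_i \sum_j `|A i j| by apply: sumr_ge0 => i _; exact: sumr_ge0.
rewrite -[leRHS](ger0_norm s0) -sqrtr_sqr /fnorm ler_wsqrtr//.
apply: le_trans (sum_sqr_le _ (fun i => sumr_ge0 _ (fun j _ => normr_ge0 (A i j)))).
apply: ler_sum => i _; apply: le_trans (sum_sqr_le _ (fun j => normr_ge0 (A i j))).
by apply: ler_sum => j _; rewrite real_normK// num_real.
Qed.

Lemma geometric_small {R : realType} (th K ep : R) : 0 < th < 1 -> 0 < ep -> exists N, K * th ^+ N <= ep.
Proof.
move=> /andP[t0 t1] ep0; have k0 : 0 < `|K| + 1 by rewrite ltr_wpDl.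
have tn : `|th| < 1 by rewrite ger0_norm// ltW.
have /cvgrPdist_lt/(_ (ep / (`|K| + 1)) (divr_gt0 ep0 k0))[N _ hN] := cvg_expr tn.
exists N; have := hN N (leqnn N); rewrite /= sub0r normrN ger0_norm ?exprn_ge0 ?(ltW t0)//.
rewrite ltr_pdivlMr// => h.
apply: le_trans (_ : (`|K| + 1) * th ^+ N <= _); last by rewrite mulrC ltW.
by rewrite ler_wpM2r ?exprn_ge0 ?(ltW t0)// (le_trans (ler_norm K))// lerDl.
Qed.

Lemma leeD_pair {R : realType} (m V k ep : R) (a b : \bar R) : 0 <= k -> (a <= ep%:E)%E -> (b <= ep%:E)%E ->
  ((m%:E * V%:E + k%:E * a) + (m%:E * V%:E + k%:E * b) <= ((m * V + k * ep) + (m * V + k * ep))%:E)%E.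
Proof.
move=> k0 h1 h2; rewrite !EFinD !EFinM.
by apply: leeD; rewrite leeD2l// lee_wpmul2l// lee_fin.
Qed.

Lemma eta_small {R : realType} (M V dl : R) : 0 <= M -> 0 <= V -> 0 < dl ->
  M * (dl / (4 * (M * V + 1))) * V <= dl / 4.
Proof.
move=> M0 V0 d0; have z0 : 0 <= M * V by rewrite mulr_ge0.
have -> : M * (dl / (4 * (M * V + 1))) * V = (M * V) * dl / (4 * (M * V + 1)).
  by field; rewrite lt0r_neq0//; lra.
by move: (M * V) z0 => z z0; rewrite ler_pdivrMr; nra.
Qed.

Section weighted_sums.
Context {R : realType} {n : nat}.
Local Notation mu := (@lebesgue_rV R n).
Variables (Omega : set 'rV[R]_n) (w : 'rV[R]_n -> R) (q : R).
Hypothesis mO : measurable Omega.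
Hypothesis mw : measurable_fun setT w.
Hypothesis w0 : forall x, 0 <= w x.
Hypothesis q1 : 1 < q.
Local Notation wint := (weighted_int Omega q w).

Lemma wint_sum (I : finType) (g : I -> 'rV[R]_n -> R) (h : 'rV[R]_n -> R) :
  measurable_fun Omega h -> (forall i, measurable_fun Omega (g i)) ->
  (forall x, Omega x -> `|h x| <= \sum_i `|g i x|) ->
  (wint h <= (#|I|%:R `^ (q - 1))%:E * \sum_i wint (g i))%E.
Proof.
move=> mh mg hg; have c0 : 0 <= #|I|%:R `^ (q - 1) :> R by exact: powR_ge0.
rewrite /weighted_int -ge0_integral_sum//; first last.
- by move=> i x _; rewrite lee_fin mulr_ge0 ?powR_ge0.
- by move=> i; exact: measurable_wint.
have ms : measurable_fun Omega (fun x => \sum_i (`|g i x| `^ q * w x)%:E)%E.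
  by apply: emeasurable_sum => i; exact: measurable_wint.
rewrite -ge0_integralZl//; last first.
  by move=> x _; apply: sume_ge0 => i _; rewrite lee_fin mulr_ge0 ?powR_ge0.
apply: ge0_le_integral => //.
- by move=> x _; rewrite lee_fin mulr_ge0 ?powR_ge0.
- exact: measurable_wint.
- exact: measurable_funeM.
- move=> x Ox; rewrite sumEFin -EFinM lee_fin -mulr_suml mulrA ler_wpM2r//.
  apply: (@le_trans _ _ ((\sum_i `|g i x|) `^ q)).
    rewrite ge0_ler_powR ?nnegrE ?hg//; first by have := q1; lra.
    exact: sumr_ge0.
  have := @powR_sum_le R I (index_enum I) predT (fun i => `|g i x|) q q1 (fun _ _ => normr_ge0 _).
  by rewrite count_predT cardT enumT.
Qed.

Lemma wint_ae0 h : measurable_fun Omega h -> (forall x, Omega x -> 0 < w x) -> wint h = 0%E ->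
  \forall x \ae mu, Omega x -> h x = 0.
Proof.
move=> mh wp h0; have mH := measurable_wint q mw mh.
have : (\int[mu]_(x in Omega) `|(`|h x| `^ q * w x)%:E|)%E = 0%E.
  by under eq_integral do rewrite abse_EFin ger0_norm ?mulr_ge0 ?powR_ge0//.
move/(ae_eq_integral_abs mu mO mH); apply: filterS => x hx Ox.
have := hx Ox => /= -[] /eqP; rewrite mulf_eq0 (gt_eqF (wp x Ox)) orbF powR_eq0 normr_eq0.
by move=> /andP[/eqP].
Qed.

End weighted_sums.

Lemma lte_lincomb_pinfty {R : realType} (a k : R) (x y : \bar R) : 0 <= a -> 0 <= k ->
  (x < +oo -> y < +oo -> a%:E * x + k%:E * y < +oo)%E.
Proof. by move=> a0 k0 xoo yoo; rewrite lte_add_pinfty// lte_mul_pinfty. Qed.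

(** * Weak derivatives of limits *)

Section weak_limits.
Context {R : realType} {n : nat}.
Local Notation mu := (@lebesgue_rV R n).
Variables (Omega : set 'rV[R]_n) (w : 'rV[R]_n -> R) (q : R).
Hypothesis oO : open Omega.
Hypothesis muO : (mu Omega < +oo)%E.
Hypothesis mw : measurable_fun setT w.
Hypothesis w0 : forall x, 0 <= w x.
Hypothesis wlow : forall K, compact K -> K `<=` Omega -> exists2 c, 0 < c & forall x, K x -> c <= w x.
Hypothesis q1 : 1 < q.
Local Notation wint := (weighted_int Omega q w).
Let mO : measurable Omega := open_measurable_rV oO.
Implicit Types a b phi A B : 'rV[R]_n -> R.

Lemma pairing_bound K c (M eta : R) a (F : 'rV[R]_n -> R) : compact K -> K `<=` Omega -> 0 < c ->
  (forall x, K x -> c <= w x) -> 0 < eta -> 0 <= M ->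
  measurable_fun Omega a -> measurable_fun Omega F ->
  (forall x, Omega x -> ~ K x -> F x = 0) -> (forall x, Omega x -> `|F x| <= M * `|a x|) ->
  (\int[mu]_(x in Omega) `|F x|%:E <= (M * eta)%:E * mu Omega + (M * eta `^ (1 - q) * c^-1)%:E * wint a)%E.
Proof.
move=> cK KO c0 wc e0 M0 ma mF F0 Fa.
have k1 : 0 <= M * eta by rewrite mulr_ge0// ltW.
have k2 : 0 <= M * eta `^ (1 - q) * c^-1 by rewrite !mulr_ge0 ?powR_ge0// invr_ge0 ltW.
have mwa := measurable_wint q mw ma.
rewrite -(integral_cst mu mO (M * eta)%:E) -ge0_integralZl//; last first.
  by move=> x _; rewrite lee_fin mulr_ge0 ?powR_ge0.
rewrite -ge0_integralD//; first last.
- exact: measurable_funeM.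
- by move=> x _; rewrite -EFinM lee_fin !mulr_ge0 ?powR_ge0// invr_ge0 ltW.
apply: ge0_le_integral => //.
- by apply/measurable_EFinP; exact: measurableT_comp.
- by apply: emeasurable_funD => //; exact: measurable_funeM.
move=> x Ox; rewrite /cst -EFinM -EFinD lee_fin.
have p0 : 0 <= M * eta `^ (1 - q) * c^-1 * (`|a x| `^ q * w x) by rewrite mulr_ge0// mulr_ge0 ?powR_ge0.
have [Kx|Kx] := pselect (K x); last by rewrite F0// normr0 addr_ge0.
apply: le_trans (Fa x Ox) _; rewrite -!mulrA -mulrDr ler_wpM2l//.
apply: le_trans (young_split e0 q1 (normr_ge0 (a x))) _.
rewrite lerD2l ler_wpM2l ?powR_ge0// mulrCA ler_peMr ?powR_ge0//.
by rewrite mulrC ler_pdivlMr// mul1r wc.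
Qed.

Lemma loc_integrable_wint A : measurable_fun Omega A -> (wint A < +oo)%E -> loc_integrable Omega A.
Proof.
move=> mA wA K cK KO; have [c c0 wc] := wlow cK KO.
have mK : measurable K.
  rewrite -[K]setCK; apply: measurableC; apply: open_measurable_rV; apply: closed_openC.
  by apply: compact_closed => //; exact: norm_hausdorff.
apply/integrableP; split; first by apply/measurable_EFinP; exact: (measurable_funS mO).
have mF : measurable_fun Omega (fun x => A x * \1_K x) by apply: measurable_funM => //; exact: measurable_indic.
have h : (\int[mu]_(x in Omega) `|A x * \1_K x|%:E <= (1 * 1)%:E * mu Omega + (1 * 1 `^ (1 - q) * c^-1)%:E * wint A)%E.
  apply: (@pairing_bound K) => //.
  - by move=> x _ Kx; rewrite indicE memNset// mulr0.
  - by move=> x _; rewrite mul1r normrM indicE; case: (_ \in _); rewrite ?normr1 ?normr0 ?mulr1 ?mulr0.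
have -> : (\int[mu]_(x in K) `|(EFin \o A) x| = \int[mu]_(x in K) `|A x * \1_K x|%:E)%E.
  by apply: eq_integral => x xK; rewrite /= indicE xK mulr1.
apply: (@le_lt_trans _ _ (\int[mu]_(x in Omega) `|A x * \1_K x|%:E)%E).
  by apply: ge0_subset_integral => //; apply/measurable_EFinP; exact: measurableT_comp.
apply: le_lt_trans h _; apply: lte_add_pinfty; first by rewrite lte_mul_pinfty// lee_fin mulr1.
by rewrite lte_mul_pinfty// lee_fin !mulr_ge0 ?powR_ge0// invr_ge0 ltW.
Qed.

(** The identity holds for the smooth [S N]. What separates it from the one for [A] and [B] is made
    small by [pairing_bound]: first [eta] is chosen, then [N] depending on [eta]. *)
Lemma weak_partial_limit j A B (S : nat -> 'rV[R]_n -> R) : measurable_fun Omega A -> measurable_fun Omega B ->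
  (wint A < +oo)%E -> (wint B < +oo)%E -> (forall N, smooth (S N)) ->
  (forall ep : R, 0 < ep -> exists N, (wint (fun x => A x - S N x)%R <= ep%:E)%E /\
     (wint (fun x => B x - partial j (S N) x)%R <= ep%:E)%E) ->
  weak_partial Omega j A B.
Proof.
move=> mA mB wA wB sS hS; split; [exact: loc_integrable_wint | exact: loc_integrable_wint | move=> phi tphi].
have [K [cK KO pK qK]] := test_partial_support tphi; have [sphi _ _] := tphi.
have [M M0 hM] := test_bounded tphi; have M0' := ltW M0.
have [c c0 wc] := wlow cK KO.
have mS (f : 'rV[R]_n -> R) : smooth f -> measurable_fun Omega f.
  by move=> sf; apply: (measurable_funS measurableT) => //; exact: measurable_smooth.
have mphi := mS _ sphi; have mdphi := mS _ (smooth_partial j sphi).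
have bnd eta a b : 0 < eta -> measurable_fun Omega a -> measurable_fun Omega b ->
    (\int[mu]_(x in Omega) `|a x * partial j phi x + b x * phi x|%:E <=
     ((M * eta)%:E * mu Omega + (M * eta `^ (1 - q) * c^-1)%:E * wint a) +
     ((M * eta)%:E * mu Omega + (M * eta `^ (1 - q) * c^-1)%:E * wint b))%E.
  move=> e0 ma mb.
  have m1 : measurable_fun Omega (fun x => a x * partial j phi x) by exact: measurable_funM.
  have m2 : measurable_fun Omega (fun x => b x * phi x) by exact: measurable_funM.
  apply: (@le_trans _ _ (\int[mu]_(x in Omega) (`|a x * partial j phi x|%:E + `|b x * phi x|%:E))%E).
    apply: ge0_le_integral => //.
    - by apply/measurable_EFinP; apply: measurableT_comp => //; exact: measurable_funD.
    - by apply: emeasurable_funD; apply/measurable_EFinP; exact: measurableT_comp.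
    - by move=> x _; rewrite -EFinD lee_fin ler_normD.
  rewrite ge0_integralD//; try by apply/measurable_EFinP; exact: measurableT_comp.
  apply: leeD; apply: (@pairing_bound K) => //.
  - by move=> x _ Kx; rewrite qK// mulr0.
  - by move=> x _; rewrite normrM mulrC ler_wpM2r//; exact: (hM x).2.
  - by move=> x _ Kx; rewrite pK// mulr0.
  - by move=> x _; rewrite normrM mulrC ler_wpM2r//; exact: (hM x).1.
have fin eta a b : 0 < eta -> (wint a < +oo)%E -> (wint b < +oo)%E ->
    (((M * eta)%:E * mu Omega + (M * eta `^ (1 - q) * c^-1)%:E * wint a) +
     ((M * eta)%:E * mu Omega + (M * eta `^ (1 - q) * c^-1)%:E * wint b) < +oo)%E.
  move=> e0 wa wb.
  have k1 : 0 <= M * eta by rewrite mulr_ge0// ltW.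
  have k2 : 0 <= M * eta `^ (1 - q) * c^-1 by rewrite !mulr_ge0 ?powR_ge0// invr_ge0 ltW.
  exact: lte_add_pinfty (lte_lincomb_pinfty k1 k2 muO wa) (lte_lincomb_pinfty k1 k2 muO wb).
have integ a b : measurable_fun Omega a -> measurable_fun Omega b -> (wint a < +oo)%E -> (wint b < +oo)%E ->
    mu.-integrable Omega (EFin \o (fun x => a x * partial j phi x + b x * phi x)).
  move=> ma mb wa wb; apply/integrableP; split.
    by apply/measurable_EFinP; apply: measurable_funD; exact: measurable_funM.
  apply: le_lt_trans (bnd 1 a b ltr01 ma mb) _; exact: fin.
have z0 : wint (fun=> 0) = 0%E.
  rewrite /weighted_int; under eq_integral do rewrite normr0 powR0 ?mul0r ?(gt_eqF (lt_trans ltr01 q1))//.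
  by rewrite integral0.
have m0 : measurable_fun Omega ((fun=> 0) : 'rV[R]_n -> R) by exact: measurable_cst.
have i1 : mu.-integrable Omega (EFin \o (fun x => A x * partial j phi x)).
  have := integ A (fun=> 0) mA m0 wA; rewrite z0 => /(_ (ltry _)).
  by rewrite (_ : (fun x => _ + _) = (fun x => A x * partial j phi x))//; apply/funext => x; rewrite mul0r addr0.
have i2 : mu.-integrable Omega (EFin \o (fun x => B x * phi x)).
  have := integ (fun=> 0) B m0 mB; rewrite z0 => /(_ (ltry _) wB).
  by rewrite (_ : (fun x => _ + _) = (fun x => B x * phi x))//; apply/funext => x; rewrite mul0r add0r.
have iF := integ A B mA mB wA wB.
have small (dl : R) : 0 < dl -> (`|\int[mu]_(x in Omega) (A x * partial j phi x + B x * phi x)%:E| <= dl%:E)%E.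
  move=> d0; have muf : mu Omega \is a fin_num by rewrite ge0_fin_numE.
  pose V := fine (mu Omega); have V0 : 0 <= V by rewrite fine_ge0.
  pose eta := dl / (4 * (M * V + 1)).
  have MV : 0 < 4 * (M * V + 1) by rewrite mulr_gt0// ltr_wpDl// mulr_ge0.
  have eta0 : 0 < eta by rewrite divr_gt0.
  pose k := M * eta `^ (1 - q) * c^-1.
  have k0 : 0 < k by rewrite !mulr_gt0 ?powR_gt0// invr_gt0.
  have [N [hN1 hN2]] := hS (dl / (4 * k)) (divr_gt0 d0 (mulr_gt0 (ltr0n R 4) k0)).
  have mSN := mS _ (sS N); have mdSN := mS _ (smooth_partial j (sS N)).
  have mAS : measurable_fun Omega (fun x => A x - S N x) by exact: measurable_funB.
  have mBS : measurable_fun Omega (fun x => B x - partial j (S N) x) by exact: measurable_funB.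
  have iD : mu.-integrable Omega (EFin \o (fun x => (A x - S N x) * partial j phi x + (B x - partial j (S N) x) * phi x)).
    exact: (integ _ _ mAS mBS (le_lt_trans hN1 (ltry _)) (le_lt_trans hN2 (ltry _))).
  have e1 : (\int[mu]_(x in Omega) (A x * partial j phi x + B x * phi x)%:E =
      \int[mu]_(x in Omega) ((A x - S N x) * partial j phi x + (B x - partial j (S N) x) * phi x)%:E)%E.
    have := int_by_parts j (sS N) tphi => h0.
    have iG : mu.-integrable Omega (EFin \o (fun x => S N x * partial j phi x + partial j (S N) x * phi x)).
      have := integrableB mO iF iD; congr (mu.-integrable Omega _).
      by apply/funext => x; rewrite /= -EFinB; congr EFin; ring.
    rewrite -[LHS]sube0 -h0 -integralB_EFin//; apply: eq_integral => x _.
    by rewrite -EFinB; congr EFin; ring.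
  rewrite e1; apply: le_trans (le_abse_integral mu mO _) _; first by apply: measurable_int; exact: iD.
  apply: le_trans (bnd eta _ _ eta0 mAS mBS) _.
  rewrite -(fineK muf) -/V; apply: le_trans (leeD_pair (M * eta) V (ltW k0) hN1 hN2) _.
  rewrite lee_fin.
  have -> : k * (dl / (4 * k)) = dl / 4 by field; exact: lt0r_neq0.
  have := eta_small M0' V0 d0; rewrite -/eta => h; lra.
have I0 : (\int[mu]_(x in Omega) (A x * partial j phi x + B x * phi x)%:E = 0)%E.
  apply/eqP; rewrite -abse_eq0 eq_le abse_ge0 andbT; apply/lee_addgt0Pr => dl d0.
  by rewrite add0e; exact: small.
have F1 := integrable_fin_num mO i1; have F2 := integrable_fin_num mO i2.
have : (\int[mu]_(x in Omega) (A x * partial j phi x)%:E + \int[mu]_(x in Omega) (B x * phi x)%:E = 0)%E.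
  by rewrite -integralD_EFin// -I0; apply: eq_integral => x _; rewrite /= EFinD.
move: F1 F2 => /=; move: (integral _ _ _) (integral _ _ _) => y1 y2 /fineK <- /fineK <-.
by rewrite -EFinD -EFinN => -[] /eqP; rewrite addr_eq0 => /eqP ->.
Qed.

End weak_limits.

(** * Iteration on the residual *)

Section divergence_equation.
Context {R : realType} {n : nat}.
Local Notation mu := (@lebesgue_rV R n).
Variables (Omega : set 'rV[R]_n) (w : 'rV[R]_n -> R) (q : R).
Hypothesis oO : open Omega.
Hypothesis muO : (mu Omega < +oo)%E.
Hypothesis mw : measurable_fun setT w.
Hypothesis w0 : forall x, 0 <= w x.
Hypothesis wpos : forall x, Omega x -> 0 < w x.
Hypothesis wlow : forall K, compact K -> K `<=` Omega -> exists2 c, 0 < c & forall x, K x -> c <= w x.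
Hypothesis q1 : 1 < q.
Local Notation wint := (weighted_int Omega q w).
Let mO : measurable Omega := open_measurable_rV oO.

Definition solvable_data (f : 'rV[R]_n -> R) : Prop := [/\ measurable_fun Omega f, (wint f < +oo)%E &
  (\int[mu]_(x in Omega) (f x)%:E = 0)%E].

Variables (C th : R).
Hypothesis C0 : 0 < C.
Hypothesis th01 : 0 < th < 1.
Hypothesis step : forall f, solvable_data f -> exists u : 'I_n -> 'rV[R]_n -> R,
  [/\ forall i, test_fun Omega (u i), forall i, (wint (u i) <= C%:E * wint f)%E,
      forall i j, (wint (partial j (u i)) <= C%:E * wint f)%E &
      (wint (fun x => f x - divergence u x)%R <= th%:E * wint f)%E].

Lemma measurable_test (g : 'rV[R]_n -> R) : smooth g -> measurable_fun Omega g.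
Proof. by move=> sg; apply: (measurable_funS measurableT) => //; exact: measurable_smooth. Qed.

Lemma residual_data (f : 'rV[R]_n -> R) u : solvable_data f -> (forall i, test_fun Omega (u i)) ->
  (wint (fun x => f x - divergence u x)%R <= th%:E * wint f)%E ->
  solvable_data (fun x => f x - divergence u x).
Proof.
move=> [mf wf f0] tu wu.
have md : measurable_fun Omega (divergence u).
  by apply: measurable_sum => i; apply: measurable_test; apply: smooth_partial; have [] := tu i.
have id i : mu.-integrable Omega (EFin \o partial i (u i)).
  have [M M0 hM] := test_bounded (tu i).
  apply: (integrable_bounded_fun oO (M := M)) => //; last by move=> x; exact: (hM x).2.
  by apply: measurable_test; apply: smooth_partial; have [] := tu i.
have dE : (fun x => (divergence u x)%:E) = (fun x => \sum_i (EFin \o partial i (u i)) x)%E.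
  by apply/funext => x; rewrite sumEFin.
have idiv : mu.-integrable Omega (EFin \o divergence u).
  rewrite (_ : EFin \o divergence u = (fun x => \sum_i (EFin \o partial i (u i)) x)%E) //.
  by apply: integrable_sum.
split.
- exact: measurable_funB.
- by apply: le_lt_trans wu _; rewrite lte_mul_pinfty// lee_fin; case/andP: th01 => /ltW.
- have intf : mu.-integrable Omega (EFin \o f).
    apply/integrableP; split; first exact/measurable_EFinP.
    by have := integral_fin_num_abs mu mO mf; rewrite f0 => /= ->.
  transitivity (\int[mu]_(x in Omega) ((f x)%:E - (divergence u x)%:E))%E.
    by apply: eq_integral => x _; rewrite EFinB.
  rewrite integralB_EFin// f0 sub0e dE integral_sum// big1 ?oppe0// => i _.
  exact: int_test_partial0.
Qed.

Lemma measurable_fnorm (k l : nat) (A : 'rV[R]_n -> 'M[R]_(k, l)) :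
  (forall i j, measurable_fun Omega (fun x => A x i j)) -> measurable_fun Omega (fun x => fnorm (A x)).
Proof.
move=> mA; apply: (measurableT_comp (continuous_measurable_fun (@sqrt_continuous R))).
by apply: measurable_sum => i; apply: measurable_sum => j; apply: measurable_funX.
Qed.

Lemma wint_fnorm (k l : nat) (A : 'rV[R]_n -> 'M[R]_(k, l)) (V : R) :
  (forall i j, measurable_fun Omega (fun x => A x i j)) ->
  (forall i j, (wint (fun x => A x i j) <= V%:E)%E) ->
  (wint (fun x => fnorm (A x)) <= ((k * l)%:R `^ (q - 1) * ((k * l)%:R * V))%:E)%E.
Proof.
move=> mA hA.
have := @wint_sum R n Omega w q mO mw w0 q1 ('I_k * 'I_l)%type (fun ij x => A x ij.1 ij.2)
  (fun x => fnorm (A x)) (measurable_fnorm mA) (fun ij => mA ij.1 ij.2) _.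
rewrite card_prod !card_ord => h; apply: le_trans (h _) _.
  move=> x _; rewrite ger0_norm; last by rewrite /fnorm sqrtr_ge0.
  apply: le_trans (fnorm_le_entries (A x)) _.
  by rewrite pair_big.
rewrite EFinM lee_wpmul2l ?lee_fin ?powR_ge0//.
apply: (@le_trans _ _ (\sum_(ij : 'I_k * 'I_l) V%:E)%E); first by apply: lee_sum => ij _; exact: hA.
by rewrite sumEFin lee_fin sumr_const card_prod !card_ord mulr_natl.
Qed.

Lemma wnorm_le (g : 'rV[R]_n -> R) (V : R) : (wint g <= V%:E)%E -> (wnorm Omega q w g <= (V `^ q^-1)%:E)%E.
Proof.
move=> h; have q0 : 0 <= q^-1 by rewrite invr_ge0; have := q1; lra.
rewrite -poweR_EFin; apply: gt0_ler_poweR => //; rewrite in_itv/= ?leey ?andbT.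
  exact: wint_ge0.
exact: le_trans (wint_ge0 _ _ w0 _) h.
Qed.

(** [u k] is the approximate solution for the [k]-th residual, so its energy decays like [th ^ k].
    The partial sums [S N i] are test functions that converge together with their gradients: this
    one fact gives membership in [sobolev0], the weak Jacobian and, at [N = 0], the energy bound. *)
Theorem divergence_solution : exists2 CF : R, 0 < CF & forall f, solvable_data f ->
  exists (u : 'rV[R]_n -> 'rV[R]_n) (Du : 'rV[R]_n -> 'M[R]_n),
      [/\ forall i, sobolev0 Omega q w (fun x => u x ord0 i),
          weak_jacobian Omega u Du,
          \forall x \ae mu, Omega x -> \tr (Du x) = f x &
          (wint (fun x => fnorm (Du x)) <= CF%:E * wint f)%E].
Proof.
have /andP[t0 t1] := th01; have [CS CS0 hCS] := wint_series mO mw wpos w0 q1 th01.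
have qi : 0 < q by have := q1; lra.
have CC : 0 <= CS * C by rewrite mulr_ge0 ?ltW.
have nn0 : 0 <= (n * n)%:R `^ (q - 1) * (n * n)%:R :> R by rewrite mulr_ge0 ?powR_ge0.
pose CF := (n * n)%:R `^ (q - 1) * (n * n)%:R * (CS * C) + 1.
exists CF; first by rewrite ltr_wpDl// mulr_ge0.
move=> f sf; have [mf wf f0] := sf.
(* A field is chosen for every function, solvable or not, so that the residuals are a plain
   iteration. *)
have /choice[U hU] : forall g, exists u : 'I_n -> 'rV[R]_n -> R, solvable_data g ->
  [/\ forall i, test_fun Omega (u i), forall i, (wint (u i) <= C%:E * wint g)%E,
      forall i j, (wint (partial j (u i)) <= C%:E * wint g)%E &
      (wint (fun x => g x - divergence u x)%R <= th%:E * wint g)%E].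
  move=> g; have [sg|sg] := pselect (solvable_data g); last by exists (fun _ => fun=> 0).
  by have [u hu] := step sg; exists u.
pose r k := iter k (fun g => (fun x => g x - divergence (U g) x)) f.
have fW : wint f \is a fin_num by rewrite ge0_fin_numE ?wint_ge0.
pose W := fine (wint f); have WE : wint f = W%:E by rewrite fineK.
have W0 : 0 <= W by rewrite fine_ge0 ?wint_ge0.
have hr k : solvable_data (r k) /\ (wint (r k) <= (th ^+ k * W)%:E)%E.
  elim: k => [|k [IH1 IH2]]; first by rewrite /r/= expr0 mul1r WE.
  have [h1 h2 h3 h4] := hU _ IH1; split; first exact: residual_data.
  apply: le_trans h4 _; rewrite exprS -mulrA EFinM lee_wpmul2l// lee_fin; exact: ltW.
pose u k := U (r k); pose V := C * W.
have V0 : 0 <= V by rewrite mulr_ge0 ?(ltW C0).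
have tu k i : test_fun Omega (u k i) by have [h _ _ _] := hU _ (hr k).1; exact: h.
have su k i : smooth (u k i) by have [] := tu k i.
have stepV k X : (X <= C%:E * wint (r k))%E -> (X <= (th ^+ k * V)%:E)%E.
  move=> h; apply: le_trans h _; apply: le_trans (lee_wpmul2l _ (hr k).2) _; first by rewrite lee_fin ltW.
  by rewrite -EFinM lee_fin /V mulrCA.
have wu i k : (wint (u k i) <= (th ^+ k * V)%:E)%E.
  by apply: stepV; have [_ h _ _] := hU _ (hr k).1; exact: h.
have wdu i j k : (wint (partial j (u k i)) <= (th ^+ k * V)%:E)%E.
  by apply: stepV; have [_ _ h _] := hU _ (hr k).1; exact: h.
have mu_ i k : measurable_fun Omega (u k i) by exact: measurable_test.
have mdu i j k : measurable_fun Omega (partial j (u k i)) by apply: measurable_test; exact: smooth_partial.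
pose A i x := series_lim (fun k => u k i x).
pose B i j x := series_lim (fun k => partial j (u k i) x).
pose S N i (x : 'rV[R]_n) := \sum_(0 <= k < N) u k i x.
have tS N i : test_fun Omega (S N i) by apply: test_fun_sum => k; exact: tu.
have sS N i : smooth (S N i) by have [] := tS N i.
have pS N i j x : partial j (S N i) x = \sum_(0 <= k < N) partial j (u k i) x.
  by rewrite /S partial_sum// => k; exact: su.
have mA i : measurable_fun Omega (A i) by apply: measurable_series_lim => k; exact: mu_.
have mB i j : measurable_fun Omega (B i j) by apply: measurable_series_lim => k; exact: mdu.
have wA i N : (wint (fun x => A i x - S N i x)%R <= (CS * th ^+ N * V)%:E)%E.
  exact: (hCS (fun k => u k i) V V0 (mu_ i) (wu i)).
have wB i j N : (wint (fun x => B i j x - partial j (S N i) x)%R <= (CS * th ^+ N * V)%:E)%E.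
  have := hCS (fun k => partial j (u k i)) V V0 (mdu i j) (wdu i j) N.
  by apply: le_trans; rewrite le_eqVlt; apply/orP; left; apply/eqP; apply: wint_eq => x _; rewrite pS.
have wA0 i : (wint (A i) <= (CS * V)%:E)%E.
  have := wA i 0%N; rewrite expr0 mulr1; apply: le_trans.
  by rewrite le_eqVlt; apply/orP; left; apply/eqP; apply: wint_eq => x _; rewrite /S big_geq// subr0.
have wB0 i j : (wint (B i j) <= (CS * V)%:E)%E.
  have := wB i j 0%N; rewrite expr0 mulr1; apply: le_trans.
  by rewrite le_eqVlt; apply/orP; left; apply/eqP; apply: wint_eq => x _; rewrite pS big_geq// subr0.
have small ep : 0 < ep -> exists N, CS * th ^+ N * V <= ep.
  move=> e0; have [N hN] := geometric_small (CS * V) th01 e0; exists N.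
  by rewrite mulrAC.
have wk i j : weak_partial Omega j (A i) (B i j).
  apply: (weak_partial_limit oO muO mw w0 wlow q1 (S := fun N => S N i) (mA i) (mB i j)).
  - by apply: le_lt_trans (wA0 i) _; rewrite ltry.
  - by apply: le_lt_trans (wB0 i j) _; rewrite ltry.
  - by move=> N; exact: sS.
  - move=> ep e0; have [N hN] := small ep e0; exists N; split.
      by apply: le_trans (wA i N) _; rewrite lee_fin.
    by apply: le_trans (wB i j N) _; rewrite lee_fin.
exists (fun x => \row_i A i x), (fun x => \matrix_(i, j) B i j x); split.
- move=> i; rewrite (_ : (fun x => _) = A i); last by apply/funext => x; rewrite mxE.
  pose g x : 'rV[R]_n := \row_j B i j x.
  have gE j : (fun x => g x ord0 j) = B i j by apply/funext => x; rewrite mxE.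
  have fin_norm (h : 'rV[R]_n -> R) (v : R) : (wint h <= v%:E)%E -> (wnorm Omega q w h < +oo)%E.
    by move=> hh; apply: le_lt_trans (wnorm_le hh) _; rewrite ltry.
  exists g.
    split; first by split; [exact: mA | exact: fin_norm (wA0 i)].
      by move=> j; rewrite gE; exact: wk.
    by move=> j; rewrite gE; split; [exact: mB | exact: fin_norm (wB0 i j)].
  move=> e e0; have e3 : 0 < e / 3 by rewrite divr_gt0.
  (* [m] exceeds the constant of [wint_fnorm] for row vectors and is at least 1, so one [N] handles
     both halves of the Sobolev norm. *)
  pose m := (1 * n)%:R `^ (q - 1) * (1 * n)%:R + 1 : R.
  have m0 : 1 <= m by rewrite lerDr mulr_ge0 ?powR_ge0.
  have mp : 0 < m by apply: lt_le_trans m0.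
  have eq0 : 0 < (e / 3) `^ q by rewrite powR_gt0.
  have [N hN] := small _ (divr_gt0 eq0 mp).
  have hN1 : CS * th ^+ N * V <= (e / 3) `^ q.
    by apply: le_trans hN _; rewrite ler_pdivrMr// ler_peMr// ltW.
  have e3q : ((e / 3) `^ q) `^ q^-1 = e / 3 by rewrite -powRrM mulfV ?lt0r_neq0// powRr1// ltW.
  exists (S N i); first exact: tS.
  have n1 : (wnorm Omega q w (fun x => A i x - S N i x)%R <= (e / 3)%:E)%E.
    by rewrite -e3q; apply: wnorm_le; apply: le_trans (wA i N) _; rewrite lee_fin.
  have n2 : (wnorm Omega q w (fun x => fnorm (g x - gradient (S N i) x)) <= (e / 3)%:E)%E.
    rewrite -e3q; apply: wnorm_le.
    have ge k l : (fun x => (g x - gradient (S N i) x) k l) = (fun x => B i l x - partial l (S N i) x).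
      by apply/funext => x; rewrite !mxE.
    apply: le_trans (wint_fnorm (V := CS * th ^+ N * V) _ _) _.
    + move=> k l; rewrite ge; apply: measurable_funB => //; apply: measurable_test; exact: smooth_partial.
    + by move=> k l; rewrite ge; exact: wB.
    + rewrite lee_fin mulrA; apply: le_trans (ler_wpM2l _ hN) _; first by rewrite mulr_ge0 ?powR_ge0.
      by rewrite mulrCA ler_piMr ?(ltW eq0)// ler_pdivrMr// mul1r lerDl.
  apply: le_lt_trans (leeD n1 n2) _; rewrite -EFinD lte_fin; lra.
- move=> i j; rewrite (_ : (fun x => _) = A i); last by apply/funext => x; rewrite mxE.
  by rewrite (_ : (fun x => (\matrix_(i, j) _) i j) = B i j); [exact: wk | apply/funext => x; rewrite mxE].
(* For each [N], [h] is the residual [r N] minus the errors of the diagonal derivatives; all of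
   these tend to 0 in energy, so [h] has energy zero. *)
- pose h x := f x - \sum_i B i i x.
  have mh : measurable_fun Omega h by apply: measurable_funB => //; apply: measurable_sum => i; exact: mB.
  suff h0 : wint h = 0%E.
    have := wint_ae0 mO mw w0 mh wpos h0; apply: filterS => x hx Ox.
    have /eqP := hx Ox; rewrite subr_eq0 => /eqP ->; rewrite /mxtrace.
    by apply: eq_bigr => i _; rewrite mxE.
  have rE N x : r N x = f x - \sum_i partial i (S N i) x.
    elim: N => [|N IH].
      by rewrite /r/= big1 ?subr0// => i _; rewrite pS big_geq.
    rewrite /r iterS -/(r N) IH /divergence -/(u N) -addrA -opprD -big_split/=; congr (_ - _).
    by apply: eq_bigr => i _; rewrite !pS big_nat_recr.
  have bnd N : (wint h <= ((#|{: option 'I_n}|)%:R `^ (q - 1))%:E *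
     ((th ^+ N * W)%:E + \sum_(i < n) (CS * th ^+ N * V)%:E))%E.
    (* [None] indexes the residual, [Some i] the error of the [i]-th diagonal derivative. *)
    pose g (o : option 'I_n) x := if o is Some i then B i i x - partial i (S N i) x else r N x.
    have mg o : measurable_fun Omega (g o).
      case: o => [i|]; last by have [[]] := hr N.
      by apply: measurable_funB => //; apply: measurable_test; exact: smooth_partial.
    apply: le_trans (wint_sum mO mw w0 q1 mh mg _) _.
      move=> x _; rewrite (bigD1 None)//= (reindex_omap Some id)/=; last by case.
      under eq_bigl do rewrite eqxx.
      have -> : h x = r N x - \sum_i (B i i x - partial i (S N i) x).
        by rewrite rE /h sumrB; ring.
      apply: le_trans (ler_normB _ _) _; rewrite lerD2l; exact: ler_norm_sum.
    rewrite lee_wpmul2l ?lee_fin ?powR_ge0//.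
    rewrite (bigD1 None)//= (reindex_omap Some id)/=; last by case.
    under eq_bigl do rewrite eqxx.
    apply: leeD; first exact: (hr N).2.
    by apply: lee_sum => i _; exact: wB.
  apply/eqP; rewrite eq_le wint_ge0// andbT; apply/lee_addgt0Pr => ep e0; rewrite add0e.
  have [N hN] := geometric_small ((#|{: option 'I_n}|)%:R `^ (q - 1) * (W + n%:R * (CS * V))) th01 e0.
  apply: le_trans (bnd N) _; rewrite sumEFin -EFinD -EFinM lee_fin sumr_const card_ord.
  apply: le_trans hN; rewrite -[_ * V *+ n]mulr_natl le_eqVlt; apply/orP; left; apply/eqP.
  by move: (_ `^ (q - 1)) (th ^+ N) (n%:R) => y1 y2 y3; ring.
- have me i j : (fun x => (\matrix_(i, j) B i j x) i j) = B i j by apply/funext => x; rewrite mxE.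
  apply: le_trans (wint_fnorm (V := CS * V) _ _) _.
  + by move=> i j; rewrite me; exact: mB.
  + by move=> i j; rewrite me; exact: wB0.
  rewrite WE -EFinM lee_fin /CF /V mulrDl mul1r !mulrA lerDl//.
Qed.

End divergence_equation.

(** * From the geometric hypotheses to the theorem *)

(** Both signs of [e] occur: for [e >= 0] the least distance on [K] gives the bound, for [e < 0] the
    greatest distance [D] does. *)
Lemma weight_lower_bound {R : realType} {n : nat} (Omega : set 'rV[R]_n) (D e : R) :
  open Omega -> boundary Omega !=set0 -> (forall x, Omega x -> dist_bd Omega x <= D) ->
  forall K, compact K -> K `<=` Omega -> exists2 c : R, 0 < c & forall x, K x -> c <= dist_bd Omega x `^ e.
Proof.
move=> oO bd0 hD K cK KO; have [K0|K0] := pselect (K !=set0); last first.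
  by exists 1 => // x Kx; exfalso; apply: K0; exists x.
have [|x1 /set_mem Kx1 hx1] := compact_EVT_min (f := dist_bd Omega) K0 cK.
  by apply: continuous_subspaceT => x; exact: dist_bd_continuous.
have r0 : 0 < dist_bd Omega x1 by apply: dist_bd_gt0 => //; exact: KO.
have D0 : 0 < D by apply: lt_le_trans r0 _; apply: hD; exact: KO.
exists (Num.min (dist_bd Omega x1 `^ e) (D `^ e)); first by rewrite lt_min !powR_gt0.
move=> x Kx; have h1 := hx1 x (mem_set Kx); have h2 := hD x (KO x Kx).
have dx : 0 < dist_bd Omega x by apply: lt_le_trans h1.
rewrite ge_min; apply/orP; have [e0|e0] := leP 0 e; [left|right].
  by rewrite ge0_ler_powR ?nnegrE ?(ltW r0) ?(ltW dx).
rewrite -[e]opprK (powRN D (- e)) (powRN (dist_bd Omega x) (- e)) lef_pV2 ?posrE ?powR_gt0//.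
by rewrite ge0_ler_powR ?nnegrE ?(ltW dx) ?(ltW D0)//; lra.
Qed.

(** An infinite dimension is excluded by the hypothesis itself, which would read [+oo < b]. *)
Lemma assouad_exponent {R : realType} {n : nat} (E : set 'rV[R]_n) (a b : R) :
  (- (a%:E - assouad_dim E) < b%:E)%E -> exists lambda C : R, [/\ 0 <= lambda, lambda < a + b, 0 < C &
   forall r s : R, 0 < r -> r < s ->
   (ereal_sup [set covering_number r (eball x s `&` E) | x in E] <= (C * (s / r) `^ lambda)%:E)%E].
Proof.
move=> h; have : (assouad_dim E < (a + b)%:E)%E.
  move: h; case: (assouad_dim E) => [y| |] //=; last by move=> _; rewrite ltNyr.
  by rewrite !lte_fin; lra.
move=> /ereal_inf_lt[_ [lambda [l0 [C C0 hC]] <-]]; rewrite lte_fin => ll.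
by exists lambda, C.
Qed.

Theorem theorem5p2 (R : realType) (n : nat) (p q beta : R)
    (Omega : set 'rV[R]_n)
    (hn : (2 <= n)%N) (hp : 1 < p) (hq : 1 < q) (hpq : p^-1 + q^-1 = 1)
    (hOmega : john_domain Omega)
    (hbeta : (- (n%:R%:E - assouad_dim (boundary Omega)) < (beta * p)%:E)%E) :
  let w := fun x : 'rV[R]_n => dist_bd Omega x `^ (- (beta * q)) in
  exists C : R, forall f : 'rV[R]_n -> R,
    wLq Omega q w f ->
    (\int[lebesgue_rV n]_(x in Omega) (f x)%:E = 0)%E ->
    exists (u : 'rV[R]_n -> 'rV[R]_n) (Du : 'rV[R]_n -> 'M[R]_n),
      [/\ forall i, sobolev0 Omega q w (fun x => u x ord0 i),
          weak_jacobian Omega u Du,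
          \forall x \ae lebesgue_rV n, Omega x -> \tr (Du x) = f x &
          (wnorm Omega q w (fun x => fnorm (Du x)) <= C%:E * wnorm Omega q w f)%E].
Proof.
move=> w; have n0 : (0 < n)%N by exact: leq_trans hn.
have [oO bO bd0 [c1 [x0 [c1p Ox0 hchain]]]] := john_chainable n0 hOmega.
have [D D0 hD] := dist_bd_bounded bd0 bO.
have [lambda [C0 [l0 ll C00 hA]]] := assouad_exponent hbeta.
have p0 : 0 < p by lra.
have q0 : 0 < q by lra.
(* Half of the room left by the hypothesis on [beta]: with [gamma = (beta - dl) * p] the inequality
   [lambda < n + gamma] stays strict, and [p * (q - 1) = q] gives [kap = dl * q]. *)
pose dl := (n%:R + beta * p - lambda) / (2 * p).
have dl0 : 0 < dl by rewrite divr_gt0; lra.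
have pq : p * (q - 1) = q.
  have : p * q * (p^-1 + q^-1) = p * q by rewrite hpq mulr1.
  rewrite mulrDr mulrAC divff ?mul1r ?lt0r_neq0// -mulrA divff ?mulr1 ?lt0r_neq0//.
  by rewrite mulrBr mulr1 => <-; ring.
have lg : lambda < n%:R + (beta - dl) * p.
  have -> : (beta - dl) * p = beta * p - (n%:R + beta * p - lambda) / 2.
    by rewrite /dl; field; rewrite lt0r_neq0.
  by lra.
have egk : - (beta * q) + (beta - dl) * p * (q - 1) = - (dl * q).
  by rewrite -mulrA pq; ring.
have [C1 [th [C10 /andP[th0 th1] hstep]]] :=
  contraction_step oO bO bd0 D0 hD hq c1p Ox0 hchain l0 C00 hA (mulr_gt0 dl0 q0) lg egk.
have muO := domain_finite oO bO.
have mw : measurable_fun setT w := measurable_weight bd0 (- (beta * q)).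
have w0 x : 0 <= w x by exact: powR_ge0.
have wpos x : Omega x -> 0 < w x by move=> Ox; apply: powR_gt0; exact: dist_bd_gt0.
have wlow := weight_lower_bound (- (beta * q)) oO bd0 hD.
(* The contraction factor is only known to be nonnegative, while the series estimate takes negative
   powers of it and asks for a positive one. *)
pose th' := Num.max th 2^-1.
have th'01 : 0 < th' < 1 by rewrite lt_max gt_max th1 invr_gt0 ltr0n orbT/=; lra.
have [|CF CF0 hCF] := divergence_solution (th := th') oO muO mw w0 wpos wlow hq C10 th'01.
  move=> f [mf wf f0]; have [u [h1 h2 h3 h4]] := hstep f mf wf f0; exists u; split => //.
  apply: le_trans h4 _; apply: lee_wpmul2r; first exact: wint_ge0.
  by rewrite lee_fin le_max lexx.
exists (CF `^ q^-1) => f [mf wf] f0.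
have wf' : (weighted_int Omega q w f < +oo)%E.
  by apply: (@lty_poweRy _ _ q^-1) => //; rewrite invr_eq0 lt0r_neq0.
have [//|u [Du [h1 h2 h3 h4]]] := hCF f; exists u, Du; split => //.
have qi : 0 <= q^-1 by rewrite invr_ge0 ltW.
have g0 := wint_ge0 Omega q w0.
rewrite -poweR_EFin /wnorm -poweRM ?lee_fin ?(ltW CF0)//; last exact: g0.
apply: gt0_ler_poweR => //; rewrite in_itv/= ?leey ?andbT; [exact: g0 | ].
by rewrite mule_ge0// ?lee_fin ?(ltW CF0)//; exact: g0.
Qed.
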